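(* Let $q\ge 1$, let $t=(t_1,\dots,t_q)\in\mathbb{R}_+^q$ and let $M$ be a finite set of monomials in the non-commuting variables $X_1,\dots,X_q,Y_1,\dots,Y_q$. There exists $\delta>0$ such that the following holds. Let $V,W\in\mathbb{C}\langle X_i,Y_i\rangle_{i=1,\dots,q}$ be linear combinations of elements of $M$ with all coefficients of modulus less than $\delta$, and assume $V^*=V$. Then there is a constant $\Phi_{t,V}(W)\in\mathbb{C}$ such that, if for every $N\ge1$ the random variable $(U_1^V,\dots,U_q^V)\in U(N)^q$ has law $\mu_{N,V}$, then $$\frac1N\operatorname{Tr}\left(W(U_i^V,(U_i^V)^*,\,i=1,\dots,q)\right)\longrightarrow\Phi_{t,V}(W)\quad\text{in probability as }N\to\infty.$$
   Context: Unitary Brownian motion: on the space $\mathfrak{u}(N)$ of skew-Hermitian $N\times N$ matrices put $\langle X,Y\rangle=-N\operatorname{Tr}(XY)$, and let $(K_t)_{t\ge0}$ be the standard Brownian motion on $(\mathfrak{u}(N),\langle\cdot,\cdot\rangle)$. The $U(N)$-Brownian motion $(U_t)_{t\ge 0}$ is the solution of the Itô equation $dU_t=U_t\,dK_t-\frac12U_t\,dt$, $U_0=\mathrm{Id}$. Let $(U_{1,s})_{s\ge0},\dots,(U_{q,s})_{s\ge0}$ be $q$ independent $U(N)$-Brownian motions. For a non-commutative polynomial $V$, $V^*$ is obtained by conjugating the coefficients, reversing the order of letters in each monomial and exchanging $X_i$ and $Y_i$ for every $i$; if $V^*=V$ then $V(u_i,u_i^*,i=1..q)$ is Hermitian for all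 unitary $u_1,\dots,u_q$. For $V=V^*$, $\mu_{N,V}$ is the probability measure on $U(N)^q$ which is absolutely continuous with respect to the law of $(U_{1,t_1},\dots,U_{q,t_q})$, with density proportional to $(u_1,\dots,u_q)\mapsto e^{N\operatorname{Tr}(V(u_i,u_i^*,\,i=1..q))}$. *)

(* Defs.v *)
From HB Require Import structures.
From mathcomp Require Import all_boot all_order all_algebra finmap.
From mathcomp Require Import spectral sesquilinear.
(* The notations of monalg clash with those of the analysis library. *)
From mathcomp.multinomials Require Import -(notations) monalg.
From mathcomp Require Import all_classical all_reals all_analysis complex.

Set Implicit Arguments.
Unset Strict Implicit.
Unset Printing Implicit Defensive.

Import Order.TTheory GRing.Theory Num.Theory.
Import numFieldNormedType.Exports.

Local Open Scope classical_set_scope.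
Local Open Scope ring_scope.
Local Open Scope complex_scope.
Local Open Scope sesquilinear_scope.

(* [inl i] is the letter X_i and [inr i] is the letter Y_i. *)
Definition letter (q : nat) : choiceType := ('I_q + 'I_q)%type.

Definition monomial (q : nat) := fmonom (letter q).

Definition ncpoly (R : realType) (q : nat) := malg (monomial q) R[i].

Definition letter_swap (q : nat) (x : letter q) : letter q :=
  match x with inl i => inr i | inr i => inl i end.

Definition monomial_star (q : nat) (m : monomial q) : monomial q :=
  FMonom (rev (map (@letter_swap q) (fmonom_val m))).

Definition ncpoly_star (R : realType) (q : nat) (V : ncpoly R q) :
    ncpoly R q :=
  \sum_(m <- msupp V)
    mkmalgU (monomial_star m) (mcoeff m V)^*.

Definition small_combination (R : realType) (q : nat)
    (M : {fset (monomial q)}) (delta : R) (V : ncpoly R q) : Prop :=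
  {subset msupp V <= M} /\
  {in M, forall m, `|mcoeff m V| < delta%:C}.

HB.instance Definition _ (R : realType) := isPointed.Build R[i] 0.

Section Matrices.
Variables (R : realType) (N : nat).

(* The Borel sigma-algebra of M_N(C) = R^(2 N^2), generated by the real and
   imaginary parts of the entries. *)
Definition mx_cylinder : set (set 'M[R[i]]_N) :=
  [set A | exists (i j : 'I_N) (B : set R), measurable B /\
     (A = [set X : 'M[R[i]]_N | B (complex.Re (X i j))] \/
      A = [set X : 'M[R[i]]_N | B (complex.Im (X i j))])].

HB.instance Definition _ := @isMeasurable.Build (sigma_display mx_cylinder)
  'M[R[i]]_N <<s mx_cylinder >> (@sigma_algebra0 _ setT mx_cylinder)
  (@sigma_algebraC _ mx_cylinder) (@sigma_algebra_bigcup _ setT mx_cylinder).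

(* <X, Y> = - N Tr (X Y), which is real for X and Y skew-Hermitian. *)
Definition u_inner (X Y : 'M[R[i]]_N) : R :=
  complex.Re (- (N%:R * \tr (X *m Y))).

Definition skew_hermitian (X : 'M[R[i]]_N) : Prop := X ^t* = - X.

Definition sqr_norm (X : 'M[R[i]]_N) : R :=
  \sum_(i < N) \sum_(j < N) (complex.Re (X i j) ^+ 2 + complex.Im (X i j) ^+ 2).

Definition unitary : Type := {u : 'M[R[i]]_N | u \is unitarymx}.

Definition unitary_val (u : unitary) : 'M[R[i]]_N := val u.

Lemma unitary1_subproof : (1%:M : 'M[R[i]]_N) \is unitarymx.
Proof. by apply/unitarymxP; rewrite mul1mx trmx1 map_mx1. Qed.

HB.instance Definition _ := Choice.on unitary.
HB.instance Definition _ := isPointed.Build unitary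
  (exist _ 1%:M unitary1_subproof).

Let unitary_preimage := g_sigma_algebra_preimage unitary_val.

Let unitary_set0 : unitary_preimage set0.
Proof. exact: (@measurable0 _ (g_sigma_algebra_preimageType unitary_val)). Qed.

Let unitary_setC A : unitary_preimage A -> unitary_preimage (~` A).
Proof. exact: (@measurableC _ (g_sigma_algebra_preimageType unitary_val)). Qed.

Let unitary_bigcup (F : (set unitary)^nat) :
  (forall i, unitary_preimage (F i)) -> unitary_preimage (\bigcup_i F i).
Proof.
exact: (@bigcupT_measurable _ (g_sigma_algebra_preimageType unitary_val)).
Qed.

HB.instance Definition _ := @isMeasurable.Build (preimage_display unitary_val)
  unitary unitary_preimage unitary_set0 unitary_setC unitary_bigcup.

End Matrices.

Arguments unitary_val {R N} u.

(* A q-tuple of unitary matrices; [q.-tuple T] carries the product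
   sigma-algebra. *)
Definition unitary_tuple (R : realType) (q N : nat) := q.-tuple (unitary R N).

Definition eval_letter (R : realType) (q N : nat) (u : unitary_tuple R q N)
    (x : letter q) : 'M[R[i]]_N :=
  match x with
  | inl i => unitary_val (tnth u i)
  | inr i => (unitary_val (tnth u i)) ^t*
  end.

Definition eval_monomial (R : realType) (q N : nat) (u : unitary_tuple R q N)
    (m : monomial q) : 'M[R[i]]_N :=
  foldr (fun x A => eval_letter u x *m A) 1%:M (fmonom_val m).

(* W(u_i, u_i^*, i = 1..q) *)
Definition ncpoly_eval (R : realType) (q N : nat) (u : unitary_tuple R q N)
    (W : ncpoly R q) : 'M[R[i]]_N :=
  \sum_(m <- msupp W) mcoeff m W *: eval_monomial u m.

(* Processes are indexed by R, but only their values at times s >= 0 are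
   ever used. *)

Section Processes.
Context {d : measure_display} {Omega : measurableType d} {R : realType}.
Variables (P : probability Omega R) (N : nat).
Implicit Types (F : R -> set (set Omega)) (X K : R -> Omega -> 'M[R[i]]_N).

Definition filtration F : Prop :=
  [/\ forall s : R, 0 <= s -> sigma_algebra setT (F s),
      forall s : R, 0 <= s -> F s `<=` measurable
    & forall s r : R, 0 <= s -> s <= r -> F s `<=` F r].

Definition measurable_wrt (G : set (set Omega)) (A : Omega -> 'M[R[i]]_N) :
  Prop := forall B : set 'M[R[i]]_N, measurable B -> G (A @^-1` B).

Definition adapted F X : Prop :=
  forall s : R, 0 <= s -> measurable_wrt (F s) (X s).

Definition continuous_paths X : Prop := forall w i j,
  {within `[0, +oo[, continuous (fun s : R => complex.Re (X s w i j))} /\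
  {within `[0, +oo[, continuous (fun s : R => complex.Im (X s w i j))}.

(* K is a standard Brownian motion in (u(N), <.,.>) relative to F.  The law of
   an increment is prescribed by that of its linear forms: for a unit vector X,
   <X, K_r - K_s> is a centred Gaussian variable with variance r - s
   ([normal_prob] takes the standard deviation). *)
Definition u_brownian_motion F K : Prop :=
  [/\ forall w, K 0 w = 0,
      forall (s : R) w, 0 <= s -> skew_hermitian (K s w),
      continuous_paths K,
      adapted F K
    & forall s r : R, 0 <= s -> s < r ->
        (forall (A : set Omega) (B : set 'M[R[i]]_N), F s A -> measurable B ->
           P (A `&` [set w | B (K r w - K s w)]) =
           (P A * P [set w | B (K r w - K s w)%R])%E) /\
        (forall X : 'M[R[i]]_N, skew_hermitian X -> u_inner X X = 1 ->
           forall B : set R, measurable B ->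
           P [set w | B (u_inner X (K r w - K s w))] =
           normal_prob 0 (Num.sqrt (r - s)) B)].

(* An elementary process on [0, s]: it equals [coef k] on the interval
   ]time k, time k.+1] for k < size, where 0 = time 0 <= ... <= time size = s. *)
Record elementary := Elementary {
  el_size : nat;
  el_time : nat -> R;
  el_coef : nat -> Omega -> 'M[R[i]]_N
}.

Definition is_elementary F (s : R) (H : elementary) : Prop :=
  [/\ el_time H 0%N = 0,
      el_time H (el_size H) = s,
      forall k, (k < el_size H)%N -> el_time H k <= el_time H k.+1,
      forall k, (k < el_size H)%N ->
        measurable_wrt (F (el_time H k)) (el_coef H k)
    & exists C : R, forall k w, (k < el_size H)%N ->
        sqr_norm (el_coef H k w) <= C].

Definition el_process (H : elementary) : R -> Omega -> 'M[R[i]]_N :=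
  fun r w => \sum_(k < el_size H)
    (if el_time H k < r <= el_time H k.+1 then el_coef H k w else 0).

Definition el_integral K (H : elementary) : Omega -> 'M[R[i]]_N :=
  fun w => \sum_(k < el_size H)
    el_coef H k w *m (K (el_time H k.+1) w - K (el_time H k) w).

(* I is (a version of) the Ito integral of X dK over [0, s], i.e. the
   L^2-limit of the integrals of elementary processes that approximate X in
   L^2(dP x dr). *)
Definition ito_integral F K X (s : R) (I : Omega -> 'M[R[i]]_N) : Prop :=
  measurable_fun setT I /\
  exists H : nat -> elementary,
    [/\ forall n, is_elementary F s (H n),
        (fun n => \int[P]_w \int[lebesgue_measure]_(r in `[0%R, s])
           (sqr_norm (el_process (H n) r w - X r w)%R)%:E)%E @ \oo --> 0%E
      & (fun n => \int[P]_w
           (sqr_norm (el_integral K (H n) w - I w)%R)%:E)%E @ \oo --> 0%E].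

Definition time_integral X (s : R) (w : Omega) : 'M[R[i]]_N :=
  \matrix_(i, j)
    ((\int[lebesgue_measure]_(r in `[0, s]) complex.Re (X r w i j)) +i*
     (\int[lebesgue_measure]_(r in `[0, s]) complex.Im (X r w i j))).

(* U is a U(N)-valued continuous adapted solution of
   dU = U dK - (1/2) U dt, U_0 = Id. *)
Definition unitary_brownian_motion (U : R -> Omega -> unitary R N) : Prop :=
  let X := fun s w => unitary_val (U s w) in
  exists F K,
    [/\ filtration F /\ u_brownian_motion F K,
        continuous_paths X,
        adapted F X,
        forall w, X 0 w = 1%:M
      & forall s : R, 0 <= s -> exists I, ito_integral F K X s I /\
          {ae P, forall w,
            X s w = 1%:M + I w - (2^-1)%:C *: time_integral X s w}].

Definition process_sigma (U : R -> Omega -> unitary R N) : set (set Omega) :=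
  <<s [set A | exists (s : R) (B : set (unitary R N)),
         [/\ 0 <= s, measurable B & A = U s @^-1` B]] >>.

(* Taking some of the A i equal to the whole space gives the product rule for
   subfamilies. *)
Definition independent_processes (q : nat)
    (U : 'I_q -> R -> Omega -> unitary R N) : Prop :=
  forall A : 'I_q -> set Omega, (forall i, process_sigma (U i) (A i)) ->
    P (\bigcap_(i in [set: 'I_q]) A i) = (\prod_(i < q) P (A i))%E.

End Processes.

Definition has_law {d d' : measure_display} {Omega : measurableType d}
    {T : measurableType d'} {R : realType} (P : probability Omega R)
    (X : Omega -> T) (mu : probability T R) : Prop :=
  measurable_fun setT X /\
  forall A : set T, measurable A -> P (X @^-1` A) = mu A.

(* nu is the law of (U_{1,t_1}, ..., U_{q,t_q}). *)
Definition ubm_law (R : realType) (q N : nat) (t : 'I_q -> R)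
    (nu : probability (unitary_tuple R q N) R) : Prop :=
  exists (d : measure_display) (Omega : measurableType d)
      (P : probability Omega R) (U : 'I_q -> R -> Omega -> unitary R N),
    [/\ forall i, unitary_brownian_motion P (U i),
        independent_processes P U
      & has_law P (fun w => [tuple U i (t i) w | i < q]) nu].

(* mu = mu_{N,V}.  When V is self-adjoint its evaluation is Hermitian and the
   trace is real.  Since mu is a probability, the constant c is the normalising constant. *)
Definition gibbs_law (R : realType) (q N : nat) (t : 'I_q -> R)
    (V : ncpoly R q) (mu : probability (unitary_tuple R q N) R) : Prop :=
  exists nu : probability (unitary_tuple R q N) R, ubm_law t nu /\
  exists c : R, forall A : set (unitary_tuple R q N), measurable A ->
    mu A = (\int[nu]_(u in A)
      (c * expR (N%:R * complex.Re (\tr (ncpoly_eval u V))))%:E)%E.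

Definition cvg_in_probability {d : nat -> measure_display}
    {Omega : forall N, measurableType (d N)} {R : realType}
    (P : forall N, probability (Omega N) R) (X : forall N, Omega N -> R[i])
    (x : R[i]) : Prop :=
  forall eps : R, 0 < eps ->
    (fun N => P N [set w | eps%:C <= `|X N w - x|]) @ \oo --> 0%E.

(* Main.v *)
(* Let V_lam = V + lam W with lam real and let L be the generator of the process
   tau |-> (U_i (t_i tau))_i.  Starting from phi_0 = N^-1 Re Tr V_lam, a recursion that does
   not depend on N (splitting and joining of words at their letters) produces functions phi_k,
   linear combinations of products of normalised traces of words, such that
   F(tau, u) = sum_(k <= K) (1 - tau)^k Re phi_k(u) satisfies
     dF/dtau + L F + (N^2 / 2) <grad F, grad F> = O(2^-K) + O_K(N^-2),
   the left-hand side being the Hamilton-Jacobi equation of N^-2 log E exp(N^2 F).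
   The phi_k are summable when V and W are small because the weights (|w| + 1)^-2 on words have
   a convolution bounded by a multiple of themselves, which absorbs the splittings.
   Gronwall's inequality, applied to E (1 + N^2 F / p)^p and not to an exponential so that only
   polynomials in the entries of the U_i occur, shows that N^-2 log E exp(N Re Tr V_lam) is
   F(0, Id) + O(2^-K) + O_K(N^-2), and F(0, Id) is a power series in lam that does not depend
   on N.  The exponential Chebyshev inequality then concentrates N^-1 Re Tr W, under mu_(N,V),
   at the coefficient of lam of this series; the imaginary part is the case of -i W.
   The Ito formula is only needed for polynomials, in the form of a first order expansion of
   E f(U_(s + h)), proved for the entries of U and then for products. *)

From HB Require Import structures.
Require Import Defs.
From mathcomp Require Import all_boot all_order all_algebra finmap.
From mathcomp Require Import spectral sesquilinear.
From mathcomp.multinomials Require Import -(notations) monalg.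
From mathcomp Require Import all_classical all_reals all_analysis complex.
From mathcomp Require Import measurable_realfun.
From mathcomp Require Import ring lra zify.

Set Implicit Arguments.
Unset Strict Implicit.
Unset Printing Implicit Defensive.

Import Order.TTheory GRing.Theory Num.Theory.
Import numFieldNormedType.Exports.

Local Open Scope classical_set_scope.
Local Open Scope ring_scope.
Local Open Scope complex_scope.
Local Open Scope sesquilinear_scope.

(** * Expectations and Gaussian moments *)

(** The expansion of E exp(N^2 F) itself has terms growing like powers of N^2; its logarithm,
    divided by N^2, is what admits an expansion uniform in N. In the exponent every residual is
    multiplied by N^2: one of size O_K(N^-2) costs a bounded factor, and one of size O(2^-K) is
    beaten by fixing K, for a given deviation, before N tends to infinity. The powers of 1 - tau are
    there because the datum is prescribed at tau = 1, while at tau = 0 all motions sit at Id and F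
    is deterministic. Chebyshev's inequality under the Gibbs measure involves the quotient of the
    Laplace transforms at lam and at 0, so the transform is bounded from above and from below. The
    remainder of second order in lam is bounded uniformly in K, and no differentiability of the
    limit in lam has to be discussed. The constants of the stochastic calculus may depend on N in
    any way, since there the time step tends to 0 with N fixed; very crude inequalities for entries
    are harmless. Only the recursion on words needs constants free of N. *)

Section Expectation.
Context {d : measure_display} {Omega : measurableType d} {R : realType}.
Variable P : probability Omega R.
Implicit Types (f g h : Omega -> R) (a b k C : R).

Definition L1 f := P.-integrable [set: Omega] (EFin \o f).
Definition L2 f := measurable_fun [set: Omega] f /\ L1 (fun w => f w ^+ 2).
Definition Ex f : R := \int[P]_w f w.

Lemma L1E f : L1 f = P.-integrable [set: Omega] (EFin \o f). Proof. by []. Qed.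
Lemma ExE f : Ex f = \int[P]_w f w. Proof. by []. Qed.

Lemma L1_meas f : L1 f -> measurable_fun setT f.
Proof. by move=> /integrableP[/measurable_EFinP]. Qed.

Lemma L2_meas f : L2 f -> measurable_fun setT f.
Proof. by case. Qed.

Lemma L1_le f g : measurable_fun setT f -> (forall w, `|f w| <= g w) -> L1 g ->
  L1 f.
Proof.
move=> mf fg; apply: le_integrable => //; first exact/measurable_EFinP.
by move=> w _ /=; rewrite lee_fin (le_trans (fg w)) ?ler_norm.
Qed.

Lemma L1D f g : L1 f -> L1 g -> L1 (fun w => f w + g w).
Proof. by move=> Lf Lg; exact: (integrableD measurableT Lf Lg). Qed.

Lemma L1Z a f : L1 f -> L1 (fun w => a * f w).
Proof. by move=> Lf; exact: (integrableZl measurableT a Lf). Qed.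

Lemma L1B f g : L1 f -> L1 g -> L1 (fun w => f w - g w).
Proof. by move=> Lf Lg; exact: (integrableB measurableT Lf Lg). Qed.

Lemma L1_cst a : L1 (fun=> a).
Proof. exact: finite_measure_integrable_cst. Qed.

Lemma L1_bnd f C : measurable_fun setT f -> (forall w, `|f w| <= C) -> L1 f.
Proof. by move=> mf fC; apply: (L1_le mf fC); exact: L1_cst. Qed.

Lemma L1_sum (I : Type) (s : seq I) (F : I -> Omega -> R) :
  (forall i, L1 (F i)) -> L1 (fun w => \sum_(i <- s) F i w).
Proof.
move=> LF; elim: s => [|i s IH].
  by under eq_fun do rewrite big_nil; exact: L1_cst.
by under eq_fun do rewrite big_cons; exact: L1D.
Qed.

Lemma ExD f g : L1 f -> L1 g -> Ex (fun w => f w + g w) = Ex f + Ex g.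
Proof. by move=> Lf Lg; rewrite /Ex RintegralD. Qed.

Lemma ExB f g : L1 f -> L1 g -> Ex (fun w => f w - g w) = Ex f - Ex g.
Proof. by move=> Lf Lg; rewrite /Ex RintegralB. Qed.

Lemma ExZ a f : L1 f -> Ex (fun w => a * f w) = a * Ex f.
Proof. by move=> Lf; rewrite /Ex RintegralZl. Qed.

Lemma Ex_cst a : Ex (fun=> a) = a.
Proof. by rewrite /Ex /Rintegral integral_cst//= probability_setT mule1. Qed.

Lemma Ex_sum (I : Type) (s : seq I) (F : I -> Omega -> R) :
  (forall i, L1 (F i)) ->
  Ex (fun w => \sum_(i <- s) F i w) = \sum_(i <- s) Ex (F i).
Proof.
move=> LF; elim: s => [|i s IH].
  by under eq_fun do rewrite big_nil; rewrite Ex_cst big_nil.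
under eq_fun do rewrite big_cons.
by rewrite ExD// ?IH ?big_cons//; exact: L1_sum.
Qed.

Lemma Ex_le f g : L1 f -> L1 g -> (forall w, f w <= g w) -> Ex f <= Ex g.
Proof. by move=> Lf Lg fg; apply: le_Rintegral. Qed.

Lemma Ex_ge0 f : (forall w, 0 <= f w) -> 0 <= Ex f.
Proof. by move=> f0; apply: Rintegral_ge0. Qed.

Lemma Ex_eq f g : f =1 g -> Ex f = Ex g.
Proof. by move=> /funext ->. Qed.

Lemma L1_norm f : L1 f -> L1 (fun w => `|f w|).
Proof. by move=> /integrable_norm. Qed.

Lemma Ex_norm f : L1 f -> `|Ex f| <= Ex (fun w => `|f w|).
Proof. by move=> Lf; apply: le_normr_Rintegral. Qed.

Lemma Ex_norm_le f g : L1 f -> L1 g -> (forall w, `|f w| <= g w) ->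
  `|Ex f| <= Ex g.
Proof.
move=> Lf Lg fg; apply: (le_trans (Ex_norm Lf)).
by apply: Ex_le => //; exact: L1_norm.
Qed.

Lemma L2_L1sqr f : L2 f -> L1 (fun w => f w ^+ 2).
Proof. by case. Qed.

Lemma L2_mul f g : L2 f -> L2 g -> L1 (fun w => f w * g w).
Proof.
move=> [mf Lf] [mg Lg].
apply: (@L1_le _ (fun w => f w ^+ 2 + g w ^+ 2)); last exact: L1D.
  exact: measurable_funM.
move=> w; rewrite normrM; set a := f w; set b := g w.
rewrite -(real_normK (num_real a)) -(real_normK (num_real b)).
have := normr_ge0 a; have := normr_ge0 b; nra.
Qed.

Lemma L2_bnd f C : measurable_fun setT f -> (forall w, `|f w| <= C) -> L2 f.
Proof.
move=> mf fC; split => //; apply: (@L1_bnd _ (C ^+ 2)).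
  exact: measurable_funX.
by move=> w; rewrite normrX lerXn2r ?nnegrE// (le_trans (normr_ge0 _) (fC w)).
Qed.

Lemma L2_cst a : L2 (fun=> a).
Proof. exact: (@L2_bnd _ `|a|). Qed.

Lemma L2_L1 f : L2 f -> L1 f.
Proof.
move=> Lf; have := L2_mul Lf (L2_cst 1).
by under eq_fun do rewrite mulr1.
Qed.

Lemma L2Z a f : L2 f -> L2 (fun w => a * f w).
Proof.
move=> [mf Lf]; split; first exact: measurable_funM.
by under eq_fun do rewrite exprMn; exact: L1Z.
Qed.

Lemma L2_le f g : measurable_fun setT f -> (forall w, `|f w| <= `|g w|) ->
  L2 g -> L2 f.
Proof.
move=> mf fg [mg Lg]; split => //; apply: (L1_le _ _ Lg).
  exact: measurable_funX.
move=> w; rewrite normrX -(real_normK (num_real (g w))).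
by rewrite lerXn2r ?nnegrE.
Qed.

Lemma L2D f g : L2 f -> L2 g -> L2 (fun w => f w + g w).
Proof.
move=> Lf Lg; split; first by apply: measurable_funD; exact: L2_meas.
under eq_fun do rewrite sqrrD.
apply: L1D; [apply: L1D|]; [exact: L2_L1sqr| |exact: L2_L1sqr].
under eq_fun do rewrite -mulr_natl.
by apply: L1Z; exact: L2_mul.
Qed.

Lemma L2B f g : L2 f -> L2 g -> L2 (fun w => f w - g w).
Proof.
move=> Lf Lg; under eq_fun do rewrite -mulN1r.
by apply: L2D => //; exact: L2Z.
Qed.

Lemma L2M_bnd f g C : measurable_fun setT f -> (forall w, `|f w| <= C) ->
  L2 g -> L2 (fun w => f w * g w).
Proof.
move=> mf fC Lg; apply: (@L2_le _ (fun w => C * g w)); last exact: L2Z.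
  by apply: measurable_funM => //; exact: L2_meas.
by move=> w; rewrite !normrM ler_wpM2r// (le_trans (fC w)) ?ler_norm.
Qed.

Lemma L1M_bnd f g C : measurable_fun setT f -> (forall w, `|f w| <= C) ->
  L1 g -> L1 (fun w => f w * g w).
Proof.
move=> mf fC Lg; apply: (@L1_le _ (fun w => C * `|g w|)); last first.
- by apply: L1Z; exact: L1_norm.
- by move=> w; rewrite normrM ler_wpM2r.
- by apply: measurable_funM => //; exact: L1_meas.
Qed.

Lemma L2_sum (I : Type) (s : seq I) (F : I -> Omega -> R) :
  (forall i, L2 (F i)) -> L2 (fun w => \sum_(i <- s) F i w).
Proof.
move=> LF; elim: s => [|i s IH].
  by under eq_fun do rewrite big_nil; exact: L2_cst.
by under eq_fun do rewrite big_cons; exact: L2D.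
Qed.

(** The free parameter [k] is what later turns a product of a large and a small term into an error
    [k h + k^-1 h^2]. *)
Lemma young (k a b : R) : 0 < k -> `|a * b| <= k * a ^+ 2 + k^-1 * b ^+ 2.
Proof.
move=> k0; rewrite normrM -(real_normK (num_real a)) -(real_normK (num_real b)).
move: `|a| `|b| (normr_ge0 a) (normr_ge0 b) => x y x0 y0; move: {a} x {b} y x0 y0 => a b a0 b0.
(* The cross term of the square leaves [2 a b], twice what is needed. *)
have -> : k * a ^+ 2 + k^-1 * b ^+ 2 = k^-1 * ((k * a - b) ^+ 2) + 2 * (a * b).
  by field; rewrite gt_eqF.
have : 0 <= k^-1 * ((k * a - b) ^+ 2).
  by rewrite mulr_ge0 ?sqr_ge0// invr_ge0 ltW.
by have := mulr_ge0 a0 b0; lra.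
Qed.

Lemma Ex_young k f g : 0 < k -> L2 f -> L2 g ->
  Ex (fun w => `|f w * g w|) <=
    k * Ex (fun w => f w ^+ 2) + k^-1 * Ex (fun w => g w ^+ 2).
Proof.
move=> k0 Lf Lg; have [Lf2 Lg2] := (L2_L1sqr Lf, L2_L1sqr Lg).
rewrite -!ExZ// -ExD; [|exact: L1Z|exact: L1Z].
apply: Ex_le => [||w]; last exact: young.
  by apply: L1_norm; exact: L2_mul.
by apply: L1D; exact: L1Z.
Qed.

Lemma Ex_mul_le k f g : 0 < k -> L2 f -> L2 g ->
  `|Ex (fun w => f w * g w)| <=
    k * Ex (fun w => f w ^+ 2) + k^-1 * Ex (fun w => g w ^+ 2).
Proof.
move=> k0 Lf Lg; apply: le_trans (Ex_young k0 Lf Lg).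
by apply: Ex_norm; exact: L2_mul.
Qed.

Lemma sqrD_le (a b : R) : (a + b) ^+ 2 <= 2 * a ^+ 2 + 2 * b ^+ 2.
Proof. by have := sqr_ge0 (a - b); rewrite sqrrB sqrrD; lra. Qed.

Lemma Ex_sqrD_le f g : L2 f -> L2 g ->
  Ex (fun w => (f w + g w) ^+ 2) <=
    2 * Ex (fun w => f w ^+ 2) + 2 * Ex (fun w => g w ^+ 2).
Proof.
move=> Lf Lg; have [Lf2 Lg2] := (L2_L1sqr Lf, L2_L1sqr Lg).
rewrite -!ExZ// -ExD; [|exact: L1Z|exact: L1Z].
apply: Ex_le => [||w]; [|by apply: L1D; exact: L1Z|exact: sqrD_le].
exact: (L2_L1sqr (L2D Lf Lg)).
Qed.

(** The factor [2 ^+ size s] comes from a plain induction; only its finiteness matters. *)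
Lemma sqr_sum_le (I : Type) (s : seq I) (x : I -> R) :
  (\sum_(i <- s) x i) ^+ 2 <= 2 ^+ size s * \sum_(i <- s) x i ^+ 2.
Proof.
elim: s => [|i s IH]; first by rewrite !big_nil expr0n/= mulr0.
rewrite !big_cons /=; apply: le_trans (sqrD_le _ _) _.
rewrite mulrDr lerD//; last by rewrite (exprS 2 (size s)) -mulrA ler_wpM2l.
rewrite ler_wpM2r ?sqr_ge0//.
by rewrite (exprS 2 (size s)) ler_peMr// exprn_ege1// ler1n.
Qed.

(** Independence on rectangles identifies the law of the pair with the product of the two laws, by
    uniqueness of product measures; Fubini then factors the integral. *)
Lemma Ex_indep f g : L1 f -> L1 g -> L1 (fun w => f w * g w) ->
  (forall A B : set R, measurable A -> measurable B ->
    P ((f @^-1` A) `&` (g @^-1` B)) = (P (f @^-1` A) * P (g @^-1` B))%E) ->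
  Ex (fun w => f w * g w) = Ex f * Ex g.
Proof.
move=> Lf Lg Lfg ind.
pose X : {mfun Omega >-> R} := mfun_Sub (mem_set (L1_meas Lf)).
pose Y : {mfun Omega >-> R} := mfun_Sub (mem_set (L1_meas Lg)).
have mXY : measurable_fun [set: Omega]
    (fun w => (f w, g w) : R * R).
  by apply/measurable_fun_pairP; split; [exact: (L1_meas Lf)|exact: (L1_meas Lg)].
pose XY : {mfun Omega >-> (R * R)%type} :=
  mfun_Sub (mem_set mXY).
pose mul (z : R * R) : \bar R := (z.1 * z.2)%:E.
have mmul : measurable_fun setT mul.
  by apply/measurable_EFinP; apply: measurable_funM.
have e : forall Z, measurable Z ->
    (distribution P X \x distribution P Y)%E Z = distribution P XY Z.
  apply: product_measure_unique => A B mA mB.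
  exact: ind.
have iXY : (distribution P XY).-integrable setT mul by exact: integrable_pushforward.
have iprod : (distribution P X \x distribution P Y)%E.-integrable setT mul.
  move: iXY => /integrableP[_ h]; apply/integrableP; split => //.
  apply: le_lt_trans h; rewrite le_eqVlt; apply/orP; left; apply/eqP.
  by apply: eq_measure_integral => A mA _; exact: e.
have E1 : (\int[P]_w (f w * g w)%:E = \int[distribution P X]_x \int[distribution P Y]_y (x * y)%:E)%E.
  rewrite -[LHS](@integral_distribution _ _ _ _ _ _ XY mul) //.
  apply: (etrans _ (esym (integral12_prod_meas1 iprod))).
  by apply: esym; apply: eq_measure_integral => A mA _; exact: e.
rewrite /Ex /Rintegral E1.
have -> : (\int[distribution P X]_x \int[distribution P Y]_y (x * y)%:E =
   \int[distribution P X]_x (x%:E * \int[P]_w (g w)%:E))%E.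
  apply: eq_integral => x _.
  under eq_integral do rewrite EFinM.
  rewrite integralZl//; last first.
    by apply: (@integrable_pushforward _ _ _ _ _ Y) => //; exact: Lg.
  by congr (_ * _)%E; rewrite (@integral_distribution _ _ _ _ _ _ Y EFin).
have fing : (\int[P]_w (g w)%:E)%E \is a fin_num by exact: integrable_fin_num.
rewrite -(fineK fing) integralZr//; last first.
  by apply: (@integrable_pushforward _ _ _ _ _ X) => //; exact: Lf.
rewrite (@integral_distribution _ _ _ _ _ _ X EFin)//.
by rewrite fineM//; exact: integrable_fin_num.
Qed.

End Expectation.

(** * Integration against a measure given by a density *)

Section Density.
Context {d : measure_display} {T : measurableType d} {R : realType}.
Variables (mu nu : {measure set T -> \bar R}) (p : T -> R).
Hypotheses (mp : measurable_fun [set: T] p) (p0 : forall x, 0 <= p x).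
Hypothesis nuE : forall A, measurable A -> nu A = (\int[mu]_(x in A) (p x)%:E)%E.
Import HBNNSimple.

(** Monotone convergence along simple approximations of [f] reduces the claim to indicators, where
    it is [nuE]. It is applied to [normal_prob], which is known through its density. *)
Lemma ge0_integral_density (f : T -> R) : measurable_fun setT f ->
  (forall x, 0 <= f x) ->
  (\int[nu]_x (f x)%:E = \int[mu]_x (f x * p x)%:E)%E.
Proof.
move=> mf f0.
have mEf : measurable_fun setT (EFin \o f) by exact/measurable_EFinP.
pose h := nnsfun_approx measurableT mEf.
have cvh x : ((h n x)%:E @[n --> \oo] --> (f x)%:E)%E.
  by apply: (cvg_nnsfun_approx measurableT mEf) => // y _; rewrite lee_fin.
have ndh x a b : (a <= b)%N -> h a x <= h b x.
  by move=> ab; exact/lefP/nd_nnsfun_approx.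
have lE1 : (\int[nu]_x (f x)%:E = limn (fun n => \int[nu]_x (h n x)%:E))%E.
  transitivity (\int[nu]_x limn (fun n => (h n x)%:E))%E.
    by apply: eq_integral => x _; apply/esym/cvg_lim.
  apply: monotone_convergence => //.
  - by move=> n; exact/measurable_EFinP.
  - by move=> n x _; rewrite lee_fin.
  - by move=> x _ a b ab; rewrite lee_fin ndh.
have lE2 : (\int[mu]_x (f x * p x)%:E =
    limn (fun n => \int[mu]_x (h n x * p x)%:E))%E.
  transitivity (\int[mu]_x limn (fun n => (h n x * p x)%:E))%E.
    apply: eq_integral => x _; apply/esym/cvg_lim => //.
    under eq_fun do rewrite EFinM.
    by rewrite EFinM; apply: cvgeZr.
  apply: monotone_convergence => //.
  - by move=> n; apply/measurable_EFinP; exact: measurable_funM.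
  - by move=> n x _; rewrite lee_fin mulr_ge0.
  - by move=> x _ a b ab; rewrite lee_fin ler_wpM2r// ndh.
rewrite lE1 lE2; congr (limn _); apply/funext => n {lE1 lE2 cvh ndh}.
move: (h n) => g {h}.
transitivity (\int[nu]_x
   (\sum_(y \in range g) (y * \1_(g @^-1` [set y]) x)%:E))%E.
  by apply: eq_integral => t _; rewrite /= fimfunE -fsumEFin.
transitivity (\int[mu]_x (\sum_(y \in range g)
    (y * \1_(g @^-1` [set y]) x)%:E * (p x)%:E))%E; last first.
  apply: eq_integral => x _.
  by rewrite [in RHS]fimfunE EFinM -fsumEFin// ge0_mule_fsuml// => y;
    exact: nnfun_muleindic_ge0.
have mi y : measurable_fun setT (fun x => (y * \1_(g @^-1` [set y]) x)%:E).
  by apply/measurable_EFinP; apply: measurable_funM.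
rewrite !ge0_integral_fsum//; last 3 first.
- by move=> y; apply: emeasurable_funM => //; exact/measurable_EFinP.
- by move=> y x _; rewrite mule_ge0 ?lee_fin// -lee_fin nnfun_muleindic_ge0.
- by move=> y x _; exact: nnfun_muleindic_ge0.
apply: eq_fsbigr => r rg.
under [LHS]eq_integral do rewrite EFinM.
rewrite integralZl_indic_nnsfun// integral_indic// setIT nuE//.
(* A negative value is never taken by the non-negative simple function [g], so its level set is
   empty. *)
have [r0|r0] := leP 0 r; last first.
  have g0 : g @^-1` [set r] = set0.
    by apply/seteqP; split => x //= gx; have : 0 <= g x by []; rewrite (gx : g x = r) leNgt r0.
  rewrite g0 integral_set0 mule0.
  by rewrite integral0_eq// => x _; rewrite indic0 mulr0 mul0e.
rewrite [in LHS]integral_mkcond -ge0_integralZl//.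
- apply: eq_integral => x _; rewrite epatch_indic/= EFinM -muleA; congr (_ * _)%E.
  by rewrite muleC.
- by apply/measurable_restrict => //; apply/measurable_EFinP/measurable_funTS.
- by move=> x _; apply: erestrict_ge0 => y _; rewrite lee_fin.
Qed.

End Density.

(** * Scaling and moments of the Gaussian law *)

Section GaussianMoments.
Context {R : realType}.
Notation mu := (@lebesgue_measure R).

Lemma ge0_integral_normal (s : R) (f : R -> R) : measurable_fun setT f ->
  (forall x, 0 <= f x) ->
  (\int[normal_prob 0 s]_x (f x)%:E =
   \int[mu]_x (f x * normal_pdf 0 s x)%:E)%E.
Proof.
move=> mf f0; apply: ge0_integral_density => //.
- exact: measurable_normal_pdf.
- exact: normal_pdf_ge0.
Qed.

(** Substitution of [s^-1 x] for [x], which carries the density of deviation 1 to that of deviation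
    [s]. Continuity of [f] makes the integrand continuous, as the substitution rule asks. *)
Lemma ge0_integral_normal_scale (s : R) (f : R -> R) : 0 < s -> continuous f ->
  (forall x, 0 <= f x) ->
  (\int[normal_prob 0%R s]_x (f x)%:E = \int[normal_prob 0%R 1%R]_x (f (s * x)%R)%:E)%E.
Proof.
move=> s0 cf f0; have sN0 : s != 0 by rewrite gt_eqF.
have mf := continuous_measurable_fun cf.
have cfs : continuous (fun x => f (s * x)).
  by move=> x; apply: (@continuous_comp _ _ _ ( *%R s) f); [exact: mulrl_continuous|exact: cf].
have mfs := continuous_measurable_fun cfs.
rewrite (ge0_integral_normal s mf f0) (ge0_integral_normal 1 mfs (fun x => f0 (s * x))).
pose F (x : R^o) : R^o := s^-1 * x.
pose G x := f (s * x) * normal_pdf 0 1 x.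
have dF x : derivable F x 1 by apply: derivableM => //; exact: derivable_cst.
have F'E : F^`()%classic = cst s^-1.
  apply/funext => x; rewrite /F derive1E deriveM// derive_cst scaler0 addr0.
  by rewrite derive_id /GRing.scale/= mulr1.
have s1 : 0 < s^-1 by rewrite invr_gt0.
transitivity (\int[mu]_x (G x)%:E)%E; last by [].
apply/esym; rewrite (increasing_ge0_integration_by_substitutionT (F := F) (G := G)).
- apply: eq_integral => x _; congr EFin; apply/esym; rewrite F'E /G /F !fctE/= mulVKf//.
  rewrite -mulrA; congr (_ * _).
  rewrite !normal_pdfE ?oner_neq0// /normal_peak /normal_fun !subr0 expr1n mul1r.
  rewrite -mulrnAr sqrtrM ?sqr_ge0// sqrtr_sqr gtr0_norm// invfM -mulrA mulrC.
  congr (_ * _ * _); congr expR; rewrite exprMn exprVn; field.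
  by rewrite sN0.
- by move=> x y xy; rewrite /F ltr_pM2l.
- by rewrite F'E => ?; exact: cvg_cst.
- by rewrite F'E; exact: is_cvg_cst.
- by rewrite F'E; exact: is_cvg_cst.
- exact: dF.
- apply/gt0_cvgMrNy => //; exact: cvg_id.
- apply/gt0_cvgMry => //; exact: cvg_id.
- move=> x; apply: cvgM; first exact: cfs.
  by apply: continuous_normal_pdf; exact: oner_neq0.
- by move=> x; rewrite /G mulr_ge0// normal_pdf_ge0.
Qed.

Lemma integrable_normal_pow4 :
  (normal_prob 0 1).-integrable [set: R] (fun x => (x ^+ 4)%:E).
Proof.
have mx : measurable_fun setT (fun x : R => x ^+ 4) by exact: measurable_funX.
apply/integrableP; split; first exact/measurable_EFinP.
under eq_integral do rewrite /= ger0_norm ?exprn_even_ge0//.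
rewrite ge0_integral_normal//; last by move=> x; rewrite exprn_even_ge0.
(* With [y = 3/8 x^2] one has [x^4 = 64/9 y^2 <= 128/9 exp y], and [exp y] turns the Gaussian factor
   of deviation 1 into the one of deviation 2; the peaks account for the two normalisations. *)
pose C : R := 128 / 9 * normal_peak 1 / normal_peak 2.
apply: (@le_lt_trans _ _ (\int[mu]_x (C%:E * (normal_pdf 0 2 x)%:E))%E).
  apply: ge0_le_integral => //.
  - by move=> x _; rewrite lee_fin mulr_ge0 ?normal_pdf_ge0// exprn_even_ge0.
  - apply/measurable_EFinP/measurable_funM => //; exact: measurable_normal_pdf.
  - by apply/measurable_EFinP/measurable_funM => //; exact: measurable_normal_pdf.
  move=> x _; rewrite -EFinM lee_fin !normal_pdfE ?oner_neq0 ?pnatr_eq0//.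
  rewrite /C (mulrA (_ / _)) mulfVK ?gt_eqF ?normal_peak_gt0 ?pnatr_eq0//.
  rewrite (mulrCA (x ^+ 4)) (mulrC (128 / 9)) -(mulrA (normal_peak 1)).
  rewrite ler_wpM2l ?normal_peak_ge0// /normal_fun subr0.
  have y0 : 0 <= 3 / 8 * x ^+ 2 by rewrite mulr_ge0// sqr_ge0.
  have := expR_ge1Dxn 1 y0; set y := 3 / 8 * x ^+ 2 => ey.
  have -> : - x ^+ 2 / (2 ^+ 2 *+ 2) = - x ^+ 2 / (1 ^+ 2 *+ 2) + y.
    by rewrite /y; field.
  have -> : x ^+ 4 = 64 / 9 * y ^+ 2.
    by rewrite /y exprMn -exprM; field.
  have f2 : (2`!%:R : R) = 2 by [].
  rewrite expRD; set e := expR (- x ^+ 2 / _).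
  have -> : 64 / 9 * y ^+ 2 * e <= 128 / 9 * (e * expR y) = 
    (0 <= e * (128 / 9 * expR y - 64 / 9 * y ^+ 2)).
    by rewrite -subr_ge0; congr (0 <= _); ring.
  by rewrite mulr_ge0 ?expR_ge0//; move: ey; rewrite f2; lra.
rewrite integralZl//; last exact: integrable_normal_pdf.
by rewrite integral_normal_pdf mule1 ltry.
Qed.

Lemma integrable_normal_pow2 :
  (normal_prob 0 1).-integrable [set: R] (fun x => (x ^+ 2)%:E).
Proof.
have mx : measurable_fun setT (fun x : R => x ^+ 2) by exact: measurable_funX.
apply: (@L1_le _ _ _ (normal_prob 0 1) _ (fun x => 1 + x ^+ 4)) => //.
  move=> x; rewrite ger0_norm ?sqr_ge0//.
  by have := sqr_ge0 (x ^+ 2 - 1); rewrite sqrrB1 -exprM; have := sqr_ge0 (x ^+ 2); rewrite -exprM; lra.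
by apply: L1D; [exact: L1_cst|exact: integrable_normal_pow4].
Qed.

(* Only the finiteness of these moments matters: their values 1 and 3 merely
   rescale the time in the limit. *)
Definition gauss2 : R := \int[normal_prob 0 1]_x x ^+ 2.
Definition gauss4 : R := \int[normal_prob 0 1]_x x ^+ 4.

End GaussianMoments.

(** * Complex entries and the inner product of u(N) *)

Notation re := complex.Re.
Notation im := complex.Im.

Section ComplexParts.
Context {R : realType}.
Implicit Types x y : R[i].

Lemma reD x y : re (x + y) = re x + re y. Proof. by case: x; case: y. Qed.
Lemma imD x y : im (x + y) = im x + im y. Proof. by case: x; case: y. Qed.
Lemma reN x : re (- x) = - re x. Proof. by case: x. Qed.
Lemma imN x : im (- x) = - im x. Proof. by case: x. Qed.
Lemma reB x y : re (x - y) = re x - re y. Proof. by rewrite reD reN. Qed.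
Lemma imB x y : im (x - y) = im x - im y. Proof. by rewrite imD imN. Qed.
Lemma reM x y : re (x * y) = re x * re y - im x * im y.
Proof. by case: x; case: y. Qed.
Lemma imM x y : im (x * y) = re x * im y + im x * re y.
Proof. by case: x => a b; case: y. Qed.
Lemma reJ x : re (conjc x) = re x. Proof. by case: x. Qed.
Lemma imJ x : im (conjc x) = - im x. Proof. by case: x. Qed.
Lemma reZ (a : R) x : re (a%:C * x) = a * re x.
Proof. by case: x => b c; rewrite /= mul0r subr0. Qed.
Lemma imZ (a : R) x : im (a%:C * x) = a * im x.
Proof. by case: x => b c; rewrite /= mul0r addr0. Qed.
Lemma natC n : (n%:R : R)%:C = n%:R :> R[i].
Proof. by rewrite rmorph_nat. Qed.

Lemma re_sum (I : Type) (s : seq I) (p : pred I) (F : I -> R[i]) :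
  re (\sum_(i <- s | p i) F i) = \sum_(i <- s | p i) re (F i).
Proof. by elim/big_rec2: _ => // i a b _ <-; rewrite reD. Qed.
Lemma im_sum (I : Type) (s : seq I) (p : pred I) (F : I -> R[i]) :
  im (\sum_(i <- s | p i) F i) = \sum_(i <- s | p i) im (F i).
Proof. by elim/big_rec2: _ => // i a b _ <-; rewrite imD. Qed.

Lemma complex_eq x y : re x = re y -> im x = im y -> x = y.
Proof. by case: x => a b; case: y => c e /= -> ->. Qed.

Lemma adjE n (M : 'M[R[i]]_n) i j : (M ^t*) i j = conjc (M j i).
Proof. by rewrite !mxE. Qed.

Lemma adjK n (M : 'M[R[i]]_n) : M ^t* ^t* = M.
Proof. by apply/matrixP => i j; rewrite !adjE conjcK. Qed.

Lemma adjD n (A B : 'M[R[i]]_n) : (A + B) ^t* = A ^t* + B ^t*.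
Proof. by rewrite linearD/= map_mxD. Qed.

Lemma adjN n (A : 'M[R[i]]_n) : (- A) ^t* = - A ^t*.
Proof. by rewrite linearN/= map_mxN. Qed.

Lemma adjZ n (a : R) (A : 'M[R[i]]_n) : (a%:C *: A) ^t* = a%:C *: A ^t*.
Proof.
apply/matrixP => i j; rewrite adjE [in LHS]mxE [in RHS]mxE adjE rmorphM.
by congr (_ * _); apply: complex_eq; rewrite /= ?oppr0.
Qed.

Lemma adjM n (A B : 'M[R[i]]_n) : (A *m B) ^t* = B ^t* *m A ^t*.
Proof.
apply/matrixP => i j; rewrite adjE !mxE rmorph_sum; apply: eq_bigr => k _.
by rewrite !adjE rmorphM mulrC.
Qed.

Lemma tr_adj n (A : 'M[R[i]]_n) : \tr (A ^t*) = conjc (\tr A).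
Proof. by rewrite rmorph_sum; apply: eq_bigr => i _; rewrite adjE. Qed.

End ComplexParts.

(* Sealed, so that conversion never unfolds traces of matrix products. *)
HB.lock Definition ui {R : realType} {N : nat} (X Y : 'M[R[i]]_N) : R :=
  u_inner X Y.

(** The projection onto u(N) along the Hermitian matrices; these are orthogonal to u(N) for [ui]. *)
HB.lock Definition skp {R : realType} {N : nat} (X : 'M[R[i]]_N) : 'M[R[i]]_N :=
  (2^-1)%:C *: (X - X ^t*).

Definition cidx (N : nat) := ('I_N * 'I_N * bool)%type.

(* The real and imaginary parts of the entries of a matrix, and the
   skew-Hermitian matrices that represent them on the skew-Hermitian ones. *)
HB.lock Definition coord {R : realType} {N : nat} (e : cidx N) (X : 'M[R[i]]_N) : R :=
  if e.2 then re (X e.1.1 e.1.2) else im (X e.1.1 e.1.2).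

HB.lock Definition cbasis {R : realType} {N : nat} (e : cidx N) : 'M[R[i]]_N :=
  skp ((if e.2 then - N%:R^-1 else N%:R^-1 *i) *: delta_mx e.1.2 e.1.1).

(** The coefficients of the linear form [ui X] in the coordinates [coord], see [ui_coord]. *)
HB.lock Definition gcoef {R : realType} {N : nat} (e : cidx N) (X : 'M[R[i]]_N) : R :=
  if e.2 then - (N%:R * re (X e.1.2 e.1.1)) else N%:R * im (X e.1.2 e.1.1).

Section InnerProduct.
Context {R : realType} {N : nat}.
Local Notation M := 'M[R[i]]_N.
Implicit Types X Y : M.

Lemma uiE X Y : ui X Y = - (N%:R * re (\tr (X *m Y))).
Proof. by rewrite ui.unlock /u_inner reN -natC reZ. Qed.

Lemma ui_sym X Y : ui X Y = ui Y X.
Proof. by rewrite !uiE mxtrace_mulC. Qed.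

Lemma uiDl X X' Y : ui (X + X') Y = ui X Y + ui X' Y.
Proof. by rewrite !uiE mulmxDl linearD/= reD mulrDr opprD. Qed.

Lemma uiDr X Y Y' : ui X (Y + Y') = ui X Y + ui X Y'.
Proof. by rewrite !uiE mulmxDr linearD/= reD mulrDr opprD. Qed.

Lemma uiZl (a : R) X Y : ui (a%:C *: X) Y = a * ui X Y.
Proof. by rewrite !uiE -scalemxAl mxtraceZ reZ mulrN mulrCA. Qed.

Lemma uiZr (a : R) X Y : ui X (a%:C *: Y) = a * ui X Y.
Proof. by rewrite ui_sym uiZl ui_sym. Qed.

Lemma uiNl X Y : ui (- X) Y = - ui X Y.
Proof. by rewrite !uiE mulNmx linearN/= reN mulrN. Qed.

Lemma uiNr X Y : ui X (- Y) = - ui X Y.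
Proof. by rewrite ui_sym uiNl ui_sym. Qed.

Lemma uiBl X X' Y : ui (X - X') Y = ui X Y - ui X' Y.
Proof. by rewrite uiDl uiNl. Qed.

Lemma uiBr X Y Y' : ui X (Y - Y') = ui X Y - ui X Y'.
Proof. by rewrite uiDr uiNr. Qed.

Lemma ui0l Y : ui 0 Y = 0.
Proof. by rewrite uiE mul0mx linear0 mulr0 oppr0. Qed.

Lemma ui0r X : ui X 0 = 0.
Proof. by rewrite ui_sym ui0l. Qed.

Lemma ui_sumr (I : Type) (s : seq I) (F : I -> M) X :
  ui X (\sum_(i <- s) F i) = \sum_(i <- s) ui X (F i).
Proof. by apply: (big_morph (ui X)); [exact: uiDr|exact: ui0r]. Qed.

Lemma ui_suml (I : Type) (s : seq I) (F : I -> M) Y :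
  ui (\sum_(i <- s) F i) Y = \sum_(i <- s) ui (F i) Y.
Proof.
by apply: (big_morph (ui^~ Y)); [by move=> A B; exact: uiDl|exact: ui0l].
Qed.

Lemma ui_skew X : skew_hermitian X -> ui X X = N%:R * sqr_norm X.
Proof.
move=> sX; rewrite uiE -mulrN -reN; congr (_ * _).
have -> : - \tr (X *m X) = \tr (X *m X ^t*) by rewrite sX mulmxN linearN.
rewrite /mxtrace re_sum; apply: eq_bigr => i _; rewrite mxE re_sum.
by apply: eq_bigr => j _; rewrite adjE; case: (X i j) => a b /=; ring.
Qed.

Lemma sqr_norm_ge0 X : 0 <= sqr_norm X.
Proof.
by apply: sumr_ge0 => i _; apply: sumr_ge0 => j _; rewrite addr_ge0 ?sqr_ge0.
Qed.

Lemma sqr_norm_entry X i j :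
  re (X i j) ^+ 2 + im (X i j) ^+ 2 <= sqr_norm X.
Proof.
rewrite /sqr_norm (bigD1 i)//= (bigD1 j)//= -addrA lerDl addr_ge0//.
  by apply: sumr_ge0 => k _; rewrite addr_ge0 ?sqr_ge0.
by apply: sumr_ge0 => k _; apply: sumr_ge0 => l _; rewrite addr_ge0 ?sqr_ge0.
Qed.

Lemma sqr_norm_eq0 X : sqr_norm X = 0 -> X = 0.
Proof.
move=> X0; apply/matrixP => i j; rewrite mxE.
have := sqr_norm_entry X i j; rewrite X0 => h.
have a0 := sqr_ge0 (re (X i j)); have b0 := sqr_ge0 (im (X i j)).
by apply: complex_eq => /=; apply/eqP; rewrite -sqrf_eq0; apply/eqP; lra.
Qed.

Lemma ui_skew_ge0 X : skew_hermitian X -> 0 <= ui X X.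
Proof. by move=> sX; rewrite ui_skew// mulr_ge0// sqr_norm_ge0. Qed.

Lemma ui_skew_eq0 X : skew_hermitian X -> ui X X = 0 -> X = 0.
Proof.
move=> sX; rewrite ui_skew// => /eqP; rewrite mulf_eq0 pnatr_eq0.
case/orP => [/eqP N0|/eqP]; last exact: sqr_norm_eq0.
by apply/matrixP => -[i Hi]; exfalso; rewrite N0 in Hi.
Qed.

Lemma skewD X Y : skew_hermitian X -> skew_hermitian Y -> skew_hermitian (X + Y).
Proof. by rewrite /skew_hermitian adjD => -> ->; rewrite opprD. Qed.

Lemma skewN X : skew_hermitian X -> skew_hermitian (- X).
Proof. by rewrite /skew_hermitian adjN => ->. Qed.

Lemma skewB X Y : skew_hermitian X -> skew_hermitian Y -> skew_hermitian (X - Y).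
Proof. by move=> sX sY; apply: skewD => //; exact: skewN. Qed.

Lemma skewZ (a : R) X : skew_hermitian X -> skew_hermitian (a%:C *: X).
Proof. by rewrite /skew_hermitian adjZ => ->; rewrite scalerN. Qed.

Lemma skew0 : skew_hermitian (0 : M).
Proof. by rewrite /skew_hermitian; apply/matrixP => i j; rewrite adjE !mxE; apply: complex_eq; rewrite /= ?oppr0. Qed.

Lemma skew_sum (I : Type) (s : seq I) (F : I -> M) :
  (forall i, skew_hermitian (F i)) -> skew_hermitian (\sum_(i <- s) F i).
Proof.
move=> sF; elim: s => [|i s IH]; first by rewrite big_nil; exact: skew0.
by rewrite big_cons; exact: skewD.
Qed.

Lemma skp_skew X : skew_hermitian (skp X).
Proof.
by rewrite /skew_hermitian skp.unlock adjZ adjD adjN adjK -scalerN opprB addrC.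
Qed.

(** Passing to the adjoint of [X] changes the sign of [ui X Y] when [Y] is skew-Hermitian, so the
    Hermitian part of [X] contributes nothing. *)
Lemma ui_skp X Y : skew_hermitian Y -> ui X Y = ui (skp X) Y.
Proof.
move=> sY; rewrite skp.unlock uiZl uiBl.
have -> : ui (X ^t*) Y = - ui X Y.
  rewrite !uiE; congr (- _); rewrite -mulrN; congr (_ * _).
  by rewrite -reJ -tr_adj adjM adjK sY mulNmx linearN/= reN mxtrace_mulC.
by rewrite opprK; field.
Qed.

Lemma skew_ui_inj X Y : skew_hermitian X -> skew_hermitian Y ->
  (forall Z, skew_hermitian Z -> ui X Z = ui Y Z) -> X = Y.
Proof.
move=> sX sY XY; apply/eqP; rewrite -subr_eq0; apply/eqP.
have sXY := skewB sX sY.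
by apply: ui_skew_eq0 => //; rewrite uiBl XY// subrr.
Qed.

Lemma ui_coord X Y : ui X Y = \sum_(e : cidx N) gcoef e X * coord e Y.
Proof.
rewrite uiE /mxtrace re_sum.
transitivity (\sum_(i < N) \sum_(j < N)
   \sum_(b : bool) gcoef (j, i, b) X * coord (j, i, b) Y).
  rewrite mulr_sumr -sumrN; apply: eq_bigr => i _.
  rewrite mxE re_sum mulr_sumr -sumrN; apply: eq_bigr => j _.
  by rewrite big_bool gcoef.unlock coord.unlock/= reM; ring.
rewrite exchange_big/= pair_bigA/= pair_bigA/=.
by apply: eq_bigr => -[[i j] b].
Qed.

Lemma cbasis_skew (e : cidx N) : skew_hermitian (cbasis e : M).
Proof. by rewrite cbasis.unlock; exact: skp_skew. Qed.

Lemma coord_ui e X : skew_hermitian X -> coord e X = ui (cbasis e) X.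
Proof.
move=> sX; rewrite cbasis.unlock -ui_skp// uiE -scalemxAl mxtraceZ.
have N0 : (N%:R : R) != 0.
  by rewrite pnatr_eq0; case: e => -[[i Hi] j b]; case: (N) Hi.
have -> : \tr (delta_mx e.1.2 e.1.1 *m X) = X e.1.1 e.1.2.
  rewrite /mxtrace (bigD1 e.1.2)//= mxE (bigD1 e.1.1)//= !mxE !eqxx mul1r.
  rewrite !big1 ?addr0//.
    by move=> i ie; rewrite mxE big1// => j _; rewrite mxE (negbTE ie) mul0r.
  by move=> j je; rewrite !mxE (negbTE je) andbF mul0r.
rewrite coord.unlock; case: e.2.
  have -> : - N%:R^-1 = (- N%:R^-1 : R)%:C :> R[i].
    by rewrite rmorphN /= fmorphV; congr (- _^-1); rewrite -natC.
  by rewrite reZ; field.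
by rewrite reM /=; field.
Qed.

(** The [2 N^2] matrices [cbasis] are a redundant spanning family of u(N). Both sides nevertheless
    pair alike with every skew-Hermitian matrix, and this determines them. *)
Lemma sum_gcoef_cbasis X : \sum_e (gcoef e X)%:C *: cbasis e = skp X.
Proof.
apply: skew_ui_inj => [||Z sZ]; [|exact: skp_skew|].
  by apply: skew_sum => e; apply: skewZ; exact: cbasis_skew.
rewrite -ui_skp// [RHS]ui_coord ui_suml; apply: eq_bigr => e _.
by rewrite uiZl coord_ui.
Qed.

(** Makes the form on projections a fixed quadratic polynomial in the entries; measurability, bounds
    and the isometry are all read off from it. *)
Lemma ui_skp2 X Y : ui (skp X) (skp Y) =
  \sum_(e : cidx N) \sum_(e' : cidx N)
    gcoef e X * gcoef e' Y * ui (cbasis e) (cbasis e').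
Proof.
rewrite -!sum_gcoef_cbasis ui_suml; apply: eq_bigr => e _.
rewrite ui_sumr; apply: eq_bigr => e' _.
by rewrite uiZl uiZr mulrA.
Qed.

End InnerProduct.

(** * Brownian increments and Ito integrals *)

Section SubAlgebra.
Context {T : pointedType} {R : realType}.
Variable G : set (set T).
Hypothesis sG : sigma_algebra setT G.

(** Phrased through [g_sigma_algebraType G] so that the closure properties of measurable functions
    are available for each [F s] of a filtration. *)
Definition fm (f : T -> R) :=
  measurable_fun [set: g_sigma_algebraType G] (f : g_sigma_algebraType G -> R).

Lemma fmP (f : T -> R) : (forall B, measurable B -> G (f @^-1` B)) <-> fm f.
Proof.
split=> [h _ B mB|mf B mB].
  by rewrite setTI; apply: sub_sigma_algebra; exact: h.
have := mf measurableT B mB; rewrite setTI.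
by rewrite measurable_g_measurableTypeE.
Qed.

Lemma fm_set (f : T -> R) B : fm f -> measurable B -> G (f @^-1` B).
Proof. by move=> /fmP; exact. Qed.

End SubAlgebra.

Section MatrixMeasurability.
Context {R : realType} {N : nat}.
Notation M := 'M[R[i]]_N.

Lemma measurable_re_entry i j : measurable_fun [set: M] (fun X : M => re (X i j)).
Proof.
move=> _ B mB; rewrite setTI; apply: sub_sigma_algebra.
by exists i, j, B; split => //; left.
Qed.

Lemma measurable_im_entry i j : measurable_fun [set: M] (fun X : M => im (X i j)).
Proof.
move=> _ B mB; rewrite setTI; apply: sub_sigma_algebra.
by exists i, j, B; split => //; right.
Qed.

Lemma measurable_coord e : measurable_fun [set: M] (fun X : M => coord e X).
Proof.
by rewrite coord.unlock; case: e.2; [exact: measurable_re_entry|exact: measurable_im_entry].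
Qed.

Lemma measurable_ui X : measurable_fun [set: M] (fun Y => ui X Y).
Proof.
under eq_fun do rewrite ui_coord.
by apply: measurable_sum => e; apply: measurable_funM => //; exact: measurable_coord.
Qed.

End MatrixMeasurability.

Lemma polarization {R : realType} (a b c e h : R) :
  h * a + 2 * e + h * c = h * (a + b + (b + c)) -> e = h * b.
Proof. by lra. Qed.

(** * Moments of the increments of the driving motion *)

Section Increments.
Context {d : measure_display} {Omega : measurableType d} {R : realType}.
Variables (P : probability Omega R) (N : nat).
Notation M := 'M[R[i]]_N.
Variables (F : R -> set (set Omega)) (K : R -> Omega -> M).
Hypothesis filF : filtration F.
Hypothesis bmK : u_brownian_motion P F K.
Notation L1 := (L1 P).
Notation L2 := (L2 P).
Notation Ex := (Ex P).
Implicit Types (s r : R).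

Lemma fil_sigma s : 0 <= s -> sigma_algebra setT (F s).
Proof. by case: filF => h _ _; exact: h. Qed.

Lemma fm_meas s (f : Omega -> R) : 0 <= s -> fm (F s) f -> measurable_fun setT f.
Proof.
move=> s0 mf _ B mB; rewrite setTI.
case: filF => _ h _; apply: (h s s0).
exact: (fm_set (fil_sigma s0) mf mB).
Qed.

Lemma fm_le s r (f : Omega -> R) : 0 <= s -> s <= r -> fm (F s) f -> fm (F r) f.
Proof.
move=> s0 sr mf; apply/(fmP (fil_sigma (le_trans s0 sr))) => B mB.
case: filF => _ _ h; apply: (h s r s0 sr).
exact: (fm_set (fil_sigma s0) mf mB).
Qed.

Lemma fm_comp s (f : Omega -> M) (g : M -> R) : 0 <= s ->
  measurable_wrt (F s) f -> measurable_fun setT g -> fm (F s) (g \o f).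
Proof.
move=> s0 mf mg; apply/(fmP (fil_sigma s0)) => B mB; rewrite comp_preimage.
by apply: mf; rewrite -[X in measurable X]setTI; exact: mg.
Qed.

Lemma fm_coord s (f : Omega -> M) e : 0 <= s -> measurable_wrt (F s) f ->
  fm (F s) (fun w => coord e (f w)).
Proof. by move=> s0 mf; apply: (fm_comp s0 mf); exact: measurable_coord. Qed.

Lemma fm_K s e : 0 <= s -> fm (F s) (fun w => coord e (K s w)).
Proof. by move=> s0; apply: fm_coord => //; case: bmK => _ _ _ h _; exact: h. Qed.

Lemma K_skew s w : 0 <= s -> skew_hermitian (K s w).
Proof. by case: bmK => _ h _ _ _; exact: h. Qed.

Definition dK s r w := K r w - K s w.

Lemma dKE s r w : dK s r w = K r w - K s w. Proof. by []. Qed.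

Lemma dK_skew s r w : 0 <= s -> s <= r -> skew_hermitian (dK s r w).
Proof. by move=> s0 sr; apply: skewB; apply: K_skew; rewrite // (le_trans s0). Qed.

Lemma dKss s w : dK s s w = 0. Proof. exact: subrr. Qed.

Lemma coordB e (X Y : M) : coord e (X - Y) = coord e X - coord e Y.
Proof. by rewrite coord.unlock !mxE; case: e.2; [exact: reB|exact: imB]. Qed.

Lemma fm_dK s r e : 0 <= s -> s <= r -> fm (F r) (fun w => coord e (dK s r w)).
Proof.
move=> s0 sr; have r0 := le_trans s0 sr.
rewrite /fm; under eq_fun do rewrite /dK coordB.
by apply: measurable_funB; [exact: fm_K|apply: (fm_le s0 sr); exact: fm_K].
Qed.

Lemma fm_ui s r X : 0 <= s -> s <= r -> fm (F r) (fun w => ui X (dK s r w)).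
Proof.
move=> s0 sr; rewrite /fm; under eq_fun do rewrite ui_coord.
apply: measurable_sum => e; apply: measurable_funM => //; exact: fm_dK.
Qed.

Lemma meas_ui s r X : 0 <= s -> s <= r ->
  measurable_fun setT (fun w => ui X (dK s r w)).
Proof.
by move=> s0 sr; apply: (fm_meas (le_trans s0 sr)); exact: fm_ui.
Qed.

Lemma law_unit s r X B : 0 <= s -> s < r -> skew_hermitian X -> ui X X = 1 ->
  measurable B ->
  P [set w | B (ui X (dK s r w))] = normal_prob 0 (Num.sqrt (r - s)) B.
Proof.
rewrite ui.unlock => s0 sr sX X1 mB.
by case: bmK => _ _ _ _ /(_ s r s0 sr)[_ /(_ X sX X1 B mB)].
Qed.

(* The normalised form [ui X dK] and a centred Gaussian have the same
   law, so they have the same integrals. *)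
Lemma integral_unit s r X (f : R -> R) : 0 <= s -> s < r ->
  skew_hermitian X -> ui X X = 1 -> continuous f -> (forall x, 0 <= f x) ->
  (\int[P]_w (f (ui X (dK s r w)))%:E =
   \int[normal_prob 0%R 1%R]_x (f (Num.sqrt (r - s) * x)%R)%:E)%E.
Proof.
move=> s0 sr sX X1 cf f0.
have h0 : 0 < Num.sqrt (r - s) by rewrite sqrtr_gt0 subr_gt0.
rewrite -ge0_integral_normal_scale//.
have mY : measurable_fun setT (fun w => ui X (dK s r w) : measurableTypeR R).
  exact: (meas_ui X s0 (ltW sr)).
pose Y := @mfun_Sub _ _ Omega (measurableTypeR R) _ (mem_set mY).
have mf := continuous_measurable_fun cf.
transitivity (\int[distribution P Y]_x (f x)%:E)%E.
  by rewrite ge0_integral_distribution//; exact/measurable_EFinP.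
apply: eq_measure_integral => A mA _.
exact: law_unit.
Qed.

Lemma integral_moment s r X n : 0 <= s -> s < r ->
  skew_hermitian X -> ui X X = 1 ->
  (\int[P]_w ((ui X (dK s r w)) ^+ n.*2)%:E =
   ((r - s) ^+ n)%:E * \int[normal_prob 0%R 1%R]_x (x ^+ n.*2)%:E)%E.
Proof.
move=> s0 sr sX X1; rewrite (integral_unit (f := fun x => x ^+ n.*2))//.
- under eq_integral do rewrite exprMn -{1}mul2n exprM sqr_sqrtr ?subr_ge0 1?ltW// EFinM.
  rewrite ge0_integralZl//=; last 3 first.
  + by apply/measurable_EFinP; exact: measurable_funX.
  + by move=> x _; rewrite lee_fin exprn_even_ge0// odd_double.
  + by rewrite lee_fin exprn_ge0// subr_ge0 ltW.
- by move=> x; exact: exprn_continuous.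
- by move=> x; rewrite exprn_even_ge0// odd_double.
Qed.

Lemma unit_moments s r X : 0 <= s -> s < r ->
  skew_hermitian X -> ui X X = 1 ->
  let Y w := ui X (dK s r w) in
  [/\ L2 Y, L2 (fun w => Y w ^+ 2), Ex Y = 0,
      Ex (fun w => Y w ^+ 2) = (r - s) * gauss2
    & Ex (fun w => Y w ^+ 4) = (r - s) ^+ 2 * gauss4].
Proof.
move=> s0 sr sX X1 Y; have mY : measurable_fun setT Y by apply: meas_ui => //; exact: ltW.
have m2 : (\int[P]_w (Y w ^+ 2)%:E = ((r - s) * gauss2)%:E)%E.
  apply: etrans (integral_moment 1 s0 sr sX X1) _.
  rewrite expr1 EFinM; congr (_ * _)%E.
  by rewrite /gauss2 /Rintegral fineK//; exact: (integrable_fin_num _ integrable_normal_pow2).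
have m4 : (\int[P]_w (Y w ^+ 4)%:E = ((r - s) ^+ 2 * gauss4)%:E)%E.
  apply: etrans (integral_moment 2 s0 sr sX X1) _.
  rewrite (EFinM (_ ^+ 2)); congr (_ * _)%E.
  by rewrite /gauss4 /Rintegral fineK//; exact: (integrable_fin_num _ integrable_normal_pow4).
have i2 : L1 (fun w => Y w ^+ 2).
  apply/integrableP; split; first by apply/measurable_EFinP; exact: measurable_funX.
  under eq_integral do rewrite /= ger0_norm ?sqr_ge0//.
  by rewrite m2 ltry.
have i4 : L1 (fun w => Y w ^+ 4).
  apply/integrableP; split; first by apply/measurable_EFinP; exact: measurable_funX.
  under eq_integral do rewrite /= ger0_norm ?exprn_even_ge0//.
  by rewrite m4 ltry.
have LY : L2 Y by split.
split => //.
- by split; [exact: measurable_funX|under eq_fun do rewrite -exprM].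
- have LY1 := L2_L1 LY.
  (* [X] and [- X] are both unit vectors, so [Y] and [- Y] have the same law and the mean
     vanishes. *)
  suff e : (\int[P]_w (Y w)%:E = \int[P]_w (- Y w)%:E)%E.
    have : Ex Y = Ex (fun w => -1 * Y w).
      by rewrite /Ex /Rintegral e; congr fine; apply: eq_integral => w _; rewrite mulN1r.
    by rewrite ExZ//; lra.
  pose Y1 : {mfun Omega >-> R} := mfun_Sub (mem_set mY).
  have mY' : measurable_fun setT (fun w => - Y w) by exact: measurableT_comp.
  pose Y2 : {mfun Omega >-> R} := mfun_Sub (mem_set mY').
  transitivity (\int[distribution P Y1]_x x%:E)%E.
    by rewrite (@integral_distribution _ _ _ _ _ _ Y1 EFin).
  transitivity (\int[distribution P Y2]_x x%:E)%E; last first.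
    rewrite (@integral_distribution _ _ _ _ _ _ Y2 EFin)//=.
    have := L1Z (-1) LY1; rewrite L1E /comp/=.
    by under eq_fun do rewrite mulN1r.
  apply: eq_measure_integral => A mA _.
  have h X2 := @law_unit s r X2 A s0 sr.
  apply: etrans (h X sX X1 mA) _; apply/esym.
  have sX' := skewN sX.
  have X1' : ui (- X) (- X) = 1 by rewrite uiNl uiNr opprK.
  apply: etrans (h (- X) sX' X1' mA); congr (P _).
  by apply/seteqP; split => w /=; rewrite /Y uiNl.
- by rewrite ExE /Rintegral m2.
- by rewrite ExE /Rintegral m4.
Qed.

Lemma moments s r X : 0 <= s -> s <= r -> skew_hermitian X ->
  let Y w := ui X (dK s r w) in
  [/\ L2 Y, L2 (fun w => Y w ^+ 2), Ex Y = 0,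
      Ex (fun w => Y w ^+ 2) = (r - s) * gauss2 * ui X X
    & Ex (fun w => Y w ^+ 4) = (r - s) ^+ 2 * gauss4 * ui X X ^+ 2].
Proof.
move=> s0; rewrite le_eqVlt => /predU1P[<-|sr] sX Y.
  have Y0 : Y = (fun=> 0) by apply/funext => w; rewrite /Y dKss ui0r.
  rewrite Y0 subrr !(mul0r, expr0n)/=.
  rewrite !Ex_cst; split => //; exact: L2_cst.
have := ui_skew_ge0 sX; rewrite le_eqVlt => /predU1P[/esym X0|X0].
  have Y0 : Y = (fun=> 0).
    by apply/funext => w; rewrite /Y (ui_skew_eq0 sX X0) ui0l.
  rewrite Y0 X0 !(mulr0, expr0n)/=.
  rewrite !Ex_cst; split => //; exact: L2_cst.
set c := Num.sqrt (ui X X).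
have c0 : 0 < c by rewrite sqrtr_gt0.
have cc : c ^+ 2 = ui X X by rewrite sqr_sqrtr// ltW.
pose X' := (c^-1)%:C *: X.
have X'1 : ui X' X' = 1.
  by rewrite uiZl uiZr -cc; field; rewrite gt_eqF.
have [h1 h2 h3 h4 h5] := unit_moments s0 sr (skewZ c^-1 sX) X'1.
pose Y' w := ui X' (dK s r w).
have YE : Y = (fun w => c * Y' w).
  by apply/funext => w; rewrite /Y /Y' uiZl mulrA mulfV ?mul1r// gt_eqF.
have h4' : L1 (fun w => Y' w ^+ 4).
  by case: h2 => _; under eq_fun do rewrite -exprM.
rewrite YE; split.
- exact: L2Z.
- by under eq_fun do rewrite exprMn; exact: L2Z.
- by rewrite ExZ ?[Ex _]h3 ?mulr0//; exact: L2_L1.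
- under Ex_eq do rewrite exprMn.
  by rewrite ExZ ?[Ex _]h4 ?cc 1?mulrC//; exact: L2_L1sqr.
- under Ex_eq do rewrite exprMn.
  by rewrite ExZ// [Ex _]h5 -cc -exprM mulrC.
Qed.

(** Polarisation of the variances along [X], [Y] and [X + Y]. *)
Lemma covariance s r X Y : 0 <= s -> s <= r ->
  skew_hermitian X -> skew_hermitian Y ->
  Ex (fun w => ui X (dK s r w) * ui Y (dK s r w)) =
  (r - s) * gauss2 * ui X Y.
Proof.
move=> s0 sr sX sY.
have [X1 _ _ X2 _] := moments s0 sr sX.
have [Y1 _ _ Y2 _] := moments s0 sr sY.
have [_ _ _ XY2 _] := moments s0 sr (skewD sX sY).
move: XY2; under Ex_eq do rewrite uiDl sqrrD -mulr_natl.
have L1XY := L2_mul X1 Y1.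
rewrite ExD; [|apply: L1D; [exact: L2_L1sqr|exact: L1Z]|exact: L2_L1sqr].
rewrite ExD; [|exact: L2_L1sqr|exact: L1Z].
rewrite ExZ// X2 Y2 uiDl !uiDr (ui_sym Y X).
exact: polarization.
Qed.

Lemma indep_dK s r Z (g : M -> R) : 0 <= s -> s <= r -> fm (F s) Z ->
  measurable_fun setT g -> L1 Z -> L1 (fun w => g (dK s r w)) ->
  L1 (fun w => Z w * g (dK s r w)) ->
  Ex (fun w => Z w * g (dK s r w)) = Ex Z * Ex (fun w => g (dK s r w)).
Proof.
move=> s0; rewrite le_eqVlt => /predU1P[<-|sr] mZ mg LZ Lg LZg.
  under [in LHS]Ex_eq do rewrite dKss mulrC.
  have -> : (fun w => g (dK s s w)) = (fun=> g 0).
    by apply/funext => w; rewrite dKss.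
  by rewrite Ex_cst ExZ// mulrC.
apply: Ex_indep => // A B mA mB.
case: bmK => _ _ _ _ /(_ s r s0 sr)[h _].
have FA := fm_set (fil_sigma s0) mZ mA.
have mgB : measurable (g @^-1` B) by rewrite -[X in measurable X]setTI; exact: mg.
exact: (h _ _ FA mgB).
Qed.

End Increments.

Lemma mul5_perm {R : comRingType} (a b c e f : R) :
  a * (b * e * (c * f)) = a * b * c * (e * f).
Proof. ring. Qed.

Lemma mul4_perm {R : comRingType} (a b c e : R) :
  a * b * c * e = a * (b * c * e).
Proof. ring. Qed.

Lemma mul4_permC {R : comRingType} (a b c e : R) :
  a * (b * c * e) = b * c * (e * a).
Proof. ring. Qed.

Lemma gcoef_coord {R : realType} {N : nat} (e : cidx N) (X : 'M[R[i]]_N) : gcoef e X =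
  (if e.2 then - N%:R else N%:R) * coord (e.1.2, e.1.1, e.2) X.
Proof. by rewrite gcoef.unlock coord.unlock/=; case: e.2; rewrite ?mulNr. Qed.

(** * Ito isometry for piecewise constant integrands *)

Section RandomForms.
Context {d : measure_display} {Omega : measurableType d} {R : realType}.
Variables (P : probability Omega R) (N : nat).
Notation M := 'M[R[i]]_N.
Variables (F : R -> set (set Omega)) (K : R -> Omega -> M).
Hypothesis filF : filtration F.
Hypothesis bmK : u_brownian_motion P F K.
Notation L1 := (L1 P).
Notation L2 := (L2 P).
Notation Ex := (Ex P).
Notation dK := (dK K).
Implicit Types (s r : R) (Y : Omega -> M).

Definition bnd Y (C : R) := forall e w, `|coord e (Y w)| <= C.

Definition adm s Y :=
  (forall e, fm (F s) (fun w => coord e (Y w))) /\ exists C, bnd Y C.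

Definition form Y s r w := ui (Y w) (dK s r w).

Lemma form_ui Y s r w : form Y s r w = ui (Y w) (dK s r w). Proof. by []. Qed.

Lemma adm_le s r Y : 0 <= s -> s <= r -> adm s Y -> adm r Y.
Proof. by move=> s0 sr [mY bY]; split=> // e; exact: (fm_le filF s0 sr). Qed.

Lemma fm_gcoef s Y e : adm s Y -> fm (F s) (fun w => gcoef e (Y w)).
Proof.
move=> [mY _]; rewrite /fm; under eq_fun do rewrite gcoef_coord.
by apply: measurable_funM => //; exact: mY.
Qed.

Lemma gcoef_bnd Y C e w : bnd Y C -> `|gcoef e (Y w)| <= N%:R * C.
Proof.
move=> bY; rewrite gcoef_coord normrM; case: e.2.
  by rewrite normrN normr_nat ler_wpM2l.
by rewrite normr_nat ler_wpM2l.
Qed.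

Lemma formE Y s r w : 0 <= s -> s <= r ->
  form Y s r w = \sum_(e : cidx N) gcoef e (Y w) * ui (cbasis e) (dK s r w).
Proof.
move=> s0 sr; rewrite /form ui_coord; apply: eq_bigr => e _.
by rewrite coord_ui//; exact: (dK_skew bmK).
Qed.

Lemma fm_form Y a s r : 0 <= a -> a <= s -> s <= r -> adm a Y ->
  fm (F r) (form Y s r).
Proof.
move=> a0 as' sr aY; have s0 := le_trans a0 as'.
have -> : form Y s r =
    (fun w => \sum_(e : cidx N) gcoef e (Y w) * ui (cbasis e) (dK s r w)).
  by apply/funext => w; exact: formE.
rewrite /fm; apply: measurable_sum => e; apply: measurable_funM.
  by apply: (fm_le filF a0 (le_trans as' sr)); exact: fm_gcoef.
exact: (fm_ui filF bmK).
Qed.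

Lemma L2_form Y s r : 0 <= s -> s <= r -> adm s Y -> L2 (form Y s r).
Proof.
move=> s0 sr aY; have -> : form Y s r =
    (fun w => \sum_(e : cidx N) gcoef e (Y w) * ui (cbasis e) (dK s r w)).
  by apply/funext => w; exact: formE.
apply: L2_sum => e; have [_ [C bY]] := aY.
apply: (@L2M_bnd _ _ _ _ _ _ (N%:R * C)).
- by apply: (fm_meas filF s0); exact: fm_gcoef.
- by move=> w; exact: gcoef_bnd.
by have [] := moments filF bmK s0 sr (cbasis_skew e).
Qed.

(** The martingale property. Expanding in [cbasis] separates the coefficients known at time [s] from
    the increments, which are independent of them and centred. *)
Lemma Ex_form_mul Y s r Z : 0 <= s -> s <= r -> adm s Y ->
  fm (F s) Z -> L2 Z -> Ex (fun w => Z w * form Y s r w) = 0.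
Proof.
move=> s0 sr aY mZ LZ; have [_ [C bY]] := aY.
have mg e : measurable_fun setT (fun w => gcoef e (Y w)).
  by apply: (fm_meas filF s0); exact: fm_gcoef.
have LZg e : L2 (fun w => Z w * gcoef e (Y w)).
  under eq_fun do rewrite mulrC.
  by apply: (@L2M_bnd _ _ _ _ _ _ (N%:R * C)) => // w; exact: gcoef_bnd.
have Lb e := moments filF bmK s0 sr (cbasis_skew e).
have LL e : L1 (fun w => Z w * gcoef e (Y w) * ui (cbasis e) (dK s r w)).
  by apply: L2_mul => //; case: (Lb e).
transitivity (Ex (fun w => \sum_(e : cidx N)
    Z w * gcoef e (Y w) * ui (cbasis e) (dK s r w))).
  apply: Ex_eq => w; rewrite formE// mulr_sumr; apply: eq_bigr => e _.
  exact: mulrA.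
rewrite Ex_sum// big1// => e _.
rewrite (indep_dK filF bmK (g := fun X => ui (cbasis e) X))//.
- by have [_ _ -> _ _] := Lb e; rewrite mulr0.
- apply: measurable_funM => //; exact: fm_gcoef.
- exact: measurable_ui.
- exact: L2_L1.
- by apply: L2_L1; case: (Lb e).
Qed.

(** Conditional Ito isometry. The increments live in u(N), so only the projections of the
    coefficients are seen. *)
Lemma Ex_form_mul2 Y Y' s r Z (C : R) : 0 <= s -> s <= r -> adm s Y -> adm s Y' ->
  fm (F s) Z -> (forall w, `|Z w| <= C) ->
  Ex (fun w => Z w * form Y s r w * form Y' s r w) =
  (r - s) * gauss2 * Ex (fun w => Z w * ui (skp (Y w)) (skp (Y' w))).
Proof.
move=> s0 sr aY aY' mZ bZ; have [_ [D bY]] := aY; have [_ [D' bY']] := aY'.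
have mg e := fm_gcoef e aY; have mg' e := fm_gcoef e aY'.
pose c (p : cidx N * cidx N) w := Z w * gcoef p.1 (Y w) * gcoef p.2 (Y' w).
pose y e w := ui (cbasis e) (dK s r w).
have Lb e := moments filF bmK s0 sr (cbasis_skew e).
have Lyy p : L1 (fun w => y p.1 w * y p.2 w).
  by apply: L2_mul; [case: (Lb p.1)|case: (Lb p.2)].
have mc p : fm (F s) (c p).
  apply: measurable_funM; last exact: mg'.
  by apply: measurable_funM => //; exact: mg.
have mc' p := fm_meas filF s0 (mc p).
pose B : R := C * (N%:R * D) * (N%:R * D').
have bc p w : `|c p w| <= B.
  rewrite /c !normrM ler_pM ?mulr_ge0//; last exact: gcoef_bnd.
  by rewrite ler_pM//; exact: gcoef_bnd.
have Lcyy p : L1 (fun w => c p w * (y p.1 w * y p.2 w)).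
  exact: (@L1M_bnd _ _ _ _ _ _ B).
transitivity (Ex (fun w => \sum_(p : cidx N * cidx N) c p w * (y p.1 w * y p.2 w))).
  apply: Ex_eq => w; rewrite !formE// -mulrA big_distrlr/= pair_bigA/= mulr_sumr.
  by apply: eq_bigr => p _; exact: mul5_perm.
rewrite Ex_sum//.
transitivity (\sum_(p : cidx N * cidx N)
    (r - s) * gauss2 * Ex (fun w => c p w * ui (cbasis p.1) (cbasis p.2))).
  apply: eq_bigr => p _.
  have Lc : L1 (c p) by exact: (L1_bnd _ (mc' p) (bc p)).
  have mb e : measurable_fun [set: M] (fun X => ui (cbasis e) X).
    exact: measurable_ui.
  have -> : Ex (fun w => c p w * (y p.1 w * y p.2 w)) =
      Ex (c p) * Ex (fun w => y p.1 w * y p.2 w).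
    exact: (indep_dK filF bmK s0 sr (mc p) (measurable_funM (mb p.1) (mb p.2))
      Lc (Lyy p) (Lcyy p)).
  rewrite (covariance filF bmK s0 sr (cbasis_skew _) (cbasis_skew _)).
  have -> : (fun w => c p w * ui (cbasis p.1) (cbasis p.2)) =
      (fun w => ui (cbasis p.1) (cbasis p.2) * c p w).
    by apply/funext => w; exact: mulrC.
  by rewrite ExZ//; exact: mul4_permC.
rewrite -mulr_sumr -Ex_sum; last first.
  move=> p; under eq_fun do rewrite mulrC.
  by apply: L1Z; exact: (L1_bnd _ (mc' p) (bc p)).
congr (_ * _); apply: Ex_eq => w.
rewrite ui_skp2 mulr_sumr; under [in RHS]eq_bigr do rewrite mulr_sumr.
rewrite pair_bigA/=; apply: eq_bigr => p _; rewrite /c.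
exact: mul4_perm.
Qed.

(** Fourth moments of order [(r - s)^2], uniform over coefficients bounded by [B]: they control the
    squared product of two increments in [product_sqr]. *)
Lemma form_pow4 (B : R) : exists C, forall Y s r, 0 <= s -> s <= r ->
  adm s Y -> bnd Y B ->
  L2 (fun w => form Y s r w ^+ 2) /\
  Ex (fun w => form Y s r w ^+ 4) <= C * (r - s) ^+ 2.
Proof.
pose n := size (index_enum (cidx N)).
pose A : R := (2 ^+ n) ^+ 2 * 2 ^+ n * (N%:R * B) ^+ 4.
exists (A * \sum_(e : cidx N) gauss4 * ui (cbasis e) (cbasis e) ^+ 2).
move=> Y s r s0 sr aY bY.
pose y e w := ui (cbasis e) (dK s r w).
have Lb e := moments filF bmK s0 sr (cbasis_skew e).
have Ly4 e : L1 (fun w => y e w ^+ 4).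
  have [_ [_ + ] _ _ _] := Lb e.
  by under eq_fun do rewrite -exprM.
have le4 w : form Y s r w ^+ 4 <= A * \sum_e y e w ^+ 4.
  rewrite formE// (exprM _ 2 2).
  have h1 := sqr_sum_le (index_enum (cidx N))
    (fun e => gcoef e (Y w) * y e w).
  have h2 := sqr_sum_le (index_enum (cidx N))
    (fun e => (gcoef e (Y w) * y e w) ^+ 2).
  apply: (@le_trans _ _ ((2 ^+ n) ^+ 2 *
      (2 ^+ n * \sum_e ((gcoef e (Y w) * y e w) ^+ 2) ^+ 2))).
    apply: (@le_trans _ _ ((2 ^+ n * \sum_e (gcoef e (Y w) * y e w) ^+ 2) ^+ 2)).
      by rewrite lerXn2r// nnegrE ?sqr_ge0// mulr_ge0// sumr_ge0// => e _; exact: sqr_ge0.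
    by rewrite exprMn ler_wpM2l// ?sqr_ge0.
  rewrite /A -(mulrA (_ ^+ 2)) -(mulrA (_ ^+ 2)) ler_wpM2l ?sqr_ge0//.
  rewrite -(mulrA (2 ^+ n)) ler_wpM2l ?exprn_ge0// mulr_sumr.
  apply: ler_sum => e _; rewrite -exprM exprMn ler_wpM2r ?exprn_even_ge0//.
  rewrite -[leLHS]ger0_norm ?exprn_even_ge0// normrX.
  have NB := le_trans (normr_ge0 _) (gcoef_bnd e w bY).
  by rewrite lerXn2r ?nnegrE//; exact: gcoef_bnd.
have mf : measurable_fun setT (form Y s r) by exact: (L2_meas (L2_form s0 sr aY)).
have LS : L1 (fun w => A * \sum_e y e w ^+ 4) by apply: L1Z; exact: L1_sum.
have L4 : L1 (fun w => form Y s r w ^+ 4).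
  apply: (L1_le _ _ LS) => [|w]; first exact: measurable_funX.
  by rewrite ger0_norm ?exprn_even_ge0.
split; first by split; [exact: measurable_funX|under eq_fun do rewrite -exprM].
apply: le_trans (Ex_le L4 LS le4) _.
rewrite ExZ; last exact: L1_sum.
rewrite Ex_sum// -(mulrA A) le_eqVlt; apply/orP; left; apply/eqP.
congr (A * _); rewrite mulr_suml; apply: eq_bigr => e _.
have [_ _ _ _ ->] := Lb e.
by rewrite -mulrA mulrC.
Qed.

(* [ui (skp Y) (skp Y)] is the squared norm of the projection of [Y] to u(N). *)
Definition qf (X : M) : R := ui (skp X) (skp X).

Lemma qf_ge0 X : 0 <= qf X.
Proof. by apply: ui_skew_ge0; exact: skp_skew. Qed.

(** A constant integrand on one interval. Intervals of different pieces may overlap, unlike those of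
    an [elementary] process, so that sums and differences of integrals over different partitions are
    mere concatenations. *)
Definition piece := (R * R * (Omega -> M))%type.
Definition valid (p : piece) := [/\ 0 <= p.1.1, p.1.1 <= p.1.2 & adm p.1.1 p.2].
Definition pint (S : seq piece) w : R := \sum_(p <- S) form p.2 p.1.1 p.1.2 w.
Lemma pintE (S : seq piece) w : pint S w = \sum_(p <- S) form p.2 p.1.1 p.1.2 w.
Proof. by []. Qed.

Definition pproc (S : seq piece) (x : R) w : M :=
  \sum_(p <- S) (if p.1.1 < x <= p.1.2 then p.2 w else 0).
Definition olen (p p' : piece) : R :=
  Num.max 0 (Num.min p.1.2 p'.1.2 - Num.max p.1.1 p'.1.1).

Lemma olenC p p' : olen p p' = olen p' p.
Proof. by rewrite /olen minC maxC (maxC p.1.1) maxC. Qed.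

Lemma formD Y a b c w : form Y a c w = form Y a b w + form Y b c w.
Proof. by rewrite /form -uiDr !dKE; congr (ui _ _); rewrite [in RHS]addrC subrKA. Qed.

(** Let [p] start first. What [p] does before the start of [p'] is orthogonal to [p']; on the common
    interval the isometry applies; afterwards only one piece goes on, and its increment is
    orthogonal to the past. *)
Lemma piece_cov p p' : valid p -> valid p' ->
  Ex (fun w => form p.2 p.1.1 p.1.2 w * form p'.2 p'.1.1 p'.1.2 w) =
  gauss2 * olen p p' * Ex (fun w => ui (skp (p.2 w)) (skp (p'.2 w))).
Proof.
wlog : p p' / p.1.1 <= p'.1.1 => [H vp vp'|].
  have [/H|/ltW/H] := leP p.1.1 p'.1.1; first exact.
  move=> /(_ vp' vp) E; rewrite olenC; apply: etrans (etrans _ E) _.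
    by apply: Ex_eq => w; exact: mulrC.
  suff -> : (fun w => ui (skp (p'.2 w)) (skp (p.2 w))) =
      (fun w => ui (skp (p.2 w)) (skp (p'.2 w))) by [].
  by apply/funext => w; rewrite ui_sym.
case: p p' => [[a b] Y] [[a' b'] Y']; rewrite /olen /valid /=.
move=> aa' [a0 ab aY] [a'0 a'b' aY'].
have aYa' := adm_le a0 aa' aY.
have zero s t y t' : a' <= s -> s <= t -> t <= t' -> adm a' y ->
    forall y', adm a' y' -> Ex (fun w => form y s t w * form y' t t' w) = 0.
  move=> a's st tt' ay y' ay'; have s0 := le_trans a'0 a's.
  have t0 := le_trans s0 st.
  apply: Ex_form_mul => //.
  - by apply: adm_le ay' => //; exact: le_trans st.
  - exact: fm_form ay.
  - by apply: L2_form => //; exact: adm_le ay.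
have same s t y y' : a' <= s -> s <= t -> adm a' y -> adm a' y' ->
    Ex (fun w => form y s t w * form y' s t w) =
    (t - s) * gauss2 * Ex (fun w => ui (skp (y w)) (skp (y' w))).
  move=> a's st ay ay'; have s0 := le_trans a'0 a's.
  have := @Ex_form_mul2 y y' s t (fun=> 1) 1 s0 st (adm_le a'0 a's ay)
    (adm_le a'0 a's ay').
  have E1 : (fun w => 1 * form y s t w * form y' s t w) =
      (fun w => form y s t w * form y' s t w).
    by apply/funext => w; rewrite mul1r.
  have E2 : (fun w => 1 * ui (skp (y w)) (skp (y' w))) =
      (fun w => ui (skp (y w)) (skp (y' w))).
    by apply/funext => w; rewrite mul1r.
  rewrite E1 E2.
  by apply; [exact: measurable_cst|move=> _; rewrite normr1].
rewrite (max_r aa').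
have L2f y s t : a' <= s -> s <= t -> adm a' y -> L2 (form y s t).
  move=> a's st ay; apply: L2_form => //; first exact: le_trans a's.
  exact: adm_le ay.
have [ba'|a'b] := leP b a'.
  have -> : Num.max 0 (Num.min b b' - a') = 0.
    by apply/max_idPl; rewrite subr_le0 ge_min ba'.
  rewrite mulr0 mul0r; apply: Ex_form_mul => //.
    by apply: (fm_le filF _ ba'); [exact: le_trans ab|exact: fm_form aY].
  exact: L2_form.
have {}a'b := ltW a'b.
have -> : Ex (fun w => form Y a b w * form Y' a' b' w) =
    Ex (fun w => form Y a' b w * form Y' a' b' w).
  under Ex_eq do rewrite (formD Y a a' b) mulrDl.
  rewrite ExD; [|apply: L2_mul|apply: L2_mul]; [|exact: L2_form|exact: L2f..].
  rewrite Ex_form_mul ?add0r//; first exact: fm_form aY.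
  exact: L2_form.
have [bb'|b'b] := leP b b'.
- rewrite max_r ?subr_ge0//.
  under Ex_eq do rewrite (formD Y' a' b b') mulrDr.
  rewrite ExD; [|by apply: L2_mul; exact: L2f|by apply: L2_mul; exact: L2f].
  rewrite (zero _ _ _ _ _ _ _ aYa' _ aY')// addr0 same//; ring.
- have {}b'b := ltW b'b; rewrite max_r ?subr_ge0//.
  under Ex_eq do rewrite (formD Y a' b' b) mulrDl.
  rewrite ExD; [|by apply: L2_mul; exact: L2f|by apply: L2_mul; exact: L2f].
  under [X in _ + X]Ex_eq do rewrite mulrC.
  rewrite (zero _ _ _ _ _ _ _ aY' _ aYa')// addr0 same//; ring.
Qed.

Definition valids (S : seq piece) := forall p, List.In p S -> valid p.

Lemma valids_cons p S : valids (p :: S) <-> valid p /\ valids S.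
Proof.
split=> [h|[vp vS] p' /= [<-//|]]; last exact: vS.
by split=> [|p' pS]; apply: h; [left|right].
Qed.

Lemma valids_cat S S' : valids S -> valids S' -> valids (S ++ S').
Proof.
elim: S => [//|p S IH] /valids_cons[vp vS] vS'.
by apply/valids_cons; split => //; exact: IH.
Qed.

Lemma pint_cat S S' w : pint (S ++ S') w = pint S w + pint S' w.
Proof. by rewrite /pint big_cat. Qed.

Lemma pproc_cat S S' x w : pproc (S ++ S') x w = pproc S x w + pproc S' x w.
Proof. by rewrite /pproc big_cat. Qed.

Lemma L2_piece p : valid p -> L2 (form p.2 p.1.1 p.1.2).
Proof. by move=> [? ? ?]; exact: L2_form. Qed.

Lemma L2_pint S : valids S -> L2 (pint S).
Proof.
rewrite /pint; elim: S => [_|p S IH /valids_cons[vp vS]].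
  by under eq_fun do rewrite big_nil; exact: L2_cst.
under eq_fun do rewrite big_cons.
by apply: L2D; [exact: L2_piece|exact: IH].
Qed.

Definition pcov S w : R := \sum_(p <- S) \sum_(p' <- S)
  olen p p' * ui (skp (p.2 w)) (skp (p'.2 w)).

Lemma L1_uisk s Y Y' : 0 <= s -> adm s Y -> adm s Y' ->
  L1 (fun w => ui (skp (Y w)) (skp (Y' w))).
Proof.
move=> s0 aY aY'; have [_ [C bY]] := aY; have [_ [C' bY']] := aY'.
under eq_fun do rewrite ui_skp2.
apply: L1_sum => e; apply: L1_sum => e'.
under eq_fun do rewrite mulrC.
apply: L1Z; apply: (@L1_bnd _ _ _ _ _ ((N%:R * C) * (N%:R * C'))).
  by apply: measurable_funM; apply: (fm_meas filF s0); exact: fm_gcoef.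
move=> w; rewrite normrM ler_pM//; exact: gcoef_bnd.
Qed.

Lemma L1_uisk_valid p p' : valid p -> valid p' ->
  L1 (fun w => ui (skp (p.2 w)) (skp (p'.2 w))).
Proof.
move=> [a0 _ aY] [a'0 _ aY'].
apply: (@L1_uisk (Num.max p.1.1 p'.1.1)); first by rewrite le_max a0.
  by apply: adm_le aY => //; rewrite le_max lexx.
by apply: adm_le aY' => //; rewrite le_max lexx orbT.
Qed.

Lemma big_L1 (S : seq piece) (f : piece -> Omega -> R) :
  (forall p, List.In p S -> L1 (f p)) ->
  L1 (fun w => \sum_(p <- S) f p w) /\
  Ex (fun w => \sum_(p <- S) f p w) = \sum_(p <- S) Ex (f p).
Proof.
elim: S => [_|p S IH h].
  under eq_fun do rewrite big_nil.
  by rewrite big_nil Ex_cst; split => //; exact: L1_cst.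
have [IH1 IH2] := IH (fun p' pS => h p' (or_intror pS)).
have hp := h p (or_introl erefl).
under eq_fun do rewrite big_cons.
by rewrite big_cons ExD// IH2; split => //; exact: L1D.
Qed.

Lemma eq_big_In (T : Type) (S : seq T) (f g : T -> R) :
  (forall p, List.In p S -> f p = g p) ->
  \sum_(p <- S) f p = \sum_(p <- S) g p.
Proof.
elim: S => [|p S IH h]; first by rewrite !big_nil.
rewrite !big_cons h ?IH//; last by left.
by move=> p' pS; apply: h; right.
Qed.

(** The square is expanded over pairs of pieces. [pcov_integral] recognises [pcov S] as the time
    integral of the squared norm of the projected integrand. *)
Lemma isometry S : valids S -> L1 (pcov S) /\
  Ex (fun w => pint S w ^+ 2) = gauss2 * Ex (pcov S).
Proof.
move=> vS.
have I p p' : List.In p S -> List.In p' S ->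
    L1 (fun w => form p.2 p.1.1 p.1.2 w * form p'.2 p'.1.1 p'.1.2 w).
  by move=> pS pS'; apply: L2_mul; apply: L2_piece; exact: vS.
have J p p' : List.In p S -> List.In p' S ->
    L1 (fun w => olen p p' * ui (skp (p.2 w)) (skp (p'.2 w))).
  by move=> pS pS'; apply: L1Z; apply: L1_uisk_valid; exact: vS.
have J2 p : List.In p S -> L1 (fun w => \sum_(p' <- S)
    olen p p' * ui (skp (p.2 w)) (skp (p'.2 w))).
  by move=> pS; have [] := @big_L1 S (fun p' w =>
    olen p p' * ui (skp (p.2 w)) (skp (p'.2 w))) (fun p' => J p p' pS).
have [J3 J4] := @big_L1 S (fun p w => \sum_(p' <- S)
    olen p p' * ui (skp (p.2 w)) (skp (p'.2 w))) J2.
split; first exact: J3.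
have I2 p : List.In p S -> L1 (fun w => \sum_(p' <- S)
    form p.2 p.1.1 p.1.2 w * form p'.2 p'.1.1 p'.1.2 w).
  by move=> pS; have [] := @big_L1 S (fun p' w =>
    form p.2 p.1.1 p.1.2 w * form p'.2 p'.1.1 p'.1.2 w) (fun p' => I p p' pS).
have [I3 I4] := @big_L1 S (fun p w => \sum_(p' <- S)
    form p.2 p.1.1 p.1.2 w * form p'.2 p'.1.1 p'.1.2 w) I2.
have -> : (fun w => pint S w ^+ 2) = (fun w => \sum_(p <- S) \sum_(p' <- S)
    form p.2 p.1.1 p.1.2 w * form p'.2 p'.1.1 p'.1.2 w).
  by apply/funext => w; rewrite expr2 /pint big_distrlr.
rewrite I4 [X in _ = _ * X]J4 mulr_sumr; apply: eq_big_In => p pS.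
have [_ E1] := @big_L1 S (fun p' w =>
    form p.2 p.1.1 p.1.2 w * form p'.2 p'.1.1 p'.1.2 w) (fun p' => I p p' pS).
have [_ E2] := @big_L1 S (fun p' w =>
    olen p p' * ui (skp (p.2 w)) (skp (p'.2 w))) (fun p' => J p p' pS).
rewrite E1 E2 mulr_sumr; apply: eq_big_In => p' pS'.
rewrite (piece_cov (vS _ pS) (vS _ pS')) ExZ ?mulrA//.
by apply: L1_uisk_valid; exact: vS.
Qed.

End RandomForms.

(** * Time integrals of piecewise constant integrands along a path *)

Section PathIntegral.
Context {R : realType}.
Notation mu := (@lebesgue_measure R).

Lemma itvoc_indic (a b a' b' x : R) :
  ((a < x <= b)%R%:R * (a' < x <= b')%R%:R =
  \1_(`]Num.max a a', Num.min b b']%classic) x :> R).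
Proof.
rewrite indicE -natrM mulnb; congr ((nat_of_bool _)%:R).
apply/idP/idP.
  move=> /andP[/andP[h1 h2] /andP[h3 h4]]; apply/mem_set.
  by rewrite /= in_itv/= gt_max le_min h1 h2 h3 h4.
move=> /set_mem; rewrite /= in_itv/= gt_max le_min.
by move=> /andP[/andP[-> ->] /andP[-> ->]].
Qed.

Lemma integral_itvoc (m M T : R) : 0 <= m -> M <= T ->
  \int[mu]_(x in `[0, T]) \1_(`]m, M]%classic) x = Num.max 0 (M - m).
Proof.
move=> m0 MT; rewrite /Rintegral integral_indic//.
have -> : `]m, M]%classic `&` `[0, T]%classic = `]m, M]%classic :> set R.
  apply/seteqP; split=> x /=; first by case.
  rewrite !in_itv/= => /andP[mx xM]; split; first by rewrite mx.
  by rewrite (le_trans m0 (ltW mx)) (le_trans xM MT).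
have := lebesgue_measure_itv (`]m, M]); rewrite /= lte_fin => E.
apply: (etrans (congr1 fine E)); case: ltP => [mM|Mm].
  by rewrite /= max_r// subr_ge0 ltW.
by rewrite max_l// subr_le0.
Qed.

Lemma integrable_itvoc (m M T : R) :
  mu.-integrable `[0, T] (EFin \o \1_(`]m, M]%classic)).
Proof.
apply: measurable_bounded_integrable => //=.
- by rewrite lebesgue_measure_itv/=; case: ifP => _; rewrite ltry.
exists 1; split => // x x1 y _ /=; rewrite indicE.
by case: (_ \in _); rewrite ?normr1 ?normr0 ltW// (lt_trans _ x1).
Qed.

End PathIntegral.

Section PathCovariance.
Context {d : measure_display} {Omega : measurableType d} {R : realType} {N : nat}.
Notation mu := (@lebesgue_measure R).
Notation M := 'M[R[i]]_N.
Notation piece := (@piece _ Omega R N).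

Lemma skpD (X Y : M) : skp (X + Y) = skp X + skp Y.
Proof.
rewrite skp.unlock adjD -scalerDr; congr (_ *: _).
by rewrite opprD addrACA.
Qed.

Lemma skp0 : skp (0 : M) = 0.
Proof. by apply: (addrI (skp (0 : M))); rewrite -skpD !addr0. Qed.

Lemma skp_suml (I : Type) (s : seq I) (f : I -> M) :
  skp (\sum_(i <- s) f i) = \sum_(i <- s) skp (f i).
Proof. by elim/big_rec2: _ => [|i a b _ <-]; [exact: skp0|exact: skpD]. Qed.

Lemma qf_pproc (S : seq piece) x w : qf (pproc S x w) =
  \sum_(p <- S) \sum_(p' <- S)
    ui (skp (p.2 w)) (skp (p'.2 w)) *
    \1_(`]Num.max p.1.1 p'.1.1, Num.min p.1.2 p'.1.2]%classic) x.
Proof.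
rewrite /qf /pproc skp_suml ui_suml; apply: eq_bigr => p _.
rewrite ui_sumr; apply: eq_bigr => p' _; rewrite -itvoc_indic.
have e (b : bool) (X : M) : skp (if b then X else 0) = (b%:R : R)%:C *: skp X.
  by case: b; rewrite ?scale1r ?scale0r// skp0.
by rewrite !e uiZl uiZr mulrA mulrC.
Qed.

Lemma integrable_sum_itvoc (T : R) (J : Type) (S : seq J) (c m1 m2 : J -> R) :
  mu.-integrable `[0, T] (EFin \o (fun x => \sum_(j <- S)
    c j * \1_(`]m1 j, m2 j]%classic) x)) /\
  \int[mu]_(x in `[0, T]) (\sum_(j <- S) c j * \1_(`]m1 j, m2 j]%classic) x) =
  \sum_(j <- S) c j * \int[mu]_(x in `[0, T]) \1_(`]m1 j, m2 j]%classic) x.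
Proof.
elim: S => [|j S [IH1 IH2]].
  have e0 : (fun x => \sum_(j <- [::]) c j * \1_(`]m1 j, m2 j]%classic) x) =
      (fun=> 0 : R) by apply/funext => x; rewrite big_nil.
  rewrite e0 big_nil; split; first exact: integrable0.
  by rewrite Rintegral_cst//= mul0r.
have e0 : (fun x => \sum_(j <- j :: S) c j * \1_(`]m1 j, m2 j]%classic) x) =
    (fun x => c j * \1_(`]m1 j, m2 j]%classic) x +
      \sum_(j <- S) c j * \1_(`]m1 j, m2 j]%classic) x).
  by apply/funext => x; rewrite big_cons.
rewrite e0 big_cons.
have I1 : mu.-integrable `[0, T] (EFin \o (fun x => c j * \1_(`]m1 j, m2 j]%classic) x)).
  by apply: (integrableZl _ (c j) (integrable_itvoc (m1 j) (m2 j) T)) => //=.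
split; first exact: (integrableD _ I1 IH1).
by rewrite RintegralD// RintegralZl ?IH2//; exact: integrable_itvoc.
Qed.

(** The squared norm of a sum is a double sum over pieces, and the product of the indicators of two
    intervals is the indicator of their intersection, of length [olen]. *)
Lemma pcov_integral (S : seq piece) T w :
  (forall p, List.In p S -> 0 <= p.1.1 /\ p.1.2 <= T) ->
  mu.-integrable `[0, T] (EFin \o (fun x => qf (pproc S x w))) /\
  \int[mu]_(x in `[0, T]) qf (pproc S x w) = pcov S w.
Proof.
move=> h; pose c (j : piece * piece) := ui (skp (j.1.2 w)) (skp (j.2.2 w)).
pose m1 (j : piece * piece) := Num.max j.1.1.1 j.2.1.1.
pose m2 (j : piece * piece) := Num.min j.1.1.2 j.2.1.2.
have e : (fun x => qf (pproc S x w)) = (fun x =>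
    \sum_(j <- allpairs pair S S) c j * \1_(`]m1 j, m2 j]%classic) x).
  by apply/funext => x; rewrite qf_pproc big_allpairs.
rewrite e; have [H1 ->] := @integrable_sum_itvoc T _ (allpairs pair S S) c m1 m2.
split => //; rewrite big_allpairs; apply: eq_big_In => p pS.
apply: eq_big_In => p' pS'; have [a0 bT] := h p pS; have [a'0 b'T] := h p' pS'.
have -> : \int[mu]_(x in `[0, T]) \1_(`]m1 (p, p'), m2 (p, p')]%classic) x =
    olen p p'.
  by apply: integral_itvoc; rewrite ?le_max ?ge_min ?a0 ?bT.
exact: mulrC.
Qed.

End PathCovariance.

(** * Entrywise norms, products and projections *)

Section SquaredNorm.
Context {R : realType} {N : nat}.
Notation M := 'M[R[i]]_N.
Implicit Types X Y G : M.

Lemma sqr_normE X : sqr_norm X = \sum_(e : cidx N) coord e X ^+ 2.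
Proof.
transitivity (\sum_(i < N) \sum_(j < N) \sum_(b : bool) coord (i, j, b) X ^+ 2).
  apply: eq_bigr => i _; apply: eq_bigr => j _.
  by rewrite big_bool coord.unlock.
by rewrite pair_bigA/= pair_bigA/=; apply: eq_bigr => -[[i j] b].
Qed.

Lemma coordD e X Y : coord e (X + Y) = coord e X + coord e Y.
Proof. by rewrite coord.unlock !mxE; case: e.2; [exact: reD|exact: imD]. Qed.

Lemma coordN e X : coord e (- X) = - coord e X.
Proof. by rewrite coord.unlock !mxE; case: e.2; [exact: reN|exact: imN]. Qed.

Lemma coord0 e : coord e (0 : M) = 0.
Proof. by rewrite coord.unlock !mxE; case: e.2. Qed.

Lemma coord_sum e (I : Type) (s : seq I) (f : I -> M) :
  coord e (\sum_(i <- s) f i) = \sum_(i <- s) coord e (f i).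
Proof. by elim/big_rec2: _ => [|i a b _ <-]; [exact: coord0|exact: coordD]. Qed.

Lemma coordZ e (a : R) X : coord e (a%:C *: X) = a * coord e X.
Proof. by rewrite coord.unlock !mxE; case: e.2; [exact: reZ|exact: imZ]. Qed.

Lemma coord_if e (b : bool) X : coord e (if b then X else 0) = b%:R * coord e X.
Proof. by case: b; rewrite ?mul1r ?mul0r// coord0. Qed.

Lemma sqr_normD X Y : sqr_norm (X + Y) <= 2 * sqr_norm X + 2 * sqr_norm Y.
Proof.
rewrite !sqr_normE !mulr_sumr -big_split/=; apply: ler_sum => e _.
by rewrite coordD sqrD_le.
Qed.

Lemma sqr_normN X : sqr_norm (- X) = sqr_norm X.
Proof. by rewrite !sqr_normE; apply: eq_bigr => e _; rewrite coordN sqrrN. Qed.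

Lemma coord_sqr_norm e X : coord e X ^+ 2 <= sqr_norm X.
Proof.
rewrite sqr_normE (bigD1 e)//= lerDl; apply: sumr_ge0 => *; exact: sqr_ge0.
Qed.

Lemma ui_sqr_le G : exists C, 0 <= C /\
  forall X, ui G X ^+ 2 <= C * sqr_norm X.
Proof.
exists (2 ^+ size (index_enum (cidx N)) * \sum_(e : cidx N) gcoef e G ^+ 2).
split=> [|X].
  by rewrite mulr_ge0 ?exprn_ge0// sumr_ge0// => *; exact: sqr_ge0.
rewrite ui_coord; apply: le_trans (sqr_sum_le _ _) _.
rewrite -mulrA ler_wpM2l ?exprn_ge0// sqr_normE mulr_suml.
apply: ler_sum => e _; rewrite exprMn ler_wpM2l ?sqr_ge0// -sqr_normE.
exact: coord_sqr_norm.
Qed.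

(** Each coordinate of [G *m X] is a linear form [ui (H e)] in [X], to which [ui_sqr_le] applies. *)
Lemma sqr_norm_mulmx G : exists C, 0 <= C /\
  forall X, sqr_norm (G *m X) <= C * sqr_norm X.
Proof.
pose H (e : cidx N) : M := (if e.2 then - N%:R^-1 else N%:R^-1 *i) *: delta_mx e.1.2 e.1.1 *m G.
have h e X : coord e (G *m X) = ui (H e) X.
  have N0 : (N%:R : R) != 0.
    by rewrite pnatr_eq0; case: e => -[[i Hi] j b]; case: (N) Hi.
  rewrite uiE /H -mulmxA -scalemxAl mxtraceZ; move: (G *m X) => A.
  have -> : \tr (delta_mx e.1.2 e.1.1 *m A) = A e.1.1 e.1.2.
    rewrite /mxtrace (bigD1 e.1.2)//= mxE (bigD1 e.1.1)//= !mxE !eqxx mul1r.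
    rewrite !big1 ?addr0//.
      by move=> i ie; rewrite mxE big1// => j _; rewrite mxE (negbTE ie) mul0r.
    by move=> j je; rewrite !mxE (negbTE je) andbF mul0r.
  rewrite coord.unlock; case: e.2.
    have -> : - N%:R^-1 = (- N%:R^-1 : R)%:C :> R[i].
      by rewrite rmorphN /= fmorphV; congr (- _^-1); rewrite -natC.
    by rewrite reZ; field.
  by rewrite reM /=; field.
have [c hc] := choice (fun e => ui_sqr_le (H e)).
exists (\sum_e c e); split=> [|X].
  by apply: sumr_ge0 => e _; case: (hc e).
rewrite sqr_normE mulr_suml; apply: ler_sum => e _; rewrite h.
by case: (hc e) => _; exact.
Qed.

Lemma qf_le : exists C, 0 <= C /\ forall X, qf X <= C * sqr_norm X.
Proof.
exists N%:R; split => // X; rewrite /qf ui_skew; last exact: skp_skew.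
rewrite ler_wpM2l// skp.unlock.
have Ja : sqr_norm (X ^t*) = sqr_norm X.
  rewrite /sqr_norm exchange_big/=; apply: eq_bigr => i _; apply: eq_bigr => j _.
  by rewrite adjE reJ imJ sqrrN.
have -> : sqr_norm ((2^-1)%:C *: (X - X ^t*)) = 2^-1 ^+ 2 * sqr_norm (X - X ^t*).
  rewrite !sqr_normE mulr_sumr; apply: eq_bigr => e _.
  by rewrite coordZ exprMn.
have := sqr_normD X (- X ^t*); rewrite sqr_normN Ja.
move: (sqr_norm _) (sqr_norm _) => a b h; lra.
Qed.

Lemma coord_mulmx e G X : coord e (G *m X) = \sum_(k < N)
  (re (G e.1.1 k) * coord (k, e.1.2, e.2) X +
   (if e.2 then -1 else 1) * (im (G e.1.1 k) * coord (k, e.1.2, ~~ e.2) X)).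
Proof.
case: e => -[i j] b; rewrite coord.unlock /=.
case: b; rewrite mxE ?re_sum ?im_sum; apply: eq_bigr => k _ /=.
  by rewrite reM mulN1r.
by rewrite imM mul1r.
Qed.

End SquaredNorm.

Section AdmClosure.
Context {d : measure_display} {Omega : measurableType d} {R : realType} {N : nat}.
Notation M := 'M[R[i]]_N.
Variables (F : R -> set (set Omega)).
Implicit Types (s : R) (Y : Omega -> M).

Lemma admN s Y : adm F s Y -> adm F s (fun w => - Y w).
Proof.
move=> [mY [C bY]]; split=> [e|].
  rewrite /fm; under eq_fun do rewrite coordN.
  by apply: measurableT_comp => //; exact: mY.
by exists C => e w; rewrite coordN normrN.
Qed.

Lemma adm0 s : adm F s (fun=> 0 : M).
Proof.
split=> [e|]; first exact: measurable_cst.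
by exists 0 => e w; rewrite coord0 normr0.
Qed.

Lemma adm_mulmx s (G : M) Y : adm F s Y -> adm F s (fun w => G *m Y w).
Proof.
move=> [mY [C bY]]; split=> [e|].
  rewrite /fm; under eq_fun do rewrite coord_mulmx.
  apply: measurable_sum => k; apply: measurable_funD; apply: measurable_funM => //.
    exact: mY.
  by apply: measurable_funM => //; exact: mY.
exists (\sum_i \sum_j (`|re (G i j)| + `|im (G i j)|) * C) => e w.
have C0 : 0 <= C by exact: le_trans (normr_ge0 _) (bY e w).
rewrite coord_mulmx; apply: le_trans (ler_norm_sum _ _ _) _.
rewrite [leRHS](bigD1 e.1.1)//= -[leLHS]addr0 lerD//; last first.
  apply: sumr_ge0 => i _; apply: sumr_ge0 => j _.
  by rewrite mulr_ge0// addr_ge0.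
apply: ler_sum => k _; apply: le_trans (ler_normD _ _) _.
rewrite mulrDl lerD// !normrM.
  by rewrite ler_wpM2l.
have -> : `|if e.2 then -1 else 1| = 1 :> R by case: e.2; rewrite ?normrN normr1.
by rewrite mul1r ler_wpM2l.
Qed.

End AdmClosure.

(* A process with continuous paths is jointly measurable: it is the pointwise
   limit of its discretisations in time. *)
Section JointMeasurability.
Context {d : measure_display} {Omega : measurableType d} {R : realType}.
Variable f : R -> Omega -> R.
Hypothesis mf : forall s : R, 0 <= s -> measurable_fun setT (f s).
Hypothesis cf : forall w, {within `[0, +oo[, continuous (fun s : R => f s w)}.

(** Rounds down to a grid of mesh [1 / (n + 1)]; a countable grid only requires measurability at
    fixed times. Negative times are sent to 0, since nothing is assumed of the process there. *)
Definition discr (n : nat) (x : R) : R :=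
  (Num.truncn (n.+1%:R * Num.max 0 x))%:R / n.+1%:R.

Lemma discr_cvg x : discr n x @[n --> \oo] --> Num.max 0 x.
Proof.
set y := Num.max 0 x; have y0 : 0 <= y by rewrite le_max lexx.
have b n : y - n.+1%:R^-1 <= discr n x <= y.
  have n0 : (0 : R) < n.+1%:R by [].
  have /andP[h1 h2] := truncn_itv (mulr_ge0 (ltW n0) y0).
  rewrite /discr -/y ler_pdivrMr// [y * _]mulrC h1 andbT.
  rewrite ler_pdivlMr// mulrBl mulVf ?gt_eqF// lerBlDr [y * _]mulrC.
  by rewrite natr1 ltW.
apply: (@squeeze_cvgr _ _ _ _ (fun n => y - n.+1%:R^-1) (fun=> y)).
- by apply: nearW => n; exact: b.
- rewrite -[X in _ --> X]subr0; apply: cvgB; first exact: cvg_cst.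
  exact: cvg_harmonic.
- exact: cvg_cst.
Qed.

Lemma measurable_discr n : measurable_fun setT
  (fun z : Omega * measurableTypeR R => f (discr n z.2) z.1).
Proof.
move=> _ B mB; rewrite setTI.
have -> : (fun z : Omega * measurableTypeR R => f (discr n z.2) z.1) @^-1` B =
   \bigcup_k (((f (k%:R / n.+1%:R)) @^-1` B) `*`
     [set x : R | Num.truncn (n.+1%:R * Num.max 0 x) = k]).
  apply/seteqP; split => [[w x]/= Bx|[w x]/= [k _ [/= Bk kE]]]; last by rewrite /discr kE.
  by exists (Num.truncn (n.+1%:R * Num.max 0 x)).
apply: bigcupT_measurable => k; apply: measurableX.
  by rewrite -[X in measurable X]setTI; apply: mf => //; rewrite divr_ge0.
have -> : [set x : R | Num.truncn (n.+1%:R * Num.max 0 x) = k] =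
    (fun x : R => n.+1%:R * Num.max 0 x) @^-1` `[k%:R, k.+1%:R[%classic.
  apply/seteqP; split => x /=.
    move=> <-; rewrite in_itv/=; apply: truncn_itv.
    by rewrite mulr_ge0// le_max lexx.
  rewrite in_itv/= => h; apply: truncn_def => //.
rewrite -[X in measurable X]setTI.
have : measurable_fun setT (fun x : R => n.+1%:R * Num.max 0 x).
  apply: measurable_funM => //; apply: measurable_maxr => //.
by apply.
Qed.

Lemma joint_measurable : measurable_fun setT
  (fun z : Omega * measurableTypeR R => f (Num.max 0 z.2) z.1).
Proof.
apply: (@measurable_fun_cvg _ _ _ _ (fun n z => f (discr n z.2) z.1)).
  exact: measurable_discr.
move=> [w x] _ /=.
have /continuous_within_itvcyP[c1 c2] := @cf w.
(* Up to time 0 the discretisation is constant; beyond it, two-sided continuity at [x] is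
   available. *)
have [x0|x0] := leP x 0.
  apply: cvg_near_cst; apply: nearW => n.
  by rewrite /discr max_l// mulr0 truncn0 mul0r.
have := c1 x; rewrite in_itv/= x0 => /(_ erefl) cx.
have dc := @discr_cvg x; rewrite max_r ?(ltW x0)// in dc.
exact: (@continuous_cvg _ _ _ _ _ _ (f^~ w) _ cx dc).
Qed.

End JointMeasurability.

(** * Expectations of time integrals *)

Section InnerIntegral.
Context {d : measure_display} {Omega : measurableType d} {R : realType}.
Variable P : probability Omega R.
Notation mu := (@lebesgue_measure R).
Notation OR := (Omega * measurableTypeR R)%type.
Implicit Types (g : OR -> R) (a b : R).

Lemma measurable_slice D g w : measurable_fun setT g ->
  measurable_fun D (fun x : measurableTypeR R => (g (w, x))%:E).
Proof.
move=> mg; apply/measurable_EFinP; apply: measurable_funTS.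
apply: (measurableT_comp mg); exact: measurable_fun_pair.
Qed.

Definition dint a b g : \bar R :=
  (\int[P]_w \int[mu]_(x in `[a, b]) (g (w, x))%:E)%E.

Let cut a b g (z : OR) : \bar R := (g z * \1_(`[a, b]%classic) z.2)%:E.

Let measurable_cut a b g : measurable_fun setT g -> measurable_fun setT (cut a b g).
Proof.
move=> mg; apply/measurable_EFinP; apply: measurable_funM => //.
exact: (measurableT_comp (measurable_indic _)).
Qed.

Let cutE a b g w :
  (\int[mu]_(x in `[a, b]) (g (w, x))%:E = \int[mu]_x cut a b g (w, x))%E.
Proof.
rewrite integral_mkcond; apply: eq_integral => x _.
by rewrite epatch_indic /cut /= EFinM.
Qed.

Lemma measurable_inner a b g : measurable_fun setT g -> (forall z, 0 <= g z) ->
  measurable_fun setT (fun w => \int[mu]_(x in `[a, b]) (g (w, x))%:E)%E.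
Proof.
move=> mg g0; under eq_fun do rewrite cutE.
have := @measurable_fun_fubini_tonelli_F _ _ _ _ R mu (cut a b g).
apply; first exact: measurable_cut.
by move=> z; rewrite lee_fin mulr_ge0.
Qed.

Lemma dint_tonelli a b g : measurable_fun setT g -> (forall z, 0 <= g z) ->
  (dint a b g = \int[mu]_(x in `[a, b]) \int[P]_w (g (w, x))%:E)%E.
Proof.
move=> mg g0; rewrite /dint; under eq_integral do rewrite cutE.
have c0 z : (0 <= cut a b g z)%E by rewrite lee_fin mulr_ge0.
have := @fubini_tonelli _ _ _ _ R P mu (cut a b g) (measurable_cut a b mg) c0.
rewrite /fubini_F /fubini_G => ->; rewrite [RHS]integral_mkcond.
apply: eq_integral => x _; rewrite epatch_indic /cut.
have mgx : measurable_fun setT (fun w => (g (w, x))%:E).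
  apply/measurable_EFinP; apply: (measurableT_comp mg).
  exact: measurable_fun_pair.
under eq_integral do rewrite EFinM /=.
rewrite ge0_integralZr//.
by move=> w _; rewrite lee_fin.
Qed.

Lemma dint_le a b g g' : measurable_fun setT g -> measurable_fun setT g' ->
  (forall z, 0 <= g z) -> (forall w x, a <= x <= b -> g (w, x) <= g' (w, x)) ->
  (forall z, 0 <= g' z) -> (dint a b g <= dint a b g')%E.
Proof.
move=> mg mg' g0 gg' g'0.
apply: ge0_le_integral => //.
- by move=> w _; apply: integral_ge0 => x _; rewrite lee_fin.
- exact: measurable_inner.
- exact: measurable_inner.
move=> w _; apply: ge0_le_integral => //=.
- by move=> x _; rewrite lee_fin.
- exact: measurable_slice.
- exact: measurable_slice.
by move=> x; rewrite /= in_itv/= lee_fin; exact: gg'.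
Qed.

Lemma dintD a b g g' : measurable_fun setT g -> measurable_fun setT g' ->
  (forall z, 0 <= g z) -> (forall z, 0 <= g' z) ->
  dint a b (fun z => g z + g' z) = (dint a b g + dint a b g')%E.
Proof.
move=> mg mg' g0 g'0.
rewrite /dint -ge0_integralD//; last 4 first.
- by move=> w _; apply: integral_ge0 => x _; rewrite lee_fin.
- exact: measurable_inner.
- by move=> w _; apply: integral_ge0 => x _; rewrite lee_fin.
- exact: measurable_inner.
apply: eq_integral => w _; rewrite -ge0_integralD//.
- by move=> x _; rewrite lee_fin.
- exact: measurable_slice.
- by move=> x _; rewrite lee_fin.
- exact: measurable_slice.
Qed.

Lemma dintZ a b c g : measurable_fun setT g -> (forall z, 0 <= g z) -> 0 <= c ->
  dint a b (fun z => c * g z) = (c%:E * dint a b g)%E.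
Proof.
move=> mg g0 c0; rewrite /dint -ge0_integralZl//.
- apply: eq_integral => w _; under eq_integral do rewrite EFinM.
  rewrite ge0_integralZl//.
  + exact: measurable_slice.
  + by move=> x _; rewrite lee_fin.
- exact: measurable_inner.
- by move=> w _; apply: integral_ge0 => x _; rewrite lee_fin.
Qed.

Lemma dint_bound a b g C : a <= b -> measurable_fun setT g -> (forall z, 0 <= g z) ->
  0 <= C -> (forall x, a <= x <= b -> (\int[P]_w (g (w, x))%:E <= C%:E)%E) ->
  (dint a b g <= (C * (b - a))%:E)%E.
Proof.
move=> ab mg g0 C0 gC; rewrite dint_tonelli//.
apply: (@le_trans _ _ (\int[mu]_(x in `[a, b]) C%:E)%E).
  apply: ge0_le_integral => //=.
  - by move=> x _; apply: integral_ge0 => w _; rewrite lee_fin.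
  - apply: measurable_funTS.
    apply: (@measurable_fun_fubini_tonelli_G _ _ _ _ R P (EFin \o g)).
      exact/measurable_EFinP.
    by move=> z; rewrite lee_fin.
rewrite integral_cst//= lebesgue_measure_itv/= lte_fin.
by case: ifP => _; rewrite ?mule0 -?EFinD -?EFinM ?lee_fin ?mulr_ge0 ?subr_ge0.
Qed.

End InnerIntegral.

Lemma near_le_cvg0 {R : realType} (u : nat -> \bar R) (e : R) : 0 < e ->
  (u @ \oo --> 0%E)%classic -> \forall n \near \oo, (u n <= e%:E)%E.
Proof.
move=> e0 /fine_cvgP[fu /cvgrPdist_le /(_ e e0)] ue.
near=> n; have fn : u n \is a fin_num by near: n.
rewrite -(fineK fn) lee_fin.
have : `|0 - fine (u n)| <= e by near: n.
by rewrite sub0r normrN; apply: le_trans; exact: ler_norm.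
Unshelve. all: by end_near. Qed.

Lemma scale2_le {R : realType} (c y z : R) : 0 <= c -> y <= 2 * z -> c * y <= 2 * c * z.
Proof. by move=> c0 h; rewrite (mulrC 2) -mulrA ler_wpM2l. Qed.

Lemma lee_scale2 {R : realType} (c e v : R) (a b : \bar R) : 0 <= c ->
  (a <= e%:E)%E -> (b <= v%:E)%E -> (c%:E * (a + b) <= (c * (e + v))%:E)%E.
Proof.
move=> c0 h1 h2; rewrite EFinM EFinD; apply: lee_wpmul2l; first by rewrite lee_fin.
exact: leeD.
Qed.

Section ExpectationBound.
Context {d : measure_display} {Omega : measurableType d} {R : realType}.
Variable P : probability Omega R.

Lemma L2_of_int (f : Omega -> R) C : measurable_fun setT f ->
  (\int[P]_w (f w ^+ 2)%:E <= C%:E)%E -> L2 P f /\ Ex P (fun w => f w ^+ 2) <= C.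
Proof.
move=> mf fC; have L : L1 P (fun w => f w ^+ 2).
  apply/integrableP; split.
    by apply/measurable_EFinP; exact: measurable_funX.
  under eq_integral do rewrite /= ger0_norm ?sqr_ge0//.
  by rewrite (le_lt_trans fC) ?ltry.
split; first by split.
rewrite -lee_fin /Ex /Rintegral fineK//; exact: integrable_fin_num.
Qed.

Lemma int_of_L1 (f : Omega -> R) : L1 P f ->
  (\int[P]_w (f w)%:E = (Ex P f)%:E)%E.
Proof. by move=> Lf; rewrite /Ex /Rintegral fineK//; exact: integrable_fin_num. Qed.

Lemma int_le2 (T f g : Omega -> R) c e : 0 <= c -> measurable_fun setT T ->
  measurable_fun setT f -> measurable_fun setT g ->
  (forall w, 0 <= f w) -> (forall w, 0 <= g w) ->
  (forall w, T w ^+ 2 <= c * (f w + g w)) ->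
  (\int[P]_w (f w)%:E <= e%:E)%E -> (\int[P]_w (g w)%:E <= e%:E)%E ->
  (\int[P]_w (T w ^+ 2)%:E <= (c * (e + e))%:E)%E.
Proof.
move=> c0 mT mf mg f0 g0 h hf hg.
apply: (@le_trans _ _ (\int[P]_w (c%:E * ((f w)%:E + (g w)%:E)))%E).
  apply: ge0_le_integral => //.
  - by move=> w _; rewrite lee_fin sqr_ge0.
  - by apply/measurable_EFinP; exact: measurable_funX.
  - apply: emeasurable_funM; first exact: measurable_cst.
    by apply: emeasurable_funD; exact/measurable_EFinP.
  - by move=> w _; rewrite -EFinD -EFinM lee_fin.
rewrite ge0_integralZl//; last 2 first.
- by apply: emeasurable_funD; exact/measurable_EFinP.
- by move=> w _; rewrite -EFinD lee_fin addr_ge0.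
rewrite (@ge0_integralD _ _ _ P setT measurableT (fun w => (f w)%:E) (fun w => (g w)%:E)).
- exact: lee_scale2.
- by move=> w _; rewrite lee_fin.
- exact/measurable_EFinP.
- by move=> w _; rewrite lee_fin.
- exact/measurable_EFinP.
Qed.

End ExpectationBound.

(** * Increments of Ito integrals *)

Section ItoIntegral.
Context {d : measure_display} {Omega : measurableType d} {R : realType}.
Variables (P : probability Omega R) (N : nat).
Notation M := 'M[R[i]]_N.
Notation OR := (Omega * measurableTypeR R)%type.
Notation mu := (@lebesgue_measure R).
Variables (F : R -> set (set Omega)) (K : R -> Omega -> M).
Hypothesis filF : filtration F.
Hypothesis bmK : u_brownian_motion P F K.
Variable X : R -> Omega -> M.
Hypothesis cX : continuous_paths X.
Hypothesis aX : adapted F X.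
Notation L1 := (L1 P).
Notation L2 := (L2 P).
Notation Ex := (Ex P).
Notation dK := (dK K).
Notation form := (form K).
Notation pint := (pint K).
Notation adm := (adm F).
Notation elem := (@elementary d Omega R N).
Notation pc := (@piece d Omega R N).
Implicit Types (s r : R) (G : M) (Z : Omega -> M) (H : elem) (S : seq pc).

(** Frozen at its initial value for negative times, which makes the process jointly measurable on
    the whole line without changing integrals over [[0, s]]. *)
Definition Xp x w := X (Num.max 0 x) w.

Lemma XpE x w : Xp x w = X (Num.max 0 x) w. Proof. by []. Qed.

Lemma measurable_Xp e : measurable_fun setT (fun z : OR => coord e (Xp z.2 z.1)).
Proof.
apply: (@joint_measurable _ _ _ (fun s w => coord e (X s w))).
  move=> s s0; apply: (fm_meas filF s0); apply: (fm_coord filF) => //.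
  exact: aX.
move=> w; have [h1 h2] := cX w e.1.1 e.1.2.
by rewrite coord.unlock; case: e.2.
Qed.

Lemma ui_mulA (G A B : M) : ui G (A *m B) = ui (G *m A) B.
Proof. by rewrite !uiE mulmxA. Qed.

(** The linear form [ui G] of the matrix-valued integral of [H]: since
    [ui G (A *m B) = ui (G *m A) B], the matrix [G] moves into the coefficients. *)
Definition pieces G H : seq pc :=
  [seq (el_time H k, el_time H k.+1, fun w => G *m el_coef H k w) |
     k <- iota 0 (el_size H)].

Lemma is_el_time s H k : is_elementary F s H -> (k <= el_size H)%N ->
  0 <= el_time H k <= s.
Proof.
move=> [t0 ts mono _ _] kn; apply/andP; split.
  elim: k kn => [|k IH] kn; first by rewrite t0.
  by rewrite (le_trans (IH (ltnW kn)))// mono.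
have [m] : exists m, (el_size H - k)%N = m by exists (el_size H - k)%N.
elim: m k kn => [|m IH] k kn hm.
  have -> : k = el_size H by apply/eqP; rewrite eqn_leq kn -subn_eq0 hm.
  by rewrite ts.
have kn' : (k < el_size H)%N by rewrite -subn_gt0 hm.
by rewrite (le_trans (mono k kn'))// IH// subnS hm.
Qed.

Lemma In_pieces G H p : List.In p (pieces G H) -> exists2 k, (k < el_size H)%N &
  p = (el_time H k, el_time H k.+1, fun w => G *m el_coef H k w).
Proof.
rewrite /pieces; elim: (el_size H) => [//|n IH].
rewrite -addn1 iotaD map_cat => h.
have := List.in_app_or _ _ _ h; case=> [/IH[k kn ->]|/=[<-|//]].
  by exists k => //; rewrite addn1 (ltn_trans kn).
by exists n; rewrite ?addn1.
Qed.

Lemma el_coef_adm s H k : is_elementary F s H -> (k < el_size H)%N ->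
  adm (el_time H k) (el_coef H k).
Proof.
move=> eH kn; have /andP[t0 _] := is_el_time eH (ltnW kn).
case: eH => [_ _ _ mH [C bH]]; split=> [e|].
  exact: (fm_coord filF e t0 (mH k kn)).
exists (C + 1) => e w; have := coord_sqr_norm e (el_coef H k w).
move=> /le_trans /(_ (bH k w kn)); move: (coord _ _) => x xC.
rewrite ler_norml; apply/andP.
have h := sqr_ge0 (x + 1); have h' := sqr_ge0 (x - 1); have := sqr_ge0 x.
by rewrite sqrrD1 in h; rewrite sqrrB1 in h'; split; lra.
Qed.

Lemma pieces_valid s G H : is_elementary F s H -> valids F (pieces G H).
Proof.
move=> eH p /In_pieces[k kn ->]; have /andP[t0 _] := is_el_time eH (ltnW kn).
split => //=; first by case: eH => _ _ h _ _; exact: h.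
by apply: adm_mulmx; exact: el_coef_adm eH kn.
Qed.

Lemma pieces_end s G H p : is_elementary F s H -> List.In p (pieces G H) ->
  p.1.2 <= s.
Proof. by move=> eH /In_pieces[k kn ->]; have /andP[] := is_el_time eH kn. Qed.

Lemma pint_pieces G H w : pint (pieces G H) w = ui G (el_integral K H w).
Proof.
rewrite !pintE /pieces big_map /el_integral ui_sumr.
rewrite -[in LHS](subn0 (el_size H)) -/(index_iota 0 (el_size H)) big_mkord.
by apply: eq_bigr => k _; rewrite !form_ui /= ui_mulA.
Qed.

Lemma pproc_pieces G H x w : pproc (pieces G H) x w = G *m el_process H x w.
Proof.
rewrite /pproc /pieces big_map /el_process mulmx_sumr.
rewrite -[in LHS](subn0 (el_size H)) -/(index_iota 0 (el_size H)) big_mkord.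
by apply: eq_bigr => k _ /=; case: ifP; rewrite ?mulmx0.
Qed.

Lemma el_process_after s H x w : is_elementary F s H -> s < x ->
  el_process H x w = 0.
Proof.
move=> eH sx; rewrite /el_process big1// => k _.
have /andP[_ h] := is_el_time eH (ltn_ord k).
by case: ifP => // /andP[_ h']; move: sx; rewrite ltNge (le_trans h' h).
Qed.

Definition negp S : seq pc :=
  [seq (p.1, fun w => - p.2 w) | p <- S].

Lemma In_negp S p : List.In p (negp S) ->
  exists2 p', List.In p' S & p = (p'.1, fun w => - p'.2 w).
Proof.
elim: S => [//|p' S IH] /=[<-|/IH[p'' h ->]]; first by exists p' => //; left.
by exists p'' => //; right.
Qed.

Lemma negp_valid S : valids F S -> valids F (negp S).
Proof.
move=> vS p /In_negp[p' /vS[h1 h2 h3] ->]; split => //=; exact: admN.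
Qed.

Lemma pint_negp S w : pint (negp S) w = - pint S w.
Proof.
rewrite !pintE /negp big_map -sumrN; apply: eq_bigr => p _.
by rewrite !form_ui /= uiNl.
Qed.

Lemma pproc_negp S x w : pproc (negp S) x w = - pproc S x w.
Proof.
rewrite /pproc /negp big_map -sumrN; apply: eq_bigr => p _ /=.
by case: ifP; rewrite ?oppr0.
Qed.

Lemma measurable_qf_pproc S : valids F S ->
  measurable_fun setT (fun z : OR => qf (pproc S z.2 z.1)).
Proof.
move=> vS; under eq_fun do rewrite qf_pproc.
have big_meas (f : pc -> OR -> R) :
    (forall p, List.In p S -> measurable_fun setT (f p)) ->
    measurable_fun setT (fun z => \sum_(p <- S) f p z).
  elim: (S) => [_|p S' IH h].
    by under eq_fun do rewrite big_nil; exact: measurable_cst.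
  under eq_fun do rewrite big_cons.
  apply: measurable_funD; first by apply: h; left.
  by apply: IH => p' p'S; apply: h; right.
apply: (big_meas (fun p (z : OR) => \sum_(p' <- S)
  ui (skp (p.2 z.1)) (skp (p'.2 z.1)) *
  \1_(`]Num.max p.1.1 p'.1.1, Num.min p.1.2 p'.1.2]%classic) z.2)) => p pS.
apply: (big_meas (fun p' (z : OR) => ui (skp (p.2 z.1)) (skp (p'.2 z.1)) *
  \1_(`]Num.max p.1.1 p'.1.1, Num.min p.1.2 p'.1.2]%classic) z.2)) => p' pS'.
apply: measurable_funM; last exact: (measurableT_comp (measurable_indic _)).
have := L1_meas (L1_uisk_valid P filF (vS _ pS) (vS _ pS')).
by move=> h; exact: (measurableT_comp h measurable_fst).
Qed.

(** The isometry in the form that compares integrands: closeness in L^2 of [dP x dr] gives closeness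
    of the integrals. *)
Lemma int_pint_sqr S T : valids F S -> (forall p, List.In p S -> p.1.2 <= T) ->
  (\int[P]_w (pint S w ^+ 2)%:E =
   gauss2%:E * dint P 0 T (fun z => qf (pproc S z.2 z.1)))%E.
Proof.
move=> vS ST; have [L1p iso] := isometry filF bmK vS.
rewrite int_of_L1; last exact: (L2_L1sqr (L2_pint filF bmK vS)).
rewrite iso EFinM; congr (_ * _)%E; rewrite -int_of_L1//.
rewrite /dint; apply: eq_integral => w _.
have h p : List.In p S -> 0 <= p.1.1 /\ p.1.2 <= T.
  by move=> pS; split; [case: (vS _ pS)|exact: ST].
have [i <-] := pcov_integral w h.
by rewrite /Rintegral fineK//; exact: integrable_fin_num.
Qed.

Lemma measurable_el_X s H : is_elementary F s H ->
  measurable_fun setT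
    (fun z : OR => sqr_norm (el_process H z.2 z.1 - Xp z.2 z.1)).
Proof.
move=> eH; under eq_fun do rewrite sqr_normE.
apply: measurable_sum => e; apply: measurable_funX.
under eq_fun do rewrite coordB.
apply: measurable_funB; last exact: measurable_Xp.
rewrite /el_process; under eq_fun do rewrite coord_sum.
apply: measurable_sum => k; under eq_fun do rewrite coord_if.
apply: measurable_funM.
  have -> : (fun z : OR => ((el_time H k < z.2 <= el_time H k.+1)%R%:R : R)) =
      (fun z : OR => \1_(`]el_time H k, el_time H k.+1]%classic) z.2).
    apply/funext => z; rewrite indicE; congr ((nat_of_bool _)%:R).
    by apply/idP/idP => [h|/set_mem//]; apply/mem_set.
  exact: (measurableT_comp (measurable_indic _)).
have [m _] := el_coef_adm eH (ltn_ord k).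
have /andP[t0 _] := is_el_time eH (ltnW (ltn_ord k)).
exact: (measurableT_comp (fm_meas filF t0 (m e)) measurable_fst).
Qed.

Lemma measurable_X_Z s Z : 0 <= s -> adm s Z ->
  measurable_fun setT (fun z : OR => sqr_norm (Xp z.2 z.1 - Z z.1)).
Proof.
move=> s0 [mZ _]; under eq_fun do rewrite sqr_normE.
apply: measurable_sum => e; apply: measurable_funX.
under eq_fun do rewrite coordB.
apply: measurable_funB; first exact: measurable_Xp.
exact: (measurableT_comp (fm_meas filF s0 (mZ e)) measurable_fst).
Qed.

Lemma measurable_coord_el_int s H (I : Omega -> M) e : is_elementary F s H ->
  measurable_fun setT I ->
  measurable_fun setT (fun w => coord e (el_integral K H w - I w)).
Proof.
move=> eH mI.
under eq_fun do rewrite coordB.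
apply: measurable_funB; last exact: (measurableT_comp (measurable_coord e) mI).
rewrite /el_integral; under eq_fun do rewrite coord_sum.
apply: measurable_sum => k.
have [m _] := el_coef_adm eH (ltn_ord k).
have /andP[t0 _] := is_el_time eH (ltnW (ltn_ord k)).
have h : el_time H k <= el_time H k.+1 by case: eH => _ _ h _ _; exact: h.
have mC e' : measurable_fun setT (fun w => coord e' (el_coef H k w)).
  exact: (fm_meas filF t0 (m e')).
have mD e' : measurable_fun setT (fun w => coord e' (dK (el_time H k) (el_time H k.+1) w)).
  by apply: (fm_meas filF (le_trans t0 h)); exact: (fm_dK filF bmK).
under eq_fun do rewrite coord_mulmx.
have reE i j : (fun w => re (el_coef H k w i j)) = (fun w => coord (i, j, true) (el_coef H k w)).
  by apply/funext => w; rewrite coord.unlock.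
have imE i j : (fun w => im (el_coef H k w i j)) = (fun w => coord (i, j, false) (el_coef H k w)).
  by apply/funext => w; rewrite coord.unlock.
apply: measurable_sum => j; apply: measurable_funD; last apply: measurable_funM => //.
  by apply: measurable_funM; [rewrite reE; exact: mC|exact: mD].
by apply: measurable_funM; [rewrite imE; exact: mC|exact: mD].
Qed.

Lemma measurable_el_int s H (I : Omega -> M) : is_elementary F s H ->
  measurable_fun setT I ->
  measurable_fun setT (fun w => sqr_norm (el_integral K H w - I w)).
Proof.
move=> eH mI; under eq_fun do rewrite sqr_normE.
apply: measurable_sum => e; apply: measurable_funX.
exact: measurable_coord_el_int eH mI.
Qed.

Lemma dint_sub a b a' b' (g : OR -> R) : measurable_fun setT g ->
  (forall z, 0 <= g z) -> a <= a' -> b' <= b -> (dint P a' b' g <= dint P a b g)%E.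
Proof.
move=> mg g0 aa' bb'; apply: ge0_le_integral => //.
- by move=> w _; apply: integral_ge0 => x _; rewrite lee_fin.
- exact: measurable_inner.
- exact: measurable_inner.
move=> w _; apply: ge0_subset_integral => //=.
- exact: measurable_slice.
- by move=> x _; rewrite lee_fin.
by move=> x /=; rewrite !in_itv/= => /andP[h1 h2]; rewrite (le_trans aa' h1) (le_trans h2 bb').
Qed.

Lemma dint_cut a b a' b' (g : OR -> R) : measurable_fun setT g ->
  (forall z, 0 <= g z) ->
  (dint P a b (fun z => (\1_(`[a', b']%classic) z.2 * g z)%R) <= dint P a' b' g)%E.
Proof.
move=> mg g0; have mi : measurable_fun setT
    (fun z : OR => \1_(`[a', b']%classic) z.2 * g z).
  by apply: measurable_funM => //; exact: (measurableT_comp (measurable_indic _)).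
apply: ge0_le_integral => //.
- by move=> w _; apply: integral_ge0 => x _; rewrite lee_fin mulr_ge0.
- by apply: (measurable_inner a b mi) => z; rewrite mulr_ge0.
- exact: measurable_inner.
move=> w _.
have -> : (\int[mu]_(x in `[a, b]) (\1_(`[a', b']%classic) x * g (w, x))%R%:E =
    \int[mu]_(x in `[a, b] `&` `[a', b']) (g (w, x))%:E)%E.
  rewrite [RHS]integral_mkcondr; apply: eq_integral => x _.
  by rewrite epatch_indic /= EFinM muleC.
apply: ge0_subset_integral => //=.
- exact: measurableI.
- exact: measurable_slice.
- by move=> x _; rewrite lee_fin.
Qed.

Lemma dint_eqX s (g : M -> M -> R) (f : R -> Omega -> M) :
  dint P 0 s (fun z => g (f z.2 z.1) (Xp z.2 z.1)) =
  (\int[P]_w \int[mu]_(x in `[0%R, s]) (g (f x w) (X x w))%:E)%E.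
Proof.
apply: eq_integral => w _; apply: eq_integral => x /set_mem /=.
by rewrite in_itv/= => /andP[x0 _]; rewrite /Xp max_r.
Qed.

(** [Is] and [Ir] are limits of unrelated sequences of elementary integrals, which need not agree on
    [[0, s]]. One list [S] collects the approximation at [r], minus the one at [s], minus the
    integrand frozen at [Z] on []s, r]]. Up to time [s] both processes are close to [X] and cancel;
    after [s] the list compares [X] with [Z], whence the [V]. The variable [T] is the error of the
    approximations themselves. *)
Lemma ito_approx G : exists C, 0 <= C /\ forall s r Is Ir Z V e,
  0 <= s -> s <= r -> ito_integral P F K X s Is -> ito_integral P F K X r Ir ->
  adm s Z -> (dint P s r (fun z => sqr_norm (Xp z.2 z.1 - Z z.1)) <= V%:E)%E ->
  0 < e -> exists S, [/\ valids F S, forall p, List.In p S -> p.1.2 <= r,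
    let T w := ui G (Ir w) - ui G (Is w) - form (fun w => G *m Z w) s r w - pint S w in
      L2 T /\ Ex (fun w => T w ^+ 2) <= C * e,
    Ex (fun w => pint S w ^+ 2) <= C * (e + V) &
    (dint P 0 s (fun z => qf (pproc S z.2 z.1)) <= (C * e)%:E)%E].
Proof.
have [C1 [C10 hC1]] := ui_sqr_le G; have [C2 [C20 hC2]] := @qf_le R N.
have [C3 [C30 hC3]] := sqr_norm_mulmx G.
have g20 : 0 <= @gauss2 R by apply: Rintegral_ge0 => x _; exact: sqr_ge0.
(* The three summands serve in turn the bound of [T], the integrand before time [s], and the second
   moment of [pint S]. *)
pose C := 4 * C1 + 4 * C2 * C3 + gauss2 * (4 * (C2 * C3)).
have CC : 0 <= 4 * C2 * C3 by rewrite !mulr_ge0.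
exists C; split; first by rewrite !addr_ge0// !mulr_ge0.
move=> s r Is Ir Z V e s0 sr [mIs [Hs [eHs Ds bs]]] [mIr [Hr [eHr Dr ar]]] aZ VZ e0.
have V0 : 0 <= V.
  rewrite -lee_fin (le_trans _ VZ)//; apply: integral_ge0 => w _.
  by apply: integral_ge0 => x _; rewrite lee_fin sqr_norm_ge0.
have [n [hDs [hbs [hDr har]]]] : exists n,
    (dint P 0 s (fun z => sqr_norm (el_process (Hs n) z.2 z.1 - Xp z.2 z.1)) <= e%:E)%E /\
    ((\int[P]_w (sqr_norm (el_integral K (Hs n) w - Is w))%:E <= e%:E)%E /\
    ((dint P 0 r (fun z => sqr_norm (el_process (Hr n) z.2 z.1 - Xp z.2 z.1)) <= e%:E)%E /\
    (\int[P]_w (sqr_norm (el_integral K (Hr n) w - Ir w))%:E <= e%:E)%E)).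
  have := filterI (filterI (near_le_cvg0 e0 Ds) (near_le_cvg0 e0 bs))
      (filterI (near_le_cvg0 e0 Dr) (near_le_cvg0 e0 ar)).
  move=> [n _ /(_ n (leqnn n))[[h1 h2] [h3 h4]]]; exists n.
  have e1 := dint_eqX s (fun A B => sqr_norm (A - B)) (el_process (Hs n)).
  have e2 := dint_eqX r (fun A B => sqr_norm (A - B)) (el_process (Hr n)).
  have h1' := @eq_ind _ _ (fun z => (z <= e%:E)%E) h1 _ (esym e1).
  have h3' := @eq_ind _ _ (fun z => (z <= e%:E)%E) h3 _ (esym e2).
  exact: conj h1' (conj h2 (conj h3' h4)).
move: {Ds bs Dr ar} (Hs n) (Hr n) (eHs n) (eHr n) hDs hbs hDr har => {}Hs {}Hr {}eHs {}eHr.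
move=> Ds bs Dr ar.
have aGZ : adm s (fun w => - (G *m Z w)) by apply: admN; exact: adm_mulmx.
pose S : seq pc := pieces G Hr ++ negp (pieces G Hs) ++ [:: (s, r, fun w => - (G *m Z w))].
have vS : valids F S.
  apply: valids_cat; first exact: pieces_valid eHr.
  apply: valids_cat; first by apply: negp_valid; exact: pieces_valid eHs.
  by move=> p [<-|//].
have eS p : List.In p S -> p.1.2 <= r.
  move=> pS; have := List.in_app_or _ _ _ pS; case; first exact: pieces_end eHr.
  move=> pS'; have := List.in_app_or _ _ _ pS'; case; last by case=> [<-|].
  by move=> /In_negp[p' h ->] /=; apply: le_trans sr; exact: pieces_end eHs h.
have pintS w : pint S w = ui G (el_integral K Hr w) - ui G (el_integral K Hs w)
    - form (fun w => G *m Z w) s r w.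
  rewrite !pint_cat pint_negp !pint_pieces addrA; congr (_ + _).
  by rewrite !pintE big_seq1 !form_ui /= uiNl.
have pprocS x w : pproc S x w = G *m (el_process Hr x w - el_process Hs x w
    - (if s < x <= r then Z w else 0)).
  rewrite !pproc_cat pproc_negp !pproc_pieces /pproc big_seq1 /= !mulmxBr addrA.
  by congr (_ + _); case: ifP; rewrite ?mulmx0 ?oppr0.
have mA := measurable_el_X eHr; have mB := measurable_el_X eHs.
have mC := measurable_X_Z s0 aZ.
set A := (fun z : OR => sqr_norm (el_process Hr z.2 z.1 - Xp z.2 z.1)) in mA Dr.
set B := (fun z : OR => sqr_norm (el_process Hs z.2 z.1 - Xp z.2 z.1)) in mB Ds.
set D := (fun z : OR => sqr_norm (Xp z.2 z.1 - Z z.1)) in mC VZ.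
have A0 z : 0 <= A z by exact: sqr_norm_ge0.
have B0 z : 0 <= B z by exact: sqr_norm_ge0.
have D0 z : 0 <= D z by exact: sqr_norm_ge0.
have qle x w : qf (pproc S x w) <= C2 * C3 * sqr_norm (el_process Hr x w - el_process Hs x w
    - (if s < x <= r then Z w else 0)).
  by rewrite pprocS (le_trans (hC2 _))// -mulrA ler_wpM2l.
have before x w : x <= s -> qf (pproc S x w) <= 2 * (C2 * C3) * (A (w, x) + B (w, x)).
  move=> xs; apply: le_trans (qle x w) _; rewrite ltNge xs /= subr0.
  apply: scale2_le; first exact: mulr_ge0.
  have -> : el_process Hr x w - el_process Hs x w =
      (el_process Hr x w - Xp x w) + - (el_process Hs x w - Xp x w).
    by rewrite opprB addrA subrK.
    have := sqr_normD (el_process Hr x w - Xp x w) (- (el_process Hs x w - Xp x w)).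
    by rewrite sqr_normN -mulrDr.
(* Beyond [s] the process approximating up to [s] has stopped, and [Z] takes its place. *)
have after x w : s < x -> x <= r ->
    qf (pproc S x w) <= 2 * (C2 * C3) * (A (w, x) + D (w, x)).
  move=> sx xr; apply: le_trans (qle x w) _; rewrite sx xr /= (el_process_after w eHs sx) subr0.
  apply: scale2_le; first exact: mulr_ge0.
  have -> : el_process Hr x w - Z w = (el_process Hr x w - Xp x w) + (Xp x w - Z w).
    by rewrite addrA subrK.
  by rewrite mulrDr; exact: sqr_normD.
have mq := measurable_qf_pproc vS.
have q0 (z : OR) : 0 <= qf (pproc S z.2 z.1) by exact: qf_ge0.
exists S; split=> //.
- have TE w : ui G (Ir w) - ui G (Is w) - form (fun w => G *m Z w) s r w - pint S w =
      - ui G (el_integral K Hr w - Ir w) + ui G (el_integral K Hs w - Is w).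
    by rewrite pintS !uiBr; ring.
  pose T w := - ui G (el_integral K Hr w - Ir w) + ui G (el_integral K Hs w - Is w).
  suff key : L2 T /\ Ex (fun w => T w ^+ 2) <= C * e.
    exact: (@eq_ind _ T (fun f => L2 f /\ Ex (fun w => f w ^+ 2) <= C * e) key _
      (esym (funext TE))).
  have mI (I : Omega -> M) H t : is_elementary F t H -> measurable_fun setT I ->
      measurable_fun setT (fun w => ui G (el_integral K H w - I w)).
    move=> eH mI; under eq_fun do rewrite ui_coord.
    apply: measurable_sum => e'; apply: measurable_funM; first exact: measurable_cst.
    exact: measurable_coord_el_int eH mI.
  have mT : measurable_fun setT T.
    rewrite /T; apply: measurable_funD; last exact: mI eHs mIs.
    by apply: measurableT_comp => //; exact: mI eHr mIr.
  have nn (f : Omega -> M) w : (0 <= (sqr_norm (f w))%:E)%E by rewrite lee_fin sqr_norm_ge0.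
  have [|h1 h2] := @L2_of_int _ _ _ P T (4 * C1 * e) mT.
  + have -> : 4 * C1 * e = 2 * C1 * (e + e) by ring.
    apply: (int_le2 (mulr_ge0 _ C10) mT (measurable_el_int eHr mIr)
      (measurable_el_int eHs mIs)) => // w; try exact: sqr_norm_ge0.
    rewrite /T; apply: le_trans (sqrD_le _ _) _.
    by rewrite sqrrN -mulrDr -mulrA ler_wpM2l// mulrDr lerD//; exact: hC1.
  + split => //; apply: le_trans h2 _; rewrite ler_wpM2r ?(ltW e0)// /C.
    by rewrite -addrA lerDl addr_ge0// !mulr_ge0.
- have h := int_pint_sqr vS eS.
  have : (\int[P]_w (pint S w ^+ 2)%:E <= (gauss2 * (4 * (C2 * C3)) * (e + V))%:E)%E.
    rewrite h -mulrA EFinM lee_wpmul2l ?lee_fin//.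
    pose E (z : OR) := 2 * (C2 * C3) * (A z + (\1_(`[0, s]%classic) z.2 * B z +
       \1_(`[s, r]%classic) z.2 * D z)).
    have m1 : measurable_fun setT (fun z : OR => \1_(`[0, s]%classic) z.2 * B z).
      by apply: measurable_funM => //; exact: (measurableT_comp (measurable_indic _)).
    have m2 : measurable_fun setT (fun z : OR => \1_(`[s, r]%classic) z.2 * D z).
      by apply: measurable_funM => //; exact: (measurableT_comp (measurable_indic _)).
    have n1 (z : OR) : 0 <= \1_(`[0, s]%classic) z.2 * B z by rewrite mulr_ge0.
    have n2 (z : OR) : 0 <= \1_(`[s, r]%classic) z.2 * D z by rewrite mulr_ge0.
    have m12 := measurable_funD m1 m2.
    have n12 z := addr_ge0 (n1 z) (n2 z).
    have mE1 := measurable_funD mA m12.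
    have nE1 z := addr_ge0 (A0 z) (n12 z).
    apply: (@le_trans _ _ (dint P 0 r E)).
      apply: dint_le => //.
      + by apply: measurable_funM => //.
      + move=> w x /andP[x0 xr]; have [xs|sx] := leP x s.
          apply: le_trans (before x w xs) _; rewrite /E ler_wpM2l ?mulr_ge0// lerD2l.
          rewrite [X in _ <= X + _](_ : _ = B (w, x)); last first.
            by rewrite /= indicE mem_set ?mul1r//= in_itv/= x0.
          by rewrite lerDl mulr_ge0.
        apply: le_trans (after x w sx xr) _; rewrite /E ler_wpM2l ?mulr_ge0// lerD2l.
        rewrite [X in _ <= _ + X](_ : _ = D (w, x)); last first.
          by rewrite /= indicE mem_set ?mul1r//= in_itv/= (ltW sx).
        by rewrite lerDr mulr_ge0.
      + by move=> z; apply: mulr_ge0 (nE1 z); rewrite !mulr_ge0.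
    rewrite (dintZ P 0 r mE1 nE1) ?mulr_ge0//.
    rewrite (dintD P 0 r mA m12 A0 n12) (dintD P 0 r m1 m2 n1 n2).
    apply: (@le_trans _ _ (2 * (C2 * C3) * (e + (e + V)))%:E).
      apply: lee_scale2; [by rewrite !mulr_ge0|exact: Dr|].
      rewrite EFinD; apply: leeD.
        by apply: le_trans Ds; exact: dint_cut.
      by apply: le_trans VZ; exact: dint_cut.
    rewrite lee_fin -subr_ge0.
    have -> : 4 * (C2 * C3) * (e + V) - 2 * (C2 * C3) * (e + (e + V)) = 2 * (C2 * C3) * V.
      by ring.
    by rewrite !mulr_ge0.
  rewrite int_of_L1 ?lee_fin; last exact: (L2_L1sqr (L2_pint filF bmK vS)).
  move=> /le_trans; apply; rewrite ler_wpM2r ?addr_ge0 ?(ltW e0)//.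
  by rewrite /C lerDr addr_ge0// mulr_ge0.
- apply: (@le_trans _ _ (dint P 0 s (fun z => 2 * (C2 * C3) * (A z + B z)))).
    apply: dint_le => //.
    + by apply: measurable_funM => //; exact: measurable_funD.
    + by move=> w x /andP[_ xs]; exact: before.
    + by move=> z; rewrite !mulr_ge0// addr_ge0.
  have mAB := measurable_funD mA mB; have nAB z := addr_ge0 (A0 z) (B0 z).
  rewrite (dintZ P 0 s mAB nAB) ?mulr_ge0// (dintD P 0 s mA mB A0 B0).
  apply: (@le_trans _ _ (2 * (C2 * C3) * (e + e))%:E).
    apply: lee_scale2; [by rewrite !mulr_ge0| |exact: Ds].
    by apply: le_trans Dr; exact: dint_sub.
  rewrite lee_fin /C -subr_ge0.
  have -> : (4 * C1 + 4 * C2 * C3 + gauss2 * (4 * (C2 * C3))) * e - 2 * (C2 * C3) * (e + e) =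
     (4 * C1 + gauss2 * (4 * (C2 * C3))) * e by ring.
  by rewrite !mulr_ge0// ?addr_ge0 ?mulr_ge0// ltW.
Qed.

(** The point of the interval of [p] nearest to [s]. A piece lying on one side of [s] is thus cut
    into itself and an empty interval, on which [form] vanishes. *)
Definition cut_time s (p : pc) := Num.max p.1.1 (Num.min p.1.2 s).

Lemma cut_time_in s p : p.1.1 <= p.1.2 ->
  p.1.1 <= cut_time s p /\ cut_time s p <= p.1.2.
Proof.
move=> h; rewrite /cut_time le_max lexx; split => //.
by rewrite ge_max h /= ge_min lexx.
Qed.

Definition before s S : seq pc := [seq (p.1.1, cut_time s p, p.2) | p <- S].
Definition after s S : seq pc := [seq (cut_time s p, p.1.2, p.2) | p <- S].

Lemma In_map T U (f : T -> U) (l : seq T) y : List.In y (map f l) ->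
  exists2 x, List.In x l & y = f x.
Proof.
elim: l => [//|x l IH] /=[<-|/IH[x' h ->]]; first by exists x => //; left.
by exists x' => //; right.
Qed.

Lemma before_valid s S : valids F S -> valids F (before s S).
Proof.
move=> vS p pS; have [p' p'S ->] := In_map pS; have [h1 h2 h3] := vS _ p'S; split => //=.
by case: (cut_time_in s h2).
Qed.

Lemma after_valid s S : valids F S -> valids F (after s S).
Proof.
move=> vS p pS; have [p' p'S ->] := In_map pS; have [h1 h2 h3] := vS _ p'S; have [h4 h5] := cut_time_in s h2.
split => //=; first exact: le_trans h1 h4.
exact: (adm_le filF h1 h4).
Qed.

Lemma pint_before_after s S w : pint S w = pint (before s S) w + pint (after s S) w.
Proof.
rewrite !pintE /before /after !big_map -big_split; apply: eq_bigr => p _ /=.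
exact: formD.
Qed.

Lemma pproc_before s S x w : valids F S ->
  pproc (before s S) x w = if x <= s then pproc S x w else 0.
Proof.
move=> vS; rewrite /pproc /before big_map /=; case: ifP => xs.
  apply: eq_bigr => p _; rewrite /cut_time /=; congr (if _ then _ else _).
  case: (ltP p.1.1 x) => //= h; rewrite le_max le_min xs andbT.
  by rewrite (lt_geF h).
rewrite big1// => p _; rewrite /cut_time le_max le_min xs andbF orbF.
by case: (ltP p.1.1 x) => //= h; rewrite (lt_geF h).
Qed.

Lemma Ex_pint_after s S (B : R) (Z' : Omega -> R) : 0 <= s -> valids F S ->
  fm (F s) Z' -> (forall w, `|Z' w| <= B) ->
  Ex (fun w => Z' w * pint (after s S) w) = 0.
Proof.
move=> s0 vS mZ' bZ'.
have E w : Z' w * pint (after s S) w = \sum_(p <- after s S) Z' w * form p.2 p.1.1 p.1.2 w.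
  by rewrite !pintE mulr_sumr.
have z p : List.In p (after s S) ->
    L1 (fun w => Z' w * form p.2 p.1.1 p.1.2 w) /\
    Ex (fun w => Z' w * form p.2 p.1.1 p.1.2 w) = 0.
  move=> pS; have [h1 h2 h3] := after_valid (s:=s) vS pS.
  have mZ := fm_meas filF s0 mZ'.
  split; first by apply: L2_L1; apply: (L2M_bnd mZ bZ'); exact: (L2_form filF bmK).
  have [sp|ps] := leP s p.1.1.
    apply: (Ex_form_mul filF bmK h1 h2 h3); first exact: (fm_le filF s0 sp).
    exact: L2_bnd mZ bZ'.
  (* A piece of [after s S] that starts before [s] comes from an interval ending before [s], and is
     empty. *)
  suff e : p.1.1 = p.1.2.
    rewrite -[RHS](Ex_cst P 0); apply: Ex_eq => w.
    by rewrite !form_ui e dKss ui0r mulr0.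
  move: ps; have [p' p'S ->] := In_map pS; rewrite /=; have [_ h4 _] := vS _ p'S; rewrite /cut_time.
  rewrite gt_max gt_min ltxx orbF => /andP[h5 h6].
  by rewrite (min_idPl (ltW h6)); apply/max_idPr.
rewrite (Ex_eq P E); have [_ ->] := big_L1 (fun p pS => (z p pS).1).
transitivity (\sum_(p <- after s S) (0 : R)); last by rewrite big1.
by apply: eq_big_In => p /z[].
Qed.

(** Sends an auxiliary parameter to 0; the constant [k] may have any sign. *)
Lemma le_of_slack (x y k : R) : (forall e, 0 < e -> x <= y + k * e) -> x <= y.
Proof.
move=> h; apply/ler_addgt0Pr => e e0.
have k0 : 0 < `|k| + 1 by rewrite ltr_wpDl.
apply: le_trans (h (e / (`|k| + 1)) (divr_gt0 e0 k0)) _; rewrite lerD2l.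
rewrite mulrA ler_pdivrMr// mulrC ler_pM2l//.
by apply: le_trans (ler_norm k) _; rewrite lerDl.
Qed.

(** Freezing the integrand at [Z] over [[s, r]] makes an error of mean square at most of order [V]
    which is orthogonal to the past. For the orthogonality the approximating list is cut at [s]: the
    part before is small by the isometry, the part after is exactly orthogonal. *)
Lemma ito_increment G : exists C, 0 <= C /\ forall s r Is Ir Z V,
  0 <= s -> s <= r -> ito_integral P F K X s Is -> ito_integral P F K X r Ir ->
  adm s Z -> (dint P s r (fun z => sqr_norm (Xp z.2 z.1 - Z z.1)) <= V%:E)%E ->
  let eps w := ui G (Ir w) - ui G (Is w) - form (fun w => G *m Z w) s r w in
  [/\ L2 eps, Ex (fun w => eps w ^+ 2) <= C * V &
    forall (Z' : Omega -> R) (B : R), fm (F s) Z' -> (forall w, `|Z' w| <= B) ->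
      Ex (fun w => Z' w * eps w) = 0].
Proof.
have [C [C0 h]] := ito_approx G; exists (2 * C); split; first by rewrite mulr_ge0.
move=> s r Is Ir Z V s0 sr hs hr aZ VZ eps.
have appr e : 0 < e -> exists S T, [/\ valids F S, forall w, eps w = T w + pint S w,
    L2 T /\ Ex (fun w => T w ^+ 2) <= C * e,
    Ex (fun w => pint S w ^+ 2) <= C * (e + V) &
    Ex (fun w => pint (before s S) w ^+ 2) <= gauss2 * (C * e)].
  move=> e0; have [S [vS eS hT hp hq]] := h s r Is Ir Z V e s0 sr hs hr aZ VZ e0.
  exists S; eexists; split; [exact: vS| |exact: hT|exact: hp|].
    by move=> w; rewrite subrK.
  have vB := before_valid (s:=s) vS.
  have eB p : List.In p (before s S) -> p.1.2 <= r.
    move=> pS; have [p' p'S ->] := In_map pS; apply: le_trans (eS _ p'S).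
    by case: (vS _ p'S) => _ h2 _; case: (cut_time_in s h2).
  have := int_pint_sqr vB eB; rewrite int_of_L1; last first.
    exact: (L2_L1sqr (L2_pint filF bmK vB)).
  move=> hI; rewrite -lee_fin hI EFinM; apply: lee_wpmul2l.
    by rewrite lee_fin; apply: Rintegral_ge0 => x _; exact: sqr_ge0.
  apply: le_trans hq.
  have mq := measurable_qf_pproc vS.
  have q0 (z : OR) : 0 <= qf (pproc S z.2 z.1) by exact: qf_ge0.
  apply: le_trans (dint_cut 0 r 0 s mq q0).
  apply: dint_le; [exact: measurable_qf_pproc| | | |].
  - by apply: measurable_funM => //; exact: (measurableT_comp (measurable_indic _)).
  - by move=> z; exact: qf_ge0.
  - move=> w x /andP[x0 _]; rewrite /= (pproc_before _ _ _ vS); case: ifP => xs.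
      by rewrite indicE mem_set ?mul1r//= in_itv/= x0.
    rewrite {1}/qf skp0 ui0l; apply: mulr_ge0 => //; exact: (q0 (w, x)).
  - by move=> z; apply: mulr_ge0 => //; exact: (q0 z).
have Leps : L2 eps.
  have [S [T [vS hE [LT _] _ _]]] := appr 1 ltr01.
  rewrite (_ : eps = fun w => T w + pint S w); last exact/funext.
  exact: (L2D LT (L2_pint filF bmK vS)).
split => //.
  apply: (@le_of_slack _ _ (4 * C)) => e e0.
  have [S [T [vS hE [LT hT] hp _]]] := appr e e0.
  have -> : Ex (fun w => eps w ^+ 2) = Ex (fun w => (T w + pint S w) ^+ 2).
    by apply: Ex_eq => w; rewrite hE.
  apply: le_trans (Ex_sqrD_le LT (L2_pint filF bmK vS)) _.
  by move: hT hp; lra.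
move=> Z' B mZ' bZ'; have mZ := fm_meas filF s0 mZ'.
have LZ : L2 Z' by exact: L2_bnd mZ bZ'.
apply/eqP; rewrite -normr_eq0 eq_le normr_ge0 andbT.
apply: (@le_of_slack _ _ (2 * Ex (fun w => Z' w ^+ 2) + C + gauss2 * C)) => k k0.
(* Accuracy [k^2] in the approximation compensates the [k^-1] of Young's inequality and leaves a
   bound of order [k]. *)
have k20 : 0 < k * k by rewrite mulr_gt0.
have [S [T [vS hE [LT hT] _ hb]]] := appr _ k20.
have Lb := L2_pint filF bmK (before_valid (s:=s) vS).
have La := L2_pint filF bmK (after_valid (s:=s) vS).
have -> : Ex (fun w => Z' w * eps w) =
    Ex (fun w => Z' w * T w) + Ex (fun w => Z' w * pint (before s S) w).
  rewrite -[RHS]addr0 -(Ex_pint_after s0 vS mZ' bZ').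
  rewrite -!ExD; last 4 first.
  - by apply: L1D; exact: L2_mul.
  - exact: L2_mul.
  - exact: L2_mul.
  - exact: L2_mul.
  by apply: Ex_eq => w; rewrite hE (pint_before_after s) !mulrDr addrA.
apply: le_trans (ler_normD _ _) _; rewrite add0r.
have b1 := Ex_mul_le k0 LZ LT; have b2 := Ex_mul_le k0 LZ Lb.
have hT' : k^-1 * Ex (fun w => T w ^+ 2) <= C * k.
  by rewrite ler_pdivrMl// mulrCA.
have hb' : k^-1 * Ex (fun w => pint (before s S) w ^+ 2) <= gauss2 * C * k.
  rewrite ler_pdivrMl//; apply: le_trans hb _.
  by have -> : k * (gauss2 * C * k) = gauss2 * (C * (k * k)) by ring.
apply: le_trans (lerD b1 b2) _; rewrite mulrDl mulrDl.
have -> : 2 * Ex (fun w => Z' w ^+ 2) * k = k * Ex (fun w => Z' w ^+ 2) + k * Ex (fun w => Z' w ^+ 2) by ring.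
by apply: le_trans (lerD (lerD (lexx _) hT') (lerD (lexx _) hb')) _; rewrite !addrA; lra.
Qed.

End ItoIntegral.

(** * First order expansion along one unitary Brownian motion *)

Section PathAverage.
Context {R : realType}.
Notation mu := (@lebesgue_measure R).
Implicit Types (a b c k B : R) (y : measurableTypeR R -> R).

Definition pin a b y : R := \int[mu]_(x in `[a, b]) y x.

Lemma path_integrable a b y B : measurable_fun setT y -> (forall x, `|y x| <= B) ->
  mu.-integrable `[a, b] (EFin \o y).
Proof.
move=> my yB; apply: measurable_bounded_integrable => //=.
- by rewrite lebesgue_measure_itv/=; case: ifP => _; rewrite ltry.
- exact: measurable_funTS.
by exists B; split; rewrite ?num_real// => x Bx z _ /=; rewrite (le_trans (yB z))// ltW.
Qed.

Lemma pin_cst a b c : a <= b -> pin a b (fun=> c) = c * (b - a).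
Proof.
move=> ab; rewrite /pin Rintegral_cst//= lebesgue_measure_itv/= lte_fin.
case: ltP => //= h; have -> : a = b by apply/le_anti/andP.
by rewrite subrr.
Qed.

Lemma pin_split s r y B : 0 <= s -> s <= r -> measurable_fun setT y ->
  (forall x, `|y x| <= B) -> pin 0 r y - pin 0 s y = pin s r y.
Proof.
move=> s0 sr my yB; rewrite /pin Rintegral_itvB ?bnd_simp//; last exact: path_integrable yB.
rewrite Rintegral_itv_obnd_cbnd//; apply: (@integrableS _ _ _ mu `[s, r]%classic `]s, r]%classic) => //.
  by move=> x /=; rewrite !in_itv/= => /andP[/ltW -> ->].
exact: path_integrable yB.
Qed.

Lemma pin_bound a b y B : a <= b -> measurable_fun setT y ->
  (forall x, `|y x| <= B) -> `|pin a b y| <= B * (b - a).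
Proof.
move=> ab my yB; rewrite -(pin_cst B ab).
apply: le_trans (le_normr_Rintegral _ (path_integrable a b my yB)) _ => //.
apply: le_Rintegral => //.
- apply: (@path_integrable a b _ (B)); first exact: measurableT_comp.
  by move=> x; rewrite normr_id.
- exact: (@path_integrable a b _ (`|B|)).
Qed.

(** Young's inequality [|y - c| <= k + k^-1 (y - c)^2], integrated: a time integral is replaced by
    its value at the left end once the mean square oscillation is known. *)
Lemma pin_dev a b y c k B : 0 < k -> a <= b -> measurable_fun setT y ->
  (forall x, `|y x| <= B) ->
  `|pin a b y - (b - a) * c| <= k * (b - a) + k^-1 * pin a b (fun x => (y x - c) ^+ 2).
Proof.
move=> k0 ab my yB; rewrite (mulrC (b - a)) -(pin_cst c ab) -(pin_cst k ab).
have iy := path_integrable a b my yB.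
have ic (z : R) : mu.-integrable `[a, b] (EFin \o (fun=> z)).
  exact: (@path_integrable a b _ (`|z|)).
have myc : measurable_fun setT (fun x => y x - c) by exact: measurable_funB.
have bc x : `|y x - c| <= B + `|c|.
  by rewrite (le_trans (ler_normB _ _))// lerD2r.
have b2 x : `|(y x - c) ^+ 2| <= (B + `|c|) ^+ 2.
  by rewrite normrX lerXn2r// nnegrE// (le_trans _ (bc x)).
have i2 : mu.-integrable `[a, b] (EFin \o (fun x => (y x - c) ^+ 2)).
  apply: (@path_integrable a b _ ((B + `|c|) ^+ 2)); first exact: measurable_funX.
  exact: b2.
have i3 : mu.-integrable `[a, b] (EFin \o (fun x => k^-1 * (y x - c) ^+ 2)).
  apply: (@path_integrable a b _ (`|k^-1| * (B + `|c|) ^+ 2)).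
    by apply: measurable_funM => //; exact: measurable_funX.
  by move=> x; rewrite normrM ler_wpM2l// b2.
rewrite /pin -RintegralB// -RintegralZl// -RintegralD//.
have i4 : mu.-integrable `[a, b] (EFin \o (fun x => y x - c)) by exact: path_integrable bc.
apply: le_trans (le_normr_Rintegral _ i4) _ => //; apply: le_Rintegral => //.
- apply: (@path_integrable a b _ (B + `|c|)); first exact: measurableT_comp.
  by move=> x; rewrite normr_id.
- apply: (@path_integrable a b _ (`|k| + `|k^-1| * (B + `|c|) ^+ 2)).
    by apply: measurable_funD => //; apply: measurable_funM => //; exact: measurable_funX.
  by move=> x; rewrite (le_trans (ler_normD _ _))// lerD2l normrM ler_wpM2l// b2.
move=> x _; have := young 1 (y x - c) k0; rewrite !mul1r expr1n mulr1//.
Qed.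

End PathAverage.

Section ExpectationAe.
Context {d : measure_display} {Omega : measurableType d} {R : realType}.
Variable P : probability Omega R.
Notation OR := (Omega * measurableTypeR R)%type.
Notation mu := (@lebesgue_measure R).

Lemma Ex_ae (f g : Omega -> R) : measurable_fun setT f -> measurable_fun setT g ->
  {ae P, forall w, f w = g w} -> Ex P f = Ex P g.
Proof.
move=> mf mg fg; rewrite /Ex /Rintegral; congr fine.
apply: ae_eq_integral => //; try exact/measurable_EFinP.
by apply: filterS fg => w + _ => ->.
Qed.

Lemma integral_le_cst (f : Omega -> R) C : measurable_fun setT f ->
  (forall w, 0 <= f w <= C) -> (\int[P]_w (f w)%:E <= C%:E)%E.
Proof.
move=> mf fC; have Lf : L1 P f.
  by apply: (@L1_bnd _ _ _ P _ C) => // w; case/andP: (fC w) => h1 h2; rewrite ger0_norm.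
rewrite int_of_L1// lee_fin -[leRHS](Ex_cst P); apply: Ex_le => //; first exact: L1_cst.
by move=> w; case/andP: (fC w).
Qed.

Lemma measurable_pin a b (g : OR -> R) B : a <= b -> measurable_fun setT g ->
  (forall z, `|g z| <= B) -> measurable_fun setT (fun w => pin a b (fun x => g (w, x))).
Proof.
move=> ab mg gB.
(* Adding [B] makes the integrand non-negative, which is the case that [measurable_inner] covers. *)
have e w : pin a b (fun x => g (w, x)) =
    fine (\int[mu]_(x in `[a, b]) (g (w, x) + B)%:E)%E - B * (b - a).
  have my : measurable_fun setT (fun x : measurableTypeR R => g (w, x)).
    by have /measurable_EFinP := measurable_slice (D:=setT) w mg.
  rewrite -(pin_cst B ab) /pin -/(Rintegral _ _ _) RintegralD// ?addrK//.
    exact: (@path_integrable _ a b _ (B)).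
  exact: (@path_integrable _ a b _ (`|B|)).
under eq_fun do rewrite e.
apply: measurable_funB => //; apply: measurableT_comp => //.
apply: (@measurable_inner _ _ _ a b (fun z => g z + B)); first exact: measurable_funD.
by move=> z; move: (gB z); rewrite ler_norml => /andP[h _]; rewrite -lerBlDr sub0r.
Qed.

Lemma Ex_pin_le a b (g : OR -> R) B C : a <= b -> measurable_fun setT g ->
  (forall z, 0 <= g z <= B) -> 0 <= C ->
  (forall x, a <= x <= b -> Ex P (fun w => g (w, x)) <= C) ->
  Ex P (fun w => pin a b (fun x => g (w, x))) <= C * (b - a).
Proof.
move=> ab mg gB C0 hC.
have g0 z : 0 <= g z by case/andP: (gB z).
have gB' z : `|g z| <= B by rewrite ger0_norm//; case/andP: (gB z).
have my w : measurable_fun setT (fun x : measurableTypeR R => g (w, x)).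
  by have /measurable_EFinP := measurable_slice (D:=setT) w mg.
have mx x : measurable_fun setT (fun w => g (w, x)).
  by apply: (measurableT_comp mg); exact: measurable_fun_pair.
have := dint_bound (P:=P) ab mg g0 C0; rewrite -lee_fin -int_of_L1; last first.
  apply: (@L1_bnd _ _ _ P _ (B * (b - a))); first exact: measurable_pin gB'.
  by move=> w; exact: pin_bound.
move=> h; apply: le_trans (h _).
  rewrite le_eqVlt; apply/orP; left; apply/eqP; apply: eq_integral => w _.
  by rewrite /pin /Rintegral fineK//; apply: integrable_fin_num => //; exact: (path_integrable a b (my w) (fun x => gB' (w, x))).
move=> x axb; rewrite int_of_L1 ?lee_fin; first exact: hC.
exact: L1_bnd (mx x) (fun w => gB' (w, x)).
Qed.

End ExpectationAe.

Section UnitaryEntries.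
Context {R : realType} {N : nat}.
Notation M := 'M[R[i]]_N.

Lemma unitary_entry_le (u : M) i j : u \is unitarymx ->
  re (u i j) ^+ 2 + im (u i j) ^+ 2 <= 1.
Proof.
move=> /unitarymxP h; have := congr1 (fun A : M => re (A i i)) h.
rewrite !mxE eqxx re_sum; under eq_bigr do rewrite adjE reM reJ imJ mulrN opprK -!expr2.
rewrite (bigD1 j)//= => <-; rewrite lerDl sumr_ge0// => k _.
by rewrite addr_ge0// sqr_ge0.
Qed.

Lemma coord_unitary_le e (u : M) : u \is unitarymx -> `|coord e u| <= 1.
Proof.
move=> hu; rewrite -(@expr_le1 _ 2)// real_normK ?num_real//.
apply: le_trans _ (unitary_entry_le e.1.1 e.1.2 hu).
by rewrite coord.unlock; case: e.2; rewrite ?lerDl ?lerDr sqr_ge0.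
Qed.

Lemma sqr_norm_unitary_le (u : M) : u \is unitarymx -> sqr_norm u <= #|{: cidx N}|%:R.
Proof.
move=> hu; rewrite sqr_normE -sum1_card natr_sum; apply: ler_sum => e _.
rewrite -real_normK ?num_real// expr_le1//; exact: coord_unitary_le.
Qed.

(** Represents [coord e] on all matrices; [cbasis e] is its projection to u(N). *)
Definition gbasis (e : cidx N) : M :=
  (if e.2 then - N%:R^-1 else N%:R^-1 *i) *: delta_mx e.1.2 e.1.1.

Lemma coord_gbasis e (X : M) : coord e X = ui (gbasis e) X.
Proof.
rewrite uiE -scalemxAl mxtraceZ.
have N0 : (N%:R : R) != 0.
  by rewrite pnatr_eq0; case: e => -[[i Hi] j b]; case: (N) Hi.
have -> : \tr (delta_mx e.1.2 e.1.1 *m X) = X e.1.1 e.1.2.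
  rewrite /mxtrace (bigD1 e.1.2)//= mxE (bigD1 e.1.1)//= !mxE !eqxx mul1r.
  rewrite !big1 ?addr0//.
    by move=> i ie; rewrite mxE big1// => j _; rewrite mxE (negbTE ie) mul0r.
  by move=> j je; rewrite !mxE (negbTE je) andbF mul0r.
rewrite coord.unlock; case: e.2.
  have -> : - N%:R^-1 = (- N%:R^-1 : R)%:C :> R[i].
    by rewrite rmorphN /= fmorphV; congr (- _^-1); rewrite -natC.
  by rewrite reZ; field.
by rewrite reM /=; field.
Qed.

Lemma measurable_unitary_val : measurable_fun setT (@unitary_val R N).
Proof.
move=> _ B mB; exists B => //.
Qed.

Lemma measurable_coord_unitary e :
  measurable_fun setT (fun u : unitary R N => coord e (unitary_val u)).
Proof. exact: (measurableT_comp (measurable_coord e) measurable_unitary_val). Qed.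

End UnitaryEntries.

(** * Mean square increments of the solution *)

Section UnitaryIncrements.
Context {d : measure_display} {Omega : measurableType d} {R : realType}.
Variables (P : probability Omega R) (N : nat).
Notation M := 'M[R[i]]_N.
Notation OR := (Omega * measurableTypeR R)%type.
Variables (F : R -> set (set Omega)) (K : R -> Omega -> M).
Hypothesis filF : filtration F.
Hypothesis bmK : u_brownian_motion P F K.
Variable U : R -> Omega -> unitary R N.
Let X s w : M := unitary_val (U s w).
Hypothesis cX : continuous_paths X.
Hypothesis aX : adapted F X.
Hypothesis sde : forall s : R, 0 <= s -> exists I, ito_integral P F K X s I /\
  {ae P, forall w, X s w = 1%:M + I w - (2^-1)%:C *: time_integral X s w}.
Notation L1 := (L1 P).
Notation L2 := (L2 P).
Notation Ex := (Ex P).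
Notation form := (form K).
Notation adm := (adm F).
Notation Xp := (Xp X).

Let Xu s w : X s w \is unitarymx. Proof. exact: valP. Qed.

Lemma fm_X s e : 0 <= s -> fm (F s) (fun w => coord e (X s w)).
Proof. by move=> s0; apply: fm_coord => //; exact: aX. Qed.

Lemma meas_X s e : 0 <= s -> measurable_fun setT (fun w => coord e (X s w)).
Proof. by move=> s0; apply: (fm_meas filF s0); exact: fm_X. Qed.

Lemma adm_X s : 0 <= s -> adm s (X s).
Proof.
move=> s0; split=> [e|]; first exact: fm_X.
by exists 1 => e w; exact: coord_unitary_le.
Qed.

Definition yX (e : cidx N) (z : OR) : R := coord e (Xp z.2 z.1).

Lemma yX_le e z : `|yX e z| <= 1.
Proof. by apply: coord_unitary_le; exact: Xu. Qed.

Lemma measurable_yX e : measurable_fun setT (yX e).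
Proof. exact: (measurable_Xp filF cX aX e). Qed.

Lemma measurable_yX_path e w :
  measurable_fun setT (fun x : measurableTypeR R => yX e (w, x)).
Proof. by have /measurable_EFinP := measurable_slice (D:=setT) w (measurable_yX e). Qed.

Lemma sde_coord s : 0 <= s -> exists I, ito_integral P F K X s I /\
  forall e, {ae P, forall w, coord e (X s w) = coord e (1%:M : M) + coord e (I w)
    - 2^-1 * pin 0 s (fun x => yX e (w, x))}.
Proof.
move=> s0; have [I [iI hI]] := sde s0; exists I; split => // e.
apply: filterS hI => w ->; rewrite coordB coordD coordZ; congr (_ - _ * _).
rewrite coord.unlock !mxE /pin; case: e => -[i j] [] /=.
  apply: eq_Rintegral => x /set_mem /=; rewrite in_itv/= => /andP[x0 _].
  by rewrite /yX !XpE coord.unlock /= max_r.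
apply: eq_Rintegral => x /set_mem /=; rewrite in_itv/= => /andP[x0 _].
by rewrite /yX !XpE coord.unlock /= max_r.
Qed.

(** By the equation, the increment corrected by the drift is almost surely an increment of the
    stochastic integral; the last term subtracts the integral with integrand frozen at [Z]. *)
Definition incr e Z s r w := coord e (X r w) - coord e (X s w)
  + 2^-1 * pin s r (fun x => yX e (w, x)) - form (fun w => gbasis e *m Z w) s r w.

Lemma incr_bound e : exists C, 0 <= C /\ forall s r Z V,
  0 <= s -> s <= r -> adm s Z ->
  (dint P s r (fun z => sqr_norm (Xp z.2 z.1 - Z z.1)) <= V%:E)%E ->
  [/\ L2 (incr e Z s r), Ex (fun w => incr e Z s r w ^+ 2) <= C * V &
    forall (Z' : Omega -> R) (B : R), fm (F s) Z' -> (forall w, `|Z' w| <= B) ->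
      Ex (fun w => Z' w * incr e Z s r w) = 0].
Proof.
have [C [C0 h]] := ito_increment filF bmK cX aX (gbasis e).
exists C; split => // s r Z V s0 sr aZ VZ; have r0 := le_trans s0 sr.
have [Is [iIs hIs]] := sde_coord s0; have [Ir [iIr hIr]] := sde_coord r0.
have := h s r Is Ir Z V s0 sr iIs iIr aZ VZ.
set eps := (fun w => _); move=> [L hV hZ].
have my w := measurable_yX_path e w.
have yb w x : `|yX e (w, x)| <= 1 by exact: yX_le.
have mp : measurable_fun setT (fun w => pin s r (fun x => yX e (w, x))).
  exact: measurable_pin sr (measurable_yX e) (yX_le e).
have LD : L2 (incr e Z s r).
  apply: L2B; last by apply: (L2_form filF bmK) => //; exact: adm_mulmx.
  apply: (@L2_bnd _ _ _ P _ (2 + 2^-1 * (1 * (r - s)))).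
    apply: measurable_funD; first by apply: measurable_funB; exact: meas_X.
    exact: measurable_funM.
  move=> w; apply: le_trans (ler_normD _ _) _; apply: lerD.
    rewrite (_ : 2 = 1 + 1)//; apply: le_trans (ler_normB _ _) _.
    by apply: lerD; exact: coord_unitary_le.
  rewrite normrM ger0_norm ?invr_ge0// ler_wpM2l ?invr_ge0//.
  exact: pin_bound.
have E : {ae P, forall w, eps w = incr e Z s r w}.
  apply: filterS2 (hIs e) (hIr e) => w hs hr.
  rewrite /eps /incr -!coord_gbasis hs hr -(pin_split s0 sr (my w) (yb w)).
  move: (pin _ _ _) (pin _ _ _) => a b; move: (form _ _ _ _) => f.
  move: (coord _ _) (coord _ _) (coord _ _) => x y z; ring.
have mE := L2_meas L; have mD := L2_meas LD.
split => //.
  rewrite (@Ex_ae _ _ _ P _ (fun w => eps w ^+ 2)) //; try exact: measurable_funX.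
  by apply: filterS E => w ->.
move=> Z' B mZ' bZ'; have mZ := fm_meas filF s0 mZ'.
rewrite -(hZ Z' B mZ' bZ'); apply: Ex_ae; try exact: measurable_funM.
by apply: filterS E => w ->.
Qed.

Variable T : R.

(** A bootstrap: the useless choice [Z = 0] already shows that increments are of order [r - s] in
    mean square. The bound [T] on the step absorbs the square of the drift. *)
Lemma incr_sqr e : exists C, 0 <= C /\ forall s r, 0 <= s -> s <= r -> r <= s + T ->
  Ex (fun w => (coord e (X r w) - coord e (X s w)) ^+ 2) <= C * (r - s).
Proof.
have [C [C0 hC]] := incr_bound e; pose n : R := #|{: cidx N}|%:R.
exists (2 * (C * n) + `|T|); split.
  by rewrite addr_ge0// !mulr_ge0.
move=> s r s0 sr rT; have rs : 0 <= r - s by rewrite subr_ge0.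
have a0 : adm s (fun=> 0 : M) by exact: adm0.
have [|L hV _] := hC s r (fun=> 0) (n * (r - s)) s0 sr a0.
  apply: dint_bound => //.
  - exact: (measurable_X_Z filF cX aX s0 a0).
  - by move=> z; exact: sqr_norm_ge0.
  move=> x _; apply: integral_le_cst.
    have := measurable_X_Z filF cX aX s0 a0.
    move=> m; apply: (measurableT_comp m); exact: measurable_fun_pair.
  move=> w; rewrite sqr_norm_ge0 /= subr0; apply: sqr_norm_unitary_le; exact: Xu.
have my w := measurable_yX_path e w.
have yb w x : `|yX e (w, x)| <= 1 by exact: yX_le.
have mp : measurable_fun setT (fun w => pin s r (fun x => yX e (w, x))).
  exact: measurable_pin sr (measurable_yX e) (yX_le e).
have bp w : `|- (2^-1 * pin s r (fun x => yX e (w, x)))| <= 2^-1 * (r - s).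
  rewrite normrN normrM ger0_norm ?invr_ge0// ler_wpM2l ?invr_ge0//.
  by have := pin_bound sr (my w) (yb w); rewrite mul1r.
have mp' : measurable_fun setT (fun w => - (2^-1 * pin s r (fun x => yX e (w, x)))).
  by apply: measurableT_comp => //; exact: measurable_funM.
have Lp := L2_bnd P mp' bp.
have E w : coord e (X r w) - coord e (X s w) =
    incr e (fun=> 0) s r w + - (2^-1 * pin s r (fun x => yX e (w, x))).
  by rewrite /incr !form_ui mulmx0 ui0l subr0 addrK.
rewrite (Ex_eq P (fun w => congr1 (fun x => x ^+ 2) (E w))).
apply: le_trans (Ex_sqrD_le L Lp) _.
have n1 : 2 * (C * n) * (r - s) = 2 * (C * (n * (r - s))) by ring.
rewrite [leRHS]mulrDl n1; apply: lerD; first exact: ler_wpM2l.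
apply: (@le_trans _ _ (2 * (2^-1 * (r - s)) ^+ 2)).
  rewrite ler_wpM2l// -[leRHS](Ex_cst P); apply: Ex_le.
  - exact: L2_L1sqr.
  - exact: L1_cst.
  move=> w; rewrite -real_normK ?num_real// lerXn2r// nnegrE//.
  by rewrite mulr_ge0 ?invr_ge0.
have TT : r - s <= `|T|.
  by apply: le_trans (ler_norm T); rewrite lerBlDl.
rewrite exprMn mulrA expr2 mulrA ler_wpM2r//.
apply: le_trans TT; rewrite -[leRHS]mul1r ler_wpM2r//; lra.
Qed.

(** With [incr_sqr], freezing at the true value [X s] is accurate to second order in the step. *)
Lemma incr_sqr_norm : exists C, 0 <= C /\ forall s r, 0 <= s -> s <= r -> r <= s + T ->
  (dint P s r (fun z => sqr_norm (Xp z.2 z.1 - X s z.1)) <= (C * (r - s) ^+ 2)%:E)%E.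
Proof.
have [C hC] := choice incr_sqr; exists (\sum_e C e).
have S0 : 0 <= \sum_e C e by apply: sumr_ge0 => e _; case: (hC e).
split => // s r s0 sr rT; have rs : 0 <= r - s by rewrite subr_ge0.
rewrite expr2 mulrA; have aZ := adm_X s0.
have m := measurable_X_Z filF cX aX s0 aZ.
apply: dint_bound => //.
- by move=> z; exact: sqr_norm_ge0.
- exact: mulr_ge0.
move=> x /andP[sx xr]; have x0 := le_trans s0 sx.
have L e : L1 (fun w => (coord e (X x w) - coord e (X s w)) ^+ 2).
  apply: L2_L1sqr; apply: (@L2_bnd _ _ _ P _ (1 + 1)).
    by apply: measurable_funB; exact: meas_X.
  by move=> w; apply: le_trans (ler_normB _ _) _; apply: lerD; exact: coord_unitary_le.
have E w : sqr_norm (Xp x w - X s w) = \sum_e (coord e (X x w) - coord e (X s w)) ^+ 2.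
  rewrite sqr_normE; apply: eq_bigr => e _; rewrite coordB !XpE max_r//.
under eq_integral do rewrite /= E.
rewrite int_of_L1; last by apply: L1_sum => e; exact: L.
rewrite lee_fin Ex_sum// mulr_suml; apply: ler_sum => e _.
have [Ce0 h] := hC e; apply: le_trans (h s x s0 sx (le_trans xr rT)) _.
by rewrite ler_wpM2l// lerD2r.
Qed.

End UnitaryIncrements.

(** * Increments of a product *)

Section ProductExpansion.
Context {d : measure_display} {Omega : measurableType d} {R : realType}.
Variable P : probability Omega R.
Notation L1 := (L1 P).
Notation L2 := (L2 P).
Notation Ex := (Ex P).

(** The error [e] is only known in mean square. Boundedness of the whole increment [f + e] trades
    two of its four powers for the constant [B]. *)
Lemma pow4_le (B f e : R) : `|f + e| <= 2 * B ->
  (f + e) ^+ 4 <= 4 * f ^+ 4 + 16 * B ^+ 2 * e ^+ 2.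
Proof.
move=> h; set D := (f + e) in h *.
have D4 : D ^+ 4 = D ^+ 2 * D ^+ 2 by rewrite -exprD.
have f4 : f ^+ 4 = f ^+ 2 * f ^+ 2 by rewrite -exprD.
have h1 : D ^+ 2 <= 2 * f ^+ 2 + 2 * e ^+ 2 := sqrD_le f e.
have h2 : D ^+ 2 <= 4 * B ^+ 2.
  have -> : 4 * B ^+ 2 = (2 * B) ^+ 2 by ring.
  by rewrite -real_normK ?num_real// lerXn2r// nnegrE// (le_trans _ h).
have D0 := sqr_ge0 D; have F0 := sqr_ge0 f; have E0 := sqr_ge0 e.
rewrite D4 f4; move: (D ^+ 2) (f ^+ 2) (e ^+ 2) (B ^+ 2) h1 h2 D0 F0 E0.
move=> {D4 f4 h D f e B} D f e B h1 h2 D0 F0 E0.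
have a1 : D * D <= D * (2 * f + 2 * e) by rewrite ler_wpM2l.
have a2 : D * (2 * e) <= 4 * B * (2 * e) by rewrite ler_wpM2r// mulr_ge0.
have a3 := sqr_ge0 (D - 2 * f); rewrite expr2 in a3; lra.
Qed.

Lemma product_sqr_le (B a1 a2 f1 f2 e1 e2 : R) :
  `|a1| <= B -> `|a2| <= B -> `|f1 + e1| <= 2 * B -> `|f2 + e2| <= 2 * B ->
  (a1 * e2 + a2 * e1 + (f1 + e1) * (f2 + e2)) ^+ 2 <=
  36 * B ^+ 2 * (e1 ^+ 2 + e2 ^+ 2) + 8 * (f1 ^+ 4 + f2 ^+ 4).
Proof.
move=> h1 h2 h3 h4; have := pow4_le h3; have := pow4_le h4.
set D1 := f1 + e1; set D2 := f2 + e2 => p2 p1.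
have q : 2 * (D1 * D2) ^+ 2 <= D1 ^+ 4 + D2 ^+ 4.
  have -> : D1 ^+ 4 = D1 ^+ 2 * D1 ^+ 2 by rewrite -exprD.
  have -> : D2 ^+ 4 = D2 ^+ 2 * D2 ^+ 2 by rewrite -exprD.
  rewrite exprMn; have := sqr_ge0 (D1 ^+ 2 - D2 ^+ 2); rewrite [X in 0 <= X -> _]expr2.
  move: (D1 ^+ 2) (D2 ^+ 2) => x y; lra.
have sq (a e : R) : `|a| <= B -> (a * e) ^+ 2 <= B ^+ 2 * e ^+ 2.
  move=> aB; rewrite exprMn ler_wpM2r ?sqr_ge0//.
  by rewrite -(real_normK (num_real a)) lerXn2r// nnegrE// (le_trans _ aB).
have r1 := sq a1 e2 h1; have r2 := sq a2 e1 h2.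
apply: le_trans (sqrD_le _ _) _.
have := sqrD_le (a1 * e2) (a2 * e1).
have E1 : 0 <= B ^+ 2 * e1 ^+ 2 by rewrite mulr_ge0 ?sqr_ge0.
have E2 : 0 <= B ^+ 2 * e2 ^+ 2 by rewrite mulr_ge0 ?sqr_ge0.
have F1 : 0 <= f1 ^+ 4 by rewrite (_ : 4 = 2 * 2)%N// exprM sqr_ge0.
have F2 : 0 <= f2 ^+ 4 by rewrite (_ : 4 = 2 * 2)%N// exprM sqr_ge0.
have -> : 36 * B ^+ 2 * (e1 ^+ 2 + e2 ^+ 2) + 8 * (f1 ^+ 4 + f2 ^+ 4) =
  36 * (B ^+ 2 * e1 ^+ 2) + 36 * (B ^+ 2 * e2 ^+ 2) + 8 * f1 ^+ 4 + 8 * f2 ^+ 4 by ring.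
move: r1 r2 q p1 p2 E1 E2 F1 F2; rewrite -!(mulrA 16).
move: (B ^+ 2 * e1 ^+ 2) (B ^+ 2 * e2 ^+ 2) (f1 ^+ 4) (f2 ^+ 4) ((D1 * D2) ^+ 2)
  (D1 ^+ 4) (D2 ^+ 4) ((a1 * e2 + a2 * e1) ^+ 2) ((a1 * e2) ^+ 2) ((a2 * e1) ^+ 2).
by move=> *; lra.
Qed.

Lemma product_rest_le (k z f1 f2 e1 e2 : R) : 0 < k -> k <= 1 -> `|z| <= 1 ->
  `|z * (f1 * e2 + e1 * f2 + e1 * e2)| <=
  k * (f1 ^+ 2 + f2 ^+ 2) + 2 * k^-1 * (e1 ^+ 2 + e2 ^+ 2).
Proof.
move=> k0 k1 z1; rewrite normrM.
apply: (@le_trans _ _ `|f1 * e2 + e1 * f2 + e1 * e2|).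
  by rewrite -[leRHS]mul1r ler_wpM2r.
have y1 := young f1 e2 k0; have y2 := young f2 e1 k0; have y3 := young e1 e2 (@ltr01 R).
apply: le_trans (ler_normD _ _) _.
apply: le_trans (lerD (ler_normD _ _) (lexx _)) _.
have ki : 1 <= k^-1 by rewrite invf_ge1.
rewrite (mulrC e1 f2); apply: le_trans (lerD (lerD y1 y2) y3) _.
rewrite invr1 !mul1r.
have a1 : e1 ^+ 2 <= k^-1 * e1 ^+ 2 by rewrite ler_peMl ?sqr_ge0.
have a2 : e2 ^+ 2 <= k^-1 * e2 ^+ 2 by rewrite ler_peMl ?sqr_ge0.
rewrite -!mulrA !mulrDr.
move: a1 a2; move: (k^-1 * e1 ^+ 2) (k^-1 * e2 ^+ 2) (k * f1 ^+ 2) (k * f2 ^+ 2) (e1 ^+ 2) (e2 ^+ 2).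
by move=> *; lra.
Qed.

Variables (a1 a2 f1 f2 e1 e2 : Omega -> R) (B A h : R).
Hypotheses (ma1 : measurable_fun setT a1) (ma2 : measurable_fun setT a2).
Hypotheses (ba1 : forall w, `|a1 w| <= B) (ba2 : forall w, `|a2 w| <= B).
Hypotheses (bD1 : forall w, `|f1 w + e1 w| <= 2 * B) (bD2 : forall w, `|f2 w + e2 w| <= 2 * B).
Hypotheses (Lf1 : L2 f1) (Lf2 : L2 f2) (Le1 : L2 e1) (Le2 : L2 e2).
Hypotheses (Lff1 : L2 (fun w => f1 w ^+ 2)) (Lff2 : L2 (fun w => f2 w ^+ 2)).
Hypotheses (f14 : Ex (fun w => f1 w ^+ 4) <= A * h ^+ 2)
  (f24 : Ex (fun w => f2 w ^+ 4) <= A * h ^+ 2).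
Hypotheses (f12 : Ex (fun w => f1 w ^+ 2) <= A * h)
  (f22 : Ex (fun w => f2 w ^+ 2) <= A * h).
Hypotheses (e12 : Ex (fun w => e1 w ^+ 2) <= A * h ^+ 2)
  (e22 : Ex (fun w => e2 w ^+ 2) <= A * h ^+ 2).

(** For factors that start at [a1], [a2] and have increments [f1 + e1], [f2 + e2], the increment of
    the product is [a1 f2 + a2 f1 + eta]: the first two terms are the martingale part and [eta] the
    new error. *)
Let eta w := a1 w * e2 w + a2 w * e1 w + (f1 w + e1 w) * (f2 w + e2 w).

Let L4 f : L2 (fun w => f w ^+ 2) -> L1 (fun w => f w ^+ 4).
Proof. by move=> /L2_L1sqr; under eq_fun do rewrite -exprM. Qed.

Let L2eta : L2 eta.
Proof.
apply: L2D; first by apply: L2D; [exact: L2M_bnd ba1 Le2|exact: L2M_bnd ba2 Le1].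
apply: L2M_bnd bD1 _; last exact: L2D.
by apply: measurable_funD; [exact: L2_meas Lf1|exact: L2_meas Le1].
Qed.

Lemma product_sqr : L2 eta /\ Ex (fun w => eta w ^+ 2) <= (72 * B ^+ 2 * A + 16 * A) * h ^+ 2.
Proof.
split; first exact: L2eta.
have Le := L1D (L2_L1sqr Le1) (L2_L1sqr Le2); have Lf := L1D (L4 Lff1) (L4 Lff2).
have L := L1D (L1Z (36 * B ^+ 2) Le) (L1Z 8 Lf).
apply: (@le_trans _ _ (Ex (fun w => 36 * B ^+ 2 * (e1 w ^+ 2 + e2 w ^+ 2) +
    8 * (f1 w ^+ 4 + f2 w ^+ 4)))).
  by apply: Ex_le => //; [exact: L2_L1sqr L2eta|move=> w; exact: product_sqr_le].
rewrite (ExD (L1Z _ Le) (L1Z _ Lf)) (ExZ _ Le) (ExZ _ Lf).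
rewrite (ExD (L2_L1sqr Le1) (L2_L1sqr Le2)) (ExD (L4 Lff1) (L4 Lff2)).
have -> : (72 * B ^+ 2 * A + 16 * A) * h ^+ 2 =
  36 * B ^+ 2 * (A * h ^+ 2 + A * h ^+ 2) + 8 * (A * h ^+ 2 + A * h ^+ 2) by ring.
apply: lerD; last by rewrite ler_wpM2l// lerD.
by apply: ler_wpM2l; [rewrite mulr_ge0 ?sqr_ge0|exact: lerD].
Qed.

(** To first order in the step, [f1 f2] is the only product of increments with a non-zero mean; it
    yields the covariation term of the product rule. *)
Lemma product_mean (Z : Omega -> R) k : measurable_fun setT Z ->
  (forall w, `|Z w| <= 1) -> 0 < k -> k <= 1 ->
  `|Ex (fun w => Z w * eta w) - (Ex (fun w => Z w * a1 w * e2 w) +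
     Ex (fun w => Z w * a2 w * e1 w) + Ex (fun w => Z w * f1 w * f2 w))| <=
  4 * A * (k * h + k^-1 * h ^+ 2).
Proof.
move=> mZ bZ k0 k1.
have LZ : L2 Z by exact: L2_bnd mZ bZ.
have i1 : L1 (fun w => Z w * a1 w * e2 w).
  apply: (L2_mul _ Le2); apply: (L2M_bnd mZ bZ); exact: L2_bnd ma1 ba1.
have i2 : L1 (fun w => Z w * a2 w * e1 w).
  apply: (L2_mul _ Le1); apply: (L2M_bnd mZ bZ); exact: L2_bnd ma2 ba2.
have i3 : L1 (fun w => Z w * f1 w * f2 w).
  by apply: (L2_mul _ Lf2); exact: (L2M_bnd mZ bZ).
have i0 : L1 (fun w => Z w * eta w) by exact: (L2_mul LZ L2eta).
rewrite -(ExD i1 i2) -(ExD (L1D i1 i2) i3) -(ExB i0 (L1D (L1D i1 i2) i3)).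
have E w : Z w * eta w - (Z w * a1 w * e2 w + Z w * a2 w * e1 w + Z w * f1 w * f2 w) =
   Z w * (f1 w * e2 w + e1 w * f2 w + e1 w * e2 w).
  by rewrite /eta; ring.
rewrite (Ex_eq P E).
have Lf := L1D (L2_L1sqr Lf1) (L2_L1sqr Lf2); have Le := L1D (L2_L1sqr Le1) (L2_L1sqr Le2).
have L := L1D (L1Z k Lf) (L1Z (2 * k^-1) Le).
apply: (@le_trans _ _ (Ex (fun w => k * (f1 w ^+ 2 + f2 w ^+ 2) +
    2 * k^-1 * (e1 w ^+ 2 + e2 w ^+ 2)))).
  apply: Ex_norm_le => //; last by move=> w; exact: product_rest_le.
  have := L1B i0 (L1D (L1D i1 i2) i3).
  by congr (P.-integrable _ (_ \o _)); apply/funext => w; rewrite E.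
rewrite (ExD (L1Z _ Lf) (L1Z _ Le)) (ExZ _ Le) (ExZ _ Lf).
rewrite (ExD (L2_L1sqr Lf1) (L2_L1sqr Lf2)) (ExD (L2_L1sqr Le1) (L2_L1sqr Le2)).
have A0 : 0 <= A * h by apply: le_trans f12; apply: Ex_ge0 => w; exact: sqr_ge0.
apply: (@le_trans _ _ (k * (A * h + A * h) + 2 * k^-1 * (A * h ^+ 2 + A * h ^+ 2))).
  apply: lerD; (apply: ler_wpM2l; last exact: lerD); first exact: ltW.
  by rewrite mulr_ge0// invr_ge0 ltW.
rewrite -subr_ge0.
have -> : 4 * A * (k * h + k^-1 * h ^+ 2) -
  (k * (A * h + A * h) + 2 * k^-1 * (A * h ^+ 2 + A * h ^+ 2)) = 2 * k * (A * h) by ring.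
by apply: mulr_ge0 => //; rewrite mulr_ge0// ltW.
Qed.

End ProductExpansion.

Section SkewForm.
Context {R : realType} {N : nat}.
Notation M := 'M[R[i]]_N.

(** The covariance per unit of time, up to the factor [gauss2], of the martingales with integrands
    [X] and [Y]. *)
Definition qq (X Y : M) : R := ui (skp X) (skp Y).

Lemma qqE (X Y : M) : qq X Y = \sum_(e : cidx N) \sum_(e' : cidx N)
  gcoef e X * gcoef e' Y * ui (cbasis e) (cbasis e' : M).
Proof. exact: ui_skp2. Qed.

Lemma qq_bound (B : R) : exists C, forall X Y : M,
  (forall e, `|coord e X| <= B) -> (forall e, `|coord e Y| <= B) -> `|qq X Y| <= C.
Proof.
exists (\sum_(e : cidx N) \sum_(e' : cidx N)
  N%:R * B * (N%:R * B) * `|ui (cbasis e) (cbasis e' : M)|) => X Y hX hY.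
have g (Z : M) e : (forall e, `|coord e Z| <= B) -> `|gcoef e Z| <= N%:R * B.
  by move=> hZ; apply: (@gcoef_bnd _ _ _ _ (fun _ : unit => Z) B e tt).
rewrite qqE; apply: le_trans (ler_norm_sum _ _ _) _; apply: ler_sum => e _.
apply: le_trans (ler_norm_sum _ _ _) _; apply: ler_sum => e' _.
by rewrite !normrM ler_wpM2r// ler_pM// g.
Qed.

End SkewForm.

(** * First order expansions form an algebra that contains the entries *)

Section Expansion.
Context {d : measure_display} {Omega : measurableType d} {R : realType}.
Variables (P : probability Omega R) (N : nat).
Notation M := 'M[R[i]]_N.
Variables (F : R -> set (set Omega)) (K : R -> Omega -> M).
Hypothesis filF : filtration F.
Hypothesis bmK : u_brownian_motion P F K.
Variable U : R -> Omega -> unitary R N.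
Hypothesis aX : adapted F (fun s w => unitary_val (U s w)).
Variable T : R.
Notation L1 := (L1 P).
Notation L2 := (L2 P).
Notation Ex := (Ex P).
Notation form := (form K).
Notation adm := (adm F).
Notation uT := (unitary R N).
Implicit Types (f l : uT -> R) (G : uT -> M).

Definition mbf f := measurable_fun setT f /\ exists C, forall u, `|f u| <= C.
Definition mbG G := forall e, mbf (fun u => coord e (G u)).

Lemma mbf_cst (c : R) : mbf (fun=> c).
Proof. by split; [exact: measurable_cst|exists `|c|]. Qed.

Lemma mbfD f f' : mbf f -> mbf f' -> mbf (fun u => f u + f' u).
Proof.
move=> [m [C h]] [m' [C' h']]; split; first exact: measurable_funD.
by exists (C + C') => u; rewrite (le_trans (ler_normD _ _))// lerD.
Qed.

Lemma mbfM f f' : mbf f -> mbf f' -> mbf (fun u => f u * f' u).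
Proof.
move=> [m [C h]] [m' [C' h']]; split; first exact: measurable_funM.
by exists (C * C') => u; rewrite normrM ler_pM.
Qed.

Lemma mbf_sum (I : Type) (s : seq I) (f : I -> uT -> R) :
  (forall i, mbf (f i)) -> mbf (fun u => \sum_(i <- s) f i u).
Proof.
move=> h; elim: s => [|i s IH].
  by under eq_fun do rewrite big_nil; exact: mbf_cst.
by under eq_fun do rewrite big_cons; exact: mbfD.
Qed.

Lemma mbGD G G' : mbG G -> mbG G' -> mbG (fun u => G u + G' u).
Proof. by move=> h h' e; under eq_fun do rewrite coordD; exact: mbfD. Qed.

Lemma mbGZ f G : mbf f -> mbG G -> mbG (fun u => (f u)%:C *: G u).
Proof. by move=> h h' e; under eq_fun do rewrite coordZ; exact: mbfM. Qed.

Lemma mbG_bound G : mbG G -> exists C, 0 <= C /\ forall e u, `|coord e (G u)| <= C.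
Proof.
move=> h; have [C hC] := choice (fun e => (h e).2).
exists (\sum_e `|C e|); split; first by apply: sumr_ge0.
move=> e u; apply: le_trans (hC e u) _; apply: le_trans (ler_norm _) _.
by rewrite (bigD1 e)//= lerDl sumr_ge0.
Qed.

Lemma mbf_qq G G' : mbG G -> mbG G' -> mbf (fun u => qq (G u) (G' u)).
Proof.
move=> h h'; under eq_fun do rewrite qqE.
apply: mbf_sum => e; apply: mbf_sum => e'; apply: mbfM; last exact: mbf_cst.
by under eq_fun do rewrite !gcoef_coord; do 2! apply: mbfM => //; exact: mbf_cst.
Qed.

Lemma fm_U s f : 0 <= s -> mbf f -> fm (F s) (fun w => f (U s w)).
Proof.
move=> s0 [mf _]; apply/(fmP (fil_sigma filF s0)) => B mB.
have [B' mB' e] := mf measurableT B mB.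
have -> : (fun w => f (U s w)) @^-1` B = (fun w => unitary_val (U s w)) @^-1` B'.
  by rewrite -[f in LHS]/(f) comp_preimage -[f @^-1` B]setTI -e setTI.
exact: aX.
Qed.

Lemma meas_U s f : 0 <= s -> mbf f -> measurable_fun setT (fun w => f (U s w)).
Proof. by move=> s0 h; apply: (fm_meas filF s0); exact: fm_U. Qed.

Lemma adm_U s G : 0 <= s -> mbG G -> adm s (fun w => G (U s w)).
Proof.
move=> s0 h; split=> [e|]; first exact: (fm_U s0 (h e)).
by have [C [_ hC]] := mbG_bound h; exists C => e w.
Qed.

Definition incr_err f G s h w :=
  f (U (s + h) w) - f (U s w) - form (fun w => G (U s w)) s (s + h) w.

(** Ito's formula to first order: over a step [h] from [s], the function [f] has the martingale
    increment with integrand [G] frozen at time [s], and the drift [l]. The mean is tested against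
    every bounded variable [Z] known at [s], because the factors of a product become such weights in
    [exp1M]. *)
Definition exp1 f l G := [/\ mbf f, mbf l, mbG G & exists C, 0 <= C /\
  forall s h, 0 <= s -> 0 <= h -> h <= T ->
  Ex (fun w => incr_err f G s h w ^+ 2) <= C * h ^+ 2 /\
  forall Z k, fm (F s) Z -> (forall w, `|Z w| <= 1) -> 0 < k -> k <= 1 ->
  `|Ex (fun w => Z w * incr_err f G s h w) - h * Ex (fun w => Z w * l (U s w))|
     <= C * (k * h + k^-1 * h ^+ 2)].

Lemma L2_incr_err f G s h : 0 <= s -> 0 <= h -> mbf f -> mbG G -> L2 (incr_err f G s h).
Proof.
move=> s0 h0 mf mG; have sh : s <= s + h by rewrite lerDl.
have [_ [C fC]] := mf.
apply: L2B; last by apply: (L2_form filF bmK) => //; exact: adm_U.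
apply: (@L2_bnd _ _ _ P _ (C + C)).
  by apply: measurable_funB; apply: meas_U => //; exact: le_trans sh.
by move=> w; apply: le_trans (ler_normB _ _) _; exact: lerD.
Qed.

Lemma exp1_cst c : exp1 (fun=> c) (fun=> 0) (fun=> 0).
Proof.
split; [exact: mbf_cst|exact: mbf_cst| |].
  by move=> e; under eq_fun do rewrite coord0; exact: mbf_cst.
exists 0; split => // s h s0 h0 hT.
have E w : incr_err (fun=> c) (fun=> 0) s h w = 0.
  by rewrite /incr_err !form_ui ui0l subrr subr0.
split.
  rewrite mul0r (Ex_eq P (g := fun=> 0)) ?Ex_cst// => w; by rewrite E expr0n.
move=> Z k _ _ _ _; rewrite mul0r.
rewrite (Ex_eq P (g := fun=> 0)); last by move=> w; rewrite E mulr0.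
rewrite [X in h * X](Ex_eq P (g := fun=> 0)); last by move=> w; rewrite mulr0.
by rewrite !Ex_cst mulr0 subr0 normr0.
Qed.

Lemma err_ge0 (h k : R) : 0 <= h -> 0 < k -> 0 <= k * h + k^-1 * h ^+ 2.
Proof. by move=> h0 k0; rewrite addr_ge0// mulr_ge0 ?invr_ge0 ?sqr_ge0// ltW. Qed.

Lemma form_bounds G : mbG G -> exists A, 0 <= A /\ forall s h, 0 <= s -> 0 <= h ->
  let f := form (fun w => G (U s w)) s (s + h) in
  [/\ L2 f, L2 (fun w => f w ^+ 2), Ex (fun w => f w ^+ 4) <= A * h ^+ 2 &
   Ex (fun w => f w ^+ 2) <= A * h].
Proof.
move=> mG; have [B [B0 hB]] := mbG_bound mG.
have [C hC] := form_pow4 filF bmK B; have [C' hC'] := @qq_bound R N B.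
have g20 : 0 <= @gauss2 R by apply: Rintegral_ge0 => x _; exact: sqr_ge0.
exists (`|C| + gauss2 * `|C'|); split; first by rewrite addr_ge0// mulr_ge0.
move=> s h s0 h0 f; have sh : s <= s + h by rewrite lerDl.
have aG := adm_U s0 mG.
have Lf : L2 f by exact: (L2_form filF bmK s0 sh aG).
have [L4 b4] := hC (fun w => G (U s w)) s (s + h) s0 sh aG (fun e w => hB e (U s w)).
rewrite addrAC subrr add0r in b4.
split => //.
  apply: le_trans b4 _; rewrite ler_wpM2r ?sqr_ge0//.
  by rewrite (le_trans (ler_norm C))// lerDl mulr_ge0.
have E w : f w ^+ 2 = 1 * f w * f w by rewrite mul1r.
rewrite (Ex_eq P E) (Ex_form_mul2 filF bmK (C := 1) s0 sh aG aG); last 2 first.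
- exact: (fm_U s0 (mbf_cst 1)).
- by move=> w; rewrite normr1.
rewrite addrAC subrr add0r.
have mq := mbf_qq mG mG; have [_ [D hD]] := mq.
have m := meas_U s0 mq.
rewrite mulrDl ler_wpDl ?mulr_ge0//.
apply: (@le_trans _ _ (gauss2 * Ex (fun w => 1 * qq (G (U s w)) (G (U s w))) * h)).
  by rewrite le_eqVlt; apply/orP; left; apply/eqP; rewrite /qq; ring.
apply: ler_wpM2r => //; apply: ler_wpM2l => //.
rewrite -[leRHS](Ex_cst P); apply: Ex_le; [|exact: L1_cst|].
  apply: (@L1_bnd _ _ _ P _ D); first by apply: measurable_funM.
  by move=> w; rewrite mul1r; exact: hD.
move=> w; rewrite mul1r; apply: le_trans (ler_norm _) (le_trans _ (ler_norm _)).
exact: hC'.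
Qed.

Lemma scaled_mean (l : uT -> R) (eps Z : Omega -> R) (s h D B : R) : 0 <= s -> mbf l -> L2 eps ->
  fm (F s) Z -> 0 < B -> (forall w, `|Z w| <= B) ->
  (forall Z, fm (F s) Z -> (forall w, `|Z w| <= 1) ->
    `|Ex (fun w => Z w * eps w) - h * Ex (fun w => Z w * l (U s w))| <= D) ->
  `|Ex (fun w => Z w * eps w) - h * Ex (fun w => Z w * l (U s w))| <= B * D.
Proof.
move=> s0 ml Le mZ B0 bZ H; have mZ' := fm_meas filF s0 mZ.
have LZ : L2 Z by exact: L2_bnd mZ' bZ.
have Ll : L2 (fun w => l (U s w)).
  by have [_ [C1 hC1]] := ml; apply: (L2_bnd P (meas_U s0 ml)) => w; exact: hC1.
have mBZ : fm (F s) (fun w => B^-1 * Z w).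
  by apply: measurable_funM => //; exact: measurable_cst.
have bBZ w : `|B^-1 * Z w| <= 1.
  by rewrite normrM gtr0_norm ?invr_gt0// ler_pdivrMl// mulr1.
have := H _ mBZ bBZ.
rewrite (Ex_eq P (fun w => esym (mulrA B^-1 (Z w) (eps w)))).
rewrite [X in h * X](Ex_eq P (fun w => esym (mulrA B^-1 (Z w) (l (U s w))))).
rewrite (ExZ _ (L2_mul LZ Le)) (ExZ _ (L2_mul LZ Ll)) mulrCA -mulrBr normrM.
by rewrite gtr0_norm ?invr_gt0// ler_pdivrMl.
Qed.

Lemma split4 (x a b c a' b' c' h e1 e2 e3 : R) : c = h * c' ->
  `|x - (a + b + c)| <= e1 -> `|a - h * a'| <= e2 -> `|b - h * b'| <= e3 ->
  `|x - h * (a' + b' + c')| <= e1 + (e2 + e3).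
Proof.
move=> -> h1 h2 h3.
have -> : x - h * (a' + b' + c') = (x - (a + b + h * c')) + ((a - h * a') + (b - h * b')) by ring.
apply: le_trans (ler_normD _ _) _; apply: lerD => //.
by apply: le_trans (ler_normD _ _) _; apply: lerD.
Qed.

(** The covariation term is [Ex_form_mul2] for the two frozen martingale increments. In the other
    terms each factor at time [s] plays the part of the weight [Z] in the expansion of the other. *)
Lemma exp1M f1 l1 G1 f2 l2 G2 : exp1 f1 l1 G1 -> exp1 f2 l2 G2 ->
  exp1 (fun u => f1 u * f2 u)
    (fun u => f1 u * l2 u + f2 u * l1 u + gauss2 * qq (G1 u) (G2 u))
    (fun u => (f1 u)%:C *: G2 u + (f2 u)%:C *: G1 u).
Proof.
move=> [mf1 ml1 mG1 [C1 [C10 hC1]]] [mf2 ml2 mG2 [C2 [C20 hC2]]].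
have mqq := mbf_qq mG1 mG2.
have mgq : mbf (fun u => gauss2 * qq (G1 u) (G2 u)) by apply: mbfM => //; exact: mbf_cst.
split; [exact: mbfM| | |].
- by apply: mbfD => //; apply: mbfD; exact: mbfM.
- by apply: mbGD; exact: mbGZ.
have [B [B1 [hB1 hB2]]] : exists B, 1 <= B /\ (forall u, `|f1 u| <= B) /\ (forall u, `|f2 u| <= B).
  have [_ [b1 h1]] := mf1; have [_ [b2 h2]] := mf2; exists (1 + `|b1| + `|b2|).
  split; first by rewrite -addrA lerDl addr_ge0.
  split=> u; first by rewrite (le_trans (h1 u))// (le_trans (ler_norm _))// addrAC lerDr addr_ge0.
  by rewrite (le_trans (h2 u))// (le_trans (ler_norm _))// lerDr addr_ge0.
have B0 : 0 < B by apply: lt_le_trans B1.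
have [A1 [A10 hA1]] := form_bounds mG1; have [A2 [A20 hA2]] := form_bounds mG2.
pose A := A1 + A2 + C1 + C2.
have [C1A C2A A1A A2A] : [/\ C1 <= A, C2 <= A, A1 <= A & A2 <= A].
  by rewrite /A; split; lra.
have A0 : 0 <= A by apply: le_trans C1A.
exists ((72 * B ^+ 2 * A + 16 * A) + (4 * A + (B * C2 + B * C1))); split.
  by rewrite !addr_ge0 ?mulr_ge0 ?sqr_ge0 ?(ltW B0).
move=> s h s0 h0 hT; have sh : s <= s + h by rewrite lerDl.
have [b1 c1] := hC1 s h s0 h0 hT; have [b2 c2] := hC2 s h s0 h0 hT.
have Le1 := L2_incr_err s0 h0 mf1 mG1; have Le2 := L2_incr_err s0 h0 mf2 mG2.
have [Lp1 Lq1 p14 p12] := hA1 s h s0 h0; have [Lp2 Lq2 p24 p22] := hA2 s h s0 h0.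
have ma1 := meas_U s0 mf1; have ma2 := meas_U s0 mf2.
pose a1 w := f1 (U s w); pose a2 w := f2 (U s w).
pose phi1 := form (fun w => G1 (U s w)) s (s + h); pose phi2 := form (fun w => G2 (U s w)) s (s + h).
pose e1 := incr_err f1 G1 s h; pose e2 := incr_err f2 G2 s h.
have E w : incr_err (fun u => f1 u * f2 u) (fun u => (f1 u)%:C *: G2 u + (f2 u)%:C *: G1 u) s h w =
    a1 w * e2 w + a2 w * e1 w + (phi1 w + e1 w) * (phi2 w + e2 w).
  rewrite /e1 /e2 /phi1 /phi2 /a1 /a2 /incr_err !form_ui uiDl !uiZl.
  by move: (ui _ _) (ui _ _) => x y; ring.
have d1 w : `|phi1 w + e1 w| <= 2 * B.
  rewrite /e1 /incr_err addrC subrK (_ : 2 * B = B + B); last by ring.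
  by apply: le_trans (ler_normB _ _) _; apply: lerD.
have d2 w : `|phi2 w + e2 w| <= 2 * B.
  rewrite /e2 /incr_err addrC subrK (_ : 2 * B = B + B); last by ring.
  by apply: le_trans (ler_normB _ _) _; apply: lerD.
have up (c D x : R) : c <= A -> 0 <= x -> D <= c * x -> D <= A * x.
  by move=> cA x0 /le_trans; apply; rewrite ler_wpM2r.
have h20 : 0 <= h ^+ 2 by exact: sqr_ge0.
have ba1 w : `|a1 w| <= B by exact: hB1.
have ba2 w : `|a2 w| <= B by exact: hB2.
have p14' := up _ _ _ A1A h20 p14; have p24' := up _ _ _ A2A h20 p24.
have p12' := up _ _ _ A1A h0 p12; have p22' := up _ _ _ A2A h0 p22.
have b1' := up _ _ _ C1A h20 b1; have b2' := up _ _ _ C2A h20 b2.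
have [Le sq] := product_sqr ma1 ma2 ba1 ba2 d1 d2 Lp1 Lp2 Le1 Le2 Lq1 Lq2 p14' p24' b1' b2'.
split.
  rewrite (Ex_eq P (fun w => congr1 (fun x => x ^+ 2) (E w))).
  apply: le_trans sq _; rewrite ler_wpM2r// lerDl.
  by rewrite !addr_ge0 ?mulr_ge0 ?(ltW B0).
move=> Z k mZ bZ k0 k1; have mZ' := fm_meas filF s0 mZ.
have LZ : L2 Z by exact: L2_bnd mZ' bZ.
have mean := product_mean ma1 ma2 ba1 ba2 d1 Lp1 Lp2 Le1 Le2 p12' p22' b1' b2' mZ' bZ k0 k1.
have bZa1 w : `|Z w * a1 w| <= B by rewrite normrM -[B]mul1r ler_pM.
have bZa2 w : `|Z w * a2 w| <= B by rewrite normrM -[B]mul1r ler_pM.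
have mZa1 : fm (F s) (fun w => Z w * a1 w) by apply: measurable_funM => //; exact: fm_U.
have mZa2 : fm (F s) (fun w => Z w * a2 w) by apply: measurable_funM => //; exact: fm_U.
have t1 := scaled_mean s0 ml2 Le2 mZa1 B0 bZa1 (fun Z mZ bZ => c2 Z k mZ bZ k0 k1).
have t2 := scaled_mean s0 ml1 Le1 mZa2 B0 bZa2 (fun Z mZ bZ => c1 Z k mZ bZ k0 k1).
rewrite (Ex_eq P (fun w => congr1 (fun x => Z w * x) (E w))).
have Ll f0 : mbf f0 -> L2 (fun w => f0 (U s w)).
  by move=> m0; have [_ [C hC]] := m0; apply: (L2_bnd P (meas_U s0 m0)) => w; exact: hC.
have i1 : L1 (fun w => Z w * a1 w * l2 (U s w)).
  by apply: L2_mul (Ll _ ml2); exact: (L2M_bnd mZ' bZ (Ll _ mf1)).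
have i2 : L1 (fun w => Z w * a2 w * l1 (U s w)).
  by apply: L2_mul (Ll _ ml1); exact: (L2M_bnd mZ' bZ (Ll _ mf2)).
have i3 : L1 (fun w => Z w * qq (G1 (U s w)) (G2 (U s w))) := L2_mul LZ (Ll _ mqq).
have EL w : Z w * (f1 (U s w) * l2 (U s w) + f2 (U s w) * l1 (U s w) +
     gauss2 * qq (G1 (U s w)) (G2 (U s w))) =
   Z w * a1 w * l2 (U s w) + Z w * a2 w * l1 (U s w) +
     gauss2 * (Z w * qq (G1 (U s w)) (G2 (U s w))).
  by rewrite /a1 /a2; ring.
rewrite [X in h * X](Ex_eq P EL) (ExD (L1D i1 i2) (L1Z _ i3)) (ExD i1 i2) (ExZ _ i3).
have ephi : Ex (fun w => Z w * phi1 w * phi2 w) =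
   h * (gauss2 * Ex (fun w => Z w * qq (G1 (U s w)) (G2 (U s w)))).
  rewrite /phi1 /phi2 (Ex_form_mul2 filF bmK (C := 1) s0 sh (adm_U s0 mG1) (adm_U s0 mG2) mZ bZ).
  by rewrite addrAC subrr add0r mulrA.
apply: le_trans (split4 ephi mean t1 t2) _.
have e0 := err_ge0 h0 k0.
set x := k * h + k^-1 * h ^+ 2 in e0 *.
apply: (@le_trans _ _ ((4 * A + (B * C2 + B * C1)) * x)).
  by rewrite le_eqVlt; apply/orP; left; apply/eqP; ring.
apply: ler_wpM2r => //; rewrite lerDr; apply: addr_ge0; last exact: mulr_ge0.
by apply: mulr_ge0 => //; apply: mulr_ge0 => //; exact: sqr_ge0.
Qed.

Hypothesis cX : continuous_paths (fun s w => unitary_val (U s w)).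
Hypothesis sde : forall s : R, 0 <= s -> exists I,
  ito_integral P F K (fun s w => unitary_val (U s w)) s I /\
  {ae P, forall w, unitary_val (U s w) = 1%:M + I w -
     (2^-1)%:C *: time_integral (fun s w => unitary_val (U s w)) s w}.

Lemma mbf_coord (e : cidx N) : mbf (fun u => coord e (unitary_val u)).
Proof.
split; first exact: measurable_coord_unitary.
by exists 1 => u; apply: coord_unitary_le; exact: (valP u).
Qed.

Lemma coord_sqr_num (x z C1 C2 C3 h : R) : 0 <= C3 -> 0 <= h ->
  x <= C1 * (C2 * h) -> z <= h ->
  2 * x + 2 * z <= (2 * (C1 * C2) + 2 + (2^-1 * C3 + 2^-1)) * h.
Proof.
move=> c0 h0 hx hz; have h1 : 0 <= C3 * h by rewrite mulr_ge0.
have -> : (2 * (C1 * C2) + 2 + (2^-1 * C3 + 2^-1)) * h =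
  2 * (C1 * (C2 * h)) + 2 * h + 2^-1 * (C3 * h) + 2^-1 * h by ring.
by move: (C1 * (C2 * h)) (C3 * h) hx h1 => y1 y2 *; lra.
Qed.

Lemma coord_mean_num (a b q C1 C2 C3 : R) : 0 <= C1 -> 0 <= C2 -> 0 <= C3 ->
  0 <= a -> 0 <= b -> q <= C3 * b ->
  2^-1 * a + 2^-1 * q <= (2 * (C1 * C2) + 2 + (2^-1 * C3 + 2^-1)) * (a + b).
Proof.
move=> c1 c2 c3 a0 b0 hq; have h1 : 0 <= C1 * C2 * (a + b) by rewrite !mulr_ge0 ?addr_ge0.
have h2 : 0 <= C3 * a by rewrite mulr_ge0.
have -> : (2 * (C1 * C2) + 2 + (2^-1 * C3 + 2^-1)) * (a + b) =
  2 * (C1 * C2 * (a + b)) + 2 * (a + b) + 2^-1 * (C3 * a) + 2^-1 * (C3 * b) +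
  2^-1 * (a + b) by ring.
by move: (C1 * C2 * (a + b)) (C3 * a) (C3 * b) h1 h2 hq => y1 y2 y3 *; lra.
Qed.

(** The noise is [incr] frozen at the current value. The drift is a time integral over the step,
    replaced by its left value through [pin_dev], with [incr_sqr] bounding the oscillation. *)
Lemma exp1_coord e : exp1 (fun u => coord e (unitary_val u))
  (fun u => - 2^-1 * coord e (unitary_val u)) (fun u => gbasis e *m unitary_val u).
Proof.
have mG : mbG (fun u => gbasis e *m unitary_val u).
  move=> e'; under eq_fun do rewrite coord_mulmx.
  by apply: mbf_sum => j; apply: mbfD; do ?(apply: mbfM; first exact: mbf_cst); exact: mbf_coord.
split => //; first exact: mbf_coord.
  by apply: mbfM; [exact: mbf_cst|exact: mbf_coord].
have [C1 [C10 h1]] := incr_bound filF bmK cX aX sde e.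
have [C2 [C20 h2]] := incr_sqr_norm filF bmK cX aX sde T.
have [C3 [C30 h3]] := incr_sqr filF bmK cX aX sde T e.
exists (2 * (C1 * C2) + 2 + (2^-1 * C3 + 2^-1)); split.
  by rewrite !addr_ge0 ?mulr_ge0 ?invr_ge0.
move=> s h s0 h0 hT; have sh : s <= s + h by rewrite lerDl.
have r0 := le_trans s0 sh.
have rT : s + h <= s + T by rewrite lerD2l.
have hh : s + h - s = h by rewrite addrAC subrr add0r.
have aZ := adm_X filF aX s0.
have [] := h1 s (s + h) _ (C2 * h ^+ 2) s0 sh aZ.
  by have := h2 s (s + h) s0 sh rT; rewrite hh.
set D := incr _ _ _ _ _ _ => LD hD zD.
pose y := yX U e; pose pp w := pin s (s + h) (fun x => y (w, x)).
have my w : measurable_fun setT (fun x : measurableTypeR R => y (w, x)).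
  exact: (measurable_yX_path filF cX aX).
have yb w x : `|y (w, x)| <= 1 by exact: yX_le.
have mpp : measurable_fun setT pp.
  exact: measurable_pin sh (measurable_yX filF cX aX e) (yX_le U e).
have bpp w : `|pp w| <= h by have := pin_bound sh (my w) (yb w); rewrite hh mul1r.
have Lpp : L2 (fun w => - 2^-1 * pp w) by apply: L2Z; exact: L2_bnd mpp bpp.
have E w : incr_err (fun u => coord e (unitary_val u)) (fun u => gbasis e *m unitary_val u) s h w =
    D w + - 2^-1 * pp w.
  rewrite /D /incr /incr_err -/y -/(pp w) -/(form _ _ _ _).
  by move: (coord _ _) (coord _ _) (form _ _ _ _) (pp w) => *; ring.
split.
  rewrite (Ex_eq P (fun w => congr1 (fun x => x ^+ 2) (E w))).
  apply: le_trans (Ex_sqrD_le LD Lpp) _.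
  have : Ex (fun w => (- 2^-1 * pp w) ^+ 2) <= h ^+ 2.
    rewrite -[leRHS](Ex_cst P); apply: Ex_le; [exact: L2_L1sqr|exact: L1_cst|].
    move=> w; rewrite -real_normK ?num_real// lerXn2r ?nnegrE//.
    rewrite normrM normrN [X in X * _]ger0_norm ?invr_ge0//; have := bpp w.
    by have := normr_ge0 (pp w); lra.
  by move=> hz; apply: coord_sqr_num => //; exact: sqr_ge0.
move=> Z k mZ bZ k0 k1; have mZ' := fm_meas filF s0 mZ.
have LZ : L2 Z by exact: L2_bnd mZ' bZ.
rewrite (Ex_eq P (fun w => congr1 (fun x => Z w * x) (E w))).
rewrite (Ex_eq P (fun w => mulrDr (Z w) _ _)) (ExD (L2_mul LZ LD) (L2_mul LZ Lpp)).
rewrite (zD Z 1 mZ bZ) add0r.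
pose c0 w := coord e (unitary_val (U s w)).
have Lc : L2 (fun w => - 2^-1 * c0 w).
  by apply: L2Z; apply: (@L2_bnd _ _ _ P _ 1); [exact: (meas_U s0 (mbf_coord e))|
    move=> w; apply: coord_unitary_le; exact: (valP (U s w))].
rewrite -(ExZ _ (L2_mul LZ Lc)) -(ExB (L2_mul LZ Lpp) (L1Z _ (L2_mul LZ Lc))).
pose g (z : Omega * measurableTypeR R) := (y z - c0 z.1) ^+ 2.
have mg : measurable_fun setT g.
  apply: measurable_funX; apply: measurable_funB; first exact: (measurable_yX filF cX aX e).
  exact: (measurableT_comp (meas_U s0 (mbf_coord e)) measurable_fst).
have bg z : 0 <= g z <= 4.
  rewrite sqr_ge0 /=; have -> : (4 : R) = 2 ^+ 2 by ring.
  rewrite /g -(real_normK (num_real (y z - c0 z.1))) lerXn2r ?nnegrE//.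
  rewrite (_ : 2 = 1 + 1)//; apply: le_trans (ler_normB _ _) _; apply: lerD.
    exact: yX_le.
  by apply: coord_unitary_le; exact: (valP (U s z.1)).
have bg' z : `|g z| <= 4 by case/andP: (bg z) => h4 h5; rewrite ger0_norm.
pose Q w := pin s (s + h) (fun x => g (w, x)).
have LQ : L1 Q.
  apply: (@L1_bnd _ _ _ P _ (4 * h)); first exact: measurable_pin bg'.
  move=> w; rewrite -[X in 4 * X]hh; apply: pin_bound => //.
  by have /measurable_EFinP := measurable_slice (D:=setT) w mg.
have hQ : Ex Q <= C3 * h * h.
  rewrite -[X in _ * X]hh; apply: (Ex_pin_le sh mg bg); first exact: mulr_ge0.
  move=> x /andP[sx xr]; have x0 := le_trans s0 sx.
  apply: (@le_trans _ _ (C3 * (x - s))).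
    have := h3 s x s0 sx (le_trans xr rT).
    by rewrite /g /y /yX /c0 /= /Xp max_r.
  by apply: ler_wpM2l => //; rewrite lerBlDl.
have L := L1D (L1_cst P (2^-1 * (k * h))) (L1Z (2^-1 * k^-1) LQ).
apply: (@le_trans _ _ (Ex (fun w => 2^-1 * (k * h) + 2^-1 * k^-1 * Q w))).
  apply: Ex_norm_le => //.
    exact: L1B (L2_mul LZ Lpp) (L1Z _ (L2_mul LZ Lc)).
  move=> w; have := pin_dev (c0 w) k0 sh (my w) (yb w).
  rewrite hh -/(pp w) -/(Q w) => dev.
  have -> : Z w * (- 2^-1 * pp w) - h * (Z w * (- 2^-1 * c0 w)) =
    Z w * (- 2^-1 * (pp w - h * c0 w)) by ring.
  rewrite normrM; apply: (@le_trans _ _ `|- 2^-1 * (pp w - h * c0 w)|).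
    by rewrite -[leRHS]mul1r ler_wpM2r.
  rewrite normrM normrN [X in X * _]ger0_norm ?invr_ge0// -(mulrA 2^-1 k^-1) -mulrDr.
  by rewrite ler_wpM2l ?invr_ge0.
rewrite (ExD (L1_cst P _) (L1Z _ LQ)) Ex_cst (ExZ _ LQ).
have ki : 0 <= k^-1 by rewrite invr_ge0 ltW.
have hQ' : k^-1 * Ex Q <= C3 * (k^-1 * h ^+ 2).
  apply: (@le_trans _ _ (k^-1 * (C3 * h * h))); first exact: ler_wpM2l.
  by rewrite le_eqVlt; apply/orP; left; apply/eqP; ring.
have z1 : 0 <= k * h by rewrite mulr_ge0// ltW.
have z2 : 0 <= k^-1 * h ^+ 2 by apply: mulr_ge0 => //; exact: sqr_ge0.
rewrite -(mulrA 2^-1 k^-1); exact: coord_mean_num.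
Qed.

End Expansion.

(** * Independent motions *)

Section Independence.
Context {d : measure_display} {Omega : measurableType d} {R : realType}.
Variable P : probability Omega R.
Notation Ex := (Ex P).
Notation L1 := (L1 P).

(** The integer part of [x], capped at [J], as a sum of indicators of half-lines; rescaled, it
    approximates a bounded function uniformly. *)
Definition staircase (J : nat) (x : R) : R := \sum_(j < J) (j.+1%:R <= x)%R%:R.

Lemma staircase_le J x : 0 <= x -> x <= J%:R -> `|x - staircase J x| <= 1.
Proof.
move=> x0; elim: J => [|J IH] xJ.
  by rewrite /staircase big_ord0 subr0; have -> : x = 0; [by apply/le_anti/andP|by rewrite normr0].
rewrite /staircase big_ord_recr /=; case: (leP J.+1%:R x) => h.
  have e : x = J.+1%:R by apply/le_anti/andP.
  rewrite (eq_bigr (fun=> 1)); last first.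
    by move=> j _; rewrite e ler_nat ltnS ltnW.
  by rewrite sumr_const card_ord -natrD addn1 e subrr normr0.
rewrite addr0; have [xJ'|Jx] := leP x J%:R; first exact: IH.
rewrite (eq_bigr (fun=> 1)); last first.
  by move=> j _; rewrite (le_trans _ (ltW Jx))// ler_nat.
rewrite sumr_const card_ord ger0_norm ?subr_ge0 ?(ltW Jx)//.
by rewrite lerBlDl natr1 ltW.
Qed.

Variables (Y g : Omega -> R) (BY B : R).
Hypothesis mY : measurable_fun setT Y.
Hypothesis bY : forall w, `|Y w| <= BY.
Hypothesis mg : measurable_fun setT g.
Hypothesis bg : forall w, `|g w| <= B.
Hypothesis indep_ge : forall c : R,
  Ex (fun w => Y w * (c <= g w)%R%:R) = Ex Y * Ex (fun w => (c <= g w)%R%:R).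

Let LY : L1 Y. Proof. exact: L1_bnd mY bY. Qed.

Let mstep c : measurable_fun setT (fun w => (c <= g w)%R%:R : R).
Proof.
have -> : (fun w => (c <= g w)%R%:R : R) = \1_([set w | c <= g w]).
  apply/funext => w; rewrite indicE; congr ((nat_of_bool _)%:R).
  by apply/idP/idP => [h|/set_mem//]; apply/mem_set.
apply: measurable_indic; rewrite -[X in measurable X]setTI.
exact: measurable_fun_le.
Qed.

Let bstep c w : `|(c <= g w)%R%:R : R| <= 1.
Proof. by case: (c <= g w); rewrite ?normr1 ?normr0. Qed.

(** A bounded [g] is, uniformly within [e], a combination of indicators of [c <= g], for which the
    product formula is assumed. *)
Lemma Ex_mul_indep_step : Ex (fun w => Y w * g w) = Ex Y * Ex g.
Proof.
apply/eqP; rewrite -subr_eq0 -normr_eq0 eq_le normr_ge0 andbT.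
have BY0 : 0 <= BY by apply: le_trans (bY point); exact: normr_ge0.
apply: (@le_of_slack _ _ _ (2 * BY)) => e e0; rewrite add0r.
(* [(g + B) / e] takes its values in [[0, 2 B / e]], so [J] stairs suffice. *)
pose J := Num.bound (2 * B / e).
have B0 : 0 <= B by apply: le_trans (bg point); exact: normr_ge0.
pose r w := g w - (e * staircase J ((g w + B) / e) - B).
have r_le w : `|r w| <= e.
  have -> : r w = e * ((g w + B) / e - staircase J ((g w + B) / e)).
    rewrite /r; field; exact: lt0r_neq0.
  have gB : 0 <= g w + B.
    by move: (bg w); rewrite ler_norml => /andP[h _]; rewrite -lerBlDr sub0r.
  rewrite normrM gtr0_norm// -[leRHS]mulr1 ler_pM2l//; apply: staircase_le.
    by rewrite divr_ge0// ltW.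
  apply: (@le_trans _ _ (2 * B / e)).
    rewrite ler_pM2r ?invr_gt0//; move: (bg w); rewrite ler_norml => /andP[_ h]; lra.
  by apply: ltW; apply: archi_boundP; rewrite divr_ge0 ?mulr_ge0// ltW.
have stE w : e * staircase J ((g w + B) / e) =
    \sum_(j < J) e * (e * j.+1%:R - B <= g w)%R%:R.
  rewrite mulr_sumr; apply: eq_bigr => j _; congr (_ * (nat_of_bool _)%:R).
  by rewrite ler_pdivlMr// lerBlDr (mulrC e).
have gE w : g w = r w + (\sum_(j < J) e * (e * j.+1%:R - B <= g w)%R%:R - B).
  by rewrite -stE /r subrK.
pose S w := \sum_(j < J) e * (e * j.+1%:R - B <= g w)%R%:R.
have mS : measurable_fun setT S.
  by apply: measurable_sum => j; apply: measurable_funM => //; exact: mstep.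
have mr : measurable_fun setT r.
  have -> : r = (fun w => g w - (S w - B)).
    by apply/funext => w; rewrite /r stE.
  by apply: measurable_funB => //; exact: measurable_funB.
have Lr : L1 r by exact: L1_bnd mr r_le.
have Lj j : L1 (fun w => e * (e * (nat_of_ord j).+1%:R - B <= g w)%R%:R).
  by apply: L1Z; exact: L1_bnd (mstep _) (bstep _).
have LYj (j : 'I_J) : L1 (fun w => Y w * (e * (e * j.+1%:R - B <= g w)%R%:R)).
  by apply: (L1M_bnd mY bY); exact: Lj.
have LS : L1 S by exact: L1_sum.
have LYr : L1 (fun w => Y w * r w) by exact: L1M_bnd mY bY Lr.
have LYS : L1 (fun w => Y w * S w) by exact: L1M_bnd mY bY LS.
have eS : Ex (fun w => Y w * S w) = Ex Y * Ex S.
  rewrite /S (Ex_eq P (fun w => mulr_sumr _ _ _ _)) Ex_sum// Ex_sum// mulr_sumr.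
  apply: eq_bigr => j _.
  rewrite (Ex_eq P (fun w => mulrCA (Y w) e _)) !ExZ; last 2 first.
  - exact: L1_bnd (mstep _) (bstep _).
  - by apply: (L1M_bnd mY bY); exact: L1_bnd (mstep _) (bstep _).
  by rewrite indep_ge mulrCA.
have LB : L1 (fun=> B) := L1_cst P B.
have e1 : Ex (fun w => Y w * g w) = Ex (fun w => Y w * r w) + (Ex Y * Ex S - Ex Y * B).
  have -> : Ex (fun w => Y w * g w) = Ex (fun w => Y w * r w + (Y w * S w - B * Y w)).
    by apply: Ex_eq => w; rewrite {1}gE -/(S w); ring.
  by rewrite (ExD LYr (L1B LYS (L1Z B LY))) (ExB LYS (L1Z B LY)) (ExZ B LY) eS (mulrC B).
have e2 : Ex g = Ex r + (Ex S - B).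
  have -> : Ex g = Ex (fun w => r w + (S w - B)) by apply: Ex_eq => w; rewrite {1}gE.
  by rewrite (ExD Lr (L1B LS LB)) (ExB LS LB) Ex_cst.
have -> : Ex (fun w => Y w * g w) - Ex Y * Ex g = Ex (fun w => Y w * r w) - Ex Y * Ex r.
  by rewrite e1 e2; ring.
have b1 : `|Ex (fun w => Y w * r w)| <= BY * e.
  rewrite -[leRHS](Ex_cst P); apply: Ex_norm_le => //; first exact: L1_cst.
  by move=> w; rewrite normrM ler_pM.
have b2 : `|Ex Y| <= BY by rewrite -[leRHS](Ex_cst P); apply: Ex_norm_le => //; exact: L1_cst.
have b3 : `|Ex r| <= e by rewrite -[leRHS](Ex_cst P); apply: Ex_norm_le => //; exact: L1_cst.
apply: le_trans (ler_normB _ _) _; rewrite (_ : 2 * BY * e = BY * e + BY * e); last by ring.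
by apply: lerD => //; rewrite normrM ler_pM.
Qed.

End Independence.

Section IndependentFamily.
Context {d : measure_display} {Omega : measurableType d} {R : realType}.
Variable P : probability Omega R.
Notation Ex := (Ex P).
Variables (q : nat) (G : 'I_q -> set (set Omega)).
Hypothesis sG : forall i, sigma_algebra setT (G i).
Hypothesis mG : forall i, G i `<=` measurable.
Hypothesis indepG : forall A : 'I_q -> set Omega, (forall i, G i (A i)) ->
  P (\bigcap_(i in [set: 'I_q]) A i) = (\prod_(i < q) P (A i))%E.

Lemma fm_sub_meas i (f : Omega -> R) : fm (G i) f -> measurable_fun setT f.
Proof.
move=> mf _ B mB; rewrite setTI; apply: (@mG i).
exact: (fm_set (sG i) mf mB).
Qed.

Lemma Ex_indic (A : set Omega) : measurable A -> Ex \1_A = fine (P A).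
Proof. by move=> mA; rewrite /Ex /Rintegral integral_indic// setIT. Qed.

Lemma prod_indic (A : 'I_q -> set Omega) w :
  \prod_i (\1_(A i) w : R) = \1_(\bigcap_(i in [set: 'I_q]) A i) w.
Proof.
rewrite [RHS]indicE; case: (pselect ((\bigcap_(i in [set: 'I_q]) A i) w)) => h.
  rewrite mem_set// big1// => i _; rewrite indicE mem_set//; exact: h.
rewrite memNset//; have [i hi] : exists i, ~ A i w.
  by apply: contrapT => hn; apply: h => i _; apply: contrapT => hA; apply: hn; exists i.
by rewrite (bigD1 i)//= indicE memNset// mul0r.
Qed.

Lemma measurable_prod_fun (I : Type) (s : seq I) (p : pred I) (f : I -> Omega -> R) :
  (forall i, measurable_fun setT (f i)) ->
  measurable_fun setT (fun w => \prod_(i <- s | p i) f i w).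
Proof.
move=> mf; elim: s => [|i s IH].
  by under eq_fun do rewrite big_nil; exact: measurable_cst.
under eq_fun do rewrite big_cons; case: (p i) => //; exact: measurable_funM.
Qed.

Lemma prod_bound (I : Type) (s : seq I) (p : pred I) (f C : I -> R) :
  (forall i, `|f i| <= C i) ->
  `|\prod_(i <- s | p i) f i| <= \prod_(i <- s | p i) C i.
Proof.
move=> h; rewrite normr_prod; apply: ler_prod => i _.
by rewrite normr_ge0 h.
Qed.

Lemma Ex_prod_indep (g : 'I_q -> Omega -> R) (B : 'I_q -> R) :
  (forall i, fm (G i) (g i)) -> (forall i w, `|g i w| <= B i) ->
  Ex (fun w => \prod_i g i w) = \prod_i Ex (g i).
Proof.
(* Induction on the number of factors that are arbitrary: those of index at least [n] are
   indicators. The base case is independence of events; the step first puts an indicator in place of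
   the factor of index [n], then reaches the general factor by [Ex_mul_indep_step]. *)
suff main n : (n <= q)%N -> forall (g : 'I_q -> Omega -> R) (B : 'I_q -> R),
  (forall i, fm (G i) (g i)) -> (forall i w, `|g i w| <= B i) ->
  (forall i : 'I_q, (n <= i)%N -> exists2 A, G i A & g i = \1_A) ->
  Ex (fun w => \prod_i g i w) = \prod_i Ex (g i).
  by move=> mg bg; apply: (main q (leqnn q) g B mg bg) => i; rewrite leqNgt ltn_ord.
elim: n => [_|n IH nq] {}g {}B mg bg ig.
  have [A hA] := choice (fun i => let: ex_intro2 A h1 h2 := ig i (leq0n i) in
    ex_intro (fun A => G i A /\ g i = \1_A) A (conj h1 h2)).
  have mA i : measurable (A i) by apply: (@mG i); case: (hA i).
  have -> : Ex (fun w => \prod_i g i w) = Ex \1_(\bigcap_(i in [set: 'I_q]) A i).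
    by apply: Ex_eq => w; rewrite -prod_indic; apply: eq_bigr => i _; case: (hA i) => _ ->.
  rewrite Ex_indic; last exact: fin_bigcap_measurable.
  rewrite indepG; last by move=> i; case: (hA i).
  under [RHS]eq_bigr => i _ do rewrite (hA i).2 Ex_indic//.
  suff -> : (\prod_(i < q) P (A i))%E = (\prod_(i < q) fine (P (A i)))%:E by [].
  elim/big_rec2 : _ => // i x y _ ->; rewrite EFinM fineK//.
  exact: fin_num_measure.
pose k := Ordinal nq.
pose Y w := \prod_(i | i != k) g i w.
have mg' i : measurable_fun setT (g i) by exact: fm_sub_meas (mg i).
have mY : measurable_fun setT Y by exact: measurable_prod_fun.
have bY w : `|Y w| <= \prod_(i | i != k) B i by exact: prod_bound.
have fG A : G k A -> fm (G k) (\1_A : Omega -> R).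
  move=> GA; rewrite /fm; apply: measurable_indic.
  exact: sub_sigma_algebra.
have sub A : G k A -> Ex (fun w => Y w * \1_A w) = (\prod_(i | i != k) Ex (g i)) * Ex \1_A.
  move=> GA; pose g' i := if i == k then \1_A else g i.
  have := IH (ltnW nq) g' (fun i => if i == k then 1 else B i).
  rewrite /g' (bigD1 k)//= eqxx => H.
  have E w : Y w * \1_A w = \prod_i g' i w.
    rewrite (bigD1 k)//= /g' eqxx mulrC; congr (_ * _).
    by apply: eq_bigr => i /negbTE ->.
  rewrite (Ex_eq P E) H.
  - by rewrite mulrC; congr (_ * _); apply: eq_bigr => i /negbTE ->.
  - by move=> i; case: eqP => [->|_]; [exact: fG|exact: mg].
  - by move=> i w; case: eqP => // _; rewrite indicE; case: (_ \in _); rewrite ?normr1 ?normr0.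
  move=> i ni; case: eqP => [->|/eqP ik]; first by exists A.
  apply: ig; rewrite ltn_neqAle ni andbT; apply: contra ik => /eqP ni'.
  by apply/eqP/val_inj; rewrite /= -ni'.
have GT : G k setT by case: (sG k) => h0 hC _; rewrite -[setT]setD0; exact: hC.
have eY : Ex Y = \prod_(i | i != k) Ex (g i).
  have := sub _ GT; rewrite Ex_indic// probability_setT mulr1 => <-.
  by apply: Ex_eq => w; rewrite indicE mem_set// mulr1.
rewrite [RHS](bigD1 k)//= -eY [RHS]mulrC.
rewrite -(Ex_mul_indep_step mY bY (mg' k) (bg k)).
  by apply: Ex_eq => w; rewrite (bigD1 k)//= mulrC.
move=> c.
have stepE : (fun w => (c <= g k w)%R%:R : R) = \1_([set w | c <= g k w]).
  apply/funext => w; rewrite indicE; congr ((nat_of_bool _)%:R).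
  by apply/idP/idP => [h|/set_mem//]; apply/mem_set.
have GA : G k [set w | c <= g k w].
  have := fm_set (sG k) (mg k) (measurable_itv `[c, +oo[).
  by congr (G k _); apply/seteqP; split => w /=; rewrite in_itv/= andbT.
rewrite eY stepE -(sub _ GA); apply: Ex_eq => w.
by rewrite -[in RHS]stepE.
Qed.

End IndependentFamily.

(** * Approximate derivatives and Gronwall inequalities *)

Section ApproximateDerivative.
Context {R : realType}.
Implicit Types (m n : R -> R) (s h k C : R).

(* The error k h + k^-1 h^2, with a free parameter k, is an explicit form of o(h). *)
Definition dq m m' := exists C, [/\ 0 <= C,
  forall s, 0 <= s -> s <= 1 -> `|m s| <= C /\ `|m' s| <= C &
  forall s h k, 0 <= s -> 0 <= h -> s + h <= 1 -> 0 < k -> k <= 1 ->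
    `|m (s + h) - m s - h * m' s| <= C * (k * h + k^-1 * h ^+ 2)].

Lemma sqr_le_err h k : 0 <= h -> 0 < k -> k <= 1 -> h ^+ 2 <= k * h + k^-1 * h ^+ 2.
Proof.
move=> h0 k0 k1; apply: (@le_trans _ _ (k^-1 * h ^+ 2)).
  by apply: ler_peMl; [exact: sqr_ge0|rewrite invf_ge1].
by rewrite lerDr mulr_ge0// ltW.
Qed.

Lemma dq_ext m m' n n' : dq m m' -> m =1 n -> m' =1 n' -> dq n n'.
Proof. by move=> h /funext <- /funext <-. Qed.

Lemma dq_ext01 m m' n n' : dq m m' -> (forall s, 0 <= s -> s <= 1 -> m s = n s) ->
  (forall s, 0 <= s -> s <= 1 -> m' s = n' s) -> dq n n'.
Proof.
move=> [C [C0 b H]] e e'; exists C; split => // [s s0 s1|s h k s0 h0 sh k0 k1].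
  by rewrite -(e s s0 s1) -(e' s s0 s1); exact: b.
have s1 : s <= 1 by apply: le_trans sh; rewrite lerDl.
by rewrite -(e _ s0 s1) -(e' _ s0 s1) -(e _ (addr_ge0 s0 h0) sh); exact: H.
Qed.

Lemma dq_cst c : dq (fun=> c) (fun=> 0).
Proof.
exists `|c|; split => // [s _ _|s h k _ h0 _ k0 _]; first by rewrite normr0.
by rewrite mulr0 subr0 subrr normr0 mulr_ge0// err_ge0.
Qed.

Lemma dq_id : dq id (fun=> 1).
Proof.
exists 1; split => // [s s0 s1|s h k _ h0 _ k0 _]; first by rewrite normr1 ger0_norm.
have -> : s + h - s - h * 1 = 0 by ring.
by rewrite normr0 mulr_ge0// err_ge0.
Qed.

Lemma dqD m m' n n' : dq m m' -> dq n n' ->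
  dq (fun s => m s + n s) (fun s => m' s + n' s).
Proof.
move=> [C [C0 b1 h1]] [D [D0 b2 h2]]; exists (C + D); split; first exact: addr_ge0.
  move=> s s0 s1; have [x1 x2] := b1 s s0 s1; have [y1 y2] := b2 s s0 s1.
  by split; apply: le_trans (ler_normD _ _) _; exact: lerD.
move=> s h k s0 h0 sh k0 k1; rewrite mulrDl.
have -> : m (s + h) + n (s + h) - (m s + n s) - h * (m' s + n' s) =
  (m (s + h) - m s - h * m' s) + (n (s + h) - n s - h * n' s) by ring.
by apply: le_trans (ler_normD _ _) _; apply: lerD; [exact: h1|exact: h2].
Qed.

Lemma dqM m m' n n' : dq m m' -> dq n n' ->
  dq (fun s => m s * n s) (fun s => m' s * n s + m s * n' s).
Proof.
move=> [C [C0 b1 h1]] [D [D0 b2 h2]].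
pose L := C + 2 * C. 
have lip s h : 0 <= s -> 0 <= h -> s + h <= 1 -> `|m (s + h) - m s| <= 3 * C * h.
  move=> s0 h0 sh; have := h1 s h 1 s0 h0 sh ltr01 (lexx _).
  have s1 : s <= 1 by apply: le_trans sh; rewrite lerDl.
  have hle : h <= 1 by apply: le_trans sh; rewrite lerDr.
  have [_ bm'] := b1 s s0 s1; rewrite mul1r invr1 mul1r => e1.
  have -> : m (s + h) - m s = (m (s + h) - m s - h * m' s) + h * m' s by ring.
  apply: le_trans (ler_normD _ _) _.
  have e2 : `|h * m' s| <= h * C by rewrite normrM (ger0_norm h0) ler_wpM2l.
  have e3 : C * (h + h ^+ 2) <= C * (h + h).
    by rewrite ler_wpM2l// lerD2l expr2 ler_piMl.
  by move: e1 e2 e3; rewrite mulrDr; lra.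
exists (2 * C * D + D * C + C * D + 3 * C * (2 * D) + C * D + C * D); split.
- by rewrite !addr_ge0 ?mulr_ge0.
- move=> s s0 s1; have [x1 x2] := b1 s s0 s1; have [y1 y2] := b2 s s0 s1.
  have CD : 0 <= C * D by exact: mulr_ge0.
  split; first by apply: (@le_trans _ _ (C * D)); [rewrite normrM ler_pM|lra].
  apply: (@le_trans _ _ (C * D + C * D)); last by lra.
  apply: le_trans (ler_normD _ _) _.
  by apply: lerD; rewrite normrM ler_pM.
move=> s h k s0 h0 sh k0 k1.
have s1 : s <= 1 by apply: le_trans sh; rewrite lerDl.
have s'0 : 0 <= s + h by exact: addr_ge0.
have [x1 x2] := b1 s s0 s1; have [y1 y2] := b2 s s0 s1; have [z1 z2] := b2 (s + h) s'0 sh.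
have e := err_ge0 h0 k0; have e2 := sqr_le_err h0 k0 k1.
have E1 := h1 s h k s0 h0 sh k0 k1; have E2 := h2 s h k s0 h0 sh k0 k1.
have lm := lip s h s0 h0 sh; set E := k * h + k^-1 * h ^+ 2 in e e2 E1 E2 *.
have -> : m (s + h) * n (s + h) - m s * n s - h * (m' s * n s + m s * n' s) =
  n s * (m (s + h) - m s - h * m' s) + m s * (n (s + h) - n s - h * n' s) +
  (m (s + h) - m s) * ((n (s + h) - n s - h * n' s) + h * n' s) by ring.
have CD : 0 <= C * D by exact: mulr_ge0.
have t1 : `|n s * (m (s + h) - m s - h * m' s)| <= D * (C * E) by rewrite normrM ler_pM.
have t2 : `|m s * (n (s + h) - n s - h * n' s)| <= C * (D * E) by rewrite normrM ler_pM.
have [u1 u2] := b1 (s + h) s'0 sh.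
have d2C : `|m (s + h) - m s| <= C + C by apply: le_trans (ler_normB _ _) _; exact: lerD.
have t3 : `|(m (s + h) - m s) * (n (s + h) - n s - h * n' s)| <= (C + C) * (D * E).
  by rewrite normrM ler_pM.
have t4 : `|(m (s + h) - m s) * (h * n' s)| <= 3 * C * h * (h * D).
  by rewrite normrM ler_pM// normrM (ger0_norm h0) ler_wpM2l.
have t5 : 3 * C * h * (h * D) <= 3 * C * D * E.
  have -> : 3 * C * h * (h * D) = 3 * C * D * h ^+ 2 by ring.
  by rewrite ler_wpM2l// !mulr_ge0.
rewrite (mulrDr (m (s + h) - m s)); apply: le_trans (ler_normD _ _) _.
apply: le_trans (lerD (ler_normD _ _) (ler_normD _ _)) _.
apply: le_trans (lerD (lerD t1 t2) (lerD t3 (le_trans t4 t5))) _.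
have CDE : 0 <= C * D * E by exact: mulr_ge0.
have -> : D * (C * E) + C * (D * E) + ((C + C) * (D * E) + 3 * C * D * E) = 7 * (C * D * E) by ring.
have -> : (2 * C * D + D * C + C * D + 3 * C * (2 * D) + C * D + C * D) * E = 12 * (C * D * E) by ring.
lra.
Qed.

Lemma dq_poly (p : {poly R}) : dq (fun s => p.[s]) (fun s => p^`().[s]).
Proof.
elim/poly_ind: p => [|p c IH].
  by apply: dq_ext (dq_cst 0) _ _ => s; rewrite ?deriv0 horner0.
apply: dq_ext (dqD (dqM IH dq_id) (dq_cst c)) _ _ => s.
  by rewrite hornerMXaddC.
by rewrite derivMXaddC hornerD hornerMX; ring.
Qed.

Lemma dq_prod (I : eqType) (r : seq I) (m m' : I -> R -> R) : uniq r ->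
  (forall i, dq (m i) (m' i)) ->
  dq (fun s => \prod_(i <- r) m i s)
     (fun s => \sum_(i <- r) m' i s * \prod_(j <- r | j != i) m j s).
Proof.
move=> + H; elim: r => [_|i r IH /=/andP[ir ur]].
  by apply: dq_ext (dq_cst 1) _ _ => s; rewrite big_nil.
apply: dq_ext (dqM (H i) (IH ur)) _ _ => s; first by rewrite big_cons.
rewrite big_cons [in X in _ = X + _]big_cons eqxx; congr (_ * _ + _).
  rewrite big_seq [RHS]big_seq_cond; apply: eq_bigl => j; rewrite andbC.
  case: (boolP (j \in r)) => jr; rewrite ?andbF ?andbT//.
  by have -> : j != i by apply: contraNneq ir => <-.
rewrite mulr_sumr; apply: eq_big_seq => j jr.
rewrite [in RHS]big_cons; have -> : i != j by apply: contraNneq ir => ->.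
by rewrite mulrCA.
Qed.

Lemma gronwall_step_num (x y z p e w we : R) :
  x - y - z <= e -> z <= p -> y + p <= w -> e <= we -> x <= w + we.
Proof. by move=> *; lra. Qed.

(** Euler's scheme with [n] steps of length [1/n]: the accumulated error is [C (k + k^-1 / n)], at
    most [2 C k] as soon as [n >= k^-2]; then [k] tends to 0. *)
Lemma dq_gronwall m m' (lam : R) : 0 <= lam -> dq m m' -> 0 <= m 0 ->
  (forall s, 0 <= s -> s <= 1 -> m' s <= lam * m s) -> m 1 <= expR lam * m 0.
Proof.
move=> l0 [C [C0 _ H]] m00 Hm.
apply: (@le_of_slack _ _ _ (expR lam * C * 2)) => k0 k00.
pose k := Num.min k0 1.
have kp : 0 < k by rewrite lt_min k00 ltr01.
have k1 : k <= 1 by rewrite ge_min lexx orbT.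
have kk0 : k <= k0 by rewrite ge_min lexx.
pose n := (Num.bound (k^-1 * k^-1)).+1.
have n0 : (0 : R) < n%:R by rewrite ltr0n.
have kn : k^-1 * k^-1 <= n%:R.
  rewrite (@le_trans _ _ (Num.bound (k^-1 * k^-1))%:R)//.
    by apply: ltW; apply: archi_boundP; rewrite mulr_ge0// invr_ge0 ltW.
  by rewrite ler_nat.
pose h : R := n%:R^-1.
have h0 : 0 <= h by rewrite invr_ge0 ltW.
pose E := C * (k * h + k^-1 * h ^+ 2).
have E0 : 0 <= E by rewrite mulr_ge0// err_ge0.
have step j : (j <= n)%N -> m (j%:R * h) <= (1 + lam * h) ^+ j * (m 0 + j%:R * E).
  have lh : 1 <= 1 + lam * h by rewrite lerDl mulr_ge0.
  elim: j => [_|j IH jn]; first by rewrite !mul0r expr0 mul1r addr0.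
  have jh : j%:R * h + h = j.+1%:R * h by rewrite -natr1 mulrDl mul1r.
  have jh1 : j%:R * h + h <= 1 by rewrite jh ler_pdivrMr// mul1r ler_nat.
  have jh0 : 0 <= j%:R * h by rewrite mulr_ge0.
  have := H (j%:R * h) h k jh0 h0 jh1 kp k1; rewrite -/E jh ler_norml => /andP[_ h2].
  have jl : j%:R * h <= 1 by apply: le_trans jh1; rewrite lerDl.
  have h3 := Hm _ jh0 jl.
  have {}h3 : h * m' (j%:R * h) <= h * (lam * m (j%:R * h)) by apply: ler_wpM2l.
  have h4 := IH (ltnW jn).
  have h5 : (1 + lam * h) * m (j%:R * h) <=
    (1 + lam * h) * ((1 + lam * h) ^+ j * (m 0 + j%:R * E)).
    by rewrite ler_wpM2l// (le_trans ler01).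
  rewrite mulrA -exprS in h5.
  have -> : (1 + lam * h) ^+ j.+1 * (m 0 + j.+1%:R * E) =
    (1 + lam * h) ^+ j.+1 * (m 0 + j%:R * E) + (1 + lam * h) ^+ j.+1 * E.
    by rewrite -natr1; ring.
  have h6 : E <= (1 + lam * h) ^+ j.+1 * E by rewrite ler_peMl// exprn_ege1.
  rewrite mulrDl mul1r in h5; move: h2 h3 h5 h6; rewrite (mulrCA h) mulrA.
  exact: gronwall_step_num.
have := step n (leqnn n); rewrite mulfV ?lt0r_neq0// => hm.
apply: le_trans hm _.
have e1 : (1 + lam * h) ^+ n <= expR lam.
  apply: (@le_trans _ _ (expR (lam * h) ^+ n)).
    by rewrite lerXn2r ?nnegrE ?addr_ge0 ?mulr_ge0 ?expR_ge0// expR_ge1Dx.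
  by rewrite -expRM_natr -mulrA mulVf ?mulr1// lt0r_neq0.
have nE : n%:R * E = C * (k + k^-1 * h).
  by rewrite /E /h; field; rewrite ?lt0r_neq0.
have kh : k^-1 * h <= k.
  by rewrite /h ler_pdivrMr// -ler_pdivrMl.
apply: (@le_trans _ _ (expR lam * (m 0 + n%:R * E))).
  by rewrite ler_wpM2r// addr_ge0// mulr_ge0// ltW.
rewrite mulrDr lerD2l -!mulrA ler_wpM2l ?expR_ge0// nE ler_wpM2l//; lra.
Qed.

Lemma gronwall_lower_num (x y z e w p : R) :
  - e <= x - y - z -> - p <= z -> w <= y - p -> w - e <= x.
Proof. by move=> *; lra. Qed.

(** The factor 2 in the exponent comes from [1 - x >= exp (- 2 x)], valid for [0 <= x <= 1/2]. Here
    the errors are damped rather than amplified along the scheme. *)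
Lemma dq_gronwall_lower m m' (lam : R) : 0 <= lam -> dq m m' -> 0 <= m 0 ->
  (forall s, 0 <= s -> s <= 1 -> - (lam * m s) <= m' s) ->
  expR (- (2 * lam)) * m 0 <= m 1.
Proof.
move=> l0 [C [C0 _ H]] m00 Hm.
apply: (@le_of_slack _ _ _ (C * 2)) => k0 k00.
pose k := Num.min k0 1.
have kp : 0 < k by rewrite lt_min k00 ltr01.
have k1 : k <= 1 by rewrite ge_min lexx orbT.
have kk0 : k <= k0 by rewrite ge_min lexx.
(* The summand [2 * lam] ensures [lam * h <= 1/2]. *)
pose n := (Num.bound (k^-1 * k^-1 + 2 * lam)).+1.
have n0 : (0 : R) < n%:R by rewrite ltr0n.
have k2 : 0 <= k^-1 * k^-1 by rewrite mulr_ge0// invr_ge0 ltW.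
have nn : k^-1 * k^-1 + 2 * lam <= n%:R.
  rewrite (@le_trans _ _ (Num.bound (k^-1 * k^-1 + 2 * lam))%:R)//.
    by apply: ltW; apply: archi_boundP; rewrite addr_ge0// mulr_ge0.
  by rewrite ler_nat.
have kn : k^-1 * k^-1 <= n%:R by apply: le_trans nn; rewrite lerDl mulr_ge0.
have ln : 2 * lam <= n%:R by apply: le_trans nn; rewrite lerDr.
pose h : R := n%:R^-1.
have h0 : 0 <= h by rewrite invr_ge0 ltW.
have lh2 : 2 * (lam * h) <= 1 by rewrite mulrA ler_pdivrMr// mul1r.
have lh0 : 0 <= lam * h by rewrite mulr_ge0.
pose E := C * (k * h + k^-1 * h ^+ 2).
have E0 : 0 <= E by rewrite mulr_ge0// err_ge0.
pose a := 1 - lam * h.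
have a0 : 0 <= a by rewrite /a; lra.
have a1 : a <= 1 by rewrite /a; lra.
have step j : (j <= n)%N -> a ^+ j * m 0 - j%:R * E <= m (j%:R * h).
  elim: j => [_|j IH jn]; first by rewrite !mul0r expr0 mul1r subr0.
  have jh : j%:R * h + h = j.+1%:R * h by rewrite -natr1 mulrDl mul1r.
  have jh1 : j%:R * h + h <= 1 by rewrite jh ler_pdivrMr// mul1r ler_nat.
  have jh0 : 0 <= j%:R * h by rewrite mulr_ge0.
  have := H (j%:R * h) h k jh0 h0 jh1 kp k1; rewrite -/E jh ler_norml => /andP[h2 _].
  have jl : j%:R * h <= 1 by apply: le_trans jh1; rewrite lerDl.
  have h3 : - (h * (lam * m (j%:R * h))) <= h * m' (j%:R * h).
    by rewrite -mulrN ler_wpM2l// Hm.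
  have h4 : a * (a ^+ j * m 0 - j%:R * E) <= m (j%:R * h) - h * (lam * m (j%:R * h)).
    apply: (@le_trans _ _ (a * m (j%:R * h))); first by rewrite ler_wpM2l// IH// ltnW.
    by rewrite le_eqVlt; apply/orP; left; apply/eqP; rewrite /a; ring.
  have h5 : a ^+ j.+1 * m 0 - j%:R * E <= a * (a ^+ j * m 0 - j%:R * E).
    have -> : a * (a ^+ j * m 0 - j%:R * E) = a ^+ j.+1 * m 0 - a * (j%:R * E).
      by rewrite exprS; ring.
    by rewrite lerD2l lerN2 ler_piMl// mulr_ge0.
  have := gronwall_lower_num h2 h3 (le_trans h5 h4).
  have -> : j.+1%:R * E = j%:R * E + E by rewrite -natr1 mulrDl mul1r.
  by rewrite opprD addrA.
have := step n (leqnn n); rewrite mulfV ?lt0r_neq0// => hm.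
have e1 : expR (- (2 * lam)) <= a ^+ n.
  have -> : expR (- (2 * lam)) = expR (- (2 * (lam * h))) ^+ n.
    rewrite -expRM_natr mulNr -!mulrA mulVf ?mulr1//; exact: lt0r_neq0.
  rewrite lerXn2r ?nnegrE ?expR_ge0// expRN.
  rewrite -[leLHS]mul1r ler_pdivrMr ?expR_gt0//.
  apply: (@le_trans _ _ (a * (1 + 2 * (lam * h)))).
    have -> : a * (1 + 2 * (lam * h)) = 1 + lam * h * (1 - 2 * (lam * h)) by rewrite /a; ring.
    by rewrite lerDl mulr_ge0// subr_ge0.
  by rewrite ler_wpM2l// expR_ge1Dx.
have nE : n%:R * E = C * (k + k^-1 * h).
  by rewrite /E /h; field; rewrite ?lt0r_neq0.
have kh : k^-1 * h <= k by rewrite /h ler_pdivrMr// -ler_pdivrMl.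
have nE2 : n%:R * E <= C * 2 * k0 by rewrite nE -mulrA ler_wpM2l//; lra.
have e2 : expR (- (2 * lam)) * m 0 <= a ^+ n * m 0 by rewrite ler_wpM2r.
by move: (n%:R * E) (_ ^+ n * _) (expR _ * _) (C * 2 * k0) hm nE2 e2 => *; lra.
Qed.

End ApproximateDerivative.

Lemma norm1_le1 {R : numDomainType} : `|1 : R| <= 1.
Proof. by rewrite normr1. Qed.

Section Calculus.
Context {R : realType} {N : nat}.
Notation M := 'M[R[i]]_N.
Notation uT := (unitary R N).

(** What is retained of [exp1] once the filtration and the driving motion are hidden: each of the
    [q] motions comes with its own, and the joint calculus only combines the resulting rules with
    independence. *)
Record calculus {d : measure_display} {Omega : measurableType d} (P : probability Omega R)
    (U : R -> Omega -> uT) (T : R) (E : (uT -> R) -> (uT -> R) -> (uT -> M) -> Prop) : Prop :=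
  Calculus {
  calc_cst : forall c, E (fun=> c) (fun=> 0) (fun=> 0);
  calc_mul : forall f1 l1 G1 f2 l2 G2, E f1 l1 G1 -> E f2 l2 G2 ->
    E (fun u => f1 u * f2 u)
      (fun u => f1 u * l2 u + f2 u * l1 u + gauss2 * qq (G1 u) (G2 u))
      (fun u => (f1 u)%:C *: G2 u + (f2 u)%:C *: G1 u);
  calc_coord : forall e, E (fun u => coord e (unitary_val u))
    (fun u => - 2^-1 * coord e (unitary_val u)) (fun u => gbasis e *m unitary_val u);
  calc_mbf : forall f l G, E f l G -> mbf f /\ mbf l;
  calc_mean : forall f l G, E f l G -> exists C, 0 <= C /\
    forall s h k, 0 <= s -> 0 <= h -> h <= T -> 0 < k -> k <= 1 ->
    `|Ex P (fun w => f (U (s + h) w)) - Ex P (fun w => f (U s w)) -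
      h * Ex P (fun w => l (U s w))| <= C * (k * h + k^-1 * h ^+ 2) }.

Lemma ubm_calculus {d : measure_display} {Omega : measurableType d}
    (P : probability Omega R) (U : R -> Omega -> uT) (T : R) :
  unitary_brownian_motion P U ->
  [/\ exists E, calculus P U T E,
      forall s, 0 <= s -> measurable_fun setT (U s) &
      forall w, unitary_val (U 0 w) = 1%:M].
Proof.
move=> [F [K [[filF bmK] cX aX X0 sde]]]; split => //.
  exists (exp1 P F K U T); split.
  - by move=> c; exact: exp1_cst.
  - by move=> *; exact: (exp1M filF bmK aX).
  - by move=> e; exact: (exp1_coord filF bmK aX T cX sde e).
  - by move=> f l G [].
  move=> f l G [mf ml mG [C [C0 hC]]]; exists C; split => // s h k s0 h0 hT k0 k1.
  have [_] := hC s h s0 h0 hT.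
  have m1 : fm (F s) (fun=> 1 : R) by exact: (fm_U filF aX s0 (mbf_cst N 1)).
  move=> /(_ (fun=> 1) k m1 (fun=> norm1_le1) k0 k1).
  have sh : s <= s + h by rewrite lerDl.
  have s'0 := le_trans s0 sh.
  have Lf r : 0 <= r -> L1 P (fun w => f (U r w)).
    by move=> r0; have [_ [B hB]] := mf; apply: (@L1_bnd _ _ _ P _ B); [exact: (meas_U filF aX r0 mf)|move=> w; exact: hB].
  have aG := adm_U filF aX s0 mG.
  have Lp : L2 P (form K (fun w => G (U s w)) s (s + h)) := L2_form filF bmK s0 sh aG.
  have e1 : Ex P (fun w => 1 * incr_err K U f G s h w) =
      Ex P (fun w => f (U (s + h) w)) - Ex P (fun w => f (U s w)).
    have z := Ex_form_mul filF bmK s0 sh aG m1 (L2_cst P 1).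
    rewrite -(ExB (Lf _ s'0) (Lf _ s0)) -[RHS]subr0 -z.
    rewrite -(ExB (L1B (Lf _ s'0) (Lf _ s0))); last by apply: L2_mul => //; exact: L2_cst.
    by apply: Ex_eq => w; rewrite /incr_err; ring.
  by rewrite e1 (Ex_eq P (fun w => mul1r (l (U s w)))).
move=> s s0 _ B [B' mB' <-]; rewrite setTI.
by have [_ h _] := filF; apply: (h s s0); rewrite setTI; exact: aX.
Qed.

End Calculus.

Lemma sum_single {R : realType} (I : finType) (i : I) (F : I -> R) :
  (forall j, j != i -> F j = 0) -> \sum_j F j = F i.
Proof. by move=> h; rewrite (bigD1 i)//= big1 ?addr0. Qed.

(** * Calculus for functions of all motions and of time *)

Section Joint.
Context {d : measure_display} {Omega : measurableType d} {R : realType} {q N : nat}.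
Variable P : probability Omega R.
Notation M := 'M[R[i]]_N.
Notation uT := (unitary R N).
Notation ut := ('I_q -> uT).
Notation Ex := (Ex P).
Notation L1 := (L1 P).
Variables (U : 'I_q -> R -> Omega -> uT) (t : 'I_q -> R).
Hypothesis t0 : forall i, 0 <= t i.
Hypothesis indU : independent_processes P U.
Hypothesis mU : forall i s, 0 <= s -> measurable_fun setT (U i s).
Variable E : 'I_q -> (uT -> R) -> (uT -> R) -> (uT -> M) -> Prop.
Hypothesis cE : forall i, calculus P (U i) (t i) (E i).

Lemma process_sigma_algebra i : sigma_algebra setT (process_sigma (U i)).
Proof. exact: smallest_sigma_algebra. Qed.

Lemma process_sigma_measurable i : process_sigma (U i) `<=` measurable.
Proof.
apply: smallest_sub; first exact: sigma_algebra_measurable.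
move=> A [s [B [s0 mB ->]]]; rewrite -[X in measurable X]setTI; exact: mU.
Qed.

Lemma fm_process i s (f : uT -> R) : 0 <= s -> mbf f ->
  fm (process_sigma (U i)) (fun w => f (U i s w)).
Proof.
move=> s0 [mf _]; apply/(fmP (process_sigma_algebra i)) => B mB.
apply: sub_sigma_algebra; exists s, (f @^-1` B); split => //.
by rewrite -[X in measurable X]setTI; exact: mf.
Qed.

Lemma Ex_prod_process (f : 'I_q -> uT -> R) (s : 'I_q -> R) :
  (forall i, 0 <= s i) -> (forall i, mbf (f i)) ->
  Ex (fun w => \prod_i f i (U i (s i) w)) = \prod_i Ex (fun w => f i (U i (s i) w)).
Proof.
move=> s0 mf; have [B hB] := choice (fun i => (mf i).2).
apply: (@Ex_prod_indep _ _ _ P q _ process_sigma_algebra process_sigma_measurable indU _ B) => //.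
by move=> i; exact: fm_process.
Qed.

(** A polynomial in time multiplied by one function of each motion: on such products independence
    reduces expectations to those of single motions. Sums of them are stable under multiplication,
    see [good_mul]. *)
Record tterm := Term {
  tc : {poly R}; tp : 'I_q -> uT -> R; tl : 'I_q -> uT -> R; tG : 'I_q -> uT -> M }.
Definition wf x := forall i, E i (tp x i) (tl x i) (tG x i).

Definition tf x tau (u : ut) : R := (tc x).[tau] * \prod_i tp x i (u i).
Definition tL x tau (u : ut) : R := (tc x)^`().[tau] * \prod_i tp x i (u i) +
  (tc x).[tau] * \sum_i t i * (tl x i (u i) * \prod_(j | j != i) tp x j (u j)).
Definition tD x i tau (u : ut) : M :=
  ((tc x).[tau] * \prod_(j | j != i) tp x j (u j))%:C *: tG x i (u i).

(* [good f L D]: L is the time derivative plus the generator applied to f, and D its gradient. *)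
Inductive good : (R -> ut -> R) -> (R -> ut -> R) -> ('I_q -> R -> ut -> M) -> Prop :=
| good_term x : wf x -> good (tf x) (tL x) (tD x)
| good_add f L D f' L' D' : good f L D -> good f' L' D' ->
    good (fun tau u => f tau u + f' tau u) (fun tau u => L tau u + L' tau u)
      (fun i tau u => D i tau u + D' i tau u).

Definition cdc (D D' : 'I_q -> R -> ut -> M) tau u : R :=
  \sum_i t i * (gauss2 * qq (D i tau u) (D' i tau u)).

Lemma good_ext f L D f' L' D' : good f L D -> (forall tau u, f tau u = f' tau u) ->
  (forall tau u, L tau u = L' tau u) -> (forall i tau u, D i tau u = D' i tau u) ->
  good f' L' D'.
Proof.
move=> g hf hL hD.
have <- : f = f' by apply/funext => tau; apply/funext => u.
have <- : L = L' by apply/funext => tau; apply/funext => u.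
by have <- : D = D' by apply/funext => i; apply/funext => tau; apply/funext => u.
Qed.

Definition mul_term x y := Term (tc x * tc y) (fun i u => tp x i u * tp y i u)
  (fun i u => tp x i u * tl y i u + tp y i u * tl x i u + gauss2 * qq (tG x i u) (tG y i u))
  (fun i u => (tp x i u)%:C *: tG y i u + (tp y i u)%:C *: tG x i u).

Lemma qqDl (X X' Y : M) : qq (X + X') Y = qq X Y + qq X' Y.
Proof. by rewrite /qq skpD uiDl. Qed.

Lemma qqC (X Y : M) : qq X Y = qq Y X.
Proof. by rewrite /qq ui_sym. Qed.

Lemma coord_inj (X Y : M) : (forall e, coord e X = coord e Y) -> X = Y.
Proof.
move=> h; apply/matrixP => i j; apply: complex_eq.
  by have := h (i, j, true); rewrite coord.unlock.
by have := h (i, j, false); rewrite coord.unlock.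
Qed.

Lemma qqZl (a : R) (X Y : M) : qq (a%:C *: X) Y = a * qq X Y.
Proof.
rewrite !qqE mulr_sumr; apply: eq_bigr => e _; rewrite mulr_sumr.
by apply: eq_bigr => e' _; rewrite !gcoef_coord coordZ; ring.
Qed.

Lemma qqZr (a : R) (X Y : M) : qq X (a%:C *: Y) = a * qq X Y.
Proof. by rewrite qqC qqZl qqC. Qed.

Lemma cdcC D D' tau u : cdc D D' tau u = cdc D' D tau u.
Proof. by apply: eq_bigr => i _; rewrite qqC. Qed.

Lemma cdcDl D1 D2 D' tau u :
  cdc (fun i tau u => D1 i tau u + D2 i tau u) D' tau u = cdc D1 D' tau u + cdc D2 D' tau u.
Proof. by rewrite /cdc -big_split; apply: eq_bigr => i _; rewrite qqDl !mulrDr. Qed.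

Lemma cdcZl (a : R -> ut -> R) D D' tau u :
  cdc (fun i tau u => (a tau u)%:C *: D i tau u) D' tau u = a tau u * cdc D D' tau u.
Proof. by rewrite /cdc mulr_sumr; apply: eq_bigr => i _; rewrite qqZl; ring. Qed.

Lemma tf_mul x y tau u : tf (mul_term x y) tau u = tf x tau u * tf y tau u.
Proof. by rewrite /tf /= hornerM big_split /= mulrACA. Qed.

Lemma tL_mul x y tau u : tL (mul_term x y) tau u =
  tf x tau u * tL y tau u + tf y tau u * tL x tau u + cdc (tD x) (tD y) tau u.
Proof.
rewrite /tL /tf /= derivM hornerD !hornerM big_split /=.
set px := \prod_i tp x i (u i); set py := \prod_i tp y i (u i).
set a := (tc x).[tau]; set b := (tc y).[tau]; set a' := _^`().[tau]; set b' := _^`().[tau].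
set Sx := \sum_i t i * (tl x i _ * _); set Sy := \sum_i t i * (tl y i _ * _).
set S := \sum_i _.
have -> : S = px * Sy + py * Sx + \sum_i t i * (gauss2 * qq (tG x i (u i)) (tG y i (u i)) *
    ((\prod_(j | j != i) tp x j (u j)) * (\prod_(j | j != i) tp y j (u j)))).
  rewrite /S /Sx /Sy !mulr_sumr -!big_split /=; apply: eq_bigr => i _.
  have -> : px = tp x i (u i) * \prod_(j | j != i) tp x j (u j) by rewrite /px (bigD1 i).
  have -> : py = tp y i (u i) * \prod_(j | j != i) tp y j (u j) by rewrite /py (bigD1 i).
  rewrite big_split /=.
  by move: (\prod_(j | _) _) (\prod_(j | _) _) => *; ring.
have -> : cdc (tD x) (tD y) tau u =
   a * b * \sum_i t i * (gauss2 * qq (tG x i (u i)) (tG y i (u i)) *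
    ((\prod_(j | j != i) tp x j (u j)) * (\prod_(j | j != i) tp y j (u j)))).
  rewrite /cdc mulr_sumr; apply: eq_bigr => i _; rewrite /tD qqZl qqZr -/a -/b.
  by move: (\prod_(j | _) _) (\prod_(j | _) _) => *; ring.
by ring.
Qed.

Lemma tD_mul x y i tau u : tD (mul_term x y) i tau u =
  (tf x tau u)%:C *: tD y i tau u + (tf y tau u)%:C *: tD x i tau u.
Proof.
rewrite /tD /tf /= hornerM big_split /=; apply: coord_inj => e.
have -> : \prod_j tp x j (u j) = tp x i (u i) * \prod_(j | j != i) tp x j (u j) by rewrite (bigD1 i).
have -> : \prod_j tp y j (u j) = tp y i (u i) * \prod_(j | j != i) tp y j (u j) by rewrite (bigD1 i).
rewrite !coordD !coordZ !coordD !coordZ.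
by move: (\prod_(j | _) _) (\prod_(j | _) _) => *; ring.
Qed.

Lemma good_mul f L D f' L' D' : good f L D -> good f' L' D' ->
  good (fun tau u => f tau u * f' tau u)
    (fun tau u => f tau u * L' tau u + f' tau u * L tau u + cdc D D' tau u)
    (fun i tau u => (f tau u)%:C *: D' i tau u + (f' tau u)%:C *: D i tau u).
Proof.
move=> g g'; elim: g => {f L D} [x wx|f L D f2 L2 D2 _ IH _ IH2]; last first.
  apply: good_ext (good_add IH IH2) _ _ _ => [tau u|tau u|i tau u].
  - by rewrite mulrDl.
  - by rewrite cdcDl; ring.
  by apply: coord_inj => e; rewrite !coordD !coordZ !coordD; ring.
elim: g' => {f' L' D'} [y wy|f L D f2 L2 D2 _ IH _ IH2]; last first.
  apply: good_ext (good_add IH IH2) _ _ _ => [tau u|tau u|i tau u].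
  - by rewrite mulrDr.
  - by rewrite ![cdc (tD x) _ _ _]cdcC cdcDl; ring.
  by apply: coord_inj => e; rewrite !coordD !coordZ !coordD; ring.
apply: good_ext (good_term (x := mul_term x y) _) _ _ _.
- by move=> i; apply: (calc_mul (cE i)); [exact: wx|exact: wy].
- exact: tf_mul.
- exact: tL_mul.
exact: tD_mul.
Qed.

Lemma good_poly (c : {poly R}) : good (fun tau _ => c.[tau]) (fun tau _ => c^`().[tau])
  (fun _ _ _ => 0).
Proof.
apply: good_ext (good_term (x := Term c (fun _ _ => 1) (fun _ _ => 0) (fun _ _ => 0)) _) _ _ _.
- by move=> i; exact: (calc_cst (cE i)).
- by move=> tau u; rewrite /tf /= big1// mulr1.
- move=> tau u; rewrite /tL /= big1// mulr1 big1 ?mulr0 ?addr0// => i _.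
  by rewrite mul0r mulr0.
by move=> i tau u; rewrite /tD /= scaler0.
Qed.

Lemma good_coord i e : good (fun _ u => coord e (unitary_val (u i)))
  (fun _ u => - 2^-1 * t i * coord e (unitary_val (u i)))
  (fun j _ u => if j == i then gbasis e *m unitary_val (u i) else 0).
Proof.
pose x := Term 1 (fun j u => if j == i then coord e (unitary_val u) else 1)
  (fun j u => if j == i then - 2^-1 * coord e (unitary_val u) else 0)
  (fun j u => if j == i then gbasis e *m unitary_val u else 0).
have pr u : \prod_(j | j != i) tp x j (u j) = 1 by rewrite big1// => j /negbTE /= ->.
apply: good_ext (good_term (x := x) _) _ _ _.
- move=> j; rewrite /x /=; case: (j == i); first exact: (calc_coord (cE j)).
  exact: (calc_cst (cE j)).
- by move=> tau u; rewrite /tf /= hornerC mul1r (bigD1 i)//= pr eqxx mulr1.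
- move=> tau u; rewrite /tL [tc x]/= derivC horner0 mul0r add0r hornerC mul1r.
  rewrite (sum_single (i := i)); first by rewrite pr [tl x i _]/= eqxx; ring.
  by move=> j /negbTE h; rewrite [tl x j _]/= h mul0r mulr0.
move=> j tau u; rewrite /tD /= hornerC mul1r; case: eqP => [->|_]; last by rewrite scaler0.
by rewrite pr scale1r.
Qed.

(** Running the [i]-th motion at speed [t i] brings all of them to their final times at
    [tau = 1]. *)
Definition at_time tau w : ut := fun i => U i (t i * tau) w.

Lemma mbf_prod_process (p : pred 'I_q) (f : 'I_q -> uT -> R) (s : 'I_q -> R) :
  (forall i, 0 <= s i) -> (forall i, mbf (f i)) ->
  L1 (fun w => \prod_(i | p i) f i (U i (s i) w)).
Proof.
move=> s0 mf; have [B hB] := choice (fun i => (mf i).2).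
apply: (@L1_bnd _ _ _ P _ (\prod_(i | p i) B i)).
  apply: measurable_prod_fun => i; apply: (measurableT_comp (mf i).1); exact: mU.
by move=> w; apply: prod_bound.
Qed.

(** Dynkin's formula. For a single term the mean is a polynomial times a product of one-motion
    means, so the product rule for [dq] gives its derivative. *)
Lemma good_mean f L D : good f L D ->
  [/\ forall tau, 0 <= tau -> L1 (fun w => f tau (at_time tau w)),
      forall tau, 0 <= tau -> L1 (fun w => L tau (at_time tau w)) &
   dq (fun tau => Ex (fun w => f tau (at_time tau w)))
      (fun tau => Ex (fun w => L tau (at_time tau w)))].
Proof.
elim => {f L D} [x wx|f L D f' L' D' _ [i1 i2 d1] _ [j1 j2 d2]]; last first.
  split=> [tau tau0|tau tau0|]; try (apply: L1D; by auto).
  apply: dq_ext01 (dqD d1 d2) _ _ => s s0 _; symmetry.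
    by rewrite (ExD (i1 s s0) (j1 s s0)).
  by rewrite (ExD (i2 s s0) (j2 s s0)).
have mp i : mbf (tp x i) by case: (calc_mbf (cE i) (wx i)).
have ml i : mbf (tl x i) by case: (calc_mbf (cE i) (wx i)).
have ti0 tau i : 0 <= tau -> 0 <= t i * tau by move=> h; rewrite mulr_ge0.
pose m i tau := Ex (fun w => tp x i (at_time tau w i)).
pose m' i tau := t i * Ex (fun w => tl x i (at_time tau w i)).
have Lf tau : 0 <= tau -> L1 (fun w => \prod_i tp x i (at_time tau w i)).
  by move=> h; apply: mbf_prod_process => // i; exact: ti0.
pose g i j := if j == i then tl x j else tp x j.
have mg i j : mbf (g i j) by rewrite /g; case: (j == i).
have gE i (u : ut) : tl x i (u i) * \prod_(j | j != i) tp x j (u j) = \prod_j g i j (u j).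
  by rewrite [RHS](bigD1 i)//= /g eqxx; congr (_ * _); apply: eq_bigr => j /negbTE ->.
have Lg tau i : 0 <= tau -> L1 (fun w => \prod_j g i j (at_time tau w j)).
  by move=> h; apply: mbf_prod_process => // j; exact: ti0.
have Ls tau : 0 <= tau -> L1 (fun w => \sum_i t i * (tl x i (at_time tau w i) *
    \prod_(j | j != i) tp x j (at_time tau w j))).
  by move=> h; apply: L1_sum => i; apply: L1Z; under eq_fun do rewrite gE; exact: Lg.
split=> [tau tau0|tau tau0|].
- by apply: L1Z; exact: Lf.
- by apply: L1D; apply: L1Z; [exact: Lf|exact: Ls].
have dqi i : dq (m i) (m' i).
  have [C [C0 hC]] := calc_mean (cE i) (wx i).
  have [_ [B1 hB1]] := mp i; have [_ [B2 hB2]] := ml i.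
  (* A step [h] of the common clock is a step [t i * h] of the motion; the factors [t i] and
     [t i ^+ 2] absorb this rescaling of the error. *)
  exists (`|B1| + t i * `|B2| + C * (t i + t i ^+ 2)); split.
  - by rewrite !addr_ge0 ?mulr_ge0 ?addr_ge0 ?sqr_ge0.
  - move=> s s0 s1.
    have b (f : uT -> R) (B : R) : mbf f -> (forall u, `|f u| <= B) ->
        `|Ex (fun w => f (at_time s w i))| <= `|B|.
      move=> mf hB; rewrite -[leRHS](Ex_cst P); apply: Ex_norm_le; [|exact: L1_cst|].
        apply: (@L1_bnd _ _ _ P _ B) => //; apply: (measurableT_comp mf.1).
        by apply: mU; exact: ti0.
      by move=> w; rewrite (le_trans (hB _))// ler_norm.
    have e0 : 0 <= C * (t i + t i ^+ 2) by rewrite mulr_ge0// addr_ge0// sqr_ge0.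
    have e1 : 0 <= t i * `|B2| by rewrite mulr_ge0.
    split.
      by apply: le_trans (b _ _ (mp i) hB1) _; rewrite -addrA lerDl addr_ge0.
    rewrite /m' normrM ger0_norm//; apply: (@le_trans _ _ (t i * `|B2|)).
      by rewrite ler_wpM2l// b.
    by rewrite addrAC lerDr addr_ge0.
  move=> s h k s0 h0 sh k0 k1.
  have th0 : 0 <= t i * h by rewrite mulr_ge0.
  have hT : t i * h <= t i.
    by rewrite ler_piMr//; apply: le_trans sh; rewrite lerDr.
  have := hC (t i * s) (t i * h) k (ti0 s i s0) th0 hT k0 k1.
  rewrite -mulrDr /m /m' /at_time (mulrCA h) mulrA => /le_trans; apply.
  have e := err_ge0 h0 k0; have kh : 0 <= k * h by rewrite mulr_ge0// ltW.
  have kh2 : 0 <= k^-1 * h ^+ 2 by apply: mulr_ge0; [rewrite invr_ge0 ltW|exact: sqr_ge0].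
  apply: (@le_trans _ _ (C * (t i + t i ^+ 2) * (k * h + k^-1 * h ^+ 2))).
    rewrite -mulrA ler_wpM2l//.
    have -> : (t i + t i ^+ 2) * (k * h + k^-1 * h ^+ 2) = k * (t i * h) + k^-1 * (t i * h) ^+ 2 +
       (t i ^+ 2 * (k * h) + t i * (k^-1 * h ^+ 2)) by ring.
    by rewrite lerDl; apply: addr_ge0; apply: mulr_ge0 => //; exact: sqr_ge0.
  by rewrite ler_wpM2r// lerDr addr_ge0 ?mulr_ge0.
have mE s : 0 <= s -> Ex (fun w => \prod_i tp x i (at_time s w i)) = \prod_i m i s.
  by move=> h; rewrite Ex_prod_process// => i; exact: ti0.
apply: dq_ext01 (dqM (dq_poly (tc x)) (dq_prod (index_enum_uniq _) dqi)) _ _ => s s0 s1.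
  by rewrite /tf (ExZ _ (Lf s s0)) mE.
rewrite /tL (ExD (L1Z _ (Lf s s0)) (L1Z _ (Ls s s0))) (ExZ _ (Lf s s0)) (ExZ _ (Ls s s0)).
rewrite mE//; congr (_ * _ + _ * _); rewrite Ex_sum; last first.
  by move=> i; apply: L1Z; under eq_fun do rewrite gE; exact: Lg.
apply: eq_bigr => i _.
rewrite (Ex_eq P (fun w => congr1 (fun x => t i * x) (gE i (at_time s w)))) (ExZ _ (Lg s i s0)).
rewrite Ex_prod_process//; last by move=> j; exact: ti0.
rewrite [in RHS](bigD1 i)//= /g eqxx /m' mulrA; congr (_ * _).
by apply: eq_bigr => j /negbTE ->.
Qed.

Lemma good_gronwall f L D (lam : R) : (forall i w, unitary_val (U i 0 w) = 1%:M) ->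
  good f L D -> 0 <= lam -> (forall u, 0 <= f 0 u) ->
  (forall tau u, 0 <= tau -> tau <= 1 -> L tau u <= lam * f tau u) ->
  Ex (fun w => f 1 (fun i => U i (t i) w)) <= expR lam * f 0 (fun=> point).
Proof.
move=> U0 g l0 f0 hL; have [i1 i2 hd] := good_mean g.
have at0 w : at_time 0 w = (fun=> point).
  by apply/funext => i; rewrite /at_time mulr0; apply: val_inj; exact: U0.
have at1 w : at_time 1 w = (fun i => U i (t i) w).
  by apply/funext => i; rewrite /at_time mulr1.
have := dq_gronwall l0 hd; rewrite (Ex_eq P (fun w => congr1 (f 1) (at1 w))).
have E0 : Ex (fun w => f 0 (at_time 0 w)) = f 0 (fun=> point).
  by rewrite (Ex_eq P (fun w => congr1 (f 0) (at0 w))) Ex_cst.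
rewrite E0 => H; apply: H; first exact: f0.
move=> s s0 s1; rewrite -(ExZ _ (i1 s s0)); apply: Ex_le; [exact: i2|exact: L1Z (i1 s s0)|].
by move=> w; exact: hL.
Qed.

Lemma good_gronwall_lower f L D (lam : R) : (forall i w, unitary_val (U i 0 w) = 1%:M) ->
  good f L D -> 0 <= lam -> (forall u, 0 <= f 0 u) ->
  (forall tau u, 0 <= tau -> tau <= 1 -> - (lam * f tau u) <= L tau u) ->
  expR (- (2 * lam)) * f 0 (fun=> point) <= Ex (fun w => f 1 (fun i => U i (t i) w)).
Proof.
move=> U0 g l0 f0 hL; have [i1 i2 hd] := good_mean g.
have at0 w : at_time 0 w = (fun=> point).
  by apply/funext => i; rewrite /at_time mulr0; apply: val_inj; exact: U0.
have at1 w : at_time 1 w = (fun i => U i (t i) w).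
  by apply/funext => i; rewrite /at_time mulr1.
have := dq_gronwall_lower l0 hd; rewrite (Ex_eq P (fun w => congr1 (f 1) (at1 w))).
have E0 : Ex (fun w => f 0 (at_time 0 w)) = f 0 (fun=> point).
  by rewrite (Ex_eq P (fun w => congr1 (f 0) (at0 w))) Ex_cst.
rewrite E0 => H; apply: H; first exact: f0.
move=> s s0 s1; rewrite -mulNr -(ExZ _ (i1 s s0)); apply: Ex_le; [exact: L1Z (i1 s s0)|exact: i2|].
by move=> w; rewrite mulNr; exact: hL.
Qed.

End Joint.

Lemma sum_flatten {V : nmodType} (I J : Type) (s : seq J) (g : J -> seq I) (f : I -> V) :
  \sum_(i <- flatten [seq g j | j <- s]) f i = \sum_(j <- s) \sum_(i <- g j) f i.
Proof. by rewrite big_flatten /= big_map. Qed.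

(** * The recursion on words *)

Section Weights.
Context {R : realType}.
Implicit Types (a b n T : nat).

Definition wt n : R := (n.+1%:R ^+ 2)^-1.

Lemma wt_gt0 n : 0 < wt n.
Proof. by rewrite invr_gt0 exprn_gt0// ltr0n. Qed.

Lemma wt_ge0 n : 0 <= wt n. Proof. exact/ltW/wt_gt0. Qed.

Lemma inv_telescope (y : R) : 0 < y -> y^-1 - (y + 1)^-1 = (y * (y + 1))^-1.
Proof. by move=> y0; field; rewrite !lt0r_neq0// addr_gt0. Qed.

Lemma wtS_le n : wt n.+1 <= (n.+1%:R)^-1 - (n.+2%:R)^-1.
Proof.
rewrite /wt; have h1 : (0 : R) < n.+1%:R by rewrite ltr0n.
have h2 : (0 : R) < n.+2%:R by rewrite ltr0n.
have -> : (n.+1%:R)^-1 - (n.+2%:R)^-1 = (n.+1%:R * n.+2%:R)^-1 :> R.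
  by rewrite -[n.+2%:R]natr1 inv_telescope.
rewrite lef_pV2 ?posrE ?mulr_gt0 ?exprn_gt0// expr2 ler_pM2r// ler_nat//.
Qed.

Lemma sum_wt_le T : \sum_(a < T) wt a <= 2.
Proof.
case: T => [|T]; first by rewrite big_ord0.
suff : \sum_(a < T.+1) wt a <= 2 - (T.+1%:R)^-1.
  by move=> /le_trans; apply; rewrite lerBlDr lerDl invr_ge0.
elim: T => [|T IH]; first by rewrite big_ord1 /wt expr1n invr1; lra.
rewrite big_ord_recr /=; apply: le_trans (lerD IH (wtS_le T)) _.
by rewrite addrA subrK.
Qed.

(** Comes from [(a + b + 1)^2 <= 2 (a + 1)^2 + 2 (b + 1)^2]. It makes the convolution [wt_conv]
    comparable to [wt T], the remaining factor being the convergent sum of the weights. *)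
Lemma wt_split a b T : (a + b)%N = T -> wt a * wt b <= 4 * wt T * (wt a + wt b) / 2.
Proof.
move=> e; rewrite /wt.
set x : R := a.+1%:R; set y : R := b.+1%:R; set z : R := T.+1%:R.
have x0 : 0 < x by rewrite ltr0n.
have y0 : 0 < y by rewrite ltr0n.
have z0 : 0 < z by rewrite ltr0n.
have zxy : z <= x + y by rewrite -natrD ler_nat -e addSn addnS -addSn leqnSn.
have -> : (x ^+ 2)^-1 * (y ^+ 2)^-1 = ((x ^+ 2) * (y ^+ 2) * z ^+ 2)^-1 * z ^+ 2.
  by field; rewrite !lt0r_neq0.
have -> : 4 * (z ^+ 2)^-1 * ((x ^+ 2)^-1 + (y ^+ 2)^-1) / 2 =
   ((x ^+ 2) * (y ^+ 2) * z ^+ 2)^-1 * (2 * (x ^+ 2 + y ^+ 2)).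
  by field; rewrite !lt0r_neq0.
rewrite ler_wpM2l ?invr_ge0 ?mulr_ge0 ?sqr_ge0//.
apply: (@le_trans _ _ ((x + y) ^+ 2)); first by rewrite lerXn2r// nnegrE ltW// addr_gt0.
by rewrite mulrDr; exact: sqrD_le.
Qed.

Lemma wt_conv T : \sum_(a < T.+1) wt a * wt (T - a) <= 8 * wt T.
Proof.
apply: (@le_trans _ _ (\sum_(a < T.+1) 2 * wt T * (wt a + wt (T - a)))).
  apply: ler_sum => a _; have h : (a + (T - a))%N = T by rewrite subnKC// -ltnS.
  apply: le_trans (wt_split h) _; rewrite le_eqVlt; apply/orP; left; apply/eqP.
  by field.
rewrite -mulr_sumr big_split /=.
have -> : \sum_(a < T.+1) wt (T - a) = \sum_(a < T.+1) wt a.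
  by rewrite [RHS](reindex_inj rev_ord_inj)/=; apply: eq_bigr => a _; rewrite subSS.
have h := sum_wt_le T.+1; have w := wt_ge0 T.
have -> : 8 * wt T = 2 * wt T * (2 + 2) by ring.
by rewrite ler_wpM2l ?mulr_ge0// lerD.
Qed.

(** The quantity is the square of [(a + 1) (b + 1) / (a + b + 1)], which increases in both
    variables. *)
Lemma nat_ratio_le (a b A B : nat) : (a <= A)%N -> (b <= B)%N ->
  wt (a + b) * (wt a * wt b)^-1 <= wt (A + B) * (wt A * wt B)^-1.
Proof.
move=> aA bB; rewrite /wt.
have p n : (0 : R) < n.+1%:R by rewrite ltr0n.
have e (m n : nat) : ((m + n).+1%:R ^+ 2)^-1 * ((m.+1%:R ^+ 2)^-1 * (n.+1%:R ^+ 2)^-1)^-1 =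
    ((m.+1%:R * n.+1%:R) / (m + n).+1%:R) ^+ 2 :> R.
  by field; rewrite !lt0r_neq0 ?p.
rewrite !e lerXn2r ?nnegrE ?divr_ge0//.
rewrite ler_pdivrMr// mulrAC ler_pdivlMr// -!natrM ler_nat.
by rewrite -(subnKC aA) -(subnKC bB); move: (A - a)%N (B - b)%N => x y; nia.
Qed.

Lemma inv_wt_le n : (wt n)^-1 <= 4 ^+ n.
Proof.
rewrite /wt invrK -natrX -natrX ler_nat; elim: n => // n IH.
rewrite [(4 ^ n.+1)%N]expnS; apply: leq_trans (_ : 4 * n.+1 ^ 2 <= _)%N; last by rewrite leq_mul2l IH.
by rewrite !expnS !expn0; lia.
Qed.

End Weights.

(** * Words, their cuts and their gradients *)

Section Words.
Context {q : nat}.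
Notation word := (seq (letter q)).

Definition lidx (x : letter q) := match x with inl i => i | inr i => i end.
Definition isX (x : letter q) := if x is inl _ then true else false.
Definition prex (x : letter q) : word := if isX x then [:: x] else [::].
Definition postx (x : letter q) : word := if isX x then [::] else [:: x].

(* dX = X dK and dY = - dK Y: a cut of w = pre ++ post is a place where dK can be inserted,
   with its sign. *)
Record cut := Cut { ci : 'I_q; cs : bool; cpre : word; cpost : word }.

Fixpoint cuts (w : word) : seq cut :=
  if w is x :: w' then
    Cut (lidx x) (isX x) (prex x) (postx x ++ w') ::
    [seq Cut (ci c) (cs c) (x :: cpre c) (cpost c) | c <- cuts w']
  else [::].

Definition wstar (w : word) : word := rev (map (@letter_swap q) w).

Definition deg (ws : seq word) := sumn (map size ws).

(** One term of the gradient of a product of traces. Opening a trace at a cut leaves, by cyclicity,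
    the rotated word [cpost ++ cpre]; the other traces are kept in [grest]. *)
Record gr := Gr { gi : 'I_q; gs : bool; gA : word; grest : seq word }.

Fixpoint gm (ws : seq word) : seq gr :=
  if ws is w :: ws' then
    [seq Gr (ci c) (cs c) (cpost c ++ cpre c) ws' | c <- cuts w] ++
    [seq Gr (gi g) (gs g) (gA g) (w :: grest g) | g <- gm ws']
  else [::].

Lemma size_cut w c : List.In c (cuts w) -> (size (cpre c) + size (cpost c) = size w)%N.
Proof.
elim: w c => [//|x w IH] c /= [<-|h] /=.
  by rewrite /prex /postx; case: (isX x); rewrite ?size_cat.
by have [c' /IH h' ->] := In_map h; rewrite /= addSn h'.
Qed.

Lemma size_wstar w : size (wstar w) = size w.
Proof. by rewrite size_rev size_map. Qed.

Lemma deg_gr ws g : List.In g (gm ws) -> (size (gA g) + deg (grest g) = deg ws)%N.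
Proof.
elim: ws g => [//|w ws IH] g /= h; case: (List.in_app_or _ _ _ h) => h'.
  by have [c /size_cut hc ->] := In_map h'; rewrite /= size_cat /deg /= -hc addnC [(_ + size (cpre c))%N]addnC addnC.
by have [g' /IH hg ->] := In_map h'; rewrite /= /deg /= -/(deg ws) -hg -/(deg (grest g')) addnCA.
Qed.

Lemma size_cuts w : size (cuts w) = size w.
Proof. by elim: w => //= x w IH; rewrite size_map IH. Qed.

End Words.

(** * The formal recursion and its bounds, free of [N] *)

Section Formal.
Context {R : realType} {q : nat}.
Notation word := (seq (letter q)).
Notation C := R[i].
Variables (t : 'I_q -> R) (kap T : R).
Hypothesis t0 : forall i, 0 <= t i.
Hypothesis tT : forall i, t i <= T.
Hypothesis kap0 : 0 <= kap.
Implicit Types (w : word) (ws : seq word) (c : cut (q := q)) (D k : nat).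

(** Real-valued, unlike the norm of [R[i]], and submultiplicative; it dominates the real and the
    imaginary part. *)
Definition nrm (z : C) : R := `|re z| + `|im z|.

Lemma nrm_ge0 z : 0 <= nrm z. Proof. exact: addr_ge0. Qed.

Lemma nrmM x y : nrm (x * y) <= nrm x * nrm y.
Proof.
rewrite /nrm reM imM; apply: le_trans (lerD (ler_normB _ _) (ler_normD _ _)) _.
by rewrite !normrM le_eqVlt; apply/orP; left; apply/eqP; ring.
Qed.

Lemma nrmZ (a : R) z : nrm (a%:C * z) = `|a| * nrm z.
Proof. by rewrite /nrm reZ imZ !normrM mulrDr. Qed.

Lemma nrmJ z : nrm (conjc z) = nrm z.
Proof. by rewrite /nrm reJ imJ normrN. Qed.

Lemma ler_sum_In (I : Type) (s : seq I) (f g : I -> R) :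
  (forall i, List.In i s -> f i <= g i) -> \sum_(i <- s) f i <= \sum_(i <- s) g i.
Proof.
elim: s => [|x s IH] h; first by rewrite !big_nil.
rewrite !big_cons lerD//; first by apply: h; left.
by apply: IH => i si; apply: h; right.
Qed.

Lemma sum_ord_widen (n m : nat) (f : nat -> R) : (n <= m)%N -> (forall a, 0 <= f a) ->
  \sum_(a < n) f a <= \sum_(a < m) f a.
Proof.
move=> nm f0; elim: m nm => [|m IH] nm; first by move: nm; rewrite leqn0 => /eqP ->.
move: nm; rewrite leq_eqVlt => /orP[/eqP -> //|]; rewrite ltnS => /IH h.
by rewrite [leRHS]big_ord_recr /= (le_trans h)// lerDl.
Qed.

Definition om ws : R := \prod_(w <- ws) wt (size w).

Lemma om_ge0 ws : 0 <= om ws.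
Proof. by apply: prodr_ge0 => w _; exact: wt_ge0. Qed.

Lemma om_gt0 ws : 0 < om ws.
Proof.
elim: ws => [|w ws IH]; first by rewrite /om big_nil.
by rewrite /om big_cons mulr_gt0// wt_gt0.
Qed.

Lemma om_cons w ws : om (w :: ws) = wt (size w) * om ws.
Proof. by rewrite /om big_cons. Qed.

Lemma om_cat ws ws' : om (ws ++ ws') = om ws * om ws'.
Proof. by rewrite /om big_cat. Qed.

Lemma om_star ws : om (map (@wstar q) ws) = om ws.
Proof. by rewrite /om big_map; apply: eq_bigr => w _; rewrite size_wstar. Qed.

Lemma deg_cons w ws : deg (w :: ws) = (size w + deg ws)%N.
Proof. by []. Qed.

Lemma deg_cat ws ws' : deg (ws ++ ws') = (deg ws + deg ws')%N.
Proof. by rewrite /deg map_cat sumn_cat. Qed.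

Lemma deg_star ws : deg (map (@wstar q) ws) = deg ws.
Proof. by elim: ws => //= w ws IH; rewrite !deg_cons size_wstar IH. Qed.

Lemma inv_om_le ws : (om ws)^-1 <= 4 ^+ deg ws.
Proof.
elim: ws => [|w ws IH]; first by rewrite /om big_nil invr1 expr0.
rewrite om_cons invfM deg_cons exprD; apply: ler_pM => //.
- by rewrite invr_ge0 wt_ge0.
- by rewrite invr_ge0 om_ge0.
exact: inv_wt_le.
Qed.

Definition sg (b : bool) : R := if b then 1 else -1.

Lemma norm_sg b : `|sg b| = 1.
Proof. by case: b; rewrite /= ?normrN normr1. Qed.

(* The generator applied to a word: a list of coefficient, split-off traces, remaining word. *)
Fixpoint Lw w : seq (R * seq word * word) :=
  if w is x :: w' then
    (- 2^-1 * t (lidx x), [::], x :: w') ::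
    [seq (e.1.1, e.1.2, x :: e.2) | e <- Lw w'] ++
    [seq (- (kap * t (lidx x)) * (sg (isX x) * sg (cs c)),
          [:: postx x ++ cpre c], prex x ++ cpost c) | c <- cuts w' & ci c == lidx x]
  else [::].

Fixpoint Lm ws : seq (R * seq word) :=
  if ws is w :: ws' then
    [seq (e.1.1, e.2 :: e.1.2 ++ ws') | e <- Lw w] ++
    [seq (e.1, w :: e.2) | e <- Lm ws']
  else [::].

Lemma In_filter (I : Type) (p : pred I) (s : seq I) x : List.In x (seq.filter p s) -> List.In x s.
Proof.
elim: s => [//|y s IH] /=; case: (p y) => /=; last by move=> h; right; exact: IH.
by case=> [->|h]; [left|right; exact: IH].
Qed.

Lemma size_prepost (x : letter q) : (size (postx x) + size (prex x) = 1)%N.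
Proof. by rewrite /prex /postx; case: (isX x). Qed.

Lemma deg_Lw w e : List.In e (Lw w) -> (deg e.1.2 + size e.2 = size w)%N.
Proof.
elim: w e => [//|x w IH] e /= [<-//|h]; case: (List.in_app_or _ _ _ h) => h'.
  by have [e' /IH he ->] := In_map h'; rewrite /= addnS he.
have [c hc' ->] := In_map h'; have hc := size_cut (In_filter hc').
by rewrite /= /deg /= addn0 !size_cat addnACA size_prepost add1n hc.
Qed.

Lemma deg_Lm ws e : List.In e (Lm ws) -> deg e.2 = deg ws.
Proof.
elim: ws e => [//|w ws IH] e /= h; case: (List.in_app_or _ _ _ h) => h'.
  have [e' /deg_Lw he ->] := In_map h'.
  by rewrite /= !deg_cons deg_cat addnA (addnC (size e'.2)) he.
by have [e' /IH he ->] := In_map h'; rewrite /= !deg_cons he.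
Qed.

(** The cut at the letter of index [j] has a prefix of length [j] or [j + 1], according to the side
    on which the noise enters. *)
Lemma cuts_sum_le w (h : nat -> R) : (forall a, 0 <= h a) ->
  \sum_(c <- cuts w) h (size (cpre c)) <= 2 * \sum_(a < (size w).+1) h a.
Proof.
move=> h0; apply: (@le_trans _ _ (\sum_(j < size w) (h j + h j.+1))).
  elim: w h h0 => [|x w IH] h h0; first by rewrite big_nil big_ord0.
  rewrite /= big_cons big_map big_ord_recl /=; apply: lerD.
    by rewrite /prex; case: (isX x); rewrite /= ?lerDl ?lerDr.
  exact: (IH (fun a => h a.+1)).
rewrite big_split /= mulr_natl mulr2n; apply: lerD.
  by apply: sum_ord_widen.
by rewrite big_ord_recl /= lerDr.
Qed.

(** Cost of the generator per letter: [T / 2] for the drift, and for the splittings [kap * T] times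
    2 from [cuts_sum_le] times 8 from [wt_conv]. *)
Definition lamc : R := 2^-1 * T + 16 * (kap * T).

Hypothesis T0 : 0 <= T.

Lemma lamc_ge0 : 0 <= lamc.
Proof. by rewrite addr_ge0 ?mulr_ge0 ?invr_ge0. Qed.

(** The shift [p] counts the letters already passed by the recursion: they lengthen the remaining
    word but not the split-off traces. *)
Lemma Lw_bound w p :
  \sum_(e <- Lw w) `|e.1.1| * om e.1.2 * wt (size e.2 + p) <=
  lamc * (size w)%:R * wt (size w + p).
Proof.
elim: w p => [|x w IH] p; first by rewrite big_nil mulr0 mul0r.
rewrite /= big_cons big_cat /= big_map big_map /=.
set n := size w; set px := size (postx x).
have sp := size_prepost x.
have b1 : `|- 2^-1 * t (lidx x)| * om [::] * wt (n.+1 + p) <= 2^-1 * T * wt (n.+1 + p).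
  rewrite /om big_nil mulr1 normrM normrN ger0_norm ?invr_ge0// ger0_norm//.
  by rewrite ler_wpM2r ?wt_ge0// ler_wpM2l ?invr_ge0.
have b2 : \sum_(e <- Lw w) `|e.1.1| * om e.1.2 * wt ((size e.2).+1 + p) <=
    lamc * n%:R * wt (n.+1 + p).
  have := IH p.+1; rewrite addnS -addSn => /(le_trans _); apply.
  by apply: ler_sum => e _; rewrite addnS -addSn.
pose g a := wt (px + a) * wt (n.+1 + p - (px + a)) : R.
have g0 a : 0 <= g a by rewrite mulr_ge0 ?wt_ge0.
have b3 : \sum_(c <- cuts w | ci c == lidx x)
    `|- (kap * t (lidx x)) * (sg (isX x) * sg (cs c))| * om [:: postx x ++ cpre c] *
    wt (size (prex x ++ cpost c) + p) <= 16 * (kap * T) * wt (n.+1 + p).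
  apply: (@le_trans _ _ (\sum_(c <- cuts w) kap * T * g (size (cpre c)))).
    rewrite big_mkcond; apply: ler_sum_In => c /size_cut hc.
    case: ifP => _; last exact: mulr_ge0 (mulr_ge0 kap0 T0) (g0 _).
    rewrite !normrM normrN !norm_sg !mulr1 om_cons /om big_nil mulr1 !size_cat -/px.
    have -> : (size (prex x) + size (cpost c) + p = n.+1 + p - (px + size (cpre c)))%N.
      by rewrite /n -hc; move: sp; rewrite -/px; lia.
    rewrite -mulrA; apply: ler_wpM2r (g0 _) _ _ _.
    by rewrite ger0_norm ?mulr_ge0//; apply: ler_wpM2l.
  rewrite -mulr_sumr; apply: le_trans (ler_wpM2l (mulr_ge0 kap0 T0) (cuts_sum_le w g0)) _.
  have : \sum_(a < n.+1) g a <= 8 * wt (n.+1 + p).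
    apply: le_trans (wt_conv _); rewrite /g.
    have : (px <= 1)%N by rewrite -sp leq_addr.
    case: (px) => [_|[_|//]].
      apply: (@sum_ord_widen _ _ (fun a => wt a * wt (n.+1 + p - a))).
        by rewrite ltnS; apply: leq_trans (leq_addr _ _).
      by move=> a; rewrite mulr_ge0 ?wt_ge0.
    rewrite [leRHS]big_ord_recl /=.
    apply: (@le_trans _ _ (\sum_(i < n.+1 + p) wt i.+1 * wt (n.+1 + p - i.+1))); last first.
      by rewrite lerDr mulr_ge0 ?wt_ge0.
    apply: (@sum_ord_widen _ _ (fun a => wt a.+1 * wt (n.+1 + p - a.+1))).
      exact: leq_addr.
    by move=> a; rewrite mulr_ge0 ?wt_ge0.
  move=> h; have kT := mulr_ge0 kap0 T0.
  have -> : 16 * (kap * T) * wt (n.+1 + p) = kap * T * (2 * (8 * wt (n.+1 + p))) by ring.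
  by rewrite ler_wpM2l// ler_wpM2l.
rewrite big_filter; apply: le_trans (lerD b1 (lerD b2 b3)) _.
rewrite le_eqVlt; apply/orP; left; apply/eqP.
by rewrite -[n.+1%:R]natr1 /lamc; ring.
Qed.

Lemma Lm_bound ws : \sum_(e <- Lm ws) `|e.1| * om e.2 <= lamc * (deg ws)%:R * om ws.
Proof.
elim: ws => [|w ws IH]; first by rewrite big_nil mulr0 mul0r.
rewrite /= big_cat big_map big_map /= om_cons deg_cons natrD.
have -> : lamc * ((size w)%:R + (deg ws)%:R) * (wt (size w) * om ws) =
  lamc * (size w)%:R * wt (size w + 0) * om ws + wt (size w) * (lamc * (deg ws)%:R * om ws).
  by rewrite addn0; ring.
apply: lerD.
  apply: le_trans (ler_wpM2r (om_ge0 ws) (Lw_bound w 0)).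
  rewrite mulr_suml le_eqVlt; apply/orP; left; apply/eqP; apply: eq_bigr => e _.
  by rewrite om_cons om_cat addn0; ring.
apply: le_trans (ler_wpM2l (wt_ge0 _) IH).
rewrite mulr_sumr le_eqVlt; apply/orP; left; apply/eqP; apply: eq_bigr => e _.
by rewrite om_cons; ring.
Qed.

(* Mono c n [:: w1; ..; wr] stands for c lam^n tr(w1) .. tr(wr). *)
Record mono := Mono { mc : C; mn : nat; mw : seq word }.
Notation fp := (seq mono).
Implicit Types (f g : fp).

Definition scalef (a : R) f : fp := [seq Mono (a%:C * mc m) (mn m) (mw m) | m <- f].

Definition Lf f : fp :=
  flatten [seq [seq Mono (e.1%:C * mc m) (mn m) e.2 | e <- Lm (mw m)] | m <- f].

(** The gradient of a real part is projected to u(N), and [qq A B] is half of [ui A B] minus half of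
    the same with the adjoint of [B]. Hence two joins, one with the second word and one with its
    adjoint. *)
Definition joinr (m m' : mono) (a b : gr (q := q)) : fp :=
  if gi a == gi b then
    let k := 2^-1 * (kap * t (gi a) * (sg (gs a) * sg (gs b))) in
    [:: Mono ((- k)%:C * (mc m * mc m')) (mn m + mn m')
          ((gA a ++ gA b) :: grest a ++ grest b);
        Mono (k%:C * (mc m * conjc (mc m'))) (mn m + mn m')
          ((gA a ++ wstar (gA b)) :: grest a ++ map (@wstar q) (grest b))]
  else [::].

Definition Gam f g : fp :=
  flatten [seq flatten [seq flatten [seq flatten [seq joinr m m' a b | b <- gm (mw m')]
    | a <- gm (mw m)] | m' <- g] | m <- f].

(** The weighted norm of the part of total degree [D]. Degrees are kept apart because the generator
    preserves them and joins add them, while both cost factors that grow with the degree. *)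
Definition ND D f : R :=
  \sum_(m <- f) (deg (mw m) == D)%:R * (nrm (mc m) * om (mw m)).

Lemma ND_ge0 D f : 0 <= ND D f.
Proof. by apply: sumr_ge0 => m _; rewrite !mulr_ge0 ?nrm_ge0 ?om_ge0. Qed.

Lemma ND_cat D f g : ND D (f ++ g) = ND D f + ND D g.
Proof. by rewrite /ND big_cat. Qed.

Lemma ND_scale D a f : ND D (scalef a f) = `|a| * ND D f.
Proof.
rewrite /ND big_map mulr_sumr; apply: eq_bigr => m _ /=.
by rewrite nrmZ; ring.
Qed.

Lemma ND_flatten D (I : Type) (s : seq I) (h : I -> fp) :
  ND D (flatten [seq h i | i <- s]) = \sum_(i <- s) ND D (h i).
Proof. exact: sum_flatten. Qed.

Lemma ND_L D f : ND D (Lf f) <= lamc * D%:R * ND D f.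
Proof.
rewrite /Lf ND_flatten /ND mulr_sumr; apply: ler_sum => m _; rewrite big_map /=.
apply: (@le_trans _ _ ((deg (mw m) == D)%:R * nrm (mc m) * \sum_(e <- Lm (mw m)) `|e.1| * om e.2)).
  rewrite mulr_sumr; apply: ler_sum_In => e /deg_Lm ->.
  by rewrite nrmZ le_eqVlt; apply/orP; left; apply/eqP; ring.
apply: (@le_trans _ _ ((deg (mw m) == D)%:R * nrm (mc m) * (lamc * (deg (mw m))%:R * om (mw m)))).
  by rewrite ler_wpM2l ?Lm_bound// mulr_ge0 ?nrm_ge0.
case: eqP => [->|_]; last by rewrite !mul0r mulr0.
by rewrite le_eqVlt; apply/orP; left; apply/eqP; ring.
Qed.

Definition ratio a b : R := wt (a + b) * (wt a * wt b)^-1.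

Lemma om_gr ws a : List.In a (gm ws) -> wt (size (gA a)) * om (grest a) = om ws.
Proof.
elim: ws a => [//|w ws IH] a /= h; case: (List.in_app_or _ _ _ h) => h'.
  by have [c /size_cut hc ->] := In_map h'; rewrite /= om_cons size_cat addnC hc.
by have [a' /IH ha ->] := In_map h'; rewrite /= !om_cons -ha mulrCA.
Qed.

Lemma size_gm ws : size (gm ws) = deg ws.
Proof.
by elim: ws => //= w ws IH; rewrite size_cat !size_map size_cuts IH deg_cons.
Qed.

(** The two terms of a join carry a factor [1/2] each. The change of weight depends on the lengths
    of the two opened words and is largest when these exhaust the degrees, by [nat_ratio_le]. *)
Lemma ND_join D m m' a b : List.In a (gm (mw m)) -> List.In b (gm (mw m')) ->
  ND D (joinr m m' a b) <= (deg (mw m) + deg (mw m') == D)%N%:R *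
    (kap * T * (ratio (deg (mw m)) (deg (mw m')) *
      (nrm (mc m) * om (mw m) * (nrm (mc m') * om (mw m'))))).
Proof.
move=> ha hb; have r0 x y : 0 <= ratio x y by rewrite mulr_ge0 ?invr_ge0 ?mulr_ge0 ?wt_ge0.
have RHS0 : 0 <= kap * T * (ratio (deg (mw m)) (deg (mw m')) *
      (nrm (mc m) * om (mw m) * (nrm (mc m') * om (mw m')))).
  by rewrite !mulr_ge0 ?nrm_ge0 ?om_ge0 ?wt_ge0 ?invr_ge0 ?mulr_ge0 ?wt_ge0.
rewrite /joinr; case: ifP => _; last by rewrite /ND big_nil mulr_ge0.
rewrite /ND !big_cons big_nil addr0 /= !deg_cons !deg_cat !size_cat size_wstar deg_star.
have da := deg_gr ha; have db := deg_gr hb; have oa := om_gr ha; have ob := om_gr hb.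
have -> : (size (gA a) + size (gA b) + (deg (grest a) + deg (grest b)) = deg (mw m) + deg (mw m'))%N.
  by rewrite -da -db; lia.
case: (_ == D); last by rewrite !mul0r addr0.
rewrite !mul1r !nrmZ normrN !om_cons !om_cat om_star !size_cat size_wstar.
rewrite !normrM !norm_sg !mulr1 ger0_norm ?invr_ge0// (ger0_norm kap0) (ger0_norm (t0 _)).
set A := size (gA a) in da oa *; set B := size (gA b) in db ob *.
have w0 : 0 <= wt (A + B) * (om (grest a) * om (grest b)) by rewrite !mulr_ge0 ?wt_ge0 ?om_ge0.
have key : wt (A + B) * (om (grest a) * om (grest b)) <=
    ratio (deg (mw m)) (deg (mw m')) * (om (mw m) * om (mw m')).
  have -> : wt (A + B) * (om (grest a) * om (grest b)) = ratio A B * (om (mw m) * om (mw m')).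
    rewrite /ratio -oa -ob; field; rewrite !lt0r_neq0 ?wt_gt0//.
  rewrite ler_wpM2r ?mulr_ge0 ?om_ge0//; apply: nat_ratio_le; first by rewrite -da leq_addr.
  by rewrite -db leq_addr.
have n1 := nrmM (mc m) (mc m'); have n2 := nrmM (mc m) (conjc (mc m')); rewrite nrmJ in n2.
have n0 : 0 <= nrm (mc m) * nrm (mc m') by rewrite mulr_ge0 ?nrm_ge0.
have kt : 0 <= kap * t (gi a) by rewrite mulr_ge0.
set W := wt (A + B) * _ in w0 key *; set Q := ratio _ _ * (_ * _) in key.
have p1 : nrm (mc m * mc m') * W <= nrm (mc m) * nrm (mc m') * Q.
  by apply: ler_pM => //; exact: nrm_ge0.
have p2 : nrm (mc m * conjc (mc m')) * W <= nrm (mc m) * nrm (mc m') * Q.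
  by apply: ler_pM => //; exact: nrm_ge0.
apply: (@le_trans _ _ (kap * t (gi a) * (nrm (mc m) * nrm (mc m') * Q))).
  rewrite -!(mulrA (2^-1 * _)); apply: le_trans (lerD (ler_wpM2l _ p1) (ler_wpM2l _ p2)) _.
  - by rewrite mulr_ge0 ?invr_ge0.
  - by rewrite mulr_ge0 ?invr_ge0.
  by rewrite le_eqVlt; apply/orP; left; apply/eqP; field.
have -> : kap * T * (ratio (deg (mw m)) (deg (mw m')) *
      (nrm (mc m) * om (mw m) * (nrm (mc m') * om (mw m')))) =
   kap * T * (nrm (mc m) * nrm (mc m') * Q) by rewrite /Q; ring.
have Q0 : 0 <= Q by rewrite /Q mulr_ge0 ?r0// mulr_ge0 ?om_ge0.
by apply: ler_wpM2r; [exact: mulr_ge0 n0 Q0|exact: ler_wpM2l].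
Qed.

Lemma sum_const_In (I : Type) (s : seq I) (f : I -> R) x :
  (forall i, List.In i s -> f i <= x) -> \sum_(i <- s) f i <= (size s)%:R * x.
Proof.
move=> h; apply: le_trans (ler_sum_In (g := fun=> x) h) _.
by rewrite big_const_seq count_predT iter_addr_0 mulr_natl.
Qed.

Lemma indic_split D x y : ((x + y == D)%N%:R : R) =
  \sum_(a < D.+1) (x == a)%:R * (y == D - a)%N%:R.
Proof.
case: (leqP x D) => xD.
  rewrite (bigD1 (Ordinal (xD : (x < D.+1)%N)))//= eqxx mul1r big1 ?addr0.
    by congr ((nat_of_bool _)%:R); apply/eqP/eqP; lia.
  move=> a ax; rewrite (_ : (x == a) = false) ?mul0r//.
  by apply: contraNF ax => /eqP e; apply/eqP/val_inj.
rewrite big1; first by case: eqP => //; lia.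
by move=> a _; rewrite (_ : (x == a) = false) ?mul0r//; apply/eqP; have := ltn_ord a; lia.
Qed.

(** A monomial of degree [a] has [a] gradient terms, one per letter, so two monomials of degrees [a]
    and [D - a] have at most [a (D - a)] joins. *)
Lemma ND_Gam D f g : ND D (Gam f g) <= kap * T *
  \sum_(a < D.+1) (a%:R * (D - a)%N%:R * ratio a (D - a)) * (ND a f * ND (D - a) g).
Proof.
rewrite /Gam ND_flatten.
pose X m := nrm (mc m) * om (mw m).
pose dm m := deg (mw m).
have sz m : (dm m)%:R = (size (gm (mw m)))%:R :> R by rewrite size_gm.
apply: (@le_trans _ _ (\sum_(m <- f) \sum_(m' <- g) (dm m)%:R * ((dm m')%:R *
    ((dm m + dm m' == D)%N%:R * (kap * T * (ratio (dm m) (dm m') * (X m * X m'))))))).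
  apply: ler_sum => m _; rewrite ND_flatten; apply: ler_sum => m' _.
  rewrite ND_flatten (sz m); apply: sum_const_In => a ha.
  rewrite ND_flatten (sz m'); apply: sum_const_In => b hb.
  exact: ND_join.
rewrite le_eqVlt; apply/orP; left; apply/eqP.
transitivity (\sum_(m <- f) \sum_(m' <- g) \sum_(a < D.+1) kap * T *
   ((a%:R * (D - a)%N%:R * ratio a (D - a)) *
    (((dm m == a)%:R * X m) * ((dm m' == D - a)%N%:R * X m')))).
  apply: eq_bigr => m _; apply: eq_bigr => m' _.
  rewrite indic_split !mulr_suml !mulr_sumr; apply: eq_bigr => a _.
  case: eqP => [->|_]; last by rewrite !mul0r !mulr0.
  case: eqP => [->|_]; last by rewrite !(mul0r, mulr0).
  by ring.
rewrite mulr_sumr; under eq_bigr do rewrite exchange_big /=.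
rewrite exchange_big /=; apply: eq_bigr => a _.
rewrite /ND !mulr_suml !mulr_sumr; apply: eq_bigr => m _.
by rewrite mulr_sumr !mulr_sumr; apply: eq_bigr => m' _.
Qed.

(** Equates the coefficients of [(1 - tau)^k] in the Hamilton-Jacobi equation. Each term depends on
    all earlier ones, so the recursion carries their list. *)
Fixpoint phis (f0 : fp) k : seq fp :=
  if k is k'.+1 then
    let s := phis f0 k' in
    rcons s (scalef (k'.+1%:R)^-1 (Lf (nth [::] s k') ++
      scalef 2^-1 (flatten [seq Gam (nth [::] s i) (nth [::] s (k' - i)) | i <- iota 0 k'.+1])))
  else [:: f0].

Definition phi f0 k := nth [::] (phis f0 k) k.

Lemma size_phis f0 k : size (phis f0 k) = k.+1.
Proof. by elim: k => //= k IH; rewrite size_rcons IH. Qed.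

Lemma nth_phis f0 k i : (i <= k)%N -> nth [::] (phis f0 k) i = phi f0 i.
Proof.
elim: k => [|k IH]; first by case: i.
rewrite leq_eqVlt => /orP[/eqP ->//|ik].
by rewrite /= nth_rcons size_phis ik; exact: IH.
Qed.

Lemma phiS f0 k : phi f0 k.+1 = scalef (k.+1%:R)^-1 (Lf (phi f0 k) ++
  scalef 2^-1 (flatten [seq Gam (phi f0 i) (phi f0 (k - i)) | i <- iota 0 k.+1])).
Proof.
have e : [seq Gam (nth [::] (phis f0 k) i) (nth [::] (phis f0 k) (k - i)) | i <- iota 0 k.+1] =
    [seq Gam (phi f0 i) (phi f0 (k - i)) | i <- iota 0 k.+1].
  apply/eq_in_map => i; rewrite mem_iota add0n => /= ik.
  by rewrite !nth_phis// leq_subr.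
rewrite {1}/phi; have -> : phis f0 k.+1 = rcons (phis f0 k) (scalef (k.+1%:R)^-1
  (Lf (nth [::] (phis f0 k) k) ++ scalef 2^-1 (flatten
    [seq Gam (nth [::] (phis f0 k) i) (nth [::] (phis f0 k) (k - i)) | i <- iota 0 k.+1]))) by [].
by rewrite e nth_rcons size_phis ltnn eqxx nth_phis.
Qed.

Variables (cc : R).
Hypothesis cc0 : 0 <= cc.
Definition mu : R := lamc + 8 * (kap * T).

Lemma mu_ge0 : 0 <= mu.
Proof. by rewrite addr_ge0 ?lamc_ge0// !mulr_ge0. Qed.

(** The majorant of [ND D (phi f0 k)]: the Taylor coefficients in time of [exp (mu D s)], so that
    the sum over [i + j = k] in the recursion is a binomial formula. Of the five powers of [D + 1],
    the factors [a (D - a)] and [ratio] of a join leave enough for the weights [wt a * wt (D - a)],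
    whose convolution restores the fifth power at the price of a factor [D]. *)
Definition X D k : R := cc ^+ D * (D.+1%:R ^+ 5)^-1 * ((mu * D%:R) ^+ k / k`!%:R).

Lemma X_ge0 D k : 0 <= X D k.
Proof.
by rewrite /X !mulr_ge0 ?exprn_ge0 ?invr_ge0 ?exprn_ge0 ?mulr_ge0 ?mu_ge0 ?ler0n.
Qed.

Lemma exp_div_fact_sum (x y : R) k :
  \sum_(i < k.+1) (x ^+ i / i`!%:R) * (y ^+ (k - i) / (k - i)`!%:R) = (x + y) ^+ k / k`!%:R.
Proof.
have f0 n : (n`!%:R : R) != 0 by rewrite pnatr_eq0 -lt0n fact_gt0.
rewrite addrC exprDn mulr_suml; apply: eq_bigr => i _.
have ik : (i <= k)%N by rewrite -ltnS.
have <- : ('C(k, i) * (i`! * (k - i)`!))%:R = k`!%:R :> R by rewrite bin_fact.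
rewrite !natrM -mulr_natr; field; rewrite !f0 /= pnatr_eq0 -lt0n bin_gt0//.
Qed.

(** After clearing denominators this is [a b (a + b + 1) <= 2 (a + b) (a + 1) (b + 1)]. *)
Lemma Gam_bound_num (a b D : nat) : (a + b = D)%N ->
  a%:R * b%:R * ratio a b * ((a.+1%:R ^+ 5)^-1 * (b.+1%:R ^+ 5)^-1) <=
  2 * D%:R * (D.+1%:R ^+ 3)^-1 * (wt a * wt b) :> R.
Proof.
move=> <-; rewrite /ratio /wt.
have p n : (0 : R) < n.+1%:R by rewrite ltr0n.
have h : a%:R * b%:R * (a + b).+1%:R <= 2 * (a + b)%:R * (a.+1%:R * b.+1%:R) :> R.
  by rewrite -!natrM ler_nat; nia.
set x : R := a.+1%:R in h *; set y : R := b.+1%:R in h *; set z : R := (a + b).+1%:R in h *.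
have x0 : 0 < x by exact: p. 
have y0 : 0 < y by exact: p.
have z0 : 0 < z by exact: p.
set A : R := a%:R in h *; set B : R := b%:R in h *; set S : R := (a + b)%:R in h *.
have -> : A * B * ((z ^+ 2)^-1 * ((x ^+ 2)^-1 * (y ^+ 2)^-1)^-1) * ((x ^+ 5)^-1 * (y ^+ 5)^-1) =
   (x ^+ 3 * y ^+ 3 * z ^+ 3)^-1 * (A * B * z).
  by field; rewrite !lt0r_neq0.
have -> : 2 * S * (z ^+ 3)^-1 * ((x ^+ 2)^-1 * (y ^+ 2)^-1) =
   (x ^+ 3 * y ^+ 3 * z ^+ 3)^-1 * (2 * S * (x * y)).
  by field; rewrite !lt0r_neq0.
by rewrite ler_wpM2l// invr_ge0 !mulr_ge0 ?exprn_ge0// ltW.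
Qed.

Lemma Gam_sum_bound (F : nat -> fp) k D :
  (forall i a, (i <= k)%N -> ND a (F i) <= X a i) ->
  2^-1 * \sum_(i < k.+1) ND D (Gam (F i) (F (k - i)%N)) <= 8 * (kap * T) * D%:R * X D k.
Proof.
move=> hF; have kT := mulr_ge0 kap0 T0.
pose e (x : R) i := x ^+ i / i`!%:R.
have e0 x i : 0 <= x -> 0 <= e x i by move=> h; rewrite /e mulr_ge0 ?exprn_ge0 ?invr_ge0 ?ler0n.
have r0 x y : 0 <= ratio x y :> R by rewrite /ratio mulr_ge0 ?invr_ge0 ?mulr_ge0 ?wt_ge0.
apply: (@le_trans _ _ (2^-1 * (\sum_(i < k.+1) kap * T * \sum_(a < D.+1)
   cc ^+ D * (2 * D%:R * (D.+1%:R ^+ 3)^-1 * (wt a * wt (D - a))) *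
   (e (mu * a%:R) i * e (mu * (D - a)%N%:R) (k - i)%N)))).
  rewrite ler_wpM2l ?invr_ge0//; apply: ler_sum => i _.
  apply: le_trans (ND_Gam _ _ _) _; apply: ler_wpM2l => //; apply: ler_sum => a _.
  have aD : (a <= D)%N by rewrite -ltnS.
  have ik : (i <= k)%N by rewrite -ltnS.
  have h1 := hF i a ik; have h2 := hF (k - i)%N (D - a)%N (leq_subr _ _).
  apply: (@le_trans _ _ (a%:R * (D - a)%N%:R * ratio a (D - a) * (X a i * X (D - a) (k - i)))).
    apply: ler_wpM2l; first by rewrite mulr_ge0// mulr_ge0.
    by apply: ler_pM => //; exact: ND_ge0.
  have h3 := Gam_bound_num (subnKC aD).
  have -> : a%:R * (D - a)%N%:R * ratio a (D - a) * (X a i * X (D - a) (k - i)) =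
     cc ^+ D * (a%:R * (D - a)%N%:R * ratio a (D - a) *
       ((a.+1%:R ^+ 5)^-1 * ((D - a).+1%:R ^+ 5)^-1)) *
     (e (mu * a%:R) i * e (mu * (D - a)%N%:R) (k - i)%N).
    by rewrite -[in cc ^+ D](subnKC aD) exprD /X /e; ring.
  apply: ler_wpM2r; first by rewrite mulr_ge0// e0// mulr_ge0 ?mu_ge0.
  by apply: ler_wpM2l => //; exact: exprn_ge0.
rewrite -mulr_sumr exchange_big /=.
under eq_bigr => a _.
  rewrite -mulr_sumr exp_div_fact_sum -mulrDr -natrD subnKC; last by rewrite -ltnS.
  over.
rewrite -mulr_suml -mulr_sumr -mulr_sumr.
have h := wt_conv D.
(* The constant [8 * (kap * T)] is [1/2 * 2 * 8]: the half of the recursion, the 2 of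
   [Gam_bound_num] and the 8 of [wt_conv]. *)
apply: (@le_trans _ _ (2^-1 * (kap * T * (cc ^+ D * (2 * D%:R * (D.+1%:R ^+ 3)^-1 * (8 * wt D)) *
    ((mu * D%:R) ^+ k / k`!%:R))))).
  rewrite ler_wpM2l ?invr_ge0// ler_wpM2l//; apply: ler_wpM2r.
    by apply: e0; rewrite mulr_ge0 ?mu_ge0.
  apply: ler_wpM2l; first exact: exprn_ge0.
  by apply: ler_wpM2l; [rewrite mulr_ge0 ?mulr_ge0 ?invr_ge0 ?exprn_ge0|exact: h].
rewrite le_eqVlt; apply/orP; left; apply/eqP; rewrite /X /wt.
have D0 : (D.+1%:R : R) != 0 by rewrite pnatr_eq0.
have K0 : (k`!%:R : R) != 0 by rewrite pnatr_eq0 -lt0n fact_gt0.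
by move: (D.+1%:R : R) D0 => z z0; field; rewrite z0 K0.
Qed.

(** The majorant satisfies [(k + 1) X D (k + 1) = mu D X D k], and [mu D] is the cost [lamc D] of
    the generator plus the cost [8 (kap T) D] of the joins. *)
Lemma phi_bound f0 : (forall D, ND D f0 <= X D 0) -> forall k D, ND D (phi f0 k) <= X D k.
Proof.
move=> h0; suff main n k D : (k <= n)%N -> ND D (phi f0 k) <= X D k by move=> k D; exact: (main k).
elim: n k D => [|n IH] k D; first by rewrite leqn0 => /eqP ->; exact: h0.
rewrite leq_eqVlt => /orP[/eqP ->|]; last by rewrite ltnS; exact: IH.
rewrite phiS ND_scale ND_cat ND_scale ND_flatten.
have -> : \sum_(i <- iota 0 n.+1) ND D (Gam (phi f0 i) (phi f0 (n - i))) =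
   \sum_(i < n.+1) ND D (Gam (phi f0 i) (phi f0 (n - i)%N)).
  by rewrite -[in iota _ _](subn0 n.+1) -/(index_iota 0 n.+1) big_mkord.
rewrite [X in _ + X * _]ger0_norm ?invr_ge0// ger0_norm ?invr_ge0//.
have g := @Gam_sum_bound (phi f0) n D (fun i a h => IH i a h).
have l := le_trans (ND_L D (phi f0 n)) (ler_wpM2l (mulr_ge0 lamc_ge0 (ler0n _ D)) (IH n D (leqnn n))).
apply: (@le_trans _ _ (n.+1%:R^-1 * (lamc * D%:R * X D n + 8 * (kap * T) * D%:R * X D n))).
  by rewrite ler_wpM2l ?invr_ge0// lerD.
rewrite le_eqVlt; apply/orP; left; apply/eqP.
have K0 : (n`!%:R : R) != 0 by rewrite pnatr_eq0 -lt0n fact_gt0.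
rewrite /X factS natrM (exprS (mu * D%:R) n) /mu; set E := (_ * D%:R) ^+ n.
have N0 : (n.+1%:R : R) != 0 by rewrite pnatr_eq0.
have D0 : (D.+1%:R : R) != 0 by rewrite pnatr_eq0.
by move: (n.+1%:R : R) (D.+1%:R : R) N0 D0 => y z y0 z0; field; rewrite K0 y0 z0.
Qed.

(** Bounds the value of [f] at all unitary matrices, since normalised traces have modulus at most
    1. *)
Definition S1 f : R := \sum_(m <- f) nrm (mc m).

Lemma S1_scale a f : S1 (scalef a f) = `|a| * S1 f.
Proof. by rewrite /S1 big_map mulr_sumr; apply: eq_bigr => m _; rewrite nrmZ. Qed.

Lemma S1_flatten (I : Type) (s : seq I) (h : I -> fp) :
  S1 (flatten [seq h i | i <- s]) = \sum_(i <- s) S1 (h i).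
Proof. exact: sum_flatten. Qed.

Lemma S1_ge0 f : 0 <= S1 f. Proof. by apply: sumr_ge0 => m _; exact: nrm_ge0. Qed.

(** Removing the weights costs [(om ws)^-1 <= 4 ^+ deg ws]. *)
Lemma S1_le f (Dm : nat) : (forall m, List.In m f -> (deg (mw m) < Dm)%N) ->
  S1 f <= \sum_(D < Dm) 4 ^+ D * ND D f.
Proof.
move=> h; under eq_bigr do rewrite /ND mulr_sumr; rewrite exchange_big /=.
apply: ler_sum_In => m /h hm; rewrite (bigD1 (Ordinal hm))//= eqxx mul1r big1 ?addr0; last first.
  move=> D Dm'; rewrite (_ : (_ == _) = false) ?mul0r ?mulr0//.
  by apply: contraNF Dm' => /eqP e; apply/eqP/val_inj.
rewrite mulrCA -[leLHS]mulr1 ler_wpM2l ?nrm_ge0//.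
have o := om_gt0 (mw m); rewrite -ler_pdivrMr// mul1r; exact: inv_om_le.
Qed.

Lemma S1_bound f (B : nat -> R) (x : R) : (forall D, ND D f <= B D) ->
  (forall n, \sum_(D < n) 4 ^+ D * B D <= x) -> S1 f <= x.
Proof.
move=> hB hx; apply: le_trans (hx (\sum_(m <- f) deg (mw m)).+1).
apply: le_trans (S1_le (Dm := (\sum_(m <- f) deg (mw m)).+1) _) _.
  elim: f {hB} => [//|y f IH] m /= [->|/IH h]; rewrite big_cons ltnS ?leq_addr//.
  by rewrite ltnS in h; rewrite (leq_trans h)// leq_addl.
by apply: ler_sum => D _; rewrite ler_wpM2l ?exprn_ge0.
Qed.

Lemma pow_fact_le_exp (x : R) k : 0 <= x -> x ^+ k / k`!%:R <= expR x.
Proof.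
move=> x0; apply: (@le_trans _ _ (series (exp_coeff x) k.+1)).
  rewrite /series /= big_nat_recr//= lerDr; apply: sumr_ge0 => i _; exact: exp_coeff_ge0.
apply: nondecreasing_cvgn_le; last exact: is_cvg_series_exp_coeff.
by apply: nondecreasing_series => i _ _; exact: exp_coeff_ge0.
Qed.

Lemma geom_half n : \sum_(D < n) (2^-1 : R) ^+ D <= 2.
Proof.
suff : \sum_(D < n) (2^-1 : R) ^+ D = 2 - 2 * 2^-1 ^+ n.
  by move=> ->; rewrite lerBlDr lerDl mulr_ge0// exprn_ge0// invr_ge0.
elim: n => [|n IH]; first by rewrite big_ord0 expr0; ring.
by rewrite big_ord_recr /= IH exprS; field.
Qed.

Hypothesis small_cc : 8 * cc * expR (2 * mu) <= 2^-1.

(** Writing [(mu D)^k / k!] as [2^-k (2 mu D)^k / k!], which is at most [2^-k exp (2 mu D)], gives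
    up part of the radius for geometric decay in [k]. The base 8 leaves room for the [4 ^+ D] of
    [S1_le] and, as [D <= 2 ^+ D], for one factor [D]. *)
Lemma X_le D k : 8 ^+ D * X D k <= 2^-1 ^+ k * 2^-1 ^+ D.
Proof.
have m0 := mu_ge0; have e0 := expR_ge0 (2 * mu).
have h1 : (mu * D%:R) ^+ k / k`!%:R <= 2^-1 ^+ k * expR (2 * mu) ^+ D.
  have -> : (mu * D%:R) ^+ k / k`!%:R = 2^-1 ^+ k * ((2 * mu * D%:R) ^+ k / k`!%:R).
    by rewrite mulrA -exprMn; congr (_ ^+ _ / _); field.
  rewrite ler_wpM2l ?exprn_ge0 ?invr_ge0// -expRM_natr.
  by apply: pow_fact_le_exp; rewrite !mulr_ge0.
have h2 : (D.+1%:R ^+ 5)^-1 <= 1 :> R.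
  by rewrite invf_le1 ?exprn_gt0 ?ltr0n// exprn_ege1// ler1n.
have i5 : 0 <= (D.+1%:R ^+ 5)^-1 :> R by rewrite invr_ge0 exprn_ge0.
have f0' : 0 <= (mu * D%:R) ^+ k / k`!%:R.
  by apply: mulr_ge0; [apply: exprn_ge0; exact: mulr_ge0|rewrite invr_ge0].
apply: (@le_trans _ _ (8 ^+ D * (cc ^+ D * 1 * (2^-1 ^+ k * expR (2 * mu) ^+ D)))).
  rewrite ler_wpM2l ?exprn_ge0// /X; apply: ler_pM => //.
    by rewrite mulr_ge0 ?exprn_ge0.
  by rewrite ler_wpM2l ?exprn_ge0.
have -> : 8 ^+ D * (cc ^+ D * 1 * (2^-1 ^+ k * expR (2 * mu) ^+ D)) =
   2^-1 ^+ k * (8 * cc * expR (2 * mu)) ^+ D.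
  by rewrite !exprMn; ring.
rewrite ler_wpM2l ?exprn_ge0 ?invr_ge0// lerXn2r// nnegrE ?invr_ge0//.
by rewrite !mulr_ge0.
Qed.

Lemma X_sum k n : \sum_(D < n) 4 ^+ D * X D k <= 2 * 2^-1 ^+ k.
Proof.
apply: (@le_trans _ _ (\sum_(D < n) 2^-1 ^+ k * 2^-1 ^+ D)).
  apply: ler_sum => D _; apply: le_trans (X_le D k).
  by rewrite ler_wpM2r ?X_ge0// lerXn2r ?nnegrE// ler_nat.
rewrite -mulr_sumr mulrC ler_wpM2r ?exprn_ge0 ?invr_ge0//; exact: geom_half.
Qed.

Lemma DX_sum k n : \sum_(D < n) 4 ^+ D * (mu * D%:R * X D k) <= 2 * mu * 2^-1 ^+ k.
Proof.
apply: (@le_trans _ _ (\sum_(D < n) mu * (2^-1 ^+ k * 2^-1 ^+ D))).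
  apply: ler_sum => D _; apply: le_trans (ler_wpM2l mu_ge0 (X_le D k)).
  have -> : 4 ^+ D * (mu * D%:R * X D k) = mu * (4 ^+ D * D%:R * X D k) by ring.
  rewrite ler_wpM2l ?mu_ge0// ler_wpM2r ?X_ge0//.
  rewrite (_ : 8 = 4 * 2)%N// natrM exprMn ler_wpM2l ?exprn_ge0//.
  by rewrite -natrX ler_nat ltnW// ltn_expl.
rewrite -!mulr_sumr (mulrC 2) -!mulrA ler_wpM2l ?mu_ge0// mulrC ler_wpM2r ?exprn_ge0 ?invr_ge0//.
exact: geom_half.
Qed.

Variable f0 : fp.
Hypothesis hf0 : forall D, ND D f0 <= X D 0.

Lemma S1_phi k : S1 (phi f0 k) <= 2 * 2^-1 ^+ k.
Proof. by apply: (S1_bound (phi_bound hf0 k)); exact: X_sum. Qed.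

Lemma S1_Lphi k : S1 (Lf (phi f0 k)) <= 2 * mu * 2^-1 ^+ k.
Proof.
apply: (@S1_bound _ (fun D => mu * D%:R * X D k)); last exact: DX_sum.
move=> D; apply: le_trans (ND_L D _) _; rewrite -!mulrA; apply: ler_pM.
- exact: lamc_ge0.
- by rewrite mulr_ge0// ND_ge0.
- by rewrite /mu lerDl !mulr_ge0.
by rewrite ler_wpM2l// phi_bound.
Qed.

Lemma S1_Gam_sum k : 2^-1 * \sum_(i < k.+1) S1 (Gam (phi f0 i) (phi f0 (k - i)%N)) <=
  2 * mu * 2^-1 ^+ k.
Proof.
pose g := scalef 2^-1 (flatten [seq Gam (phi f0 i) (phi f0 (k - i)) | i <- iota 0 k.+1]).
have e (h : nat -> R) : \sum_(i <- iota 0 k.+1) h i = \sum_(i < k.+1) h i.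
  by rewrite -[in iota _ _](subn0 k.+1) -/(index_iota 0 k.+1) big_mkord.
have -> : 2^-1 * \sum_(i < k.+1) S1 (Gam (phi f0 i) (phi f0 (k - i)%N)) = S1 g.
  rewrite /g S1_scale S1_flatten ger0_norm ?invr_ge0//.
  by rewrite (e (fun i => S1 (Gam (phi f0 i) (phi f0 (k - i))))).
apply: (@S1_bound _ (fun D => mu * D%:R * X D k)); last exact: DX_sum.
move=> D; rewrite /g ND_scale ND_flatten ger0_norm ?invr_ge0//.
rewrite (e (fun i => ND D (Gam (phi f0 i) (phi f0 (k - i))))).
have := @Gam_sum_bound (phi f0) k D (fun i a _ => phi_bound hf0 i a).
move=> /le_trans; apply; rewrite ler_wpM2r ?X_ge0// ler_wpM2r// /mu lerDr lamc_ge0//.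
Qed.

End Formal.

(** * Traces of words in unitary matrices *)

(** The complex bilinear extension of the inner product, with real part [ui]. *)
HB.lock Definition qc {R : realType} {N : nat} (A B : 'M[R[i]]_N) : R[i] := - (N%:R * \tr (A *m B)).

Section ComplexForm.
Context {R : realType} {N : nat}.
Notation M := 'M[R[i]]_N.
Notation C := R[i].

Definition ii : C := 0 +i* 1.

Lemma reii z : re (ii * z) = - im z.
Proof. by rewrite reM /= mul0r mul1r sub0r. Qed.

Lemma imii z : im (ii * z) = re z.
Proof. by rewrite imM /= mul0r mul1r add0r. Qed.

Lemma skpZ (a : R) (A : M) : skp (a%:C *: A) = a%:C *: skp A.
Proof. apply: coord_inj => e; rewrite skp.unlock adjZ -scalerBr !coordZ; ring. Qed.

Lemma skpN (A : M) : skp (- A) = - skp A.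
Proof. by rewrite skp.unlock adjN -scalerN opprB opprK addrC. Qed.

(** Since [im z = re (- i z)], the imaginary part of a function with complex gradient [A] has the
    gradient [- i A], here projected to u(N). *)
Definition iskp (A : M) : M := skp (- (ii *: A)).

Lemma iskpD A B : iskp (A + B) = iskp A + iskp B.
Proof. by rewrite /iskp scalerDr opprD skpD. Qed.

Lemma iiZC (a : R) (A : M) : ii *: (a%:C *: A) = a%:C *: (ii *: A).
Proof. by rewrite !scalerA mulrC. Qed.

Lemma iiK (A : M) : ii *: (ii *: A) = - A.
Proof.
rewrite scalerA; have -> : ii * ii = -1 by apply: complex_eq; rewrite /=; ring.
by rewrite scaleN1r.
Qed.

Lemma scale_parts (z : C) (A : M) : z *: A = (re z)%:C *: A - (im z)%:C *: - (ii *: A).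
Proof.
rewrite scalerN opprK scalerA -scalerDl; congr (_ *: _).
by apply: complex_eq; rewrite ?reD ?imD ?reZ ?imZ /=; ring.
Qed.

Lemma skp_scale (z : C) (A : M) : skp (z *: A) = (re z)%:C *: skp A - (im z)%:C *: iskp A.
Proof. by rewrite scale_parts skpD skpN !skpZ. Qed.

Lemma iskp_scale (z : C) (A : M) : iskp (z *: A) = (re z)%:C *: iskp A + (im z)%:C *: skp A.
Proof.
have e : - (ii *: (z *: A)) = (re z)%:C *: - (ii *: A) + (im z)%:C *: A.
  rewrite {1}(scale_parts z A) scalerN opprK scalerDr !iiZC iiK opprD scalerN opprK.
  by rewrite scalerN.
by rewrite /iskp e skpD !skpZ.
Qed.

Lemma iskp0 : iskp 0 = 0.
Proof. by rewrite /iskp scaler0 oppr0 skp0. Qed.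

Lemma ui_ii (A B : M) : ui (ii *: A) B = ui A (ii *: B).
Proof. by rewrite !uiE -scalemxAl -scalemxAr. Qed.

Lemma adj_ii (A : M) : (ii *: A) ^t* = - (ii *: A ^t*).
Proof.
apply/matrixP => i j; rewrite adjE [in LHS]mxE [in RHS]mxE [in RHS]mxE adjE.
by apply: complex_eq; rewrite ?reN ?imN ?reJ ?imJ ?reii ?imii ?reJ ?imJ ?opprK.
Qed.

Lemma qq_half (A B : M) : qq A B = 2^-1 * (ui A B - ui A (B ^t*)).
Proof. by rewrite /qq -ui_skp; [rewrite skp.unlock uiZr uiBr|exact: skp_skew]. Qed.

Lemma re_qc (A B : M) : re (qc A B) = ui A B.
Proof. by rewrite qc.unlock uiE reN -natC reZ. Qed.

Lemma im_qc (A B : M) : im (qc A B) = - ui (ii *: A) B.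
Proof. by rewrite qc.unlock uiE -scalemxAl mxtraceZ reii imN -natC imZ; ring. Qed.

(** Together with [qq_iC]: the covariances of real and imaginary parts combine to the bilinear form
    [qc], as the terms with adjoints cancel. *)
Lemma qq_ii (A B : M) :
  qq A B - qq (- (ii *: A)) (- (ii *: B)) = re (qc A B).
Proof.
by rewrite !qq_half re_qc adjN adj_ii opprK !uiNl !uiNr !ui_ii !iiK !uiNr; field.
Qed.

Lemma qq_iC (A B : M) :
  qq A (- (ii *: B)) + qq (- (ii *: A)) B = im (qc A B).
Proof.
by rewrite !qq_half im_qc adjN adj_ii opprK !uiNl !uiNr !ui_ii; field.
Qed.

Lemma qq_skp (A B A' B' : M) : skp A = skp A' -> skp B = skp B' -> qq A B = qq A' B'.
Proof. by rewrite /qq => -> ->. Qed.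

Lemma qcDl (A A' B : M) : qc (A + A') B = qc A B + qc A' B.
Proof. by rewrite qc.unlock mulmxDl linearD/= mulrDr opprD. Qed.

Lemma qcDr (A B B' : M) : qc A (B + B') = qc A B + qc A B'.
Proof. by rewrite qc.unlock mulmxDr linearD/= mulrDr opprD. Qed.

Lemma qc0l (B : M) : qc 0 B = 0.
Proof. by rewrite qc.unlock mul0mx linear0 mulr0 oppr0. Qed.

Lemma qc0r (B : M) : qc B 0 = 0.
Proof. by rewrite qc.unlock mulmx0 linear0 mulr0 oppr0. Qed.

Lemma qcZl (z : C) (A B : M) : qc (z *: A) B = z * qc A B.
Proof. by rewrite qc.unlock -scalemxAl mxtraceZ mulrN mulrCA. Qed.

Lemma qcZr (z : C) (A B : M) : qc A (z *: B) = z * qc A B.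
Proof. by rewrite qc.unlock -scalemxAr mxtraceZ mulrN mulrCA. Qed.

Lemma qc_suml (I : Type) (s : seq I) (p : pred I) (F : I -> M) B :
  qc (\sum_(i <- s | p i) F i) B = \sum_(i <- s | p i) qc (F i) B.
Proof. by apply: (big_morph (qc^~ B)); [by move=> x y; exact: qcDl|exact: qc0l]. Qed.

Lemma qc_sumr (I : Type) (s : seq I) (p : pred I) (F : I -> M) B :
  qc B (\sum_(i <- s | p i) F i) = \sum_(i <- s | p i) qc B (F i).
Proof. by apply: (big_morph (qc B)); [by move=> x y; exact: qcDr|exact: qc0r]. Qed.

End ComplexForm.

Lemma addr_adbc {V : nmodType} (a b c e : V) : (a + e) + (b + c) = (a + b) + (c + e).
Proof. by rewrite addrACA (addrC e). Qed.

(** * The calculus for complex-valued functions *)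

Section ComplexGood.
Context {d : measure_display} {Omega : measurableType d} {R : realType} {q N : nat}.
Variable P : probability Omega R.
Notation M := 'M[R[i]]_N.
Notation C := R[i].
Notation uT := (unitary R N).
Notation ut := ('I_q -> uT).
Variables (U : 'I_q -> R -> Omega -> uT) (t : 'I_q -> R).
Variable E : 'I_q -> (uT -> R) -> (uT -> R) -> (uT -> M) -> Prop.
Hypothesis cE : forall i, calculus P (U i) (t i) (E i).

Notation good := (good t E).
Implicit Types (f L : R -> ut -> C) (G : 'I_q -> R -> ut -> M).

Definition ccdc G G' tau u : C := \sum_i (t i * gauss2)%:C * qc (G i tau u) (G' i tau u).

(* A complex gradient: d f = sum_i <G_i, u_i^-1 d u_i> for the complex bilinear extension
   of the inner product. *)
Definition cgood f L G := exists D1 D2,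
  [/\ good (fun tau u => re (f tau u)) (fun tau u => re (L tau u)) D1,
      good (fun tau u => im (f tau u)) (fun tau u => im (L tau u)) D2,
      forall i tau u, skp (D1 i tau u) = skp (G i tau u) &
      forall i tau u, skp (D2 i tau u) = iskp (G i tau u)].

Lemma cgood_ext f L G f' L' G' : cgood f L G -> (forall tau u, f tau u = f' tau u) ->
  (forall tau u, L tau u = L' tau u) -> (forall i tau u, G i tau u = G' i tau u) -> cgood f' L' G'.
Proof.
move=> g hf hL hG.
have <- : f = f' by apply/funext => tau; apply/funext => u.
have <- : L = L' by apply/funext => tau; apply/funext => u.
by have <- : G = G' by apply/funext => i; apply/funext => tau; apply/funext => u.
Qed.

Lemma cgood_add f L G f' L' G' : cgood f L G -> cgood f' L' G' ->
  cgood (fun tau u => f tau u + f' tau u) (fun tau u => L tau u + L' tau u)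
    (fun i tau u => G i tau u + G' i tau u).
Proof.
move=> [D1 [D2 [g1 g2 s1 s2]]] [D1' [D2' [g1' g2' s1' s2']]].
exists (fun i tau u => D1 i tau u + D1' i tau u), (fun i tau u => D2 i tau u + D2' i tau u).
split.
- by apply: good_ext (good_add g1 g1') _ _ _ => // tau u; rewrite reD.
- by apply: good_ext (good_add g2 g2') _ _ _ => // tau u; rewrite imD.
- by move=> i tau u; rewrite !skpD s1 s1'.
by move=> i tau u; rewrite !skpD s2 s2' iskpD.
Qed.

Lemma cgood_cst (c : C) : cgood (fun _ _ => c) (fun _ _ => 0) (fun _ _ _ => 0).
Proof.
exists (fun _ _ _ => 0), (fun _ _ _ => 0); split.
- apply: good_ext (good_poly cE (re c)%:P) _ _ _ => //= tau u; rewrite ?derivC ?horner0 ?hornerC//.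
- apply: good_ext (good_poly cE (im c)%:P) _ _ _ => //= tau u; rewrite ?derivC ?horner0 ?hornerC//.
- by [].
by move=> i tau u; rewrite iskp0 skp0.
Qed.

Lemma good_neg (f L : R -> ut -> R) D : good f L D ->
  good (fun tau u => - f tau u) (fun tau u => - L tau u) (fun i tau u => - D i tau u).
Proof.
move=> g; apply: good_ext (good_mul cE (good_poly cE (-1)%:P) g) _ _ _ => [tau u|tau u|i tau u].
- by rewrite hornerC mulN1r.
- rewrite hornerC derivC horner0 mulN1r mulr0 addr0 [cdc _ _ _ _ _]big1 ?addr0// => i _.
  by rewrite -(scale0r 0) qqZl !(mul0r, mulr0).
by rewrite hornerC scaler0 addr0 rmorphN1 scaleN1r.
Qed.

Lemma cgood_mul f L G f' L' G' : cgood f L G -> cgood f' L' G' ->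
  cgood (fun tau u => f tau u * f' tau u)
    (fun tau u => f tau u * L' tau u + f' tau u * L tau u + ccdc G G' tau u)
    (fun i tau u => f tau u *: G' i tau u + f' tau u *: G i tau u).
Proof.
move=> [D1 [D2 [g1 g2 s1 s2]]] [D1' [D2' [g1' g2' s1' s2']]].
have e1 tau u : cdc t D1 D1' tau u - cdc t D2 D2' tau u = re (ccdc G G' tau u).
  rewrite /cdc /ccdc re_sum -sumrB; apply: eq_bigr => i _; rewrite reZ -qq_ii.
  rewrite (qq_skp (s1 i tau u) (s1' i tau u)) (qq_skp (s2 i tau u) (s2' i tau u)); ring.
have e2 tau u : cdc t D1 D2' tau u + cdc t D2 D1' tau u = im (ccdc G G' tau u).
  rewrite /cdc /ccdc im_sum -big_split; apply: eq_bigr => i _; rewrite imZ -qq_iC.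
  rewrite (qq_skp (s1 i tau u) (s2' i tau u)) (qq_skp (s2 i tau u) (s1' i tau u)) /=; ring.
have m1 := good_add (good_mul cE g1 g1') (good_neg (good_mul cE g2 g2')).
have m2 := good_add (good_mul cE g1 g2') (good_mul cE g2 g1').
eexists; eexists; split.
- apply: good_ext m1 _ _ (fun _ _ _ => erefl) => [tau u|tau u]; first by rewrite reM.
  by rewrite !reD !reM -e1; ring.
- apply: good_ext m2 _ _ (fun _ _ _ => erefl) => [tau u|tau u].
    by rewrite imM; congr (_ + _); exact: mulrC.
  by rewrite !imD !imM -e2; ring.
- move=> i tau u; rewrite skpD skpN !skpD !skpZ s1 s1' s2 s2' !skp_scale.
  by rewrite opprD addrACA.
move=> i tau u; rewrite !skpD !skpZ s1 s1' s2 s2' !iskpD !iskp_scale.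
exact: addr_adbc.
Qed.

Lemma ccdc0l G tau u : ccdc (fun _ _ _ => 0) G tau u = 0.
Proof. by rewrite /ccdc big1// => i _; rewrite qc0l mulr0. Qed.

Lemma cgood_scale (c : C) f L G : cgood f L G ->
  cgood (fun tau u => c * f tau u) (fun tau u => c * L tau u) (fun i tau u => c *: G i tau u).
Proof.
move=> g; apply: cgood_ext (cgood_mul (cgood_cst c) g) _ _ _ => //.
  by move=> tau u; rewrite mulr0 ccdc0l !addr0.
by move=> i tau u; rewrite scaler0 addr0.
Qed.

Lemma cgood_sum (I : Type) (s : seq I) (f L : I -> R -> ut -> C) (G : I -> 'I_q -> R -> ut -> M) :
  (forall i, cgood (f i) (L i) (G i)) ->
  cgood (fun tau u => \sum_(i <- s) f i tau u) (fun tau u => \sum_(i <- s) L i tau u)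
    (fun j tau u => \sum_(i <- s) G i j tau u).
Proof.
move=> h; elim: s => [|i s IH].
  by apply: cgood_ext (cgood_cst 0) _ _ _ => *; rewrite big_nil.
by apply: cgood_ext (cgood_add (h i) IH) _ _ _ => *; rewrite big_cons.
Qed.

End ComplexGood.

Section DeltaMatrices.
Context {R : realType} {N : nat}.
Notation M := 'M[R[i]]_N.
Implicit Types (A B X Y : M) (a b k l : 'I_N).

Lemma mul_delta_l X k a i j : (delta_mx k a *m X) i j = (i == k)%:R * X a j.
Proof.
rewrite mxE (bigD1 a)//= mxE eqxx andbT big1 ?addr0// => l la.
by rewrite mxE (negbTE la) andbF mul0r.
Qed.

Lemma mul_delta_r X b k i j : (X *m delta_mx b k) i j = X i b * (j == k)%:R.
Proof.
rewrite mxE (bigD1 b)//= mxE eqxx /= big1 ?addr0// => l lb.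
by rewrite mxE (negbTE lb) mulr0.
Qed.

Lemma trace_delta_mul k l Y : \tr (delta_mx k l *m Y) = Y l k.
Proof.
rewrite /mxtrace (bigD1 k)//= mul_delta_l eqxx mul1r big1 ?addr0// => i ik.
by rewrite mul_delta_l (negbTE ik) mul0r.
Qed.

Lemma delta_mul_delta X k a b l : delta_mx k a *m X *m delta_mx b l = X a b *: delta_mx k l.
Proof.
apply/matrixP => i j; rewrite mul_delta_r mul_delta_l [RHS]mxE mxE.
by rewrite mulrAC mulrC -natrM mulnb.
Qed.

(** The noise inserted at two places is contracted: the trace of a product with two matrix units
    falls apart into two entries. All splittings of words come from this identity. *)
Lemma qc_delta A B A' B' k a b l :
  qc (A *m delta_mx k a *m B) (A' *m delta_mx b l *m B') =
  - (N%:R * ((B *m A') a b * (B' *m A) l k)).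
Proof.
have e : A *m delta_mx k a *m B *m (A' *m delta_mx b l *m B') =
    A *m (delta_mx k a *m (B *m A') *m delta_mx b l *m B') by rewrite !mulmxA.
rewrite qc.unlock e mxtrace_mulC delta_mul_delta -!scalemxAl mxtraceZ -mulmxA.
by rewrite trace_delta_mul.
Qed.

Lemma sum_delta_l A B X a b :
  \sum_k X a k *: (A *m delta_mx b k *m B) = A *m delta_mx b a *m (X *m B).
Proof.
have -> : A *m delta_mx b a *m (X *m B) = A *m (delta_mx b a *m X) *m B by rewrite !mulmxA.
under eq_bigr => k _ do rewrite scalemxAl scalemxAr.
rewrite -mulmx_suml -mulmx_sumr; congr (_ *m _ *m _).
apply/matrixP => i j; rewrite summxE mul_delta_l (bigD1 j)//= !mxE eqxx andbT mulrC big1 ?addr0// => k kj.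
by rewrite !mxE [j == k]eq_sym (negbTE kj) andbF mulr0.
Qed.

Lemma sum_delta_r A B X a b :
  \sum_k X k b *: (A *m delta_mx k a *m B) = (A *m X) *m delta_mx b a *m B.
Proof.
rewrite -(mulmxA A X); under eq_bigr => k _ do rewrite scalemxAl scalemxAr.
rewrite -mulmx_suml -mulmx_sumr; congr (_ *m _ *m _).
apply/matrixP => i j; rewrite summxE mul_delta_r (bigD1 i)//= !mxE eqxx /= big1 ?addr0// => k ki.
by rewrite !mxE eq_sym (negbTE ki) mulr0.
Qed.

End DeltaMatrices.

Section WordEvaluation.
Context {R : realType} {q N : nat}.
Notation M := 'M[R[i]]_N.
Notation C := R[i].
Notation word := (seq (letter q)).
Implicit Types (u : 'I_q -> unitary R N) (w : word) (ws : seq word).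

Definition lev u (x : letter q) : M :=
  match x with inl i => unitary_val (u i) | inr i => (unitary_val (u i)) ^t* end.
Definition wev u w : M := foldr (fun x A => lev u x *m A) 1%:M w.
Definition trn u w : C := (N%:R^-1 : R)%:C * \tr (wev u w).
Definition tre u ws : C := \prod_(w <- ws) trn u w.

Lemma wev_cons u x w : wev u (x :: w) = lev u x *m wev u w.
Proof. by []. Qed.

Lemma wev_cat u w w' : wev u (w ++ w') = wev u w *m wev u w'.
Proof. by elim: w => [|x w IH] /=; rewrite ?mul1mx// IH mulmxA. Qed.

Lemma tre_cons u w ws : tre u (w :: ws) = trn u w * tre u ws.
Proof. by rewrite /tre big_cons. Qed.

Lemma tre_cat u ws ws' : tre u (ws ++ ws') = tre u ws * tre u ws'.
Proof. by rewrite /tre big_cat. Qed.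

Lemma tre0 u : tre u [::] = 1.
Proof. by rewrite /tre big_nil. Qed.

Lemma adj1 : (1%:M : M) ^t* = 1%:M.
Proof. by rewrite trmx1 map_mx1. Qed.

Lemma lev_swap u x : lev u (letter_swap x) = (lev u x) ^t*.
Proof. by case: x => i /=; rewrite ?adjK. Qed.

Lemma wev_star u w : wev u (wstar w) = (wev u w) ^t*.
Proof.
elim: w => [|x w IH]; first by rewrite /= adj1.
by rewrite /wstar /= rev_cons -cats1 wev_cat -/(wstar w) IH adjM /= mulmx1 lev_swap.
Qed.

Lemma trn_star u w : trn u (wstar w) = conjc (trn u w).
Proof.
rewrite /trn wev_star tr_adj; apply: complex_eq; rewrite ?reJ ?imJ !(reZ, imZ) ?reJ ?imJ//.
by rewrite mulrN.
Qed.

Lemma conjM (x y : C) : conjc (x * y) = conjc x * conjc y.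
Proof. by apply: complex_eq; rewrite !(reM, imM, reJ, imJ); ring. Qed.

Lemma tre_star u ws : tre u (map (@wstar q) ws) = conjc (tre u ws).
Proof.
elim: ws => [|w ws IH]; first by rewrite !tre0; apply: complex_eq; rewrite /= ?oppr0.
by rewrite [map _ _]/= !tre_cons IH trn_star; symmetry; exact: conjM.
Qed.

Lemma adj_unitary (A : M) : A \is unitarymx -> A ^t* \is unitarymx.
Proof.
move=> h; apply/unitarymxP; rewrite adjK.
have := mulmxKtV 1%:M h erefl; rewrite mul1mx => ->//.
Qed.

Lemma lev_unitary u x : lev u x \is unitarymx.
Proof. by case: x => i /=; [exact: (valP (u i))|apply: adj_unitary; exact: (valP (u i))]. Qed.

Lemma wev_unitary u w : wev u w \is unitarymx.
Proof.
elim: w => [|x w IH]; last exact: (mul_unitarymx (lev_unitary u x) IH).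
by apply/unitarymxP; rewrite mul1mx adj1.
Qed.

Lemma norm_le1_sq (z : C) : re z ^+ 2 + im z ^+ 2 <= 1 -> `|z| <= 1.
Proof.
case: z => a b /= h; rewrite normc_def /= -[1]/(1%:C) lecR -[leRHS]sqrtr1.
by rewrite ler_sqrt.
Qed.

Lemma re_le_norm (z : C) (a : R) : `|z| <= a%:C -> `|re z| <= a.
Proof.
move=> h; have := le_trans (normc_ge_Re z) h; by rewrite lecR.
Qed.

Lemma trn_le u w : `|trn u w| <= 1.
Proof.
rewrite /trn normrM.
have n0 : 0 <= N%:R^-1 :> R by rewrite invr_ge0.
have -> : `|(N%:R^-1 : R)%:C| = (N%:R^-1 : R)%:C :> C by rewrite ger0_norm// lecR.
have h : `|\tr (wev u w)| <= (N%:R : R)%:C :> C.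
  apply: le_trans (ler_norm_sum _ _ _) _; apply: le_trans (ler_sum _ (G := fun=> 1) _) _.
    by move=> i _; apply: norm_le1_sq; apply: unitary_entry_le; exact: wev_unitary.
  by rewrite sumr_const card_ord natC.
apply: le_trans (ler_wpM2l _ h) _; first by rewrite lecR.
have -> : (1 : C) = (1 : R)%:C by [].
rewrite -rmorphM lecR.
have [->|N0] := eqVneq N 0%N; first by rewrite mulr0.
by rewrite mulVf// pnatr_eq0.
Qed.

Lemma tre_le u ws : `|tre u ws| <= 1.
Proof.
elim: ws => [|w ws IH]; first by rewrite tre0 normr1.
by rewrite tre_cons normrM -[leRHS]mul1r ler_pM//; exact: trn_le.
Qed.

End WordEvaluation.

(** * Generator and gradient of words and of products of traces *)

Section WordGood.
Context {d : measure_display} {Omega : measurableType d} {R : realType} {q N : nat}.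
Variable P : probability Omega R.
Notation M := 'M[R[i]]_N.
Notation C := R[i].
Notation uT := (unitary R N).
Notation ut := ('I_q -> uT).
Notation word := (seq (letter q)).
Variables (U : 'I_q -> R -> Omega -> uT) (t : 'I_q -> R).
Variable E : 'I_q -> (uT -> R) -> (uT -> R) -> (uT -> M) -> Prop.
Hypothesis cE : forall i, calculus P (U i) (t i) (E i).

Notation cgood := (cgood t E).
Notation kap := (@gauss2 R).
Implicit Types (w : word) (ws : seq word) (j : 'I_q) (u : ut).

Lemma skp_adj (A : M) : skp (A ^t*) = - skp A.
Proof. by rewrite skp.unlock adjK -scalerN opprB. Qed.

Lemma iskp_adj (A : M) : iskp (A ^t*) = iskp A.
Proof. by rewrite {1}/iskp -adj_ii skp_adj -skpN. Qed.

Lemma adj_delta (a b : 'I_N) : (delta_mx b a : M) ^t* = delta_mx a b.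
Proof.
apply/matrixP => i j; rewrite adjE !mxE andbC.
by case: (_ && _); apply: complex_eq; rewrite /= ?oppr0.
Qed.

(** The scale [- 1/N] is that of [gbasis]; the sign is that of the noise at a letter, plus for [X]
    and minus for [Y]. *)
Definition gcf (s : bool) : C := (- (N%:R^-1) * sg s : R)%:C.

Definition letterG u (x : letter q) (a b : 'I_N) j : M :=
  if j == lidx x then gcf (isX x) *: (wev u (postx x) *m delta_mx b a *m wev u (prex x)) else 0.

Lemma gbasis_re (a b : 'I_N) : gbasis (a, b, true) = (- (N%:R^-1) : R)%:C *: delta_mx b a :> M.
Proof.
rewrite /gbasis /=; congr (_ *: _).
by apply: complex_eq; rewrite ?reN ?imN /= -natC -fmorphV /= ?oppr0.
Qed.

Lemma gbasis_im (a b : 'I_N) : gbasis (a, b, false) = - (ii *: ((- (N%:R^-1) : R)%:C *: delta_mx b a)) :> M.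
Proof.
rewrite /gbasis /= scalerA -scaleNr; congr (_ *: _).
by apply: complex_eq; rewrite ?reN ?imN ?reii ?imii /= ?oppr0 ?opprK.
Qed.

Lemma cgood_letter x a b : cgood (fun _ u => lev u x a b)
  (fun _ u => (- 2^-1 * t (lidx x))%:C * lev u x a b) (fun j _ u => letterG u x a b j).
Proof.
case: x => i.
  eexists; eexists; split.
  - apply: good_ext (good_coord cE i (a, b, true)) _ _ (fun _ _ _ => erefl) => [tau u|tau u].
      by rewrite coord.unlock.
    by rewrite coord.unlock reZ.
  - apply: good_ext (good_coord cE i (a, b, false)) _ _ (fun _ _ _ => erefl) => [tau u|tau u].
      by rewrite coord.unlock.
    by rewrite coord.unlock imZ.
  - move=> j tau u; rewrite /letterG /= !mul1mx !mulmx1 /gcf /sg mulr1; case: (eqVneq j i) => // _.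
    by rewrite gbasis_re -scalemxAl.
  move=> j tau u; rewrite /letterG /= !mul1mx !mulmx1 /gcf /sg mulr1; case: (eqVneq j i) => _.
    by rewrite gbasis_im mulNmx -!scalemxAl.
  by rewrite iskp0 skp0.
eexists; eexists; split.
- apply: good_ext (good_coord cE i (b, a, true)) _ _ (fun _ _ _ => erefl) => [tau u|tau u].
    by rewrite coord.unlock adjE reJ.
  by rewrite coord.unlock reZ adjE reJ.
- apply: good_ext (good_neg cE (good_coord cE i (b, a, false))) _ _ (fun _ _ _ => erefl) => [tau u|tau u].
    by rewrite coord.unlock adjE imJ.
  by rewrite coord.unlock imZ adjE imJ mulrN.
- move=> j tau u; rewrite /letterG /= !mulmx1 /gcf /sg mulrN mulr1 opprK; case: (eqVneq j i) => // _.
  rewrite -(adj_delta b a) -adjM -adjZ skp_adj gbasis_re -scalemxAl.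
  by rewrite rmorphN scaleNr skpN.
move=> j tau u; rewrite /letterG /= !mulmx1 /gcf /sg mulrN mulr1 opprK; case: (eqVneq j i) => _.
  rewrite -(adj_delta b a) -adjM -adjZ iskp_adj gbasis_im mulNmx opprK -!scalemxAl.
  by rewrite rmorphN scaleNr scalerN.
by rewrite iskp0 oppr0 skp0.
Qed.

Definition wG u w (a b : 'I_N) j : M :=
  \sum_(c <- cuts w | ci c == j) gcf (cs c) *: (wev u (cpost c) *m delta_mx b a *m wev u (cpre c)).

Definition wL u w : M :=
  \sum_(e <- Lw t kap w) ((e.1.1)%:C * tre u e.1.2) *: wev u e.2.

Lemma wG_cons u x w a b j :
  \sum_k (lev u x a k *: wG u w k b j + wev u w k b *: letterG u x a k j) = wG u (x :: w) a b j.
Proof.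
rewrite big_split /= /wG big_cons big_map /= addrC /letterG [lidx x == j]eq_sym.
have -> : \sum_k lev u x a k *: (\sum_(c <- cuts w | ci c == j)
      gcf (cs c) *: (wev u (cpost c) *m delta_mx b k *m wev u (cpre c))) =
   \sum_(c <- cuts w | ci c == j) gcf (cs c) *: (wev u (cpost c) *m delta_mx b a *m
      (lev u x *m wev u (cpre c))).
  under eq_bigr => k _ do rewrite scaler_sumr.
  rewrite exchange_big /=; apply: eq_bigr => c _.
  rewrite -sum_delta_l scaler_sumr; apply: eq_bigr => k _.
  by rewrite !scalerA mulrC.
case: (j == lidx x); last by rewrite big1 ?add0r// => k _; rewrite scaler0.
congr (_ + _); rewrite wev_cat -sum_delta_r scaler_sumr; apply: eq_bigr => k _.
by rewrite !scalerA mulrC.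
Qed.

Lemma wL_cons u x w : wL u (x :: w) = (- 2^-1 * t (lidx x))%:C *: wev u (x :: w) + lev u x *m wL u w +
  \sum_(c <- cuts w | ci c == lidx x)
    ((- (kap * t (lidx x)) * (sg (isX x) * sg (cs c)))%:C * trn u (postx x ++ cpre c)) *:
      (wev u (prex x) *m wev u (cpost c)).
Proof.
rewrite /wL /= big_cons big_cat /= !big_map /= big_filter tre0 mulr1 -addrA.
congr (_ + (_ + _)).
  by rewrite mulmx_sumr; apply: eq_bigr => e _; rewrite scalemxAr.
by apply: eq_bigr => c _; rewrite tre_cons tre0 mulr1 wev_cat.
Qed.

Lemma gcf_num (N0 : (N != 0)%N) (ti : R) (s s' : bool) (T : C) :
  (ti * kap)%:C * (gcf s * (gcf s' * - (N%:R * T))) =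
  (- (kap * ti) * (sg s * sg s'))%:C * ((N%:R^-1 : R)%:C * T).
Proof.
have n0 : (N%:R : R) != 0 by rewrite pnatr_eq0.
rewrite /gcf -natC; apply: complex_eq; rewrite !(reM, imM, reN, imN) /=; field => //.
Qed.

(** Contracting the noise at [x] with the noise at a cut of [w] closes the word between them, by the
    sum over [k], to a trace. The factor [N] of [qc] and the two factors [1/N] of [gcf] leave [1/N]:
    the trace comes out normalised and no power of [N] remains. *)
Lemma ccdc_letter_word u x w a b (tau : R) :
  \sum_k ccdc t (fun j _ u => letterG u x a k j) (fun j _ u => wG u w k b j) tau u =
  \sum_(c <- cuts w | ci c == lidx x)
    ((- (kap * t (lidx x)) * (sg (isX x) * sg (cs c)))%:C * trn u (postx x ++ cpre c)) *
      (wev u (prex x) *m wev u (cpost c)) a b.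
Proof.
(* An index [a : 'I_N] exists. *)
have N0 : (N != 0)%N by case: (N) a => [[]|].
have e k : ccdc t (fun j _ u => letterG u x a k j) (fun j _ u => wG u w k b j) tau u =
    \sum_(c <- cuts w | ci c == lidx x) (t (lidx x) * kap)%:C * (gcf (isX x) * (gcf (cs c) *
       - (N%:R * ((wev u (cpre c) *m wev u (postx x)) k k *
          (wev u (prex x) *m wev u (cpost c)) a b)))).
  rewrite /ccdc (bigD1 (lidx x))//= big1 ?addr0 => [|j /negbTE jx]; last first.
    by rewrite /letterG jx qc0l mulr0.
  rewrite /letterG eqxx qcZl /wG qc_sumr !mulr_sumr; apply: eq_bigr => c _.
  by rewrite qcZr qc_delta [X in N%:R * X]mulrC.
rewrite (eq_bigr _ (fun k _ => e k)) exchange_big /=; apply: eq_bigr => c _.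
under eq_bigr => k _ do rewrite (gcf_num N0).
by rewrite -!mulr_sumr -mulr_suml /trn wev_cat mxtrace_mulC !mulrA.
Qed.

Lemma cgood_word w a b : cgood (fun _ u => wev u w a b) (fun _ u => wL u w a b)
  (fun j _ u => wG u w a b j).
Proof.
elim: w a b => [|x w IH] a b.
  apply: cgood_ext (cgood_cst cE ((1%:M : M) a b)) _ _ _ => // [tau u|j tau u].
    by rewrite /wL big_nil mxE.
  by rewrite /wG big_nil.
apply: cgood_ext (cgood_sum cE (index_enum 'I_N)
  (fun k => cgood_mul cE (cgood_letter x a k) (IH k b))) _ _ _ => [tau u|tau u|j tau u].
- by rewrite wev_cons mxE.
- rewrite wL_cons big_split /= ccdc_letter_word big_split /= !mxE summxE.
  congr (_ + _); last by apply: eq_bigr => c _; rewrite [RHS]mxE.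
  rewrite addrC; congr (_ + _); rewrite mulr_sumr; apply: eq_bigr => k _.
  by rewrite mulrCA [wev _ _ _ _ * _]mulrC.
exact: wG_cons.
Qed.

Lemma cgood_trn w : cgood (fun _ u => trn u w)
  (fun _ u => \sum_(e <- Lw t kap w) (e.1.1)%:C * (tre u e.1.2 * trn u e.2))
  (fun j _ u => \sum_(c <- cuts w | ci c == j)
     (- ((N%:R ^+ 2)^-1 * sg (cs c)) : R)%:C *: wev u (cpost c ++ cpre c)).
Proof.
apply: cgood_ext (cgood_scale cE ((N%:R^-1 : R)%:C) (cgood_sum cE (index_enum 'I_N)
   (fun a => cgood_word w a a))) _ _ _ => [//|tau u|j tau u].
  rewrite /wL; under eq_bigr => a _ do rewrite summxE.
  rewrite exchange_big /= mulr_sumr; apply: eq_bigr => e _.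
  under eq_bigr => a _ do rewrite mxE.
  by rewrite -mulr_sumr /trn -mulrA mulrCA; congr (_ * _); rewrite mulrCA.
rewrite /wG exchange_big /= scaler_sumr; apply: eq_bigr => c _.
rewrite -scaler_sumr -mulmx_suml -mulmx_sumr wev_cat.
have -> : \sum_(a < N) delta_mx a a = 1%:M :> M.
  apply/matrixP => i k; rewrite summxE (bigD1 i)//= !mxE eqxx /= eq_sym big1 ?addr0// => l li.
  by rewrite !mxE eq_sym (negbTE li).
rewrite mulmx1 scalerA; congr (_ *: _); rewrite /gcf -rmorphM /=; congr (_%:C).
by rewrite expr2 invfM; ring.
Qed.

(* The error of the first order term: the joins inside a single monomial. *)
Fixpoint Le ws : seq (R * seq word) :=
  if ws is w :: ws' then
    [seq (e.1, w :: e.2) | e <- Le ws'] ++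
    flatten [seq [seq (- (kap * t (ci c)) * (sg (cs c) * sg (gs g)),
        ((cpost c ++ cpre c) ++ gA g) :: grest g) | g <- gm ws' & ci c == gi g] | c <- cuts w]
  else [::].

Definition evl u (l : seq (R * seq word)) : C := \sum_(e <- l) (e.1)%:C * tre u e.2.

Definition mG u ws j : M :=
  \sum_(g <- gm ws | gi g == j)
    ((- ((N%:R ^+ 2)^-1 * sg (gs g)) : R)%:C * tre u (grest g)) *: wev u (gA g).

Definition n2 : C := ((N%:R ^+ 2)^-1 : R)%:C.

Lemma qc_wev u w w' : qc (wev u w) (wev u w') = - ((N%:R ^+ 2 : R)%:C * trn u (w ++ w')).
Proof.
have [N0|N0] := eqVneq N 0%N.
  rewrite qc.unlock; have -> : (N%:R : C) = 0 by rewrite N0.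
  by have -> : (N%:R : R) = 0; [rewrite N0|rewrite expr2 !mul0r].
rewrite qc.unlock -wev_cat /trn mulrA -rmorphM -natC; congr (- (_ * _)).
have n0 : (N%:R : R) != 0 by rewrite pnatr_eq0.
by congr (_%:C); field.
Qed.

Lemma ccdc_joins (I J : Type) (r : seq I) (s : seq J) (F : I -> M) (F' : J -> M)
    (i0 : I -> 'I_q) (j0 : J -> 'I_q) (G G' : 'I_q -> R -> ut -> M) (tau : R) u :
  (forall j, G j tau u = \sum_(i <- r | i0 i == j) F i) ->
  (forall j, G' j tau u = \sum_(i <- s | j0 i == j) F' i) ->
  ccdc t G G' tau u =
  \sum_(i <- r) \sum_(j <- s | i0 i == j0 j) (t (i0 i) * kap)%:C * qc (F i) (F' j).
Proof.
move=> hG hG'; rewrite /ccdc.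
transitivity (\sum_i \sum_(a <- r) \sum_(b <- s)
   if (i0 a == i) && (j0 b == i) then (t i * kap)%:C * qc (F a) (F' b) else 0).
  apply: eq_bigr => i _; rewrite hG hG' qc_suml mulr_sumr big_mkcond /=; apply: eq_bigr => a _.
  case: eqP => _ /=; last by rewrite big1.
  by rewrite qc_sumr mulr_sumr big_mkcond.
rewrite exchange_big /=; apply: eq_bigr => a _; rewrite exchange_big /= [RHS]big_mkcond.
apply: eq_bigr => b _; rewrite (bigD1 (i0 a))//= eqxx big1 ?addr0 => [|i /negbTE h].
  by rewrite /= eq_sym.
by rewrite eq_sym h.
Qed.

Lemma evl_cat u l l' : evl u (l ++ l') = evl u l + evl u l'.
Proof. by rewrite /evl big_cat. Qed.

Lemma evl_cons u w l : evl u [seq (e.1, w :: e.2) | e <- l] = trn u w * evl u l.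
Proof.
by rewrite /evl big_map mulr_sumr; apply: eq_bigr => e _; rewrite tre_cons mulrCA.
Qed.

Lemma n2_num (a s s' : R) (T Q : C) :
  (a * kap)%:C * ((- ((N%:R ^+ 2)^-1 * s))%:C * ((- ((N%:R ^+ 2)^-1 * s'))%:C * T *
     - ((N%:R ^+ 2 : R)%:C * Q))) =
  n2 * ((- (kap * a) * (s * s'))%:C * (Q * T)).
Proof.
rewrite /n2; set x : R := N%:R ^+ 2.
have e : x^-1 * x^-1 * x = x^-1.
  by have [->|x0] := eqVneq x 0; [rewrite invr0 !mul0r|rewrite -mulrA mulVf ?mulr1].
have -> : (x^-1)%:C * ((- (kap * a) * (s * s'))%:C * (Q * T)) =
    (x^-1 * x^-1 * x)%:C * ((- (kap * a) * (s * s'))%:C * (Q * T)) by rewrite e.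
by rewrite !(rmorphM, rmorphN) /=; ring.
Qed.

(** The covariance of two normalised traces joins them: two gradients of order [N^-2] against [N^2]
    from [qc_wev] leave [N^-2]. Hence the generator on products is [Lm], a derivation, up to
    [n2]. *)
Lemma cgood_tre ws : cgood (fun _ u => tre u ws)
  (fun _ u => evl u (Lm t kap ws) + n2 * evl u (Le ws)) (fun j _ u => mG u ws j).
Proof.
elim: ws => [|w ws IH].
  apply: cgood_ext (cgood_cst cE 1) _ _ _ => [tau u|tau u|j tau u]; first by rewrite tre0.
    by rewrite /evl /= !big_nil mulr0 addr0.
  by rewrite /mG big_nil.
apply: cgood_ext (cgood_mul cE (cgood_trn w) IH) _ _ _ => [tau u|tau u|j tau u].
- by rewrite tre_cons.
- rewrite (ccdc_joins (fun=> erefl) (fun=> erefl)) [Lm _ _ _]/= [Le _]/= !evl_cat !evl_cons.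
  set J := \sum_(c <- _) _.
  have h1 : evl u [seq (e.1.1, e.2 :: e.1.2 ++ ws) | e <- Lw t kap w] =
      tre u ws * \sum_(e <- Lw t kap w) (e.1.1)%:C * (tre u e.1.2 * trn u e.2).
    by rewrite mulr_sumr /evl big_map /=; apply: eq_bigr => e _; rewrite tre_cons tre_cat; ring.
  have h2 : J = n2 * evl u (flatten [seq [seq (- (kap * t (ci c)) * (sg (cs c) * sg (gs g)),
        ((cpost c ++ cpre c) ++ gA g) :: grest g) | g <- gm ws & ci c == gi g] | c <- cuts w]).
    rewrite /evl sum_flatten mulr_sumr; apply: eq_bigr => c _.
    rewrite big_map big_filter mulr_sumr; apply: eq_bigr => g _ /=.
    by rewrite qcZl qcZr qc_wev n2_num tre_cons.
  by rewrite h1 h2; ring.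
rewrite /mG /= big_cat /= !big_map /= addrC !scaler_sumr; congr (_ + _).
  by apply: eq_bigr => c _; rewrite scalerA tre_cons mulrCA.
by apply: eq_bigr => c _; rewrite scalerA mulrC.
Qed.

End WordGood.

(** * Values of formal expressions at unitary matrices *)

Section FormalEvaluation.
Context {d : measure_display} {Omega : measurableType d} {R : realType} {q N : nat}.
Variable P : probability Omega R.
Notation M := 'M[R[i]]_N.
Notation C := R[i].
Notation uT := (unitary R N).
Notation ut := ('I_q -> uT).
Variables (U : 'I_q -> R -> Omega -> uT) (t : 'I_q -> R).
Variable E : 'I_q -> (uT -> R) -> (uT -> R) -> (uT -> M) -> Prop.
Hypothesis cE : forall i, calculus P (U i) (t i) (E i).

Notation cgood := (cgood t E).
Notation good := (good t E).
Notation kap := (@gauss2 R).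
Notation n2 := (@n2 R N).
Notation fp := (seq (@mono R q)).
Variable lam : R.
Implicit Types (j : 'I_q) (u : ut) (f g : fp).

Definition lc (m : @mono R q) : C := mc m * (lam ^+ mn m)%:C.
Definition ev u f : C := \sum_(m <- f) lc m * tre u (mw m).
Definition everr u f : C := \sum_(m <- f) lc m * evl u (Le t (mw m)).
Definition fgs f := flatten [seq [seq (m, a) | a <- gm (mw m)] | m <- f].
Definition gc u (p : @mono R q * @gr q) : C :=
  lc p.1 * ((- ((N%:R ^+ 2)^-1 * sg (gs p.2)) : R)%:C * tre u (grest p.2)).
Definition fG u f j : M := \sum_(p <- fgs f | gi p.2 == j) gc u p *: wev u (gA p.2).

Lemma ev_cat u f g : ev u (f ++ g) = ev u f + ev u g.
Proof. by rewrite /ev big_cat. Qed.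

Lemma ev_flatten u (I : Type) (s : seq I) (h : I -> fp) :
  ev u (flatten [seq h i | i <- s]) = \sum_(i <- s) ev u (h i).
Proof. exact: sum_flatten. Qed.

Lemma ev_scale u (a : R) f : ev u (scalef a f) = a%:C * ev u f.
Proof. by rewrite /ev big_map mulr_sumr; apply: eq_bigr => m _; rewrite /lc /= !mulrA. Qed.

Lemma sum_fgs {V : nmodType} f (F : @mono R q * @gr q -> V) :
  \sum_(p <- fgs f) F p = \sum_(m <- f) \sum_(a <- gm (mw m)) F (m, a).
Proof. by rewrite /fgs sum_flatten; apply: eq_bigr => m _; rewrite big_map. Qed.

Lemma cgood_ev f : cgood (fun _ u => ev u f)
  (fun _ u => ev u (Lf t kap f) + n2 * everr u f) (fun j _ u => fG u f j).
Proof.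
apply: cgood_ext (cgood_sum cE f (fun m => cgood_scale cE (lc m) (cgood_tre cE (mw m)))) _ _ _
  => [//|tau u|j tau u].
  rewrite /Lf ev_flatten /everr mulr_sumr -big_split; apply: eq_bigr => m _ /=.
  rewrite mulrDr mulrCA; congr (_ + _); rewrite /evl /ev big_map mulr_sumr; apply: eq_bigr => e _.
  by rewrite /lc /=; ring.
rewrite /fG [RHS]big_mkcond /= sum_fgs; apply: eq_bigr => m _.
rewrite -big_mkcond /mG scaler_sumr; apply: eq_bigr => a _.
by rewrite scalerA.
Qed.

Lemma adj_sum (I : Type) (s : seq I) (p : pred I) (F : I -> M) :
  (\sum_(i <- s | p i) F i) ^t* = \sum_(i <- s | p i) (F i) ^t*.
Proof.
apply: (big_morph (fun A : M => A ^t*)) => [A B|]; first exact: adjD.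
by apply/matrixP => i j; rewrite adjE !mxE; apply: complex_eq; rewrite /= ?oppr0.
Qed.

Lemma adjZC (z : C) (A : M) : (z *: A) ^t* = conjc z *: A ^t*.
Proof. by apply/matrixP => i j; rewrite adjE [in LHS]mxE [in RHS]mxE adjE -conjM. Qed.

Lemma fG_adj u f j : (fG u f j) ^t* =
  \sum_(p <- fgs f | gi p.2 == j) conjc (gc u p) *: wev u (wstar (gA p.2)).
Proof. by rewrite /fG adj_sum; apply: eq_bigr => p _; rewrite adjZC wev_star. Qed.

Lemma conj_gc u p : conjc (gc u p) = conjc (mc p.1) * (lam ^+ mn p.1)%:C *
  ((- ((N%:R ^+ 2)^-1 * sg (gs p.2)) : R)%:C * tre u (map (@wstar q) (grest p.2))).
Proof.
rewrite /gc /lc !conjM tre_star.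
by congr (_ * _ * (_ * _)); apply: complex_eq; rewrite /= ?oppr0.
Qed.

Lemma qc_terms (a s s' : R) (c c' x x' : C) u (w w' : seq (letter q)) :
  (a * kap)%:C * qc ((c * ((- ((N%:R ^+ 2)^-1 * s))%:C * x)) *: wev u w)
     ((c' * ((- ((N%:R ^+ 2)^-1 * s'))%:C * x')) *: wev u w') =
  n2 * ((- (kap * a * (s * s')))%:C * (c * c' * (trn u (w ++ w') * (x * x')))).
Proof.
rewrite qcZl qcZr qc_wev; have := @n2_num R N a s s' (x * x') (trn u (w ++ w')).
set A := (a * kap)%:C; set Y := (- (_^-1 * s))%:C; set Z := (- (_^-1 * s'))%:C.
set W := (N%:R ^+ 2)%:C; set T := trn _ _ => e.
have -> : A * (c * (Y * x) * (c' * (Z * x') * - (W * T))) =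
   c * c' * (A * (Y * (Z * (x * x') * - (W * T)))) by ring.
by rewrite e -mulNr; ring.
Qed.

Lemma pair_join u (p p' : @mono R q * @gr q) : gi p.2 = gi p'.2 ->
  (2^-1)%:C * ((t (gi p.2) * kap)%:C * (qc (gc u p *: wev u (gA p.2)) (gc u p' *: wev u (gA p'.2)) -
     qc (gc u p *: wev u (gA p.2)) (conjc (gc u p') *: wev u (wstar (gA p'.2))))) =
  n2 * ev u (joinr t kap p.1 p'.1 p.2 p'.2).
Proof.
move=> e; rewrite mulrBr conj_gc /gc !qc_terms /joinr e eqxx /ev !big_cons big_nil addr0 /=.
rewrite !tre_cons !tre_cat /lc /= !exprD.
set x := tre _ (grest p.2); set y := tre _ (grest p'.2); set z := tre _ _; set T := trn _ _; set T' := trn _ _.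
set s := sg _; set s' := sg _; set l := lam ^+ _; set l' := lam ^+ _; set a := t _.
rewrite !(rmorphM, rmorphN) /=.
set h := (2^-1)%:C; ring.
Qed.

Lemma ccdcBr G G' G'' tau u : ccdc t G G' tau u - ccdc t G G'' tau u =
  \sum_i (t i * kap)%:C * (qc (G i tau u) (G' i tau u) - qc (G i tau u) (G'' i tau u)).
Proof. by rewrite /ccdc -sumrB; apply: eq_bigr => i _; rewrite mulrBr. Qed.

(** The covariance with the gradient of [g] and the one with its adjoint are the two terms of
    [joinr], pair by pair of gradient terms. *)
Lemma ev_Gam u f g (tau : R) :
  (2^-1)%:C * (ccdc t (fun j _ u => fG u f j) (fun j _ u => fG u g j) tau u -
    ccdc t (fun j _ u => fG u f j) (fun j _ u => (fG u g j) ^t*) tau u) =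
  n2 * ev u (Gam t kap f g).
Proof.
rewrite (ccdc_joins (G := fun j _ u => fG u f j) (G' := fun j _ u => fG u g j) t
   (fun=> erefl) (fun=> erefl)).
rewrite (ccdc_joins (G := fun j _ u => fG u f j) (G' := fun j _ u => (fG u g j) ^t*) t
   (fun=> erefl) (fG_adj u g)).
rewrite -sumrB /Gam ev_flatten !mulr_sumr sum_fgs; apply: eq_bigr => m _.
rewrite ev_flatten mulr_sumr.
under [RHS]eq_bigr => m' _ do rewrite ev_flatten mulr_sumr.
rewrite [RHS]exchange_big /=; apply: eq_bigr => a _.
rewrite -sumrB big_mkcond /= sum_fgs mulr_sumr; apply: eq_bigr => m' _.
rewrite ev_flatten !mulr_sumr; apply: eq_bigr => b _ /=.
case: eqP => h; last by rewrite /joinr; case: eqP => // _; rewrite /ev big_nil !mulr0.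
by rewrite -mulrBr; exact: (pair_join u (p := (m, a)) (p' := (m', b)) h).
Qed.

(** The [N^-2] found here is what the factor [N^2 / 2] of the Hamilton-Jacobi equation
    compensates. *)
Lemma cdc_ev u f g (D D' : 'I_q -> R -> ut -> M) (tau : R) :
  (forall j, skp (D j tau u) = skp (fG u f j)) -> (forall j, skp (D' j tau u) = skp (fG u g j)) ->
  cdc t D D' tau u = (N%:R ^+ 2)^-1 * re (ev u (Gam t kap f g)).
Proof.
move=> hD hD'; rewrite -reZ -/n2 -(ev_Gam u f g tau) reZ ccdcBr re_sum /cdc mulr_sumr.
apply: eq_bigr => i _; rewrite (qq_skp (hD i) (hD' i)) qq_half reZ reB !re_qc; ring.
Qed.

Lemma im_le_norm (z : C) (a : R) : `|z| <= a%:C -> `|im z| <= a.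
Proof.
move=> h; rewrite -normrN -reii; apply: re_le_norm; rewrite normrM.
suff -> : `|ii| = 1 :> C by rewrite mul1r.
by rewrite normc_def /= expr0n expr1n add0r sqrtr1.
Qed.

Lemma re_mul_le (z w : C) (a : R) : `|w| <= a%:C -> `|re (z * w)| <= nrm z * a.
Proof.
move=> h; rewrite reM; apply: le_trans (ler_normB _ _) _; rewrite !normrM mulrDl.
by apply: lerD; apply: ler_wpM2l => //; [exact: re_le_norm|exact: im_le_norm].
Qed.

Lemma normCr (x : R) : `|x%:C| = `|x|%:C :> C.
Proof. by rewrite normc_def /= expr0n addr0 sqrtr_sqr. Qed.

Lemma lc_le (m : @mono R q) (w : C) (a : R) : `|lam| <= 1 -> `|w| <= a%:C ->
  `|re (lc m * w)| <= nrm (mc m) * a.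
Proof.
move=> l1 h; rewrite /lc -mulrA; apply: re_mul_le; rewrite normrM normCr.
rewrite -[leRHS]mul1r ler_pM//; first by rewrite lecR.
by rewrite lecR normrX exprn_ile1.
Qed.

Lemma ev_le u f : `|lam| <= 1 -> `|re (ev u f)| <= S1 f.
Proof.
move=> l1; rewrite /ev re_sum; apply: le_trans (ler_norm_sum _ _ _) _; apply: ler_sum => m _.
by rewrite -[leRHS]mulr1; apply: lc_le => //; exact: tre_le.
Qed.

Definition S1e f : R := \sum_(m <- f) nrm (mc m) * \sum_(e <- Le t (mw m)) `|e.1|.

Lemma everr_le u f : `|lam| <= 1 -> `|re (everr u f)| <= S1e f.
Proof.
move=> l1; rewrite /everr re_sum; apply: le_trans (ler_norm_sum _ _ _) _; apply: ler_sum => m _.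
apply: lc_le => //; rewrite /evl rmorph_sum; apply: le_trans (ler_norm_sum _ _ _) _.
apply: ler_sum => e _; rewrite normrM normCr -[leRHS]mulr1; apply: ler_wpM2l; last exact: tre_le.
by rewrite lecR.
Qed.

End FormalEvaluation.

(** * Exponential moments *)

Section Antidiagonals.
Context {R : realType}.
Implicit Types (K k Q : nat) (h G : nat -> nat -> R) (A p : nat -> R).

Lemma antidiag_sum h Q :
  \sum_(k < Q) \sum_(i < k.+1) h i (k - i)%N = \sum_(i < Q) \sum_(j < Q - i) h i j.
Proof.
transitivity (\sum_(k < Q) \sum_(i < Q | (i < k.+1)%N) h i (k - i)%N).
  by apply: eq_bigr => k _; rewrite (big_ord_widen Q (fun i => h i (k - i)%N)).
rewrite (exchange_big_dep xpredT)//=; apply: eq_bigr => i _.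
have := big_geq_mkord i Q xpredT (fun k => h i (k - i)%N); rewrite /= => <-.
rewrite -{1}(add0n (i : nat)) big_addn big_mkord; apply: eq_bigr => j _; by rewrite addnK.
Qed.

Lemma antidiag_low h K :
  \sum_(i < K.+1) \sum_(j < K.+1 | (i + j < K)%N) h i j =
  \sum_(k < K) \sum_(i < k.+1) h i (k - i)%N.
Proof.
rewrite antidiag_sum big_ord_recr /= [X in _ + X]big_pred0 ?addr0 => [|j].
  apply: eq_bigr => i _.
  rewrite (big_ord_widen K.+1 (h i)); last by rewrite ltnW// ltnS leq_subr.
  by apply: eq_bigl => j; have := ltn_ord i; lia.
lia.
Qed.

(** The square of indices up to [K] meets only antidiagonals below [2 K + 2]; non-negativity permits
    completing each of them. *)
Lemma antidiag_high h K : (forall i j, 0 <= h i j) ->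
  \sum_(i < K.+1) \sum_(j < K.+1 | (K <= i + j)%N) h i j <=
  \sum_(k < K.+1 + K.+1 | (K <= k)%N) \sum_(i < k.+1) h i (k - i)%N.
Proof.
move=> h0; pose g i j := if (K <= i + j)%N then h i j else 0.
have g0 i j : 0 <= g i j by rewrite /g; case: ifP.
have -> : \sum_(k < K.+1 + K.+1 | (K <= k)%N) \sum_(i < k.+1) h i (k - i)%N =
    \sum_(k < K.+1 + K.+1) \sum_(i < k.+1) g i (k - i)%N.
  rewrite big_mkcond; apply: eq_bigr => k _; rewrite /g.
  case: ifP => hk; [apply: eq_bigr => i _|rewrite big1// => i _];
    by rewrite subnKC ?hk// -ltnS.
rewrite antidiag_sum.
apply: le_trans (_ : \sum_(i < K.+1) \sum_(j < K.+1 + K.+1 - i) g i j <= _).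
  apply: ler_sum => i _; rewrite big_mkcond.
  apply: (@sum_ord_widen _ _ _ (g i)) => //; have := ltn_ord i; lia.
apply: (@sum_ord_widen _ _ _ (fun i => \sum_(j < K.+1 + K.+1 - i) g i j)); first lia.
by move=> i; apply: sumr_ge0.
Qed.

(** For the series cut off at [K], the recursion [hp] cancels the coefficients of [s^k] with
    [k < K]. There remain the generator of the last term and the pairs with [i + j >= K]. *)
Lemma telescoped_residual A p G (s : R) K :
  (forall k, k.+1%:R * p k.+1 = A k + 2^-1 * \sum_(i < k.+1) G i (k - i)%N) ->
  \sum_(k < K.+1) (s ^+ k * A k - k%:R * s ^+ k.-1 * p k) +
    2^-1 * \sum_(i < K.+1) \sum_(j < K.+1) s ^+ (i + j) * G i j =
  s ^+ K * A K + 2^-1 * \sum_(i < K.+1) \sum_(j < K.+1 | (K <= i + j)%N) s ^+ (i + j) * G i j.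
Proof.
move=> hp; rewrite sumrB [\sum_(k < K.+1) _ * p k]big_ord_recl /= !mul0r add0r.
rewrite [\sum_(k < K.+1) _]big_ord_recr /=.
have -> : \sum_(i < K) (bump 0 i)%:R * s ^+ (bump 0 i).-1 * p (bump 0 i) =
   \sum_(i < K) s ^+ i * A i + 2^-1 * \sum_(k < K) \sum_(i < k.+1) s ^+ (i + (k - i)) * G i (k - i)%N.
  rewrite mulr_sumr -big_split; apply: eq_bigr => k _; rewrite /bump /= add1n mulrAC hp mulrDl.
  rewrite mulrC; congr (_ + _); rewrite -mulrA mulr_suml; congr (_ * _).
  by apply: eq_bigr => i _; rewrite subnKC 1?mulrC// -ltnS.
rewrite -(antidiag_low (fun i j => s ^+ (i + j) * G i j)).
have -> : \sum_(i < K.+1) \sum_(j < K.+1) s ^+ (i + j) * G i j =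
   \sum_(i < K.+1) \sum_(j < K.+1 | (i + j < K)%N) s ^+ (i + j) * G i j +
   \sum_(i < K.+1) \sum_(j < K.+1 | (K <= i + j)%N) s ^+ (i + j) * G i j.
  rewrite -big_split; apply: eq_bigr => i _ /=; rewrite (bigID (fun j : 'I_K.+1 => (i + j < K)%N)) /=.
  by congr (_ + _); apply: eq_bigl => j; rewrite -leqNgt.
ring.
Qed.

Lemma geom_tail (K n : nat) : \sum_(k < n | (K <= k)%N) (2^-1 : R) ^+ k <= 2 * 2^-1 ^+ K.
Proof.
apply: le_trans (_ : \sum_(k < n - K) 2^-1 ^+ (k + K) <= _).
  have := big_geq_mkord K n xpredT (fun k => (2^-1 : R) ^+ k); rewrite /= => <-.
  by rewrite -{1}(add0n K) big_addn big_mkord.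
under eq_bigr do rewrite exprD.
by rewrite -mulr_suml ler_wpM2r ?exprn_ge0 ?invr_ge0//; exact: geom_half.
Qed.

(** The constant 6 is 2 from [A K] plus [2 * 2] from the geometric tail of the antidiagonals. *)
Lemma residual_bound A G (H : nat -> nat -> R) (s m : R) K : 0 <= s -> s <= 1 -> 0 <= m ->
  (forall i j, `|G i j| <= H i j) -> `|A K| <= 2 * m * 2^-1 ^+ K ->
  (forall k, 2^-1 * \sum_(i < k.+1) H i (k - i)%N <= 2 * m * 2^-1 ^+ k) ->
  `|s ^+ K * A K + 2^-1 * \sum_(i < K.+1) \sum_(j < K.+1 | (K <= i + j)%N) s ^+ (i + j) * G i j|
    <= 6 * m * 2^-1 ^+ K.
Proof.
move=> s0 s1 m0 hG hA hH.
have sp n : 0 <= s ^+ n <= 1 by rewrite exprn_ge0// exprn_ile1.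
have sm (n : nat) (x : R) : `|s ^+ n * x| <= `|x|.
  by case/andP: (sp n) => a b; rewrite normrM ger0_norm// ler_piMl.
have H0 i j : 0 <= H i j by apply: le_trans (hG i j).
have h2 : 2^-1 * \sum_(i < K.+1) \sum_(j < K.+1 | (K <= i + j)%N) H i j <= 4 * m * 2^-1 ^+ K.
  apply: le_trans (ler_wpM2l _ (antidiag_high K H0)) _; first by rewrite invr_ge0.
  apply: (@le_trans _ _ (\sum_(k < K.+1 + K.+1 | (K <= k)%N) 2 * m * 2^-1 ^+ k)).
    by rewrite mulr_sumr; apply: ler_sum => k _; exact: hH.
  rewrite -mulr_sumr; apply: le_trans (ler_wpM2l _ (geom_tail _ _)) _; first exact: mulr_ge0.
  by rewrite le_eqVlt; apply/orP; left; apply/eqP; ring.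
have -> : 6 * m * 2^-1 ^+ K = 2 * m * 2^-1 ^+ K + 4 * m * 2^-1 ^+ K by ring.
apply: le_trans (ler_normD _ _) _; apply: lerD; first exact: le_trans (sm _ _) hA.
rewrite normrM ger0_norm ?invr_ge0//; apply: le_trans h2; rewrite ler_wpM2l ?invr_ge0//.
apply: le_trans (ler_norm_sum _ _ _) _; apply: ler_sum => i _.
apply: le_trans (ler_norm_sum _ _ _) _; apply: ler_sum => j _.
exact: le_trans (sm _ _) (hG i j).
Qed.

End Antidiagonals.

Section ExpBounds.
Context {R : realType}.

(** From [y - 2 y^2 <= log (1 + y) <= y] for [|y| <= 1/2], with [y = x / n]: the polynomial
    [(1 + x / n)^n] stands in for the exponential, which lies outside the class [good]. *)
Lemma exp_le_pow (x : R) (n : nat) : (0 < n)%N -> `|x| <= 2^-1 * n%:R ->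
  expR (x - 2 * x ^+ 2 / n%:R) <= (1 + x / n%:R) ^+ n /\ (1 + x / n%:R) ^+ n <= expR x.
Proof.
move=> n0 hx; have np : (0 : R) < n%:R by rewrite ltr0n.
pose y := x / n%:R.
have hy : `|y| <= 2^-1 by rewrite normrM normfV (ger0_norm (ler0n _ n)) ler_pdivrMr.
have [y1 y2] : - 2^-1 <= y /\ y <= 2^-1 by move: hy; rewrite ler_norml => /andP.
have e1 : expR (y - 2 * y ^+ 2) <= 1 + y.
  have z1 : 0 < 1 - (y - 2 * y ^+ 2).
    have := sqr_ge0 y; set z := y ^+ 2 => z0; lra.
  have e2 : 1 - (y - 2 * y ^+ 2) <= (expR (y - 2 * y ^+ 2))^-1.
    by rewrite -expRN; apply: le_trans (expR_ge1Dx _).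
  have e3 : expR (y - 2 * y ^+ 2) <= (1 - (y - 2 * y ^+ 2))^-1.
    by rewrite -[leLHS]invrK lef_pV2 ?posrE ?invr_gt0 ?expR_gt0.
  apply: le_trans e3 _; rewrite -[leLHS]mul1r ler_pdivrMr//.
  have : 0 <= y ^+ 2 * (1 + 2 * y) by rewrite mulr_ge0 ?sqr_ge0//; lra.
  have -> : (1 + y) * (1 - (y - 2 * y ^+ 2)) = 1 + y ^+ 2 * (1 + 2 * y) by ring.
  by rewrite lerDl.
split.
  have -> : x - 2 * x ^+ 2 / n%:R = (y - 2 * y ^+ 2) * n%:R.
    by rewrite /y; field; exact: lt0r_neq0.
  rewrite expRM_natr -/y lerXn2r// nnegrE ?expR_ge0//; lra.
have -> : expR x = expR y ^+ n by rewrite -expRM_natr /y divfK// lt0r_neq0.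
rewrite -/y lerXn2r// ?nnegrE ?expR_ge0//; first lra.
exact: expR_ge1Dx.
Qed.

End ExpBounds.

(** * From a Hamilton-Jacobi residual to exponential moments *)

Section ExponentialMoment.
Context {d : measure_display} {Omega : measurableType d} {R : realType} {q N : nat}.
Variable P : probability Omega R.
Notation M := 'M[R[i]]_N.
Notation uT := (unitary R N).
Notation ut := ('I_q -> uT).
Notation Ex := (Ex P).
Notation L1 := (L1 P).
Variables (U : 'I_q -> R -> Omega -> uT) (t : 'I_q -> R).
Hypothesis t0 : forall i, 0 <= t i.
Hypothesis indU : independent_processes P U.
Hypothesis mU : forall i s, 0 <= s -> measurable_fun setT (U i s).
Variable E : 'I_q -> (uT -> R) -> (uT -> R) -> (uT -> M) -> Prop.
Hypothesis cE : forall i, calculus P (U i) (t i) (E i).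
Hypothesis U0 : forall i w, unitary_val (U i 0 w) = 1%:M.

Notation good := (good t E).

Lemma cdcZr (a : R -> ut -> R) (D D' : 'I_q -> R -> ut -> M) tau u :
  cdc t D (fun i tau u => (a tau u)%:C *: D' i tau u) tau u = a tau u * cdc t D D' tau u.
Proof. by rewrite cdcC cdcZl cdcC. Qed.

Lemma cdc0l (D : 'I_q -> R -> ut -> M) tau u : cdc t (fun _ _ _ => 0) D tau u = 0.
Proof. by rewrite /cdc big1// => i _; rewrite -(scale0r 0) qqZl mul0r mulr0 mulr0. Qed.

(** The chain rule for a power. The binomial coefficient is half the second derivative, because
    [cdc D D] is twice the second order part of the generator. *)
Lemma good_pow h L D n : good h L D ->
  good (fun tau u => h tau u ^+ n)
    (fun tau u => n%:R * h tau u ^+ n.-1 * L tau u +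
       'C(n, 2)%:R * h tau u ^+ n.-2 * cdc t D D tau u)
    (fun i tau u => (n%:R * h tau u ^+ n.-1)%:C *: D i tau u).
Proof.
move=> g; elim: n => [|n IH].
  apply: good_ext (good_poly cE 1%:P) _ _ _ => [tau u|tau u|i tau u].
  - by rewrite hornerC expr0.
  - by rewrite derivC horner0 !mul0r addr0.
  by rewrite mul0r scale0r.
apply: good_ext (good_mul cE g IH) _ _ _ => [tau u|tau u|i tau u].
- by rewrite exprS.
- rewrite cdcZr binS bin1 natrD -natr1 /=.
  case: n {IH} => [|n] /=; first by rewrite !(mul0r, mulr0, expr0, add0r, addr0, mul1r).
  case: n => [|n] /=; first by rewrite bin_small// !(mul0r, mulr0, expr0, add0r, addr0, mul1r, mulr1) ?expr1; ring.
  rewrite !exprS; ring.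
apply: coord_inj => e; rewrite !coordD !coordZ -natr1 /=.
case: n {IH} => [|n] /=; first by rewrite !(mul0r, mulr0, expr0, add0r, addr0, mul1r, mulr1).
by rewrite !exprS; ring.
Qed.

Lemma good_affine (b : R) F L D : good F L D ->
  good (fun tau u => 1 + b * F tau u) (fun tau u => b * L tau u) (fun i tau u => b%:C *: D i tau u).
Proof.
move=> g; apply: good_ext (good_add (good_poly cE 1%:P) (good_mul cE (good_poly cE b%:P) g)) _ _ _
  => [tau u|tau u|i tau u].
- by rewrite !hornerC.
- by rewrite !hornerC !derivC !horner0 cdc0l; ring.
by rewrite !hornerC scaler0 addr0 add0r.
Qed.

(** As for [exp (a F)], the generator of [h^n] is [a (L + a/2 c) h^n], with corrections of order
    [1/n]; [r] bounds the Hamilton-Jacobi residual in parentheses. *)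
Lemma pow_generator_num (n : nat) (a r B B2 F L c h : R) : (0 < n)%N -> 0 <= a -> 0 <= r ->
  0 <= B2 -> h = 1 + a * F / n%:R -> `|F| <= B -> `|c| <= B2 -> `|L + a / 2 * c| <= r -> 2 * (a * B) <= n%:R ->
  `|n%:R * h ^+ n.-1 * (a / n%:R * L) + 'C(n, 2)%:R * h ^+ n.-2 * ((a / n%:R) * (a / n%:R * c))| <=
  (a * r + (2 * a ^+ 2 * B * r + 2 * a ^+ 2 * B2 * (1 + a * B)) / n%:R) * h ^+ n.
Proof.
move=> n0 a0 r0 B20 hE hF hc hL hn.
have np : (0 : R) < n%:R by rewrite ltr0n.
pose y := a * F / n%:R; pose b := a * B / n%:R.
have hy : `|y| <= b.
  rewrite /y /b !normrM normfV (ger0_norm a0) (ger0_norm (ler0n _ n)).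
  by apply: ler_wpM2r; [rewrite invr_ge0|exact: ler_wpM2l].
have b2 : b <= 2^-1 by rewrite ler_pdivrMr//; lra.
have b0 : 0 <= b by apply: le_trans hy.
have [y1 y2] : - b <= y /\ y <= b by move: hy; rewrite ler_norml => /andP.
have hp : 0 < h by rewrite hE -/y; lra.
pose k := h^-1; have k0 : 0 <= k by rewrite invr_ge0 ltW.
have hk : h * k = 1 by rewrite mulfV// lt0r_neq0.
have k1 : k <= 1 + 2 * b.
  rewrite /k -[leLHS]mul1r ler_pdivrMr//.
  apply: (@le_trans _ _ ((1 + 2 * b) * (1 - b))); last first.
    apply: ler_wpM2l; first by rewrite addr_ge0// mulr_ge0.
    by rewrite hE -/y; lra.
  have : 0 <= b * (1 - 2 * b) by rewrite mulr_ge0//; lra.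
  have -> : (1 + 2 * b) * (1 - b) = 1 + b * (1 - 2 * b) by ring.
  by rewrite lerDl.
have k2 : k <= 2 by lra.
have kk : k ^+ 2 <= 4 by have -> : (4 : R) = 2 ^+ 2; [ring|rewrite lerXn2r// nnegrE].
(* The second order term has the factor [k^2 (1 - 1/n) = k + k^2 v]: its main part pairs with the
   first order term and [v] is of order [1/n]. *)
pose v := 1 - n%:R^-1 - h.
have hv : `|v| <= (1 + a * B) / n%:R.
  have -> : v = - (n%:R^-1 + y) by rewrite /v hE -/y; ring.
  rewrite normrN mulrDl mul1r; apply: le_trans (ler_normD _ _) _; apply: lerD => //.
  by rewrite ger0_norm// invr_ge0.
have hn1 : h ^+ n.-1 = h ^+ n * k.
  by case: (n) n0 => // m _ /=; rewrite exprSr -mulrA hk mulr1.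
have hn2 : 'C(n, 2)%:R * h ^+ n.-2 = h ^+ n * (k ^+ 2 * (n%:R * (n%:R - 1) / 2)).
  have e m : 'C(m, 2)%:R = m%:R * (m%:R - 1) / 2 :> R.
    elim: m => [|m IH]; first by rewrite !mul0r.
    by rewrite binS bin1 natrD IH -natr1; field.
  rewrite -e; case: (n) n0 => // -[|m] _; first by rewrite bin_small// !(mul0r, mulr0).
  rewrite /= 2!exprSr expr2.
  have -> : h ^+ m * h * h * (k * k * 'C(m.+2, 2)%:R) = (h * k) * (h * k) * ('C(m.+2, 2)%:R * h ^+ m) by ring.
  by rewrite hk !mul1r.
have -> : n%:R * h ^+ n.-1 * (a / n%:R * L) + 'C(n, 2)%:R * h ^+ n.-2 * (a / n%:R * (a / n%:R * c)) =
   (a * (k * (L + a / 2 * c)) + a ^+ 2 / 2 * c * (k ^+ 2 * v)) * h ^+ n.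
  rewrite hn1 hn2.
  have -> : a * (k * (L + a / 2 * c)) + a ^+ 2 / 2 * c * (k ^+ 2 * v) =
     a * k * L + a ^+ 2 / 2 * c * (k * (1 + k * v)) by ring.
  have -> : k * (1 + k * v) = k ^+ 2 * (1 - n%:R^-1).
    have -> : 1 + k * v = h * k + k * v by rewrite hk.
    by rewrite /v; ring.
  by field; exact: lt0r_neq0.
rewrite normrM [ `|h ^+ n|]ger0_norm ?exprn_ge0 ?(ltW hp)//.
apply: ler_wpM2r; first by rewrite exprn_ge0// ltW.
have t1 : `|a * (k * (L + a / 2 * c))| <= a * ((1 + 2 * b) * r).
  rewrite !normrM (ger0_norm a0) (ger0_norm k0); apply: ler_wpM2l => //.
  by apply: ler_pM.
have t2 : `|a ^+ 2 / 2 * c * (k ^+ 2 * v)| <= a ^+ 2 / 2 * B2 * (4 * ((1 + a * B) / n%:R)).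
  rewrite normrM [ `|_ * c|]normrM [ `|_ * v|]normrM.
  rewrite [ `|a ^+ 2 / 2|]ger0_norm ?divr_ge0 ?sqr_ge0// [ `|k ^+ 2|]ger0_norm ?sqr_ge0//.
  apply: ler_pM.
  - by apply: mulr_ge0 => //; rewrite divr_ge0// sqr_ge0.
  - by apply: mulr_ge0 => //; exact: sqr_ge0.
  - by apply: ler_wpM2l => //; rewrite divr_ge0// sqr_ge0.
  by apply: ler_pM => //; exact: sqr_ge0.
apply: le_trans (ler_normD _ _) (le_trans (lerD t1 t2) _).
rewrite le_eqVlt; apply/orP; left; apply/eqP; rewrite /b; field; exact: lt0r_neq0.
Qed.

Variables (F L : R -> ut -> R) (D : 'I_q -> R -> ut -> M) (a r B B2 : R).
Hypothesis gF : good F L D.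
Hypothesis a0 : 0 <= a.
Hypothesis r0 : 0 <= r.
Hypothesis bF : forall tau u, 0 <= tau -> tau <= 1 -> `|F tau u| <= B.
Hypothesis bc : forall tau u, 0 <= tau -> tau <= 1 -> `|cdc t D D tau u| <= B2.
Hypothesis bL : forall tau u, 0 <= tau -> tau <= 1 -> `|L tau u + a / 2 * cdc t D D tau u| <= r.

(** Gronwall is run with rate [lam <= a r + 1]. The upper bound pays 1 for this and 1 for passing
    from the power to the exponential, in all 2; the lower one pays [2 * 1] for the doubled rate and
    again 1, in all 3. *)
Lemma exp_moment :
  let X := Ex (fun w => expR (a * F 1 (fun i => U i (t i) w))) in
  X <= expR (a * r + 2 + a * F 0 (fun=> point)) /\
  expR (a * F 0 (fun=> point) - (2 * (a * r) + 3)) <= X.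
Proof.
move=> X; have B0 : 0 <= B by apply: le_trans (bF (fun=> point) (lexx 0) ler01).
have B20 : 0 <= B2 by apply: le_trans (bc (fun=> point) (lexx 0) ler01).
pose C1 := 2 * a ^+ 2 * B * r + 2 * a ^+ 2 * B2 * (1 + a * B).
have aB0 : 0 <= a * B by exact: mulr_ge0.
have a2 : 0 <= a ^+ 2 := sqr_ge0 a.
have C10 : 0 <= C1.
  by apply: addr_ge0; apply: mulr_ge0 => //; rewrite ?addr_ge0// mulr_ge0// mulr_ge0.
(* The four summands make [n] large enough, in turn, for the corrections of the generator, for
   [|a F / n| <= 1/2], for the power to approximate the exponential within a factor [e], and for [n]
   to be positive. *)
pose y := C1 + 2 * (a * B) + 2 * (a * B) ^+ 2 + 1.
have y0 : 0 <= y.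
  have := sqr_ge0 (a * B); rewrite /y; set z := (a * B) ^+ 2; lra.
pose n := Num.bound y; have hn : y <= n%:R by apply: ltW; exact: archi_boundP.
have q0 : 0 <= 2 * (a * B) ^+ 2 by rewrite mulr_ge0 ?sqr_ge0.
have [n1 n2 n3 n4] : [/\ C1 <= n%:R, 2 * (a * B) <= n%:R, 2 * (a * B) ^+ 2 <= n%:R & 1 <= n%:R :> R].
  by move: hn; rewrite /y; split; lra.
have n0 : (0 < n)%N by rewrite -(ltr_nat R); lra.
have np : (0 : R) < n%:R by rewrite ltr0n.
pose lam := a * r + C1 / n%:R.
have lam0 : 0 <= lam by rewrite addr_ge0 ?mulr_ge0 ?invr_ge0.
have lam1 : lam <= a * r + 1 by rewrite lerD2l ler_pdivrMr// mul1r.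
have gp := good_pow n (good_affine (a / n%:R) gF).
have eh tau u : 1 + a / n%:R * F tau u = 1 + (a * F tau u) / n%:R by ring.
have bx tau u : 0 <= tau -> tau <= 1 -> `|a * F tau u| <= a * B.
  by move=> h1 h2; rewrite normrM (ger0_norm a0); apply: ler_wpM2l => //; exact: bF.
have pe tau u : 0 <= tau -> tau <= 1 ->
    expR (a * F tau u - 1) <= (1 + (a * F tau u) / n%:R) ^+ n /\
    (1 + (a * F tau u) / n%:R) ^+ n <= expR (a * F tau u).
  move=> h1 h2; have b := bx tau u h1 h2.
  have [] := @exp_le_pow R (a * F tau u) n n0; first lra.
  move=> e1 e2; split=> //; apply: le_trans e1; rewrite ler_expR lerD2l lerN2 ler_pdivrMr// mul1r.
  apply: le_trans n3; rewrite ler_wpM2l// -(real_normK (num_real (a * F tau u))).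
  by rewrite lerXn2r ?nnegrE.
have gb tau u : 0 <= tau -> tau <= 1 -> `|n%:R * (1 + a / n%:R * F tau u) ^+ n.-1 * (a / n%:R * L tau u) +
     'C(n, 2)%:R * (1 + a / n%:R * F tau u) ^+ n.-2 *
       cdc t (fun i tau u => (a / n%:R)%:C *: D i tau u) (fun i tau u => (a / n%:R)%:C *: D i tau u) tau u|
    <= lam * (1 + a / n%:R * F tau u) ^+ n.
  move=> h1 h2; rewrite (cdcZl t (fun _ _ => a / n%:R)) (cdcZr (fun _ _ => a / n%:R)).
  apply: (pow_generator_num n0 a0 r0 B20) (eh tau u) (bF u h1 h2) (bc u h1 h2) (bL u h1 h2) n2.
have h0 u : 0 <= (1 + a / n%:R * F 0 u) ^+ n.
  by rewrite eh; apply: le_trans (pe 0 u (lexx 0) ler01).1; exact: expR_ge0.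
have up := @good_gronwall _ _ _ _ _ _ _ _ t0 indU mU _ cE _ _ _ lam U0 gp lam0 h0
  (fun tau u h1 h2 => le_trans (ler_norm _) (gb tau u h1 h2)).
have lo := @good_gronwall_lower _ _ _ _ _ _ _ _ t0 indU mU _ cE _ _ _ lam U0 gp lam0 h0
  (fun tau u h1 h2 => lerNnormlW (gb tau u h1 h2)).
have at1 w : at_time U t 1 w = (fun i => U i (t i) w).
  by apply/funext => i; rewrite /at_time mulr1.
have Lp : L1 (fun w => (1 + a / n%:R * F 1 (fun i => U i (t i) w)) ^+ n).
  have [i1 _ _] := good_mean t0 indU mU cE gp.
  by have := i1 1 ler01; under eq_fun do rewrite at1.
have Le : L1 (fun w => expR (a * F 1 (fun i => U i (t i) w))).
  have [i1 _ _] := good_mean t0 indU mU cE gF.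
  have m1 := L1_meas (i1 1 ler01).
  apply: (@L1_bnd _ _ _ P _ (expR (a * B))).
    apply: measurableT_comp => //; apply: measurable_funM => //.
    by move: m1; under eq_fun do rewrite at1.
  move=> w; rewrite ger0_norm ?expR_ge0// ler_expR.
  exact: le_trans (ler_norm _) (bx 1 _ ler01 (lexx _)).
have [p0l p0u] := pe 0 (fun=> point) (lexx 0) ler01.
have hb tau u : expR (a * F tau u - 1) = expR (-1) * expR (a * F tau u) by rewrite addrC expRD.
split.
  have s1 : X <= expR 1 * Ex (fun w => (1 + a / n%:R * F 1 (fun i => U i (t i) w)) ^+ n).
    rewrite -(ExZ _ Lp); apply: Ex_le; [exact: Le|exact: L1Z|move=> w].
    have [e1 _] := pe 1 (fun i => U i (t i) w) ler01 (lexx _).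
    rewrite eh; apply: le_trans (ler_wpM2l (expR_ge0 1) e1).
    by rewrite -expRD addrCA subrr addr0.
  apply: le_trans s1 _; apply: le_trans (ler_wpM2l (expR_ge0 1) up) _.
  rewrite eh; apply: le_trans (_ : expR 1 * (expR lam * expR (a * F 0 (fun=> point))) <= _).
    by apply: ler_wpM2l; [exact: expR_ge0|apply: ler_wpM2l p0u; exact: expR_ge0].
  by rewrite -!expRD ler_expR; lra.
apply: le_trans (_ : Ex (fun w => (1 + a / n%:R * F 1 (fun i => U i (t i) w)) ^+ n) <= _); last first.
  apply: Ex_le => // w; rewrite eh.
  by have [_ e2] := pe 1 (fun i => U i (t i) w) ler01 (lexx _).
apply: le_trans lo; rewrite eh.
apply: le_trans (ler_wpM2l (expR_ge0 _) p0l).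
by rewrite -expRD ler_expR; lra.
Qed.

End ExponentialMoment.

(** * The truncated solution of the Hamilton-Jacobi equation *)

Section ApproximateSolution.
Context {d : measure_display} {Omega : measurableType d} {R : realType} {q N : nat}.
Variable P : probability Omega R.
Notation M := 'M[R[i]]_N.
Notation uT := (unitary R N).
Notation ut := ('I_q -> uT).
Notation Ex := (Ex P).
Variables (U : 'I_q -> R -> Omega -> uT) (t : 'I_q -> R).
Hypothesis t0 : forall i, 0 <= t i.
Hypothesis indU : independent_processes P U.
Hypothesis mU : forall i s, 0 <= s -> measurable_fun setT (U i s).
Variable E : 'I_q -> (uT -> R) -> (uT -> R) -> (uT -> M) -> Prop.
Hypothesis cE : forall i, calculus P (U i) (t i) (E i).
Hypothesis U0 : forall i w, unitary_val (U i 0 w) = 1%:M.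
Hypothesis N0 : (0 < N)%N.

Notation good := (good t E).
Notation fp := (seq (@mono R q)).
Notation kap := (@gauss2 R).

Variables (lam m : R) (phi : nat -> fp).
Hypothesis lam1 : `|lam| <= 1.
Hypothesis m0 : 0 <= m.
Hypothesis phiS : forall k, phi k.+1 = scalef (k.+1%:R)^-1 (Lf t kap (phi k) ++
  scalef 2^-1 (flatten [seq Gam t kap (phi i) (phi (k - i)%N) | i <- iota 0 k.+1])).
Hypothesis hL : forall k, S1 (Lf t kap (phi k)) <= 2 * m * 2^-1 ^+ k.
Hypothesis hG : forall k,
  2^-1 * \sum_(i < k.+1) S1 (Gam t kap (phi i) (phi (k - i)%N)) <= 2 * m * 2^-1 ^+ k.

Notation reev u f := (re (ev lam (u : ut) f)).
Implicit Types u : ut.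
Let n2 : R := (N%:R ^+ 2)^-1.

Lemma good_sum (n : nat) (f L : nat -> R -> ut -> R) (D : nat -> 'I_q -> R -> ut -> M) :
  (forall k, good (f k) (L k) (D k)) ->
  good (fun tau u => \sum_(k < n) f k tau u) (fun tau u => \sum_(k < n) L k tau u)
    (fun j tau u => \sum_(k < n) D k j tau u).
Proof.
move=> h; elim: n => [|n IH].
  apply: good_ext (good_poly cE 0) _ _ _ => *; rewrite ?big_ord0// ?deriv0 ?horner0//.
by apply: good_ext (good_add IH (h n)) _ _ _ => *; rewrite big_ord_recr.
Qed.

Lemma good_rev k : exists D, good (fun _ u => reev u (phi k))
    (fun _ u => reev u (Lf t kap (phi k)) + n2 * re (everr t lam u (phi k))) D /\
  forall j tau u, skp (D j tau u) = skp (fG lam u (phi k) j).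
Proof.
have [D [D' [g _ hD _]]] := cgood_ev cE lam (phi k).
exists D; split=> //; apply: good_ext g _ _ (fun _ _ _ => erefl) => [//|tau u].
by rewrite reD reZ.
Qed.

Definition F K tau u : R := \sum_(k < K.+1) (1 - tau) ^+ k * reev u (phi k).
Definition Fgen K tau u : R := \sum_(k < K.+1)
  ((1 - tau) ^+ k * (reev u (Lf t kap (phi k)) + n2 * re (everr t lam u (phi k))) -
   k%:R * (1 - tau) ^+ k.-1 * reev u (phi k)).

Lemma cdc_suml (n : nat) (D : nat -> 'I_q -> R -> ut -> M) D' tau u :
  cdc t (fun j tau u => \sum_(k < n) D k j tau u) D' tau u = \sum_(k < n) cdc t (D k) D' tau u.
Proof.
elim: n => [|n IH].
  rewrite big_ord0 -[RHS](cdc0l t D' tau u); apply: eq_bigr => i _; by rewrite big_ord0.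
rewrite big_ord_recr /= -IH -cdcDl; apply: eq_bigr => i _; by rewrite big_ord_recr.
Qed.

Lemma good_F K : exists D, good (F K) (Fgen K) D /\
  forall tau u, cdc t D D tau u = n2 * \sum_(i < K.+1) \sum_(j < K.+1)
    (1 - tau) ^+ (i + j) * reev u (Gam t kap (phi i) (phi j)).
Proof.
have [D hD] := choice good_rev.
pose p k : {poly R} := (1 - 'X) ^+ k.
have pE k tau : (p k).[tau] = (1 - tau) ^+ k by rewrite /p horner_exp !hornerE.
have pD k tau : (p k)^`().[tau] = - (k%:R * (1 - tau) ^+ k.-1).
  rewrite /p deriv_exp derivB derivC derivX hornerMn hornerM horner_exp !hornerE.
  by rewrite -mulr_natl; ring.
exists (fun j tau u => \sum_(k < K.+1) ((1 - tau) ^+ k)%:C *: D k j tau u); split.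
  apply: good_ext (good_sum K.+1 (fun k => good_mul cE (good_poly cE (p k)) (hD k).1)) _ _ _.
  - by move=> tau u; apply: eq_bigr => k _; rewrite pE.
  - move=> tau u; apply: eq_bigr => k _; rewrite pE pD cdc0l; ring.
  by move=> j tau u; apply: eq_bigr => k _; rewrite pE scaler0 addr0.
move=> tau u.
rewrite (cdc_suml K.+1 (fun k j tau u => ((1 - tau) ^+ k)%:C *: D k j tau u)) mulr_sumr; apply: eq_bigr => i _.
rewrite (cdcZl t (fun tau _ => (1 - tau) ^+ i)) cdcC.
rewrite (cdc_suml K.+1 (fun k j tau u => ((1 - tau) ^+ k)%:C *: D k j tau u)) !mulr_sumr; apply: eq_bigr => j _.
rewrite (cdcZl t (fun tau _ => (1 - tau) ^+ j)) cdcC.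
have -> : cdc t (D i) (D j) tau u = n2 * reev u (Gam t kap (phi i) (phi j)).
  by apply: cdc_ev => j'; [exact: (hD i).2|exact: (hD j).2].
by rewrite exprD; ring.
Qed.

Lemma rev_phiS u k : k.+1%:R * reev u (phi k.+1) = reev u (Lf t kap (phi k)) +
  2^-1 * \sum_(i < k.+1) reev u (Gam t kap (phi i) (phi (k - i)%N)).
Proof.
rewrite phiS ev_scale reZ mulrA mulfV ?pnatr_eq0// mul1r ev_cat reD ev_scale reZ.
congr (_ + _ * _); rewrite ev_flatten re_sum.
by rewrite -[in iota _ _](subn0 k.+1) -/(index_iota 0 k.+1) big_mkord.
Qed.

(** [N^2 / 2] cancels the [N^-2] in [c], so the main terms telescope; only the joins inside single
    monomials, collected in [everr], keep the factor [N^-2]. *)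
Lemma residual_le K tau u (c : R) : 0 <= tau -> tau <= 1 ->
  c = n2 * \sum_(i < K.+1) \sum_(j < K.+1)
    (1 - tau) ^+ (i + j) * reev u (Gam t kap (phi i) (phi j)) ->
  `|Fgen K tau u + N%:R ^+ 2 / 2 * c| <= 6 * m * 2^-1 ^+ K + n2 * \sum_(k < K.+1) S1e t (phi k).
Proof.
move=> h0 h1 ->; set s := 1 - tau.
have [s0 s1] : 0 <= s /\ s <= 1 by rewrite /s; split; lra.
have nn : N%:R ^+ 2 * n2 = 1 by rewrite /n2 mulfV// expf_neq0// pnatr_eq0 -lt0n.
pose A k := reev u (Lf t kap (phi k)); pose G i j := reev u (Gam t kap (phi i) (phi j)).
have -> : Fgen K tau u + N%:R ^+ 2 / 2 *
    (n2 * \sum_(i < K.+1) \sum_(j < K.+1) s ^+ (i + j) * reev u (Gam t kap (phi i) (phi j))) =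
  (\sum_(k < K.+1) (s ^+ k * A k - k%:R * s ^+ k.-1 * reev u (phi k)) +
    2^-1 * \sum_(i < K.+1) \sum_(j < K.+1) s ^+ (i + j) * G i j) +
  n2 * \sum_(k < K.+1) s ^+ k * re (everr t lam u (phi k)).
  have -> : N%:R ^+ 2 / 2 * (n2 * \sum_(i < K.+1) \sum_(j < K.+1) s ^+ (i + j) * G i j) =
    2^-1 * \sum_(i < K.+1) \sum_(j < K.+1) s ^+ (i + j) * G i j.
    have e Z : N%:R ^+ 2 / 2 * (n2 * Z) = (N%:R ^+ 2 * n2) * (2^-1 * Z) by ring.
    by rewrite e nn mul1r.
  rewrite [RHS]addrAC; congr (_ + _); rewrite mulr_sumr -big_split; apply: eq_bigr => k _ /=.
  by rewrite -/s /A; ring.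
rewrite (@telescoped_residual R A (fun k => reev u (phi k)) G s K (rev_phiS u)).
apply: le_trans (ler_normD _ _) _; apply: lerD.
  apply: (@residual_bound _ A G (fun i j => S1 (Gam t kap (phi i) (phi j)))) => //.
    by move=> i j; exact: ev_le.
  exact: le_trans (ev_le _ _ lam1) (hL K).
have n20 : 0 <= n2 by rewrite invr_ge0 sqr_ge0.
rewrite normrM (ger0_norm n20); apply: ler_wpM2l => //.
apply: le_trans (ler_norm_sum _ _ _) _; apply: ler_sum => k _.
rewrite normrM ger0_norm ?exprn_ge0//; apply: le_trans (everr_le t u (phi k) lam1).
by apply: ler_piMl => //; exact: exprn_ile1.
Qed.

(** The case [a = N^2] of [exp_moment]: at [tau = 1] only [phi 0] is left of [F K], and at [tau = 0]
    all its terms are evaluated at the identity. *)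
Lemma log_laplace_le K :
  let X := Ex (fun w => expR (N%:R ^+ 2 * reev (fun i => U i (t i) w) (phi 0))) in
  let S := \sum_(k < K.+1) reev (fun=> point) (phi k) in
  let r := 6 * m * 2^-1 ^+ K + n2 * \sum_(k < K.+1) S1e t (phi k) in
  X <= expR (N%:R ^+ 2 * (S + r) + 2) /\ expR (N%:R ^+ 2 * (S - 2 * r) - 3) <= X.
Proof.
move=> X S r.
have [D [gF hc]] := good_F K.
have S1e0 k : 0 <= S1e t (phi k).
  by apply: sumr_ge0 => x _; rewrite mulr_ge0 ?nrm_ge0// sumr_ge0.
have n20 : 0 <= n2 by rewrite invr_ge0 sqr_ge0.
have r0 : 0 <= r.
  by rewrite addr_ge0 ?mulr_ge0 ?exprn_ge0 ?invr_ge0 ?sumr_ge0.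
have sp tau n : 0 <= tau -> tau <= 1 -> `|(1 - tau) ^+ n : R| <= 1.
  by move=> h0 h1; rewrite normrX exprn_ile1// ger0_norm; lra.
have bF tau u : 0 <= tau -> tau <= 1 -> `|F K tau u| <= \sum_(k < K.+1) S1 (phi k).
  move=> h0 h1; apply: le_trans (ler_norm_sum _ _ _) _; apply: ler_sum => k _.
  by rewrite normrM -[leRHS]mul1r; apply: ler_pM => //; [exact: sp|exact: ev_le].
have bc tau u : 0 <= tau -> tau <= 1 -> `|cdc t D D tau u| <=
    n2 * \sum_(i < K.+1) \sum_(j < K.+1) S1 (Gam t kap (phi i) (phi j)).
  move=> h0 h1; rewrite hc normrM (ger0_norm n20); apply: ler_wpM2l => //.
  apply: le_trans (ler_norm_sum _ _ _) _; apply: ler_sum => i _.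
  apply: le_trans (ler_norm_sum _ _ _) _; apply: ler_sum => j _.
  by rewrite normrM -[leRHS]mul1r; apply: ler_pM => //; [exact: sp|exact: ev_le].
have a0 : 0 <= (N%:R : R) ^+ 2 by exact: sqr_ge0.
have [up lo] := exp_moment t0 indU mU cE U0 gF a0 r0 bF bc
  (fun tau u h0 h1 => residual_le h0 h1 (hc tau u)).
have F1 u : F K 1 u = reev u (phi 0).
  rewrite /F big_ord_recl subrr expr0 mul1r big1 ?addr0// => k _.
  by rewrite expr0n mul0r.
have F0 : F K 0 (fun=> point) = S by apply: eq_bigr => k _; rewrite subr0 expr1n mul1r.
move: up lo; rewrite F0 (Ex_eq P (fun w => congr1 (fun x => expR (N%:R ^+ 2 * x)) (F1 _))) => up lo.
split.
  apply: le_trans up _; rewrite ler_expR le_eqVlt; apply/orP; left; apply/eqP; ring.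
apply: le_trans lo; rewrite ler_expR le_eqVlt; apply/orP; left; apply/eqP; ring.
Qed.

End ApproximateSolution.

(** * Concentration under the Gibbs measure *)

Section Evaluation.
Context {R : realType} {q N : nat}.
Notation C := R[i].
Notation ut := (unitary_tuple R q N).
Notation word := (seq (letter q)).

Lemma eval_monomialE (u : ut) (m : monomial q) : eval_monomial u m = wev (tnth u) (fmonom_val m).
Proof. by rewrite /eval_monomial /wev; congr foldr; apply/funext => -[i|i]. Qed.

Definition mfC {d} {T : measurableType d} (f : T -> C) :=
  measurable_fun setT (fun x => re (f x)) /\ measurable_fun setT (fun x => im (f x)).

Lemma mfC_cst {d} {T : measurableType d} (c : C) : mfC (fun _ : T => c).
Proof. by split; exact: measurable_cst. Qed.

Lemma mfC_mul {d} {T : measurableType d} (f g : T -> C) : mfC f -> mfC g -> mfC (fun x => f x * g x).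
Proof.
move=> [f1 f2] [g1 g2]; split.
  by under eq_fun do rewrite reM; apply: measurable_funB; exact: measurable_funM.
by under eq_fun do rewrite imM; apply: measurable_funD; exact: measurable_funM.
Qed.

Lemma mfC_sum {d} {T : measurableType d} (I : Type) (s : seq I) (f : I -> T -> C) :
  (forall i, mfC (f i)) -> mfC (fun x => \sum_(i <- s) f i x).
Proof.
move=> h; split.
  by under eq_fun do rewrite re_sum; apply: measurable_sum => i; exact: (h i).1.
by under eq_fun do rewrite im_sum; apply: measurable_sum => i; exact: (h i).2.
Qed.

Lemma mfC_lev x a b : mfC (fun u : ut => lev (tnth u) x a b).
Proof.
have mc i e : measurable_fun setT (fun u : ut => coord e (unitary_val (tnth u i))).
  exact: (measurableT_comp (measurable_coord_unitary e) (measurable_tnth i)).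
case: x => i; split.
- by have := mc i (a, b, true); rewrite coord.unlock.
- by have := mc i (a, b, false); rewrite coord.unlock.
- under eq_fun do rewrite adjE reJ; by have := mc i (b, a, true); rewrite coord.unlock.
- under eq_fun do rewrite adjE imJ; apply: measurable_funN.
  by have := mc i (b, a, false); rewrite coord.unlock.
Qed.

Lemma mfC_wev w a b : mfC (fun u : ut => wev (tnth u) w a b).
Proof.
elim: w a b => [|x w IH] a b; first exact: mfC_cst.
under eq_fun do rewrite wev_cons mxE.
by apply: mfC_sum => k; apply: mfC_mul; [exact: mfC_lev|exact: IH].
Qed.

Lemma mfC_trn w : mfC (fun u : ut => trn (tnth u) w).
Proof.
by apply: mfC_mul; [exact: mfC_cst|apply: mfC_sum => i; exact: mfC_wev].
Qed.

Lemma mfC_tre ws : mfC (fun u : ut => tre (tnth u) ws).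
Proof.
elim: ws => [|w ws IH]; first by under eq_fun do rewrite tre0; exact: mfC_cst.
by under eq_fun do rewrite tre_cons; apply: mfC_mul => //; exact: mfC_trn.
Qed.

Lemma mfC_ev lam f : mfC (fun u : ut => ev lam (tnth u) f).
Proof. by apply: mfC_sum => m; apply: mfC_mul; [exact: mfC_cst|exact: mfC_tre]. Qed.

End Evaluation.

(** * The datum [V + lam W] and its smallness *)

Section InitialDatum.
Context {R : realType} {q : nat}.
Notation C := R[i].
Notation word := (seq (letter q)).
Variables (I : eqType) (s : seq I) (wd : I -> word).
Implicit Types v w : I -> C.

Definition datum v w : seq (@mono R q) :=
  [seq Mono (v m) 0 [:: wd m] | m <- s] ++ [seq Mono (w m) 1 [:: wd m] | m <- s].

Definition lin {N} (u : 'I_q -> unitary R N) v : C := \sum_(m <- s) v m * trn u (wd m).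

Lemma ev_datum {N} (u : 'I_q -> unitary R N) lam v w :
  ev lam u (datum v w) = lin u v + lam%:C * lin u w.
Proof.
rewrite /ev /datum big_cat !big_map /= mulr_sumr; congr (_ + _); apply: eq_bigr => m _.
  by rewrite /lc tre_cons tre0 expr0 /= !mulr1.
by rewrite /lc tre_cons tre0 expr1 /=; ring.
Qed.

Lemma nrm_le2 (z : C) (e : R) : `|z| < e%:C -> nrm z <= 2 * e.
Proof.
move=> /ltW h; rewrite /nrm mulr_natl mulr2n.
by apply: lerD; [exact: re_le_norm|exact: im_le_norm].
Qed.

(** Only degrees up to the length of the longest word occur, so the bounds [b D] amount to finitely
    many conditions. *)
Lemma datum_small (b : nat -> R) : (forall D, 0 < b D) -> exists delta, 0 < delta /\
  forall v w, {in s, forall m, `|v m| < delta%:C} -> {in s, forall m, `|w m| < delta%:C} ->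
  forall D, ND D (datum v w) <= b D.
Proof.
move=> b0; pose Dm := \max_(m <- s) size (wd m).
pose be := \big[Num.min/1]_(D < Dm.+1) b D.
have be0 : 0 < be by rewrite /be; elim/big_ind: _ => // x y x0 y0; rewrite lt_min x0 y0.
have beD D : (D <= Dm)%N -> be <= b D.
  move=> h; exact: (bigmin_le 1 (Ordinal (h : (D < Dm.+1)%N)) (fun D : 'I_Dm.+1 => b D)).
(* Two lists of [size s] monomials, and a factor 2 for passing from the modulus to [nrm]. *)
pose n : R := (4 * size s).+1%:R.
have n0 : 0 < n by rewrite ltr0n.
exists (be / n); split; first exact: divr_gt0.
move=> v w hv hw D.
case: (leqP D Dm) => DD; last first.
  apply: le_trans (ltW (b0 D)); rewrite /ND /datum big_cat !big_map /=.
  have z (x : I -> C) : \sum_(j <- s) (deg [:: wd j] == D)%:R * (nrm (x j) * om [:: wd j]) = 0 :> R.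
    rewrite big_seq big1// => m ms; rewrite deg_cons addn0.
    rewrite (_ : (_ == _) = false) ?mul0r//; apply/eqP => e; move: DD; rewrite -e.
    by apply/negP; rewrite -leqNgt; exact: (@leq_bigmax_seq _ s xpredT (fun m => size (wd m)) m ms isT).
  by rewrite !z addr0.
apply: le_trans (beD D DD); rewrite /ND /datum big_cat !big_map /=.
have z (x : I -> C) : {in s, forall m, `|x m| < (be / n)%:C} ->
    \sum_(j <- s) (deg [:: wd j] == D)%:R * (nrm (x j) * om [:: wd j]) <= (size s)%:R * (2 * (be / n)).
  move=> hx; apply: (@le_trans _ _ (\sum_(j <- s) 2 * (be / n))); last first.
    by rewrite big_const_seq count_predT iter_addr_0 -[leLHS]mulr_natl.
  rewrite big_seq [leRHS]big_seq; apply: ler_sum => m ms.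
  have e0 : 0 <= 2 * (be / n) by rewrite mulr_ge0// divr_ge0// ltW.
  have o1 : om [:: wd m] <= 1 :> R.
    rewrite /om big_cons big_nil mulr1 /wt invf_le1 ?exprn_gt0 ?ltr0n//.
    by rewrite exprn_ege1// ler1n.
  case: eqP => _; last by rewrite mul0r.
  rewrite mul1r -[leRHS]mulr1; apply: ler_pM => //; [exact: nrm_ge0|exact: om_ge0|].
  by apply: nrm_le2; exact: hx.
apply: le_trans (lerD (z _ hv) (z _ hw)) _.
have -> : (size s)%:R * (2 * (be / n)) + (size s)%:R * (2 * (be / n)) = (4 * size s)%N%:R / n * be.
  by rewrite natrM; field; exact: lt0r_neq0.
by rewrite -[leRHS]mul1r ler_wpM2r ?ltW// ltr_pdivrMr// mul1r ltr_nat.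
Qed.

End InitialDatum.

Section LimitValue.
Context {R : realType} {q : nat}.
Notation fp := (seq (@mono R q)).
Implicit Types (f : fp) (lam : R).

Definition sval lam f : R := \sum_(m <- f) re (mc m) * lam ^+ mn m.
(** The coefficient of [lam] in the value at the identity, where every normalised trace is 1. *)
Definition slope f : R := \sum_(m <- f) re (mc m) * (mn m == 1)%N%:R.

Lemma ev_identity {N} lam f : (0 < N)%N -> re (ev lam (fun=> point : unitary R N) f) = sval lam f.
Proof.
move=> N0; rewrite /ev re_sum; apply: eq_bigr => m _.
have w1 w : wev (fun=> point : unitary R N) w = 1%:M :> 'M[R[i]]_N.
  elim: w => // x w IH; rewrite wev_cons IH mulmx1.
  by case: x => i; rewrite /lev /= ?adj1.
have -> : tre (fun=> point : unitary R N) (mw m) = 1.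
  rewrite /tre big1// => w _; rewrite /trn w1 mxtrace1 -natC -rmorphM mulVf//.
  by rewrite pnatr_eq0 -lt0n.
by rewrite mulr1 /lc mulrC reZ mulrC.
Qed.

Lemma nrm_re (z : R[i]) : `|re z| <= nrm z. Proof. by rewrite /nrm lerDl. Qed.

Lemma slope_le f : `|slope f| <= S1 f.
Proof.
apply: le_trans (ler_norm_sum _ _ _) _; apply: ler_sum => m _.
rewrite normrM; apply: le_trans (nrm_re _); case: eqP => _; rewrite ?normr1 ?mulr1// normr0 mulr0//.
Qed.

Lemma sval_expand lam f : `|lam| <= 1 -> `|sval lam f - sval 0 f - lam * slope f| <= lam ^+ 2 * S1 f.
Proof.
move=> l1; rewrite /sval /slope mulr_sumr -!sumrB mulr_sumr.
apply: le_trans (ler_norm_sum _ _ _) _; apply: ler_sum => m _.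
have -> : re (mc m) * lam ^+ mn m - re (mc m) * 0 ^+ mn m - lam * (re (mc m) * (mn m == 1%N)%:R) =
   (lam ^+ mn m - 0 ^+ mn m - lam * (mn m == 1%N)%:R) * re (mc m) by ring.
rewrite normrM; apply: ler_pM => //; last exact: nrm_re.
case: (mn m) => [|[|n]].
- by rewrite !expr0 subrr mulr0 subr0 normr0 sqr_ge0.
- by rewrite expr1 expr0n subr0 mulr1 subrr normr0 sqr_ge0.
rewrite expr0n mulr0 !subr0 -addn2 exprD normrM [ `|lam ^+ 2|]ger0_norm ?sqr_ge0//.
by rewrite ler_piMl ?sqr_ge0// normrX exprn_ile1.
Qed.

End LimitValue.

(** * Exponential Chebyshev inequality for a tilted measure *)

Section GibbsTail.
Context {d : measure_display} {T : measurableType d} {R : realType}.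
Variables (nu mu' : probability T R) (c : R) (g h : T -> R) (B : R).
Hypothesis muE : forall A, measurable A -> mu' A = (\int[nu]_(u in A) (c * expR (g u))%:E)%E.
Hypotheses (mg : measurable_fun setT g) (mh : measurable_fun setT h).
Hypotheses (bg : forall u, `|g u| <= B) (bh : forall u, `|h u| <= B).

Let Lexp (f : T -> R) (C : R) : measurable_fun setT f -> (forall u, `|f u| <= C) -> L1 nu (fun u => expR (f u)).
Proof.
move=> mf bf; apply: (@L1_bnd _ _ _ nu _ (expR C)); first exact: measurableT_comp.
by move=> u; rewrite ger0_norm ?expR_ge0// ler_expR (le_trans (ler_norm _)).
Qed.

(** The total mass 1 of [mu'] forces [c = 1 / Z0]; then [exp (l (h - e))] dominates the indicator of
    the event. *)
Lemma gibbs_tail (l e : R) : 0 <= l ->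
  let Z0 := Ex nu (fun u => expR (g u)) in
  0 < Z0 /\ (mu' [set u | (e <= h u)%R] <=
    (expR (- (l * e)) * Ex nu (fun u => expR (g u + l * h u)) / Z0)%:E)%E.
Proof.
move=> l0 Z0.
have Lg : L1 nu (fun u => expR (g u)) by exact: Lexp mg bg.
have cZ : c * Z0 = 1.
  have := probability_setT mu'; rewrite muE// int_of_L1; last exact: L1Z.
  by rewrite (ExZ c Lg) => -[].
have Z00 : 0 <= Z0 by apply: Ex_ge0 => u; exact: expR_ge0.
have Z0p : 0 < Z0.
  rewrite lt_neqAle Z00 andbT; apply/eqP => z; move: cZ; rewrite -z mulr0 => /eqP.
  by rewrite eq_sym oner_eq0.
have cE : c = Z0^-1 by apply: (mulIf (lt0r_neq0 Z0p)); rewrite cZ mulVf// lt0r_neq0.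
have c0 : 0 <= c by rewrite cE invr_ge0.
split=> //; set A := [set u | _].
have mA : measurable A by rewrite -[X in measurable X]setTI; exact: measurable_fun_le.
pose G u := expR (- (l * e)) * (c * expR (g u + l * h u)).
have Lgh : L1 nu (fun u => expR (g u + l * h u)).
  apply: (@Lexp _ (B + l * B)); first by apply: measurable_funD => //; exact: measurable_funM.
  move=> u; apply: le_trans (ler_normD _ _) _; apply: lerD => //.
  by rewrite normrM (ger0_norm l0); exact: ler_wpM2l.
have LG : L1 nu G by apply: L1Z; exact: L1Z.
have -> : expR (- (l * e)) * Ex nu (fun u => expR (g u + l * h u)) / Z0 = Ex nu G.
  rewrite /G (ExZ _ (L1Z c Lgh)) (ExZ c Lgh) cE; ring.
rewrite -int_of_L1// muE// integral_mkcond; apply: ge0_le_integral => //.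
- by move=> u _; rewrite /patch; case: ifP => // _; rewrite lee_fin mulr_ge0// expR_ge0.
- apply/(measurable_restrictT _ mA)/measurable_EFinP; apply: measurable_funM => //.
  by apply: measurable_funTS; exact: measurableT_comp.
- by apply/measurable_EFinP; exact: L1_meas LG.
move=> u _; rewrite /patch; case: ifP => [/set_mem Au|_]; last first.
  by rewrite lee_fin /G !mulr_ge0// expR_ge0.
rewrite lee_fin /G mulrCA; apply: ler_wpM2l => //; rewrite -expRD ler_expR.
have : l * e <= l * h u by exact: ler_wpM2l.
lra.
Qed.

End GibbsTail.

Section Laplace.
Context {R : realType} {q : nat}.
Variables (t : 'I_q -> R).
Hypothesis t0 : forall i, 0 <= t i.
Notation fp := (seq (@mono R q)).
Notation kap := (@gauss2 R).

Definition tsum : R := \sum_i t i.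
Definition rate : R := mu kap tsum.
(** Chosen for equality in [radius_small], the condition under which the formal bounds sum up. *)
Definition radius : R := (16 * expR (2 * rate))^-1.

Lemma tsum_ge i : t i <= tsum.
Proof. by rewrite /tsum (bigD1 i)//= lerDl sumr_ge0. Qed.

Lemma tsum_ge0 : 0 <= tsum. Proof. exact: sumr_ge0. Qed.

Lemma kap_ge0 : 0 <= kap. Proof. by apply: Rintegral_ge0 => x _; exact: sqr_ge0. Qed.

Lemma rate_ge0 : 0 <= rate. Proof. by apply: mu_ge0; [exact: kap_ge0|exact: tsum_ge0]. Qed.

Lemma radius_gt0 : 0 < radius. Proof. by rewrite invr_gt0 mulr_gt0 ?expR_gt0. Qed.

Lemma radius_small : 8 * radius * expR (2 * rate) <= 2^-1.
Proof.
rewrite /radius le_eqVlt; apply/orP; left; apply/eqP; field.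
exact: lt0r_neq0 (expR_gt0 _).
Qed.

Variable f0 : fp.
Hypothesis hf0 : forall D, ND D f0 <= X kap tsum radius D 0.

Notation phi := (phi t kap f0).

Lemma S1_phi_le k : S1 (phi k) <= 2 * 2^-1 ^+ k.
Proof.
exact: (S1_phi t0 tsum_ge kap_ge0 tsum_ge0 (ltW radius_gt0) radius_small hf0).
Qed.

Definition Sk K lam : R := \sum_(k < K.+1) sval lam (phi k).
Definition err K N : R := 6 * rate * 2^-1 ^+ K + (N%:R ^+ 2)^-1 * \sum_(k < K.+1) S1e t (phi k).

(** The bounds on the space of the motions are carried over to their law [nu]. The functions [phi]
    depend only on [t] and [f0], so [Sk] is the same for every [N]. *)
Lemma ubm_laplace N (nu : probability (unitary_tuple R q N) R) lam K : (0 < N)%N ->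
  ubm_law t nu -> `|lam| <= 1 ->
  let Z := Ex nu (fun u => expR (N%:R ^+ 2 * re (ev lam (tnth u) f0))) in
  Z <= expR (N%:R ^+ 2 * (Sk K lam + err K N) + 2) /\
  expR (N%:R ^+ 2 * (Sk K lam - 2 * err K N) - 3) <= Z.
Proof.
move=> N0 [d [Om [P [U [bmU indU [mX hX]]]]]] l1 Z.
have [E cE] := choice (fun i => let: And3 h _ _ := ubm_calculus (t i) (bmU i) in h).
have mU i s : 0 <= s -> measurable_fun setT (U i s) by have [_ h _] := ubm_calculus (t i) (bmU i); exact: h.
have U0 i w : unitary_val (U i 0 w) = 1%:M by have [_ _ h] := ubm_calculus (t i) (bmU i); exact: h.
have hL k : S1 (Lf t kap (phi k)) <= 2 * rate * 2^-1 ^+ k.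
  exact: (S1_Lphi t0 tsum_ge kap_ge0 tsum_ge0 (ltW radius_gt0) radius_small hf0).
have hG k : 2^-1 * \sum_(i < k.+1) S1 (Gam t kap (phi i) (phi (k - i)%N)) <= 2 * rate * 2^-1 ^+ k.
  exact: (S1_Gam_sum t0 tsum_ge kap_ge0 tsum_ge0 (ltW radius_gt0) radius_small hf0).
have := log_laplace_le t0 indU mU cE U0 N0 l1 rate_ge0 (phiS t kap f0) hL hG K.
have -> : \sum_(k < K.+1) re (ev lam (fun=> point : unitary R N) (phi k)) = Sk K lam.
  by apply: eq_bigr => k _; exact: ev_identity.
have -> : phi 0 = f0 by [].
pose G (u : unitary_tuple R q N) := expR (N%:R ^+ 2 * re (ev lam (tnth u) f0)).
pose X w := [tuple U i (t i) w | i < q].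
have eX w : (fun i => U i (t i) w) = tnth (X w) by apply/funext => i; rewrite tnth_mktuple.
have eG w : expR (N%:R ^+ 2 * re (ev lam (fun i => U i (t i) w) f0)) = G (X w) by rewrite eX.
rewrite (Ex_eq P eG); suff -> : Ex P (fun w => G (X w)) = Z by [].
have mG : measurable_fun setT G.
  by apply: measurableT_comp => //; apply: measurable_funM => //; exact: (mfC_ev lam f0).1.
rewrite /Z /Ex /Rintegral; congr fine.
rewrite -(eq_measure_integral (m1 := pushforward P X) nu); last first.
  by move=> A mA _; exact: hX.
by rewrite ge0_integral_pushforward//; apply/measurable_EFinP.
Qed.

End Laplace.

Lemma exponent_num (R : realFieldType) (l e f sl S S0 x k : R) : 0 <= l -> l <= e / 16 ->
  S - S0 - sl <= 4 * l ^+ 2 -> sl - f <= l * (e / 8) -> k <= l * (e / 8) ->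
  - (l * e) - f + S - S0 + k <= - (l * e / 2).
Proof.
move=> l0 le h1 h2 h3; have : l ^+ 2 <= l * (e / 16) by rewrite expr2 ler_wpM2l.
move: (l ^+ 2) h1 => y h1.
have e8 : l * (e / 8) = (l * e) / 8 by ring.
rewrite e8 in h2 h3; have -> : l * (e / 16) = (l * e) / 16 by ring.
move: (l * e) h2 h3 => z *; lra.
Qed.

Lemma tail_exponent_num (R : realFieldType) (n l e f S S0 E1 er CK : R) : 0 < n ->
  n * er = n * E1 + CK -> - (l * e) - f + S - S0 + 3 * E1 <= - (l * e / 2) ->
  - (n * l * e) + (- (n * f) + (n * (S + er) + 2)) <=
  (3 * CK + 5 - l * e / 2 * n) + (n * (S0 - 2 * er) - 3).
Proof.
move=> n0 her h; have := ler_wpM2l (ltW n0) h.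
have -> : n * (S + er) = n * S + (n * E1 + CK) by rewrite mulrDr her.
have -> : n * (S0 - 2 * er) = n * S0 - 2 * (n * E1 + CK) by rewrite -her; ring.
have -> : n * (- (l * e) - f + S - S0 + 3 * E1) =
  - (n * l * e) - n * f + n * S - n * S0 + 3 * (n * E1) by ring.
have -> : n * - (l * e / 2) = - (n * l * e / 2) by ring.
have -> : l * e / 2 * n = n * l * e / 2 by ring.
move: (n * l * e) (n * f) (n * S) (n * S0) (n * E1) => *; lra.
Qed.

(** * Tail bounds under the Gibbs measure *)

Section Concentration.
Context {R : realType} {q : nat}.
Variables (t : 'I_q -> R).
Hypothesis t0 : forall i, 0 <= t i.
Notation kap := (@gauss2 R).
Notation C := R[i].
Variables (I : eqType) (s : seq I) (wd : I -> seq (letter q)) (v w : I -> C).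
Notation f0 := (datum s wd v w).
Hypothesis hf0 : forall D, ND D f0 <= X kap (tsum t) (radius t) D 0.
Notation phi := (phi t kap f0).

Definition slope_seq k : R := slope (phi k).
Definition mean : R := limn (series slope_seq).

Lemma slope_seq_cvg : series slope_seq @ \oo --> mean.
Proof.
apply: normed_cvg; apply: (@series_le_cvg _ _ (geometric 2 2^-1)) => [n|n|n|].
- exact: normr_ge0.
- by rewrite /geometric /= mulr_ge0 ?exprn_ge0 ?invr_ge0.
- by rewrite /geometric /=; apply: le_trans (slope_le _) (S1_phi_le t0 hf0 n).
apply: is_cvg_geometric_series; rewrite ger0_norm ?invr_ge0//; lra.
Qed.

(** The constant 18 is [3 * 6]: in the quotient of Laplace transforms the residual enters once from
    above and twice from below. *)
Lemma truncation (a b : R) : 0 < a -> 0 < b -> exists K,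
  `|\sum_(k < K.+1) slope_seq k - mean| <= a /\ 18 * rate t * 2^-1 ^+ K <= b.
Proof.
move=> a0 b0.
have h1 : \forall K \near \oo, `|mean - series slope_seq K| < a.
  by move/cvgrPdist_lt: slope_seq_cvg; apply.
have h2 : \forall K \near \oo, `|0 - 18 * rate t * 2^-1 ^+ K| < b.
  have : (fun K => geometric (18 * rate t) 2^-1 K) @ \oo --> (0 : R).
    by apply: cvg_geometric; rewrite ger0_norm ?invr_ge0//; lra.
  by move/cvgrPdist_lt; apply.
have [K1 _ H1] := h1; have [K2 _ H2] := h2.
exists (K1 + K2)%N; split.
  have /= := H1 (K1 + K2).+1; rewrite distrC /series /= big_mkord => H; apply/ltW/H.
  by rewrite -addnS; exact: leq_addr.
have /= := H2 (K1 + K2)%N (leq_addl _ _); rewrite sub0r normrN => H.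
exact: le_trans (ler_norm _) (ltW H).
Qed.

Lemma Sk_expand K lam : `|lam| <= 1 ->
  `|Sk t f0 K lam - Sk t f0 K 0 - lam * \sum_(k < K.+1) slope_seq k| <= 4 * lam ^+ 2.
Proof.
move=> l1; rewrite mulr_sumr /Sk -!sumrB; apply: le_trans (ler_norm_sum _ _ _) _.
apply: (@le_trans _ _ (\sum_(k < K.+1) lam ^+ 2 * (2 * 2^-1 ^+ k))).
  apply: ler_sum => k _; apply: le_trans (sval_expand _ l1) _.
  by rewrite ler_wpM2l ?sqr_ge0//; exact: S1_phi_le.
rewrite -!mulr_sumr [4 * _]mulrC ler_wpM2l ?sqr_ge0//.
have -> : (4 : R) = 2 * 2 by ring.
by rewrite ler_wpM2l//; exact: geom_half.
Qed.

Lemma lin_le N (u : 'I_q -> unitary R N) (x : I -> C) : `|re (lin s wd u x)| <= S1 (datum s wd x x).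
Proof.
have := @ev_le R q N 0 u (datum s wd x x); rewrite normr0 ler01 => /(_ isT).
by rewrite ev_datum rmorph0 mul0r addr0.
Qed.

(** The sign [sig] gives both tails. Tilting by [l * sig], Chebyshev gains [l e] per unit of [N^2].
    Against it stand the second order term [4 l^2 <= l e / 4] and twice [l e / 8] from the
    truncation, so [l e / 2] survives. The choice of [K], and with it [A] and [a], precedes [N]. *)
Lemma upper_tail (sig e : R) : `|sig| = 1 -> 0 < e -> exists A a, 0 < a /\
  forall N (nu mu' : probability (unitary_tuple R q N) R) (c : R), (0 < N)%N -> ubm_law t nu ->
  (forall A, measurable A ->
     mu' A = (\int[nu]_(u in A) (c * expR (N%:R ^+ 2 * re (lin s wd (tnth u) v)))%:E)%E) ->
  (mu' [set u | (e <= sig * (re (lin s wd (tnth u) w) - mean))%R] <=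
    (expR (A - a * N%:R ^+ 2))%:E)%E.
Proof.
move=> s1 e0; pose l := Num.min 1 (e / 16).
have l0 : 0 < l by rewrite lt_min ltr01 divr_gt0.
have [l1 le] : l <= 1 /\ l <= e / 16 by rewrite !ge_min !lexx orbT.
have b0 : 0 < l * (e / 8) by rewrite mulr_gt0// divr_gt0.
have a0 : 0 < e / 8 by rewrite divr_gt0.
have [K [hK1 hK2]] := truncation a0 b0.
pose CK := \sum_(k < K.+1) S1e t (phi k).
(* [CK] is the part of the residual of order [N^-2], multiplied by [N^2] and counted three times;
   [5 = 2 + 3] are the constants of the two Laplace bounds. *)
exists (3 * CK + 5), (l * e / 2); split; first by rewrite divr_gt0// mulr_gt0.
move=> N nu mu' c N0 hnu hmu.
have n2 : 0 < N%:R ^+ 2 :> R by rewrite exprn_gt0// ltr0n.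
pose g (u : unitary_tuple R q N) := N%:R ^+ 2 * re (lin s wd (tnth u) v).
pose h (u : unitary_tuple R q N) := sig * (re (lin s wd (tnth u) w) - mean).
have mlin x : measurable_fun setT (fun u : unitary_tuple R q N => re (lin s wd (tnth u) x)).
  have := (@mfC_ev R q N 0 (datum s wd x x)).1; congr measurable_fun; apply/funext => u.
  by rewrite ev_datum rmorph0 mul0r addr0.
have mg : measurable_fun setT g by apply: measurable_funM.
have mh : measurable_fun setT h by apply: measurable_funM => //; apply: measurable_funB.
pose B := N%:R ^+ 2 * S1 (datum s wd v v) + (S1 (datum s wd w w) + `|mean|).
have bg u : `|g u| <= B.
  apply: (@le_trans _ _ (N%:R ^+ 2 * S1 (datum s wd v v))).
    by rewrite normrM ger0_norm ?(ltW n2)// ler_wpM2l ?(ltW n2)//; exact: lin_le.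
  by rewrite lerDl addr_ge0// S1_ge0.
have bh u : `|h u| <= B.
  apply: (@le_trans _ _ (S1 (datum s wd w w) + `|mean|)).
    rewrite normrM s1 mul1r; apply: le_trans (ler_normB _ _) _.
    by rewrite lerD2r; exact: lin_le.
  by rewrite lerDr mulr_ge0 ?(ltW n2)// S1_ge0.
have N2l : 0 <= N%:R ^+ 2 * l by rewrite mulr_ge0// ltW.
have [Z0 tail] := gibbs_tail hmu mg mh bg bh e N2l.
apply: le_trans tail _; rewrite lee_fin.
have ls1 : `|l * sig| <= 1 by rewrite normrM s1 mulr1 gtr0_norm.
have [up _] := ubm_laplace t0 hf0 K N0 hnu ls1.
have l01 : `|0 : R| <= 1 by rewrite normr0.
have [_ lo] := ubm_laplace t0 hf0 K N0 hnu l01.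
have e1 u : expR (g u + N%:R ^+ 2 * l * h u) =
   expR (- (N%:R ^+ 2 * (l * sig * mean))) *
   expR (N%:R ^+ 2 * re (ev (l * sig) (tnth u) f0)).
  rewrite -expRD ev_datum reD reZ /g /h; congr expR; ring.
have e2 u : expR (N%:R ^+ 2 * re (ev 0 (tnth u) f0)) = expR (g u).
  by rewrite ev_datum rmorph0 mul0r addr0.
rewrite (Ex_eq nu e2) in lo; rewrite (Ex_eq nu e1) ExZ; last first.
  apply: (@L1_bnd _ _ _ nu _ (expR (N%:R ^+ 2 * S1 f0))).
    by apply: measurableT_comp => //; apply: measurable_funM => //; exact: (mfC_ev (l * sig) f0).1.
  move=> u; rewrite ger0_norm ?expR_ge0// ler_expR ler_wpM2l ?(ltW n2)//.
  exact: le_trans (ler_norm _) (ev_le _ _ ls1).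
rewrite ler_pdivrMr//.
apply: le_trans (ler_wpM2l (expR_ge0 _) (ler_wpM2l (expR_ge0 _) up)) _.
apply: le_trans (ler_wpM2l (expR_ge0 _) lo); rewrite -!expRD ler_expR.
apply: (@tail_exponent_num _ (N%:R ^+ 2) _ _ _ _ _ (6 * rate t * 2^-1 ^+ K)) => //.
  by rewrite /err mulrDr; congr (_ + _); rewrite mulrA mulfV ?mul1r// lt0r_neq0.
have hS := Sk_expand K ls1; have hl2 : (l * sig) ^+ 2 = l ^+ 2.
  by rewrite exprMn -[sig ^+ 2]real_normK ?num_real// s1 expr1n mulr1.
have -> : 3 * (6 * rate t * 2^-1 ^+ K) = 18 * rate t * 2^-1 ^+ K by ring.
apply: (@exponent_num _ _ _ _ (l * sig * \sum_(k < K.+1) slope_seq k)) => //.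
- exact: ltW.
- by rewrite hl2 in hS; exact: le_trans (ler_norm _) hS.
- rewrite -mulrBr; apply: le_trans (ler_norm _) _.
  by rewrite !normrM s1 mulr1 gtr0_norm// ler_wpM2l// ltW.
Qed.

End Concentration.

Section Limits.
Context {R : realType}.

(** Compared with the harmonic sequence through [exp (a N^2) >= 1 + a N^2 >= b (N + 1)], where [b]
    is at most 1 and at most [a]. *)
Lemma cvg_expR_sqr (A a : R) : 0 < a -> (fun N => (expR (A - a * N%:R ^+ 2))%:E) @ \oo --> 0%E.
Proof.
move=> a0; pose b := Num.min 1 a.
have b0 : 0 < b by rewrite lt_min ltr01.
have [b1 ba] : b <= 1 /\ b <= a by rewrite !ge_min !lexx orbT.
have h : (fun N => ((expR A * b^-1) * N.+1%:R^-1)%:E) @ \oo --> 0%E.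
  apply: cvg_EFin; first by near=> n.
  rewrite -(mulr0 (expR A * b^-1)); apply: cvgMr; exact: cvg_harmonic.
apply: squeeze_cvge (cvg_cst 0%E) h; near=> N; rewrite !lee_fin expR_ge0 /=.
rewrite expRD -mulrA; apply: ler_wpM2l; first exact: expR_ge0.
rewrite -invfM expRN lef_pV2 ?posrE ?expR_gt0 ?mulr_gt0 ?ltr0n//.
apply: le_trans (expR_ge1Dx _).
have n1 : (N%:R : R) <= N%:R ^+ 2 by rewrite -natrX ler_nat -mulnn; case: (N) => // m; rewrite leq_pmulr.
rewrite -natr1 mulrDr mulr1 addrC lerD//.
apply: (@le_trans _ _ (b * N%:R ^+ 2)); first by rewrite ler_wpM2l// ltW.
by rewrite ler_wpM2r// sqr_ge0.
Unshelve. all: by end_near. Qed.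

End Limits.

Section PolynomialEvaluation.
Context {R : realType} {q N : nat}.
Variable M : {fset (monomial q)}.
Notation C := R[i].

Notation wd := (@fmonom_val (letter q)).
Notation lin := (lin (enum_fset M) wd).

Lemma sum_msupp {V' : nmodType} (V : ncpoly R q) (F : monomial q -> V') : {subset msupp V <= M} ->
  (forall m, m \notin msupp V -> F m = 0) -> \sum_(m <- msupp V) F m = \sum_(m <- M) F m.
Proof.
move=> sV F0; rewrite [RHS](bigID (fun m => m \in msupp V)) /= [X in _ + X]big1 ?addr0; last exact: F0.
rewrite -[RHS]big_filter; apply: perm_big; apply: uniq_perm.
- exact: fset_uniq.
- by rewrite filter_uniq// fset_uniq.
by move=> m; rewrite mem_filter; case: (boolP (m \in msupp V)) => // /sV ->.
Qed.

Lemma trace_eval (u : unitary_tuple R q N) (V : ncpoly R q) : {subset msupp V <= M} ->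
  (N%:R^-1 : R)%:C * \tr (ncpoly_eval u V) = lin (tnth u) (fun m => mcoeff m V).
Proof.
move=> sV; rewrite /ncpoly_eval sum_msupp//; last first.
  by move=> m /mcoeff_outdom ->; rewrite scale0r.
rewrite linear_sum mulr_sumr; apply: eq_bigr => m _.
by rewrite /= mxtraceZ mulrCA eval_monomialE.
Qed.

Lemma lin_scale (u : 'I_q -> unitary R N) (a : C) v :
  lin u (fun m => a * v m) = a * lin u v.
Proof. by rewrite /lin mulr_sumr; apply: eq_bigr => m _; rewrite mulrA. Qed.

Lemma norm_ge_sqr (z : C) (e : R) : 0 < e -> (e%:C <= `|z|) = (e ^+ 2 <= re z ^+ 2 + im z ^+ 2).
Proof.
case: z => a b e0; rewrite normc_def /= lecR -{1}[e]gtr0_norm// -sqrtr_sqr ler_sqrt//.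
by rewrite addr_ge0// sqr_ge0.
Qed.

Lemma norm_ge_parts (z c : C) (e : R) : 0 < e -> e%:C <= `|z - c| ->
  e / 2 <= 1 * (re z - re c) \/ e / 2 <= -1 * (re z - re c) \/
  e / 2 <= 1 * (im z - im c) \/ e / 2 <= -1 * (im z - im c).
Proof.
move=> e0; rewrite norm_ge_sqr// reB imB !mul1r !mulN1r.
set x := re z - _; set y := im z - _ => h.
case: (leP (e / 2) x) => h1; first by left.
case: (leP (e / 2) (- x)) => h2; first by right; left.
case: (leP (e / 2) y) => h3; first by right; right; left.
case: (leP (e / 2) (- y)) => h4; first by right; right; right.
exfalso; have x2 : x ^+ 2 <= (e / 2) ^+ 2.
  rewrite -[x ^+ 2]real_normK ?num_real// lerXn2r ?nnegrE ?divr_ge0 ?(ltW e0)// ler_norml; lra.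
have y2 : y ^+ 2 <= (e / 2) ^+ 2.
  rewrite -[y ^+ 2]real_normK ?num_real// lerXn2r ?nnegrE ?divr_ge0 ?(ltW e0)// ler_norml; lra.
have e2 : 0 < e ^+ 2 by rewrite exprn_gt0.
have e4 : (e / 2) ^+ 2 = e ^+ 2 / 4 by field.
rewrite e4 in x2 y2; move: (x ^+ 2) (y ^+ 2) (e ^+ 2) h x2 y2 e2 => *; lra.
Qed.

End PolynomialEvaluation.

Section Union4.
Context {d : measure_display} {T : measurableType d} {R : realType} (P : probability T R).

Lemma probability_cover4 (E A1 A2 A3 A4 : set T) (b1 b2 b3 b4 : \bar R) :
  measurable E -> measurable A1 -> measurable A2 -> measurable A3 -> measurable A4 ->
  E `<=` A1 `|` (A2 `|` (A3 `|` A4)) ->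
  (P A1 <= b1 -> P A2 <= b2 -> P A3 <= b3 -> P A4 <= b4 -> P E <= b1 + (b2 + (b3 + b4)))%E.
Proof.
move=> mE m1 m2 m3 m4 sub h1 h2 h3 h4.
have m34 := measurableU _ _ m3 m4; have m234 := measurableU _ _ m2 m34.
have mA := measurableU _ _ m1 m234.
apply: le_trans (le_measure P _ _ sub) _; rewrite ?inE//.
apply: le_trans (measureU2 _ m1 m234) _; apply: leeD => //.
apply: le_trans (measureU2 _ m2 m34) _; apply: leeD => //.
by apply: le_trans (measureU2 _ m3 m4) _; exact: leeD.
Qed.

End Union4.

Theorem theorem1p2 (R : realType) (q : nat) (q_ge1 : (1 <= q)%N)
    (t : 'I_q -> R) (t_ge0 : forall i, 0 <= t i)
    (M : {fset (monomial q)}) :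
  exists delta : R, 0 < delta /\
    forall V W : ncpoly R q,
      small_combination M delta V -> small_combination M delta W ->
      ncpoly_star V = V ->
      exists Phi : R[i],
        forall (d : nat -> measure_display)
            (Omega : forall N, measurableType (d N))
            (P : forall N, probability (Omega N) R)
            (UV : forall N, Omega N -> unitary_tuple R q N),
          (forall N, (1 <= N)%N ->
             exists mu : probability (unitary_tuple R q N) R,
               gibbs_law t V mu /\ has_law (P N) (UV N) mu) ->
          cvg_in_probability P
            (fun N w => N%:R^-1 * \tr (ncpoly_eval (UV N w) W)) Phi.
Proof.
pose wd := @fmonom_val (letter q).
(* At [k = 0] the majorant is positive in every degree, so it can serve as the threshold for the
   datum. *)
have b0 D : 0 < X (@gauss2 R) (tsum t) (radius t) D 0.
  by rewrite /X expr0 fact0 divr1 mulr1 divr_gt0 ?exprn_gt0 ?radius_gt0.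
have [delta [delta0 hd]] := datum_small (enum_fset M) wd b0.
exists delta; split=> // V W [sV dV] [sW dW] _.
pose v (m : monomial q) := mcoeff m V.
pose w (m : monomial q) := mcoeff m W.
pose w' (m : monomial q) := - ii * mcoeff m W : R[i].
have dw' : {in enum_fset M, forall m, `|w' m| < delta%:C}.
  move=> m mM; rewrite normrM normrN.
  have -> : `|ii| = 1 :> R[i] by rewrite normc_def /= expr0n expr1n add0r sqrtr1.
  by rewrite mul1r; exact: dW.
have h1 := hd v w dV dW; have h2 := hd v w' dV dw'.
pose m1 := mean t (enum_fset M) wd v w; pose m2 := mean t (enum_fset M) wd v w'.
exists (m1 +i* m2) => d Omega P UV hUV e e0.
(* Outside the disc of radius [e] the real or the imaginary part deviates by at least [e / 2] in one
   of two directions: four one-sided tails. *)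
have e20 : 0 < e / 2 by rewrite divr_gt0.
have n1 : `|1 : R| = 1 by rewrite normr1.
have nN1 : `|-1 : R| = 1 by rewrite normrN normr1.
have [A1 [a1 [a10 H1]]] := upper_tail t_ge0 h1 n1 e20.
have [A2 [a2 [a20 H2]]] := upper_tail t_ge0 h1 nN1 e20.
have [A3 [a3 [a30 H3]]] := upper_tail t_ge0 h2 n1 e20.
have [A4 [a4 [a40 H4]]] := upper_tail t_ge0 h2 nN1 e20.
pose H N := ((expR (A1 - a1 * N%:R ^+ 2))%:E + ((expR (A2 - a2 * N%:R ^+ 2))%:E +
  ((expR (A3 - a3 * N%:R ^+ 2))%:E + (expR (A4 - a4 * N%:R ^+ 2))%:E)))%E.
have H0 : H @ \oo --> 0%E.
  rewrite -[X in _ --> X]adde0; apply: cvgeD => //; first exact: cvg_expR_sqr.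
  rewrite -[X in _ --> X]adde0; apply: cvgeD => //; first exact: cvg_expR_sqr.
  by rewrite -[X in _ --> X]adde0; apply: cvgeD => //; exact: cvg_expR_sqr.
apply: squeeze_cvge (cvg_cst 0%E) H0; near=> N; rewrite measure_ge0 /=.
have N0 : (0 < N)%N by near: N; exists 1%N.
have [mu [[nu [hnu [c hmu]]] [mUV hlaw]]] := hUV N N0.
have Nn0 : (N%:R : R) != 0 by rewrite pnatr_eq0 -lt0n.
have tr_lin (Q : ncpoly R q) (u : unitary_tuple R q N) : {subset msupp Q <= M} ->
    N%:R^-1 * \tr (ncpoly_eval u Q) = lin (enum_fset M) wd (tnth u) (fun m => mcoeff m Q).
  by move=> sQ; rewrite -(trace_eval u sQ) -natC -fmorphV.
(* The exponent of the density is [N^2] times a normalised trace, the scale on which the Laplace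
   transform was estimated. *)
have dens (u : unitary_tuple R q N) : N%:R * re (\tr (ncpoly_eval u V)) =
    N%:R ^+ 2 * re (lin (enum_fset M) wd (tnth u) v).
  by rewrite /v -(trace_eval u sV) reZ expr2 mulrA mulfK.
have hmu' A : measurable A -> mu A =
    (\int[nu]_(u in A) (c * expR (N%:R ^+ 2 * re (lin (enum_fset M) wd (tnth u) v)))%:E)%E.
  by move=> mA; rewrite hmu//; apply: eq_integral => u _; rewrite dens.
pose z (u : unitary_tuple R q N) := lin (enum_fset M) wd (tnth u) w.
have z' u : re (lin (enum_fset M) wd (tnth u) w') = im (z u).
  by rewrite /w' lin_scale mulNr reN reii opprK.
have mz : mfC z.
  by apply: mfC_sum => m; apply: mfC_mul; [exact: mfC_cst|exact: mfC_trn].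
have := H1 N nu mu c N0 hnu hmu'; have := H2 N nu mu c N0 hnu hmu'.
have := H3 N nu mu c N0 hnu hmu'; have := H4 N nu mu c N0 hnu hmu'.
rewrite -/m1 -/m2; under [X in mu X]eq_set do rewrite z'; move=> B4.
under [X in mu X]eq_set do rewrite z'; move=> B3 B2 B1.
pose E := [set u : unitary_tuple R q N | e%:C <= `|z u - (m1 +i* m2)|].
have mtail (f : unitary_tuple R q N -> R) (s x : R) : measurable_fun setT f ->
    measurable [set u | e / 2 <= s * (f u - x)].
  move=> mf; rewrite -[X in measurable X]setTI; apply: measurable_fun_le => //.
  by apply: measurable_funM => //; exact: measurable_funB.
have mE : measurable E.
  have -> : E = [set u | e ^+ 2 <= (re (z u) - m1) ^+ 2 + (im (z u) - m2) ^+ 2].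
    by apply/seteqP; split=> u; rewrite /E /= norm_ge_sqr// reB imB.
  rewrite -[X in measurable X]setTI; apply: measurable_fun_le => //.
  by apply: measurable_funD; apply: measurable_funX; apply: measurable_funB => //; [exact: mz.1|exact: mz.2].
have -> : [set x | e%:C <= `|N%:R^-1 * \tr (ncpoly_eval (UV N x) W) - (m1 +i* m2)|] = UV N @^-1` E.
  by apply/seteqP; split=> x; rewrite /E /= tr_lin.
rewrite hlaw//.
apply: (probability_cover4 mE _ _ _ _ _ B1 B2 B3 B4).
- by apply: mtail; exact: mz.1.
- by apply: mtail; exact: mz.1.
- by apply: mtail; exact: mz.2.
- by apply: mtail; exact: mz.2.
move=> u /(norm_ge_parts e0) [h|[h|[h|h]]]; [left|right; left|right; right; left|right; right; right]; exact: h.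
Unshelve. all: by end_near. Qed.
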